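(* Let $f:\mathbb{R}^p\to\mathbb{R}$, its maximizer $x^*$, and a symmetric positive semidefinite matrix $G^2\le -\nabla^2 f(x^* )$ be such that $u\mapsto \ell(x^*+u)=f(x^*+u)+\frac12\|Gu\|^2$ is concave on $\mathbb{R}^p$. With the notation of the context, suppose $\omega\le1/3$ and $\omega\,\mathtt{p}_G\le 2/3$. Let $x\in\mathbb{R}^p$ be any point and $\mathsf{H}$ any symmetric positive definite $p\times p$ matrix. (i) With $X\sim P_f$ and $\gamma_{\mathsf{H}}\sim N(0,\mathsf{H}^{-2})$, $$\sup_{A\in\mathcal{B}(\mathbb{R}^p)}\bigl|P_f(X-x\in A)-\mathbb{P}(\gamma_{\mathsf{H}}\in A)\bigr|\le 4(\diamondsuit+e^{-\mathtt{x}})+\operatorname{TV}\bigl(N(x,\mathsf{H}^{-2}),N(x^*,\mathsf{D}_G^{-2})\bigr)$$ with $\diamondsuit=\diamondsuit_2$ or $\diamondsuit=\diamondsuit_3$. (ii) Furthermore, there is an absolute constant $C$ such that for $X\sim P_f$, $\gamma\sim N(0,I_p)$ and any linear mapping $Q:\mathbb{R}^p\to\mathbb{R}^q$ with $3\|Q\mathsf{D}_G^{-2}Q^\top\|^2\le\|Q\mathsf{D}_G^{-2}Q^\top\|_{\mathrm{Fr}}^2$, $$\sup_{r>0}\Bigl|P_f\bigl(\|Q(X-x)\|\le r\bigr)-\mathbb{P}\bigl(\|Q\mathsf{H}^{-1}\gamma\|\le r\bigr)\Bigr|\le 4(\diamondsuit_3+e^{-\mathtt{x}})+\frac{C}{\|Q\mathsf{D}_G^{-2}Q^\top\|_{\mathrm{Fr}}}\Bigl(\|Q(\mathsf{D}_G^{-2}-\mathsf{H}^{-2})Q^\top\|_1+\|Q(x-x^*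 )\|^2\Bigr).$$
   Context: Setting: $f:\mathbb{R}^p\to\mathbb{R}$ is three times continuously differentiable, $\int e^{f(x)}dx<\infty$, $x^*$ is a point of global maximum of $f$, and $-\nabla^2 f(x^* )$ is strictly positive definite. $P_f$ is the probability measure with density proportional to $e^{f(x)}$. Notation: $\mathsf{D}_G^2=-\nabla^2 f(x^* )$, $\mathsf{D}^2=-\nabla^2 f(x^* )-G^2\ge 0$; $\mathsf{D},\mathsf{D}_G,G$ are symmetric positive semidefinite square roots. $\mathtt{p}_G=\operatorname{tr}(\mathsf{D}^2\mathsf{D}_G^{-2})$. Some $\nu\in(0,1)$ (e.g. $\nu=2/3$) and some $\mathtt{x}>0$ (chosen so that $e^{-\mathtt{x}}$ is negligible) are fixed, and $\mathtt{r}_G=2\sqrt{\mathtt{p}_G}+\sqrt{2\mathtt{x}}$, $\mathcal{U}=\{u\in\mathbb{R}^p:\|\mathsf{D}u\|\le\nu^{-1}\mathtt{r}_G\}$. $\delta_3(x^*,u)=f(x^*+u)-f(x^* )-\langle\nabla f(x^* ),u\rangle-\frac12\langle\nabla^2f(x^* ),u^{\otimes2}\rangle$, and $\omega=\sup_{u\in\mathcal{U}}\frac{|\delta_3(x^*,u)|}{\|\mathsf{D}u\|^2/2}$. $\diamondsuit_2=\frac{0.75\,\omega\,\mathtt{p}_G}{1-\omega}$ and $\diamondsuit_3=\frac{\mathbb{E}\tau_3(\gamma_G)}{4(1-\omega)^{3/2}}$ with $\gamma_G\sim N(0,\mathsf{D}_G^{-2})$. Bounds involving $\diamondsuit_3$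 presuppose a 3-homogeneous function $\tau_3$, $\tau_3(tu)=|t|^3\tau_3(u)$, such that $|\delta_3(x^*,u)|\le\frac16\tau_3(u)$. $\operatorname{TV}(P,Q)=\sup_{\|g\|_\infty\le1}|\int g\,dP-\int g\,dQ|$. $\mathcal{B}(\mathbb{R}^p)$ is the Borel $\sigma$-field. For a symmetric matrix $M$ with eigenvalues $\lambda_j(M)$: $\|M\|$ is the operator norm, $\|M\|_{\mathrm{Fr}}$ the Frobenius norm, $\|M\|_1=\sum_j|\lambda_j(M)|$. *)

(* Defs.v *)
From HB Require Import structures.
From mathcomp Require Import all_boot all_order all_algebra.
From mathcomp Require Import interval_inference.
From mathcomp Require Import all_classical all_reals all_analysis.
From mathcomp Require Import measurable_realfun.
From mathcomp Require Import lra.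

Set Implicit Arguments.
Unset Strict Implicit.
Unset Printing Implicit Defensive.

Import Order.TTheory GRing.Theory Num.Theory.
Import numFieldNormedType.Exports.

Local Open Scope classical_set_scope.
Local Open Scope ring_scope.

Fact mx_borel_display : measure_display.
Proof. exact. Qed.

Section mx_borel.
Context (R : realType) (m n : nat).

Definition mx_borel : set (set 'M[R]_(m, n)) := <<s open >>.

Let borel0 : mx_borel set0. Proof. exact: sigma_algebra0. Qed.
Let borelC A : mx_borel A -> mx_borel (~` A).
Proof. exact: sigma_algebraC. Qed.
Let borelU (F : (set 'M[R]_(m, n))^nat) :
  (forall i, mx_borel (F i)) -> mx_borel (\bigcup_i F i).
Proof. exact: sigma_algebra_bigcup. Qed.

HB.instance Definition _ := @isMeasurable.Build mx_borel_display
  'M[R]_(m, n) mx_borel borel0 borelC borelU.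

End mx_borel.

Section mx_measurable.
Context (R : realType).

Lemma open_mx_measurable m n (A : set 'M[R]_(m, n)) : open A -> measurable A.
Proof. by move=> oA; exact: sub_sigma_algebra. Qed.

Lemma continuous_mx_measurable m n (f : 'M[R]_(m, n) -> R) :
  continuous f -> measurable_fun setT f.
Proof.
move=> /continuousP cf; apply: (measurability _ (RGenOInfty.measurableE R)).
move=> _ [_ [a ->] <-]; rewrite setTI; apply: open_mx_measurable.
by apply: cf; exact: interval_open.
Qed.

Lemma measurable_mx_entry m n i j :
  measurable_fun setT (fun A : 'M[R]_(m, n) => A i j).
Proof. by apply: continuous_mx_measurable; exact: coord_continuous. Qed.

Lemma measurable_mx_entries d (T : measurableType d) m n
    (F : T -> 'M[R]_(m, n)) :
  (forall i j, measurable_fun setT (fun t => F t i j)) ->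
  measurable_fun setT F.
Proof.
move=> mF.
apply: (@measurability _ _ T _ setT F (@open 'M[R]_(m, n))) => //.
move=> _ [U oU <-]; rewrite setTI.
pose I := [set k : 'M[rat]_(m, n) * rat |
  [set x : 'M[R]_(m, n) |
    forall i j, ball (ratr (k.1 i j) : R) (ratr k.2) (x i j)] `<=` U].
have -> : F @^-1` U = \bigcup_(k in I) \bigcap_(i in [set: 'I_m])
   \bigcap_(j in [set: 'I_n])
   (fun t => F t i j) @^-1` ball (ratr (k.1 i j) : R) (ratr k.2).
  apply/seteqP; split=> t /=.
  - move=> UFt.
    have /nbhs_ballP[e /= e0 eU] : nbhs (F t) U by apply: open_nbhs_nbhs.
    have [r /andP[r0 re]] : exists r : rat, 0 < (ratr r : R) < e / 2.
      have [r] := rat_in_itvoo (divr_gt0 e0 (ltr0n _ 2)).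
      by rewrite in_itv /= => h; exists r.
    have H i j : exists q : rat, ball (ratr q : R) (ratr r) (F t i j).
      have [|q] := @rat_in_itvoo R (F t i j - ratr r) (F t i j + ratr r).
        by rewrite ltrD2l gtrN.
      rewrite in_itv /= => /andP[h1 h2]; exists q.
      by rewrite /ball /= ltr_distl; apply/andP; split; lra.
    have /choice[q qP] : forall ij : 'I_m * 'I_n, exists q : rat,
        ball (ratr q : R) (ratr r) (F t ij.1 ij.2) by case=> i j; exact: H.
    exists (\matrix_(i, j) q (i, j), r) => [x /= xq|i _ j _ /=].
      apply: eU; split=> // i j; apply: (@le_ball _ _ _ (ratr r + ratr r)).
        by lra.
      apply: (@ball_triangle _ _ (ratr (q (i, j)) : R)).
        by apply/ball_sym; exact: (qP (i, j)).
      by have := xq i j; rewrite mxE.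
    by rewrite mxE; exact: (qP (i, j)).
  - by move=> [k Ik kt]; apply: Ik => i j; exact: kt.
rewrite bigcup_mkcond; apply: countable_bigcupT_measurable => [|k].
  exact: countableP.
case: ifPn => // _.
apply: fin_bigcap_measurable => // i _; apply: fin_bigcap_measurable => // j _.
by rewrite -[X in measurable X]setTI; apply: mF => //; exact: measurable_ball.
Qed.

End mx_measurable.

Section lebesgue_cV.
Context (R : realType).

Let cons_cV n (y : R * 'cV[R]_n) : 'cV[R]_n.+1 := col_mx (y.1)%:M y.2.

Fixpoint lebesgue_cV n : set 'cV[R]_n -> \bar R :=
  match n with
  | 0 => \d_(0 : 'cV[R]_0)
  | n.+1 => pushforward (lebesgue_measure \x @lebesgue_cV n)%E (@cons_cV n)
  end.

Let cons_cV0 n (y : R * 'cV[R]_n) : cons_cV y ord0 0 = y.1.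
Proof.
have -> : @ord0 n = lshift n (@ord0 0) by apply: val_inj.
by rewrite [LHS]col_mxEu mxE eqxx mulr1n.
Qed.

Let cons_cVS n (y : R * 'cV[R]_n) i : cons_cV y (lift ord0 i) 0 = y.2 i 0.
Proof.
have -> : lift ord0 i = rshift 1 i by apply: val_inj.
by rewrite [LHS]col_mxEd.
Qed.

Lemma measurable_cons_cV n : measurable_fun setT (@cons_cV n).
Proof.
apply: measurable_mx_entries => i j; rewrite ord1.
have -> : (fun y : R * 'cV[R]_n => cons_cV y i 0) =
    (fun y => if unlift ord0 i is Some k then y.2 k 0 else y.1).
  by apply/funext => y; case: unliftP => [k ->|->]; rewrite ?cons_cVS ?cons_cV0.
case: (unlift _ _) => [k|]; last exact: measurable_fst.
by apply: (measurableT_comp (measurable_mx_entry k 0)); exact: measurable_snd.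
Qed.

Let uncons_cV n (v : 'cV[R]_n.+1) : R * 'cV[R]_n :=
  (v ord0 0, \col_i v (lift ord0 i) 0).

Let cons_cVK n : cancel (@cons_cV n) (@uncons_cV n).
Proof.
move=> y; rewrite /uncons_cV cons_cV0 [RHS]surjective_pairing; congr pair.
by apply/colP => i; rewrite mxE cons_cVS.
Qed.

Let measurable_uncons_cV n : measurable_fun setT (@uncons_cV n).
Proof.
apply: measurable_fun_pair; first exact: measurable_mx_entry.
apply: measurable_mx_entries => i j.
rewrite [X in measurable_fun _ X](_ : _ = fun v : 'cV[R]_n.+1 => v (lift ord0 i) 0).
  exact: measurable_mx_entry.
by apply/funext => v; rewrite mxE.
Qed.

Lemma lebesgue_cV_sigma_finite_measure n :
  exists mu : {sigma_finite_measure set 'cV[R]_n -> \bar R},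
    @lebesgue_cV n = mu.
Proof.
elim: n => [|n [mu IH]]; first by exists \d_(0 : 'cV[R]_0).
pose m1 := (@lebesgue_measure R \x mu)%E.
pose m2 := measure_function_pushforward__canonical__measure_function_Measure m1 (@measurable_cons_cV n).
have sf : sigma_finite setT m2.
  have /sigma_finiteP[F [FT ndF Foo]] := sigma_finiteT (@lebesgue_measure R).
  have /sigma_finiteP[G [GT ndG Goo]] := sigma_finiteT mu.
  exists (fun k => @uncons_cV n @^-1` (F k `*` G k)).
    rewrite -preimage_bigcup -(preimage_setT (@uncons_cV n)); congr (_ @^-1` _).
    apply/esym/seteqP; split=> // -[x y] _.
    have [i _ Fx] : (\bigcup_i F i) x by rewrite -FT.
    have [j _ Gy] : (\bigcup_i G i) y by rewrite -GT.
    exists (maxn i j) => //; split.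
    - by move: x Fx; exact/subsetPset/ndF/leq_maxl.
    - by move: y Gy; exact/subsetPset/ndG/leq_maxr.
  move=> k; have [mF Fk] := Foo k; have [mG Gk] := Goo k; split.
    rewrite -[X in measurable X]setTI; apply: measurable_uncons_cV => //.
    exact: measurableX.
  rewrite (_ : m2 _ = m1 (F k `*` G k)); last first.
    by congr (m1 _); apply/funext => y; rewrite /preimage /mkset cons_cVK.
  by rewrite /m1 product_measure1E// lte_mul_pinfty// ge0_fin_numE.
pose H := Measure_isSigmaFinite.Build _ _ _ _ sf.
pose mu' := HB.pack_for (SigmaFiniteMeasure.type _ R) (Measure.sort m2) H.
by exists mu'; rewrite /= IH.
Qed.

Let lebesgue_cV0 n : @lebesgue_cV n set0 = 0%E.
Proof. by have [mu ->] := lebesgue_cV_sigma_finite_measure n. Qed.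

Let lebesgue_cV_ge0 n A : (0 <= @lebesgue_cV n A)%E.
Proof. by have [mu ->] := lebesgue_cV_sigma_finite_measure n. Qed.

Let lebesgue_cV_sigma_additive n : semi_sigma_additive (@lebesgue_cV n).
Proof.
have [mu ->] := lebesgue_cV_sigma_finite_measure n.
exact: measure_semi_sigma_additive.
Qed.

HB.instance Definition _ n := isMeasure.Build _ _ _ (@lebesgue_cV n)
  (@lebesgue_cV0 n) (@lebesgue_cV_ge0 n) (@lebesgue_cV_sigma_additive n).

Let lebesgue_cV_sigma_finite n : sigma_finite setT (@lebesgue_cV n).
Proof.
by have [mu ->] := lebesgue_cV_sigma_finite_measure n; exact: sigma_finiteT.
Qed.

HB.instance Definition _ n := Measure_isSigmaFinite.Build _ _ _
  (@lebesgue_cV n) (@lebesgue_cV_sigma_finite n).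

End lebesgue_cV.
Arguments lebesgue_cV {R} n _.

Section linear_algebra.
Context (R : realType).
Implicit Types (m n p : nat).

Definition enorm n (u : 'cV[R]_n) : R := Num.sqrt (\sum_i u i 0 ^+ 2).

Definition psdmx n (M : 'M[R]_n) : Prop :=
  M^T = M /\ forall u : 'cV[R]_n, 0 <= (u^T *m M *m u) 0 0.

Definition posdefmx n (M : 'M[R]_n) : Prop :=
  M^T = M /\ forall u : 'cV[R]_n, u != 0 -> 0 < (u^T *m M *m u) 0 0.

Definition psd_sqrt n (S A : 'M[R]_n) : Prop := psdmx S /\ S *m S = A.

Definition opnorm m n (M : 'M[R]_(m, n)) : R :=
  sup [set enorm (M *m u) | u in [set u : 'cV[R]_n | enorm u <= 1]].

Definition frobnorm m n (M : 'M[R]_(m, n)) : R :=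
  Num.sqrt (\sum_i \sum_j M i j ^+ 2).

(* The eigenvalues of [M] with multiplicity, in some order, when the
   characteristic polynomial splits over [R] (e.g., when [M] is symmetric);
   the empty sequence otherwise. *)
Definition eigenvalues n (M : 'M[R]_n) : seq R :=
  xget [::] [set s | char_poly M = \prod_(a <- s) ('X - a%:P)].

Definition tracenorm n (M : 'M[R]_n) : R := \sum_(a <- eigenvalues M) `|a|.

End linear_algebra.

Section calculus.
Context (R : realType) (p : nat).
Implicit Types (f : 'cV[R]_p -> R) (x u : 'cV[R]_p).

Fixpoint Ck (k : nat) f : Prop :=
  match k with
  | 0 => continuous f
  | k.+1 => (forall x, differentiable f x) /\
            forall v, Ck k (fun x => 'D_v f x)
  end.

Definition grad f x : 'cV[R]_p := \col_i 'D_(delta_mx i 0) f x.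

Definition hess f x : 'M[R]_p :=
  \matrix_(i, j) 'D_(delta_mx i 0) (fun y => 'D_(delta_mx j 0) f y) x.

Definition delta3 f x u : R :=
  f (x + u) - f x - ((grad f x)^T *m u) 0 0
  - 2^-1 * (u^T *m hess f x *m u) 0 0.

Definition concave f : Prop := convex_function setT (fun u => - f u).

End calculus.

Section gaussian.
Context (R : realType) (p : nat).
Implicit Types (m : 'cV[R]_p) (S : 'M[R]_p).

(* Meaningful for a positive definite covariance matrix [S]. *)
Definition gauss_pdf m S (u : 'cV[R]_p) : R :=
  expR (- 2^-1 * ((u - m)^T *m invmx S *m (u - m)) 0 0)
  / Num.sqrt ((2 * pi) ^+ p * \det S).

Definition gauss m S (A : set 'cV[R]_p) : \bar R :=
  (\int[lebesgue_cV p]_(u in A) (gauss_pdf m S u)%:E)%E.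

Lemma gauss_pdf_ge0 m S u : 0 <= gauss_pdf m S u.
Proof. by rewrite divr_ge0 ?expR_ge0 ?sqrtr_ge0. Qed.

Lemma measurable_gauss_pdf m S : measurable_fun setT (gauss_pdf m S).
Proof.
apply: measurable_funM => //; apply: measurableT_comp => //.
apply: measurable_funM => //.
rewrite [X in measurable_fun _ X](_ : _ = fun u : 'cV[R]_p =>
    \sum_j (\sum_i (u i 0 - m i 0) * invmx S i j) * (u j 0 - m j 0)).
  apply: measurable_sum => j; apply: measurable_funM.
    apply: measurable_sum => i; apply: measurable_funM => //.
    by apply: measurable_funB => //; exact: measurable_mx_entry.
  by apply: measurable_funB => //; exact: measurable_mx_entry.
apply/funext => u; rewrite mxE; apply: eq_bigr => j _; rewrite !mxE.
by congr (_ * _); apply: eq_bigr => i _; rewrite !mxE.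
Qed.

Let gauss0 m S : gauss m S set0 = 0%E.
Proof. exact: integral_set0. Qed.

Let gauss_ge0 m S A : (0 <= gauss m S A)%E.
Proof. by apply: integral_ge0 => u _; rewrite lee_fin gauss_pdf_ge0. Qed.

Let gauss_sigma_additive m S : semi_sigma_additive (gauss m S).
Proof.
apply: semi_sigma_additive_nng_induced => [|u].
  by apply/measurable_EFinP; exact: measurable_gauss_pdf.
by rewrite lee_fin gauss_pdf_ge0.
Qed.

HB.instance Definition _ m S := isMeasure.Build _ _ _ (gauss m S)
  (@gauss0 m S) (@gauss_ge0 m S) (@gauss_sigma_additive m S).

End gaussian.

Section laplace.
Local Open Scope ereal_scope.
Context (R : realType) (p : nat).
Implicit Types (f : 'cV[R]_p -> R) (D DG : 'M[R]_p).

Definition gibbs f (A : set 'cV[R]_p) : \bar R :=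
  (\int[lebesgue_cV p]_(y in A) (expR (f y))%:E)
  / (\int[lebesgue_cV p]_y (expR (f y))%:E).

(* Test functions range over [-1, 1], so this is twice the supremum over
   events. *)
Definition TV (P Q : set 'cV[R]_p -> \bar R) : \bar R :=
  ereal_sup [set `|\int[P]_u (g u)%:E - \int[Q]_u (g u)%:E|
    | g in [set g : 'cV[R]_p -> R |
            measurable_fun setT g /\ forall u, (`|g u| <= 1)%R]].

Definition pG D DG : R := \tr (D *m D *m invmx (DG *m DG)).

Definition rG D DG (xx : R) : R :=
  (2 * Num.sqrt (pG D DG) + Num.sqrt (2 * xx))%R.

Definition Uset D DG (nu xx : R) : set 'cV[R]_p :=
  [set u | (enorm (D *m u) <= nu^-1 * rG D DG xx)%R].

(* Extended-real quotient: a positive number divided by 0 is +oo, so that a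
   finite supremum forces [delta3] to vanish on the kernel of [D], and 0 / 0
   (in particular at u = 0) is 0. *)
Definition omega f (xs : 'cV[R]_p) D DG (nu xx : R) : \bar R :=
  ereal_sup [set `|delta3 f xs u|%:E / (enorm (D *m u) ^+ 2 / 2)%:E
    | u in Uset D DG nu xx].

Definition diam2 (w : R) D DG : R :=
  (3 / 4 * w * pG D DG / (1 - w))%R.

Definition diam3 (w : R) DG (tau3 : 'cV[R]_p -> R) : \bar R :=
  (\int[gauss 0 (invmx (DG *m DG))]_u (tau3 u)%:E)
  / (4 * (1 - w) `^ (3 / 2))%:E.

(* Measurability makes the expectation of [tau3] in [diam3] meaningful; the last
   clause makes [tau3] nonnegative, so that expectation is in [0, +oo] and no
   integrability is required. *)
Definition tau3_bound f (xs : 'cV[R]_p) (tau3 : 'cV[R]_p -> R) : Prop :=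
  [/\ measurable_fun setT tau3,
      forall (t : R) u, tau3 (t *: u) = (`|t| ^+ 3 * tau3 u)%R
    & forall u, (`|delta3 f xs u| <= 6^-1 * tau3 u)%R].

Definition law_dist f (x : 'cV[R]_p) (H : 'M[R]_p) : \bar R :=
  ereal_sup [set `|gibbs f [set y | A (y - x)%R]
                   - gauss 0 (invmx (H *m H)) A|
    | A in [set A : set 'cV[R]_p | measurable A]].

Definition ball_dist f (x : 'cV[R]_p) (H : 'M[R]_p) q (Q : 'M[R]_(q, p)) :
    \bar R :=
  ereal_sup [set `|gibbs f [set y | (enorm (Q *m (y - x)) <= r)%R]
                   - gauss 0 1%:M
                       [set g | (enorm (Q *m (invmx H *m g)) <= r)%R]|
    | r in [set r : R | (0 < r)%R]].

End laplace.

(* Main.v *)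
(** Put u = L g, where L whitens D_G^2 and diagonalises D^2 as diag(lam), so
    that g is standard Gaussian, 0 <= lam_i <= 1 and the sum of the lam_i is
    p_G.  The Gibbs measure becomes the Gaussian one tilted by e^d, where
    d(g) = delta_3(x^*, L g), and concavity of l says that d - Z/2 is concave,
    with Z = sum_i lam_i g_i^2.  Everything reduces to bounds on the means of
    (e^d - 1)_+ and (1 - e^d)_+ .  Outside U, concavity along rays gives
    d <= Z/2 - (1 - w) r sqrt(Z)/2, which is integrated over dyadic shells.
    For the bound in terms of E|d|, one compares E F(g) with E F((1 - k lam) g)
    as k tends to 0, F being supported near U: concavity bounds
    d((1 - k lam) g) from below, and the resulting first-order inequality
    controls E (e^d - 1)_+ on U by a multiple of E|d|.

    For balls, the law of a Gaussian quadratic form without dominant eigenvalue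
    has density at most C / ||S||_Fr: two large eigenvalues give a planar
    density bound, and otherwise the characteristic function is integrable.
    Anderson's inequality then controls shifts of the mean, coordinate by
    coordinate, with a loss quadratic in the shift; hence it also controls
    independent Gaussian noise, and adding the positive and negative parts of
    S_1 - S_2 as noise makes two covariance matrices equal. *)

Require Import Defs.
From HB Require Import structures.
From mathcomp Require Import all_boot all_order all_algebra.
From mathcomp Require Import interval_inference.
From mathcomp Require Import all_classical all_reals all_analysis.
From mathcomp Require Import measurable_realfun.
From mathcomp Require Import ring lra.
From mathcomp Require complex.

Set Implicit Arguments.
Unset Strict Implicit.
Unset Printing Implicit Defensive.

Import Order.TTheory GRing.Theory Num.Theory.
Import numFieldNormedType.Exports.

Local Open Scope classical_set_scope.
Local Open Scope ring_scope.

(** * Integration against densities and affine maps *)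

(** A bound of at least 1 is trivial, so [4 * expR (- xx) < 1] may be assumed, which bounds
    [a = sqrt (2 * xx)] below. The defect [(1 - expR d)_+] is kept to a quarter of the bound allowed
    for the excess [(expR d - 1)_+], so that normalising the tilted law costs no further factor.
    Outside U, concavity along rays loses a factor [1 - w] in the exponent: in general the tail is
    only a multiple of [expR (- (1 - w) * xx)]. With [diam2] the difference is paid by [w * pG].
    With [diam3] nothing can pay for it, as E|d| has no lower bound in terms of [w]. When
    [a > 4 * sqrt pG] the dilation argument therefore runs on a region larger than U, beyond which
    the tail stays below [expR (- xx)] in spite of the loss. The dilation is applied to [Psi d / q]
    with [q = Z / 2]: [Psi] vanishes for [d <= 3 / 2], where [expR d - 1] is at most linear in d,
    and the division by [q] makes the first-order gain a constant multiple of [Psi]. Since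
    [6 * E|d| <= E tau3] and [4 * diam3 = (1 - w) ^ (- 3 / 2) * E tau3], the multiple of E|d| may
    not exceed [6 * (1 - w) ^ (- 3 / 2)]; this fixes [barK]. *)

Section density.
Local Open Scope ereal_scope.
Context d (T : measurableType d) (R : realType).
Variables (mu nu : {measure set T -> \bar R}) (g : T -> R).
Hypothesis mg : measurable_fun setT g.
Hypothesis g0 : forall x, (0 <= g x)%R.
Hypothesis nuE : forall A, measurable A -> nu A = \int[mu]_(x in A) (g x)%:E.

Import HBNNSimple.

(** Both sides are monotone limits along the simple functions approximating [f]; on an indicator the
    claim is [nuE]. *)
Lemma ge0_integral_density (f : T -> \bar R) :
  measurable_fun setT f -> (forall x, 0 <= f x) ->
  \int[nu]_x f x = \int[mu]_x (f x * (g x)%:E).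
Proof.
move=> mf f0.
pose h := nnsfun_approx measurableT mf.
have mE : measurable_fun setT (EFin \o g) by exact/measurable_EFinP.
transitivity (limn (fun n => \int[nu]_x (h n x)%:E)).
  rewrite -monotone_convergence//.
  - apply: eq_integral => y _; apply/esym/cvg_lim => //.
    exact: cvg_nnsfun_approx.
  - by move=> n; exact/measurable_EFinP/measurable_funP.
  - by move=> n y _; rewrite lee_fin.
  - by move=> y _ m n mn; rewrite lee_fin; exact/lefP/nd_nnsfun_approx.
transitivity (limn (fun n => \int[mu]_x ((h n x)%:E * (g x)%:E))); last first.
  rewrite -monotone_convergence//; last 3 first.
  - by move=> n; apply: emeasurable_funM => //; exact/measurable_EFinP/measurable_funP.
  - by move=> n y _; rewrite -EFinM lee_fin mulr_ge0.
  - move=> y _ m n mn; rewrite -!EFinM lee_fin ler_wpM2r//.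
    exact/lefP/nd_nnsfun_approx.
  apply: eq_integral => y _; apply/cvg_lim => //.
  by apply: cvgeZr => //; exact: cvg_nnsfun_approx.
congr (limn _); apply/funext => n.
transitivity (\sum_(k \in range (h n)) \int[nu]_x (k * \1_(h n @^-1` [set k]) x)%:E).
  under eq_integral do rewrite fimfunE -fsumEFin//.
  rewrite ge0_integral_fsum//; last 2 first.
  - by move=> y; exact/measurable_EFinP/measurable_funM.
  - by move=> y x _; rewrite EFinM nnfun_muleindic_ge0.
transitivity (\sum_(k \in range (h n)) \int[mu]_x ((k * \1_(h n @^-1` [set k]) x)%:E * (g x)%:E)); last first.
  rewrite -ge0_integral_fsum//.
  - apply: eq_integral => x _.
    by rewrite [in RHS]fimfunE -fsumEFin// ge0_mule_fsuml// => k; rewrite EFinM nnfun_muleindic_ge0.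
  - by move=> r; apply: emeasurable_funM => //; exact/measurable_EFinP/measurable_funM.
  - by move=> r x _; rewrite mule_ge0 ?lee_fin//= -lee_fin EFinM nnfun_muleindic_ge0.
apply: eq_fsbigr => r _.
have mA : measurable (h n @^-1` [set r]) by [].
have [r0|r0] := ltP r 0%R.
  rewrite preimage_nnfun0//.
  by rewrite !integral0_eq// => x _; rewrite indic0 mulr0 ?mul0e.
under eq_integral do rewrite EFinM.
rewrite ge0_integralZl//; last exact/measurable_EFinP.
rewrite integral_indic// setIT nuE//.
under [RHS]eq_integral do rewrite EFinM -muleA.
rewrite [RHS]ge0_integralZl//; last 2 first.
- by apply: emeasurable_funM => //; exact/measurable_EFinP.
- by move=> x _; rewrite mule_ge0// lee_fin.
congr (_ * _); rewrite integral_mkcond; apply: eq_integral => x _.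
by rewrite patchE indicE; case: ifPn => _; rewrite ?mul1e ?mul0e.
Qed.

End density.

(** * Affine changes of variables on the line *)

Section affine1.
Context (R : realType).
Local Notation mu := (@lebesgue_measure R).

Lemma measurable_affine1 (a b : R) :
  measurable_fun setT ((fun t => a * t + b) : measurableTypeR R -> measurableTypeR R).
Proof. by apply: measurable_funD => //; apply: measurable_funM. Qed.

(** The rescaled pushforward agrees with [mu] on half-open intervals, and these values determine
    Lebesgue measure. *)
Lemma lebesgue_measure_affine1 (a b : R) (A : set R) : 0 < a -> measurable A ->
  (a%:E * mu ((fun t => a * t + b)%R @^-1` A) = mu A)%E.
Proof.
move=> a0 mA.
pose m1 := measure_function_pushforward__canonical__measure_function_Measure mu (measurable_affine1 a b).
pose m2 := mscale (NngNum (ltW a0)) m1.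
have H : forall X, ocitv X -> mu X = m2 X.
  move=> _ [[x y] _ <-] /=.
  rewrite /m2 /mscale /= /pushforward.
  have -> : ((fun t => a * t + b) @^-1` `]x, y]) =
      `](x - b) / a, (y - b) / a]%classic :> set R.
    apply/seteqP; split => t /=; rewrite !in_itv /= ltr_pdivrMr// ler_pdivlMr// => /andP[h1 h2]; apply/andP; split; lra.
  rewrite !lebesgue_measure_itv /= !lte_fin ltr_pM2r ?invr_gt0// ltrD2r.
  case: ifPn => _; last by rewrite mule0.
  by rewrite -!EFinD -EFinM; congr EFin; field; rewrite gt_eqF.
by have := lebesgue_measure_unique H mA => ->.
Qed.

Lemma ge0_integral_affine1_gt0 (a b : R) (F : R -> \bar R) : 0 < a ->
  measurable_fun setT F -> (forall t, 0 <= F t)%E ->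
  (\int[mu]_t F (a * t + b)%R = a^-1%:E * \int[mu]_t F t)%E.
Proof.
move=> a0 mF F0.
pose m1 := measure_function_pushforward__canonical__measure_function_Measure mu (measurable_affine1 a b).
have -> : (\int[mu]_t F (a * t + b)%R = \int[m1]_t F t)%E.
  by rewrite ge0_integral_pushforward//; exact: measurable_affine1.
have ai0 : 0 <= a^-1 by rewrite invr_ge0 ltW.
pose k : {nonneg R} := NngNum ai0.
rewrite [in RHS](_ : a^-1%:E = k%:num%:E)%E// -ge0_integral_mscale//.
apply: eq_measure_integral => A mA _.
rewrite /= /mscale /= -(lebesgue_measure_affine1 b a0 mA).
by rewrite muleA -EFinM mulVf ?gt_eqF// mul1e.
Qed.

Lemma ge0_integral_opp (F : R -> \bar R) :
  measurable_fun setT F -> (forall t, 0 <= F t)%E ->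
  (\int[mu]_t F (- t)%R = \int[mu]_t F t)%E.
Proof.
move=> mF F0.
have mN : measurable_fun setT (-%R : measurableTypeR R -> measurableTypeR R) by exact: oppr_measurable.
pose m1 := measure_function_pushforward__canonical__measure_function_Measure mu mN.
have -> : (\int[mu]_t F (- t)%R = \int[m1]_t F t)%E.
  by rewrite ge0_integral_pushforward.
by apply: eq_measure_integral => A mA _; exact: lebesgue_measureN.
Qed.

Lemma ge0_integral_affine1 (a b : R) (F : R -> \bar R) : a != 0 ->
  measurable_fun setT F -> (forall t, 0 <= F t)%E ->
  (\int[mu]_t F (a * t + b)%R = `|a|^-1%:E * \int[mu]_t F t)%E.
Proof.
move=> a0 mF F0; have [/ltr0_norm an|ap|/eqP] := ltgtP a 0; last by rewrite (negbTE a0).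
- have na : 0 < - a by rewrite -an normr_gt0.
  rewrite an -(ge0_integral_affine1_gt0 b na mF F0).
  rewrite -(@ge0_integral_opp (fun t => F (a * t + b)))//.
    by apply: eq_integral => t _; congr F; ring.
  exact: (measurableT_comp mF (measurable_affine1 a b)).
- by rewrite gtr0_norm// ge0_integral_affine1_gt0.
Qed.

End affine1.

(** * Linear changes of variables in several dimensions *)

Section lebesgue_cV_theory.
Context (R : realType).
Local Notation mu := (@lebesgue_measure R).

Definition ccons n (t : R) (v : 'cV[R]_n) : 'cV[R]_n.+1 :=
  @col_mx R 1 n 1 t%:M v.

Lemma ccons0 n t (v : 'cV[R]_n) : ccons t v ord0 0 = t.
Proof.
have -> : @ord0 n = lshift n (@ord0 0) by apply: val_inj.
by rewrite [LHS]col_mxEu mxE eqxx mulr1n.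
Qed.

Lemma cconsS n t (v : 'cV[R]_n) i : ccons t v (lift ord0 i) 0 = v i 0.
Proof.
have -> : lift ord0 i = rshift 1 i by apply: val_inj.
by rewrite [LHS]col_mxEd.
Qed.

Lemma sum_ccons n (V : nmodType) t (v : 'cV[R]_n) (G : 'I_n.+1 -> R -> V) :
  \sum_i G i (ccons t v i 0) = G ord0 t + \sum_i G (lift ord0 i) (v i 0).
Proof.
by rewrite big_ord_recl ccons0; congr (_ + _); apply: eq_bigr => i _; rewrite cconsS.
Qed.

Lemma measurable_ccons n :
  measurable_fun setT (fun y : measurableTypeR R * 'cV[R]_n => ccons y.1 y.2).
Proof. exact: measurable_cons_cV. Qed.

Lemma measurable_ccons1 n (v : 'cV[R]_n) :
  measurable_fun setT (fun t : measurableTypeR R => ccons t v).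
Proof. exact: (measurableT_comp (@measurable_ccons n) (measurable_pair2 v)). Qed.

Lemma measurable_ccons2 n (t : R) :
  measurable_fun setT (fun v : 'cV[R]_n => ccons t v).
Proof. exact: (measurableT_comp (@measurable_ccons n) (measurable_pair1 (t : measurableTypeR R))). Qed.

Lemma ge0_integral_cVS n (F : 'cV[R]_n.+1 -> \bar R) :
  measurable_fun setT F -> (forall u, 0 <= F u)%E ->
  (\int[lebesgue_cV n.+1]_u F u =
   \int[mu]_t \int[lebesgue_cV n]_v F (ccons t v))%E.
Proof.
move=> mF F0.
transitivity (\int[mu \x @lebesgue_cV R n]_y F (ccons y.1 y.2))%E.
  by rewrite -(ge0_integral_pushforward (@measurable_ccons n) (mu \x @lebesgue_cV R n)%E measurableT mF).
rewrite fubini_tonelli1//=.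
exact: (measurableT_comp mF (@measurable_ccons n)).
Qed.

Lemma ge0_integral_cVS_swap n (F : 'cV[R]_n.+1 -> \bar R) :
  measurable_fun setT F -> (forall u, 0 <= F u)%E ->
  (\int[lebesgue_cV n.+1]_u F u =
   \int[lebesgue_cV n]_v \int[mu]_t F (ccons t v))%E.
Proof.
move=> mF F0; rewrite ge0_integral_cVS//.
rewrite (@fubini_tonelli _ _ _ _ _ mu (@lebesgue_cV R n) (fun y => F (ccons y.1 y.2)))//.
exact: (measurableT_comp mF (@measurable_ccons n)).
Qed.

Lemma measurable_mulmx_cV m n (A : 'M[R]_(m, n)) (b : 'cV[R]_m) :
  measurable_fun setT (fun u : 'cV[R]_n => A *m u + b).
Proof.
apply: measurable_mx_entries => i j.
rewrite [X in measurable_fun _ X](_ : _ = fun u : 'cV[R]_n => \sum_k A i k * u k j + b i j).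
  apply: measurable_funD => //; apply: measurable_sum => k.
  by apply: measurable_funM => //; exact: measurable_mx_entry.
by apply/funext => u; rewrite !mxE.
Qed.

Lemma integral_cV0 (F : 'cV[R]_0 -> \bar R) : measurable_fun setT F ->
  (\int[lebesgue_cV 0]_u F u = F 0%R)%E.
Proof. by move=> mF; rewrite /= integral_dirac// diracT mul1e. Qed.

Lemma ge0_integral_shift_cV n (b : 'cV[R]_n) (F : 'cV[R]_n -> \bar R) :
  measurable_fun setT F -> (forall u, 0 <= F u)%E ->
  (\int[lebesgue_cV n]_u F (u + b)%R = \int[lebesgue_cV n]_u F u)%E.
Proof.
elim: n b F => [|n IH] b F mF F0.
  by apply: eq_integral => u _; congr F; rewrite [u + b]flatmx0 [u]flatmx0.
have mS m (c : 'cV[R]_m) : measurable_fun setT (fun u : 'cV[R]_m => u + c).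
  have := measurable_mulmx_cV 1%:M c.
  by apply: eq_measurable_fun => u _; rewrite mul1mx.
pose b0 := b ord0 0; pose b1 : 'cV[R]_n := \col_i b (lift ord0 i) 0.
have bE t v : ccons t v + b = ccons (1 * t + b0) (v + b1).
  apply/colP => i; rewrite mxE; case: (unliftP ord0 i) => [j ->|->].
    by rewrite !cconsS !mxE.
  by rewrite !ccons0 mul1r.
rewrite ge0_integral_cVS//; last exact: (measurableT_comp mF (mS _ b)).
rewrite [RHS](ge0_integral_cVS mF F0).
under eq_integral => t _ do under eq_integral do rewrite bE.
transitivity (\int[mu]_t \int[lebesgue_cV n]_v F (ccons (1 * t + b0)%R v))%E.
  apply: eq_integral => t _; apply: (IH b1 (fun v => F (ccons (1 * t + b0) v))) => //.
  exact: (measurableT_comp mF (measurable_ccons2 _)).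
rewrite (@ge0_integral_affine1 R 1 b0 (fun t => \int[lebesgue_cV n]_v F (ccons t v)))%E//.
- by rewrite normr1 invr1 mul1e.
- apply: (@measurable_fun_fubini_tonelli_F _ _ _ _ _ (@lebesgue_cV R n) (fun y => F (ccons y.1 y.2))) => //.
  exact: (measurableT_comp mF (@measurable_ccons n)).
- by move=> t; exact: integral_ge0.
Qed.

(** The change of variables formula for [A]. It passes to products, so it suffices to factor an
    invertible matrix into simple ones. *)
Let lincov n (A : 'M[R]_n) := forall F : 'cV[R]_n -> \bar R,
  measurable_fun setT F -> (forall u, 0 <= F u)%E ->
  (\int[lebesgue_cV n]_u F (A *m u)%R = (`|\det A|^-1)%:E * \int[lebesgue_cV n]_u F u)%E.

Let mlin n (A : 'M[R]_n) : measurable_fun setT (fun u : 'cV[R]_n => A *m u).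
Proof.
have := measurable_mulmx_cV A 0.
by apply: eq_measurable_fun => u _; rewrite addr0.
Qed.

Let lincovM n (A B : 'M[R]_n) : lincov A -> lincov B -> lincov (A *m B).
Proof.
move=> hA hB F mF F0.
under eq_integral do rewrite -mulmxA.
rewrite (hB (fun u => F (A *m u)))//; last exact: (measurableT_comp mF (@mlin n A)).
by rewrite hA// muleA -EFinM det_mulmx normrM invfM mulrC.
Qed.

Let ccons_mul n (a : R) (r : 'rV[R]_n) (c : 'cV[R]_n) (B : 'M[R]_n) t v :
  (block_mx a%:M r c B : 'M[R]_n.+1) *m ccons t v =
  ccons (a * t + (r *m v) 0 0) (B *m v + t *: c).
Proof.
rewrite {1}/ccons [LHS](@mul_block_col R 1 n 1 n 1); apply: (congr2 (@col_mx R 1 n 1)).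
  by apply/matrixP => i j; rewrite !ord1 !mxE big_ord1 !mxE eqxx !mulr1n.
by rewrite addrC; congr (_ + _); rewrite mul_mx_scalar.
Qed.

Let lincov_lower n (c : 'cV[R]_n) (B : 'M[R]_n) : lincov B ->
  lincov (block_mx 1%:M 0 c B : 'M[R]_n.+1).
Proof.
move=> hB F mF F0.
rewrite ge0_integral_cVS//; last exact: (measurableT_comp mF (@mlin n.+1 _)).
rewrite [in RHS]ge0_integral_cVS//.
have -> : \det (block_mx 1%:M 0 c B : 'M[R]_n.+1) = \det B.
  by rewrite [LHS](@det_lblock _ 1 n) det1 mul1r.
rewrite -ge0_integralZl//; first last.
- by move=> t _; exact: integral_ge0.
- apply: (@measurable_fun_fubini_tonelli_F _ _ _ _ _ (@lebesgue_cV R n) (fun y => F (ccons y.1 y.2))) => //.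
  exact: (measurableT_comp mF (@measurable_ccons n)).
apply: eq_integral => t _.
have mFt : measurable_fun setT (fun v => F (ccons t v)).
  exact: (measurableT_comp mF (measurable_ccons2 _)).
rewrite -(ge0_integral_shift_cV (t *: c) mFt)// -hB//.
  by apply: eq_integral => v _; rewrite ccons_mul mul0mx mxE addr0 mul1r.
have := measurable_mulmx_cV 1%:M (t *: c).
move=> h; apply: (measurableT_comp mFt).
by apply: eq_measurable_fun h => u _; rewrite mul1mx.
Qed.

Let lincov_upper n (a : R) (r : 'rV[R]_n) : a != 0 ->
  lincov (block_mx a%:M r 0 1%:M : 'M[R]_n.+1).
Proof.
move=> a0 F mF F0.
rewrite ge0_integral_cVS_swap//; last exact: (measurableT_comp mF (@mlin n.+1 _)).
rewrite [in RHS]ge0_integral_cVS_swap//.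
have -> : \det (block_mx a%:M r 0 1%:M : 'M[R]_n.+1) = a.
  by rewrite [LHS](@det_ublock _ 1 n) det1 mulr1 det_scalar expr1.
rewrite -ge0_integralZl//; first last.
- by move=> t _; exact: integral_ge0.
- apply: (@measurable_fun_fubini_tonelli_G _ _ _ _ _ mu (fun y : measurableTypeR R * 'cV[R]_n => F (ccons y.1 y.2))) => //.
  exact: (measurableT_comp mF (@measurable_ccons n)).
apply: eq_integral => v _.
have mFt : measurable_fun setT (fun t : R => F (ccons t v)).
  exact: (measurableT_comp mF (measurable_ccons1 _)).
rewrite -(ge0_integral_affine1 ((r *m v) 0 0) a0 mFt)//.
by apply: eq_integral => t _; rewrite ccons_mul mul1mx scaler0 addr0.
Qed.

(** Block LU factorisation with pivot [a]: a lower factor carrying the Schur complement [B'], times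
    an upper factor that changes only the first coordinate. *)
Let lincov_block n (a : R) (r : 'rV[R]_n) (c : 'cV[R]_n) (B : 'M[R]_n) : a != 0 ->
  (forall B' : 'M[R]_n, B' \in unitmx -> lincov B') ->
  (block_mx a%:M r c B : 'M[R]_n.+1) \in unitmx ->
  lincov (block_mx a%:M r c B : 'M[R]_n.+1).
Proof.
move=> a0 IH uA.
pose B' := B - (a^-1 *: c) *m r.
have AE : (block_mx a%:M r c B : 'M[R]_n.+1) =
    (block_mx 1%:M 0 (a^-1 *: c) B' : 'M[R]_n.+1) *m (block_mx a%:M r 0 1%:M : 'M[R]_n.+1).
  rewrite [RHS](@mulmx_block R 1 n 1 n 1 n) !mul1mx !mulmx0 !mul0mx !addr0 mulmx1 /B'.
  by rewrite mul_mx_scalar scalerA divff// scale1r addrC subrK.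
move: uA; rewrite AE unitmx_mul => /andP[u1 _].
apply: lincovM; last exact: lincov_upper.
apply/lincov_lower/IH; move: u1; rewrite !unitmxE.
by rewrite [X in X \is a GRing.unit](@det_lblock _ 1 n) det1 mul1r.
Qed.

Lemma ge0_integral_linear_cV n (A : 'M[R]_n) (F : 'cV[R]_n -> \bar R) :
  A \in unitmx -> measurable_fun setT F -> (forall u, 0 <= F u)%E ->
  (\int[lebesgue_cV n]_u F (A *m u)%R = (`|\det A|^-1)%:E * \int[lebesgue_cV n]_u F u)%E.
Proof.
move=> uA; move: F; rewrite -[forall F, _]/(lincov A).
elim: n A uA => [|n IH] A uA.
  move=> F mF F0; rewrite det_mx00 normr1 invr1 mul1e.
  by apply: eq_integral => u _; congr F; rewrite [A *m u]flatmx0 [u]flatmx0.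
have AE : A = (block_mx (A 0 0)%:M (ursubmx (A : 'M[R]_(1 + n))) (dlsubmx (A : 'M[R]_(1 + n))) (drsubmx (A : 'M[R]_(1 + n))) : 'M[R]_n.+1).
  rewrite -[LHS](@submxK _ 1 n 1 n A).
  apply: (congr1 (fun X => @block_mx R 1 n 1 n X (ursubmx _) (dlsubmx _) (drsubmx _))).
  apply/matrixP => i j; rewrite !ord1 !mxE eqxx mulr1n.
  by congr (A _ _); apply: val_inj.
have [a0|a0] := eqVneq (A 0 0) 0; last by rewrite AE; apply: lincov_block; rewrite // -AE.
(* A zero pivot with a zero column below it would make the determinant vanish. *)
have [c0|[i ci]] : dlsubmx (A : 'M[R]_(1 + n)) = 0 \/ exists i, dlsubmx (A : 'M[R]_(1 + n)) i 0 != 0.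
  have [|/negP h] := boolP [exists i, dlsubmx (A : 'M[R]_(1 + n)) i 0 != 0].
    by move/existsP; right.
  left; apply/colP => i; rewrite [RHS]mxE; apply/eqP; apply/negPn/negP => hi.
  by apply: h; apply/existsP; exists i.
  move: uA; rewrite AE c0 a0 unitmxE [X in X \is a GRing.unit](@det_ublock _ 1 n).
  by rewrite det_scalar expr1 mul0r unitr0.
pose r : 'rV[R]_n := delta_mx 0 i.
(* [U 1] adds row [i] of the lower block to the top row and so makes the pivot nonzero; [U (-1)]
   undoes this. *)
pose U (s : R) : 'M[R]_n.+1 := block_mx 1%:M (s *: r) 0 1%:M.
have UK : U (-1) *m U 1 = 1%:M.
  rewrite /U [LHS](@mulmx_block R 1 n 1 n 1 n) !mul1mx !mulmx0 !mul0mx !addr0 mulmx1.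
  rewrite scaleN1r scale1r subrr add0r -[RHS]/(1%:M : 'M[R]_(1 + n)).
  by rewrite [RHS](@scalar_mx_block _ 1 n).
have U1u : U 1 \in unitmx by case/mulmx1_unit: UK.
have -> : A = U (-1) *m (U 1 *m A) by rewrite mulmxA UK mul1mx.
apply: lincovM; first by apply: lincov_upper; rewrite oner_eq0.
have UA : U 1 *m A = (block_mx (dlsubmx (A : 'M[R]_(1 + n)) i 0)%:M
    (ursubmx (A : 'M[R]_(1 + n)) + r *m drsubmx (A : 'M[R]_(1 + n)))
    (dlsubmx (A : 'M[R]_(1 + n))) (drsubmx (A : 'M[R]_(1 + n))) : 'M[R]_n.+1).
  rewrite {1}AE /U [LHS](@mulmx_block R 1 n 1 n 1 n) !mul1mx !mul0mx !add0r scale1r a0.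
  rewrite [0%:M]raddf0 add0r.
  apply: (congr1 (fun X => @block_mx R 1 n 1 n X (_ + _) (dlsubmx _) (drsubmx _))).
  apply/matrixP => a b; rewrite !ord1 -rowE !mxE eqxx mulr1n.
  by congr (A _ _); apply: val_inj.
by rewrite UA; apply: lincov_block => //; rewrite -UA unitmx_mul U1u.
Qed.

End lebesgue_cV_theory.

(** * The standard Gaussian measure *)

Lemma invmx_uniq (F : comUnitRingType) n (A B : 'M[F]_n) : A *m B = 1%:M -> invmx A = B.
Proof.
move=> AB; have [uA _] := mulmx1_unit AB.
by rewrite -[RHS](mulKmx uA) AB mulmx1.
Qed.

Section std_gauss.
Context (R : realType).
Local Notation mu := (@lebesgue_measure R).
Local Notation N1 := (@normal_prob R 0 1).

Definition sqnorm n (u : 'cV[R]_n) : R := \sum_i u i 0 ^+ 2.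

Lemma sqnormE n (u : 'cV[R]_n) : sqnorm u = (u^T *m u) 0 0.
Proof. by rewrite mxE; apply: eq_bigr => i _; rewrite mxE expr2. Qed.

Lemma sqnorm0 n : sqnorm (0 : 'cV[R]_n) = 0.
Proof. by rewrite /sqnorm big1// => i _; rewrite mxE expr0n. Qed.

Lemma sqnorm_ge0 n (u : 'cV[R]_n) : 0 <= sqnorm u.
Proof. by apply: sumr_ge0 => i _; exact: sqr_ge0. Qed.

Lemma sqr_enorm n (u : 'cV[R]_n) : enorm u ^+ 2 = sqnorm u.
Proof. by rewrite sqr_sqrtr// sqnorm_ge0. Qed.

Lemma sqnorm_ccons n t (v : 'cV[R]_n) : sqnorm (ccons t v) = t ^+ 2 + sqnorm v.
Proof. by rewrite /sqnorm (sum_ccons _ _ (fun _ x => x ^+ 2)). Qed.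

Lemma measurable_sqnorm n : measurable_fun setT (@sqnorm n).
Proof.
by apply: measurable_sum => i; apply: measurable_funX; exact: measurable_mx_entry.
Qed.

Definition std_gauss {n} : set 'cV[R]_n -> \bar R := gauss 0 1%:M.
HB.instance Definition _ n := Measure.on (@std_gauss n).

Definition std_pdf n (u : 'cV[R]_n) : R :=
  expR (- 2^-1 * sqnorm u) / Num.sqrt ((2 * pi) ^+ n).

Lemma std_pdfE n : @std_pdf n = gauss_pdf 0 1%:M :> ('cV[R]_n -> R).
Proof.
apply/funext => u; rewrite /std_pdf /gauss_pdf det1 mulr1 subr0 invmx1 mulmx1.
by rewrite sqnormE.
Qed.

Lemma std_pdf_ge0 n (u : 'cV[R]_n) : 0 <= std_pdf u.
Proof. by rewrite std_pdfE gauss_pdf_ge0. Qed.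

Lemma measurable_std_pdf n : measurable_fun setT (@std_pdf n).
Proof. by rewrite std_pdfE; exact: measurable_gauss_pdf. Qed.

Lemma std_gaussE n (A : set 'cV[R]_n) : measurable A ->
  std_gauss A = (\int[lebesgue_cV n]_(u in A) (std_pdf u)%:E)%E.
Proof. by rewrite std_pdfE. Qed.

Lemma normal_pdf01 t : normal_pdf 0 1 t = expR (- 2^-1 * t ^+ 2) / Num.sqrt (2 * pi) :> R.
Proof.
rewrite /normal_pdf oner_eq0 /normal_peak /normal_fun subr0 expr1n mul1r mulrC.
congr (expR _ / _); first by field.
by congr (Num.sqrt _); rewrite mulr_natl.
Qed.

Lemma std_pdf_ccons n t (v : 'cV[R]_n) :
  std_pdf (ccons t v) = normal_pdf 0 1 t * std_pdf v.
Proof.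
rewrite /std_pdf sqnorm_ccons mulrDr expRD (exprS _ n) sqrtrM ?mulr_ge0 ?pi_ge0//.
by rewrite invfM normal_pdf01; ring.
Qed.

Lemma ge0_integral_std_gauss n (F : 'cV[R]_n -> \bar R) :
  measurable_fun setT F -> (forall u, 0 <= F u)%E ->
  (\int[std_gauss]_u F u = \int[lebesgue_cV n]_u (F u * (std_pdf u)%:E))%E.
Proof.
move=> mF F0; apply: ge0_integral_density => //.
- exact: measurable_std_pdf.
- exact: std_pdf_ge0.
- exact: std_gaussE.
Qed.

Lemma ge0_integral_normal (F : R -> \bar R) :
  measurable_fun setT F -> (forall u, 0 <= F u)%E ->
  (\int[N1]_u F u = \int[mu]_u (F u * (normal_pdf 0 1 u)%:E))%E.
Proof.
move=> mF F0; apply: ge0_integral_density => //.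
- exact: measurable_normal_pdf.
- exact: normal_pdf_ge0.
Qed.

Lemma measurable_integral_ccons n (F : 'cV[R]_n.+1 -> \bar R)
    (m : {sigma_finite_measure set 'cV[R]_n -> \bar R}) :
  measurable_fun setT F -> (forall u, 0 <= F u)%E ->
  measurable_fun setT (fun t : R => \int[m]_v F (ccons t v))%E.
Proof.
move=> mF F0.
apply: (@measurable_fun_fubini_tonelli_F _ _ _ _ _ m (fun y : measurableTypeR R * 'cV[R]_n => F (ccons y.1 y.2))) => //.
exact: (measurableT_comp mF (@measurable_ccons R n)).
Qed.

Let std_gauss_rec n (F : 'cV[R]_n.+1 -> \bar R) :
  measurable_fun setT F -> (forall u, 0 <= F u)%E ->
  (\int[std_gauss]_u F u = \int[mu]_t ((normal_pdf 0 1 t)%:E * \int[@std_gauss n]_v F (ccons t v)))%E.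
Proof.
move=> mF F0; rewrite ge0_integral_std_gauss// ge0_integral_cVS//; last 2 first.
- by apply: emeasurable_funM => //; apply/measurable_EFinP; exact: measurable_std_pdf.
- by move=> u; rewrite mule_ge0// lee_fin std_pdf_ge0.
apply: eq_integral => t _.
have mFt : measurable_fun setT (fun v => F (ccons t v)).
  exact: (measurableT_comp mF (measurable_ccons2 _)).
rewrite ge0_integral_std_gauss// -ge0_integralZl//.
- by apply: eq_integral => v _; rewrite std_pdf_ccons EFinM; rewrite muleCA.
- by apply: emeasurable_funM => //; apply/measurable_EFinP; exact: measurable_std_pdf.
- by move=> v _; rewrite mule_ge0// lee_fin std_pdf_ge0.
- by rewrite lee_fin normal_pdf_ge0.
Qed.

Let std_gauss_setT n : (\int[@std_gauss n]_u 1 = 1)%E.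
Proof.
elim: n => [|n IH].
  rewrite ge0_integral_std_gauss// integral_cV0; last first.
    by apply: emeasurable_funM => //; apply/measurable_EFinP; exact: measurable_std_pdf.
  by rewrite mul1e /std_pdf /sqnorm big_ord0 mulr0 expR0 expr0 sqrtr1 divr1.
rewrite std_gauss_rec//; under eq_integral do rewrite IH mule1.
exact: integral_normal_pdf.
Qed.

Let std_gauss_prob n : @std_gauss n setT = 1%E.
Proof. by rewrite -(std_gauss_setT n) integral_cst// mul1e. Qed.

HB.instance Definition _ n :=
  @Measure_isProbability.Build _ _ R (@std_gauss n) (@std_gauss_prob n).

Lemma ge0_integral_std_gaussS n (F : 'cV[R]_n.+1 -> \bar R) :
  measurable_fun setT F -> (forall u, 0 <= F u)%E ->
  (\int[std_gauss]_u F u = \int[N1]_t \int[@std_gauss n]_v F (ccons t v))%E.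
Proof.
move=> mF F0; rewrite std_gauss_rec// ge0_integral_normal//.
- by apply: eq_integral => t _; rewrite muleC.
- exact: (measurable_integral_ccons _ mF).
- by move=> t; exact: integral_ge0.
Qed.

(** Under [L g + m] the quadratic form in the density becomes [sqnorm g], and the Jacobian cancels
    the determinant in the normalising factor. *)
Lemma ge0_integral_gauss n (m : 'cV[R]_n) (S L : 'M[R]_n) (F : 'cV[R]_n -> \bar R) :
  L \in unitmx -> L *m L^T = S ->
  measurable_fun setT F -> (forall u, 0 <= F u)%E ->
  (\int[gauss m S]_u F u = \int[std_gauss]_g F (L *m g + m)%R)%E.
Proof.
move=> uL LS mF F0.
have mE (H : 'cV[R]_n -> R) : measurable_fun setT H -> measurable_fun setT (EFin \o H).
  by move=> ?; apply/measurable_EFinP.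
rewrite (@ge0_integral_density _ _ _ (lebesgue_cV n) _ (gauss_pdf m S))//; last 2 first.
- exact: measurable_gauss_pdf.
- exact: gauss_pdf_ge0.
rewrite ge0_integral_std_gauss//; last first.
  exact: (measurableT_comp mF (measurable_mulmx_cV L m)).
have mG : measurable_fun setT (fun u => F u * (gauss_pdf m S u)%:E)%E.
  by apply: emeasurable_funM => //; apply: mE; exact: measurable_gauss_pdf.
have G0 u : (0 <= F u * (gauss_pdf m S u)%:E)%E by rewrite mule_ge0// lee_fin gauss_pdf_ge0.
rewrite -[LHS](ge0_integral_shift_cV m mG G0) /=.
have dL : `|\det L| != 0 by rewrite normr_eq0 -unitfE -unitmxE.
have mGm : measurable_fun setT (fun u : 'cV[R]_n => F (u + m)%R * (gauss_pdf m S (u + m))%:E)%E.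
  have h := measurable_mulmx_cV 1%:M m.
  apply: (measurableT_comp mG).
  by apply: eq_measurable_fun h => u _; rewrite mul1mx.
have := congr1 (fun x => `|\det L|%:E * x)%E (ge0_integral_linear_cV uL mGm (fun u => G0 (u + m))).
rewrite /= muleA -EFinM divff// mul1e => <-.
rewrite -ge0_integralZl; [|by []|exact: (measurableT_comp mG (measurable_mulmx_cV L m))|by move=> g _; exact: G0|by rewrite lee_fin].
apply: eq_integral => g _; rewrite muleCA -EFinM; congr (_ * _%:E)%E.
rewrite /gauss_pdf /std_pdf addrK mulrCA -LS.
have -> : ((L *m g)^T *m invmx (L *m L^T) *m (L *m g)) 0 0 = sqnorm g.
  rewrite sqnormE; congr fun_of_matrix.
  have uLT : L^T \in unitmx by rewrite unitmx_tr.
  have -> : invmx (L *m L^T) = invmx L^T *m invmx L.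
    by apply: invmx_uniq; rewrite -mulmxA mulKVmx// mulmxV.
  by rewrite trmx_mul !mulmxA mulmxK// mulmxKV.
congr (_ * _); rewrite det_mulmx det_tr -expr2 sqrtrM ?exprn_ge0 ?mulr_ge0 ?pi_ge0//.
by rewrite sqrtr_sqr invfM mulrCA divff ?mulr1.
Qed.

(** The weight is the Jacobian times the ratio of the Gaussian densities at [A g] and [g]. Rotation
    invariance, exponential moments of quadratic forms and the dilation argument all come from this
    formula. *)
Lemma ge0_integral_std_gauss_linear n (A : 'M[R]_n) (F : 'cV[R]_n -> \bar R) :
  A \in unitmx -> measurable_fun setT F -> (forall u, 0 <= F u)%E ->
  (\int[std_gauss]_g (F (A *m g)%R *
      (`|\det A| * expR (2^-1 * (sqnorm g - sqnorm (A *m g))))%:E) =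
   \int[std_gauss]_g F g)%E.
Proof.
move=> uA mF F0.
have mAg : measurable_fun setT (fun g : 'cV[R]_n => A *m g).
  have h := measurable_mulmx_cV A 0.
  by apply: eq_measurable_fun h => u _; rewrite addr0.
have mFA : measurable_fun setT (fun g => F (A *m g)) by exact: (measurableT_comp mF mAg).
have mE (H : 'cV[R]_n -> R) : measurable_fun setT H -> measurable_fun setT (EFin \o H).
  by move=> ?; apply/measurable_EFinP.
rewrite !ge0_integral_std_gauss//; last 2 first.
- apply: emeasurable_funM => //; apply: mE; apply: measurable_funM => //.
  apply: measurableT_comp => //; apply: measurable_funM => //; apply: measurable_funB.
    exact: measurable_sqnorm.
  exact: (measurableT_comp (@measurable_sqnorm n) mAg).
- by move=> g; rewrite mule_ge0// lee_fin mulr_ge0// expR_ge0.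
have dA : `|\det A| != 0 by rewrite normr_eq0 -unitfE -unitmxE.
have mG : measurable_fun setT (fun u => F u * (std_pdf u)%:E)%E.
  by apply: emeasurable_funM => //; apply: mE; exact: measurable_std_pdf.
have G0 u : (0 <= F u * (std_pdf u)%:E)%E by rewrite mule_ge0// lee_fin std_pdf_ge0.
have := congr1 (fun x => `|\det A|%:E * x)%E (ge0_integral_linear_cV uA mG G0).
rewrite /= muleA -EFinM divff// mul1e => <-.
rewrite -ge0_integralZl//; last exact: (measurableT_comp mG mAg).
apply: eq_integral => g _; rewrite muleCA -muleA -EFinM -EFinM; congr (_ * _%:E)%E.
rewrite /std_pdf; rewrite -!mulrA; congr (_ * _); rewrite mulrA -expRD; congr (expR _ * _).
by ring.
Qed.

Lemma ge0_integral_std_gauss_orthogonal n (A : 'M[R]_n) (F : 'cV[R]_n -> \bar R) :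
  A^T *m A = 1%:M -> measurable_fun setT F -> (forall u, 0 <= F u)%E ->
  (\int[std_gauss]_g F (A *m g)%R = \int[std_gauss]_g F g)%E.
Proof.
move=> AA mF F0.
have uA : A \in unitmx by case: (mulmx1_unit AA).
rewrite -(@ge0_integral_std_gauss_linear n A F uA mF F0); apply: eq_integral => g _.
have -> : `|\det A| = 1.
  have /eqP : \det A ^+ 2 = 1 by rewrite expr2 -{1}det_tr -det_mulmx AA det1.
  by rewrite sqrf_eq1 => /orP[] /eqP ->; rewrite ?normrN normr1.
have -> : sqnorm (A *m g) = sqnorm g.
  by rewrite !sqnormE trmx_mul -mulmxA (mulmxA A^T) AA mul1mx.
by rewrite subrr mulr0 expR0 mulr1 mule1.
Qed.

Definition dmx n (c : 'I_n -> R) : 'M[R]_n := diag_mx (\row_i c i).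

Lemma mul_dmx n (c : 'I_n -> R) (g : 'cV[R]_n) : dmx c *m g = \col_i (c i * g i 0).
Proof. by rewrite /dmx mul_diag_mx; apply/colP => i; rewrite !mxE. Qed.

Lemma det_dmx n (c : 'I_n -> R) : \det (dmx c) = \prod_i c i.
Proof. by rewrite det_diag; apply: eq_bigr => i _; rewrite mxE. Qed.

Lemma unit_dmx n (c : 'I_n -> R) : (forall i, c i != 0) -> dmx c \in unitmx.
Proof.
by move=> c0; rewrite unitmxE det_dmx unitfE prodf_seq_neq0; apply/allP => i _; rewrite c0.
Qed.

(** Case [F = 1] of the linear change of variables, for the diagonal matrix with entries
    [sqrt (1 - c i)]. *)
Lemma std_gauss_expR_quad n (c : 'I_n -> R) : (forall i, c i < 1) ->
  (\int[std_gauss]_g (expR (2^-1 * \sum_i c i * g i 0 ^+ 2))%:E =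
   ((Num.sqrt (\prod_i (1 - c i)))^-1)%:E)%E.
Proof.
move=> c1.
have c1' i : 0 < 1 - c i by rewrite subr_gt0.
pose A := dmx (fun i => Num.sqrt (1 - c i)).
have uA : A \in unitmx by apply: unit_dmx => i; rewrite gt_eqF// sqrtr_gt0.
have dA : \det A = Num.sqrt (\prod_i (1 - c i)).
  rewrite det_dmx; elim/big_rec2: _ => [|i x y _ ->]; first by rewrite sqrtr1.
  by rewrite sqrtrM// ltW.
have dA0 : 0 < \det A.
  by rewrite dA sqrtr_gt0 prodr_gt0.
have := @ge0_integral_std_gauss_linear n A (cst 1)%E uA (measurable_cst _) (fun=> @lee01 R).
rewrite /= integral_cst// mul1e; have /= -> := @probability_setT _ _ _ (@std_gauss n).
under eq_integral => g _.
  rewrite mul1e EFinM gtr0_norm//.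
  have -> : sqnorm g - sqnorm (A *m g) = \sum_i c i * g i 0 ^+ 2.
    rewrite -sumrB; apply: eq_bigr => i _; rewrite mul_dmx mxE exprMn sqr_sqrtr ?ltW//.
    by ring.
  over.
rewrite ge0_integralZl//; last 2 first.
- apply/measurable_EFinP; apply: measurableT_comp => //; apply: measurable_funM => //.
  apply: measurable_sum => i; apply: measurable_funM => //; apply: measurable_funX.
  exact: measurable_mx_entry.
- by rewrite lee_fin ltW.
move=> /(congr1 (fun x => ((\det A)^-1)%:E * x)%E).
by rewrite muleA -EFinM mulVf ?gt_eqF// mul1e mule1 dA.
Qed.

End std_gauss.

(** * Gaussian tails *)

Section exp_bounds.
Context (R : realType).
Implicit Types (x y t : R).

Lemma expR_convex01 t x : 0 <= t <= 1 -> expR (t * x) <= 1 - t + t * expR x.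
Proof.
move=> /andP[t0 t1].
have := convex_expR (Itv01 t0 t1) x 0; rewrite !convRE /= expR0 mulr0 addr0 mulr1.
by rewrite addrC.
Qed.

Lemma expR1_ge : 53 / 20 <= expR 1 :> R.
Proof.
have h : (1 + 1 / 32) ^+ 32 <= expR 1 :> R.
  rewrite [in leRHS](_ : 1 = 32%:R * (1 / 32)); last by field.
  by rewrite expRM_natl lerXn2r ?nnegrE ?expR_ge0 ?addr_ge0 ?divr_ge0//; exact: expR_ge1Dx.
apply: le_trans h; have -> : (1 + 1 / 32) ^+ 32 = ((1 + 1 / 32) ^+ 4) ^+ 8 :> R by rewrite -exprM.
have h1 : 113 / 100 <= (1 + 1 / 32) ^+ 4 :> R by rewrite !exprS expr0; lra.
apply: (@le_trans _ _ ((113 / 100) ^+ 8 : R)); last first.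
  by rewrite lerXn2r// nnegrE; [lra|exact: le_trans h1].
have -> : (113 / 100) ^+ 8 = ((113 / 100) ^+ 4) ^+ 2 :> R by rewrite -exprM.
have h2 : 163 / 100 <= (113 / 100) ^+ 4 :> R by rewrite !exprS expr0; lra.
rewrite expr2; apply: (@le_trans _ _ (163 / 100 * (163 / 100) : R)); first by lra.
by apply: ler_pM => //; lra.
Qed.

Lemma expR2_ge : 7 <= expR 2 :> R.
Proof.
rewrite (_ : 2 = 1 + 1 :> R) ?expRD; last by ring.
have := expR1_ge; set e := expR 1 => he.
apply: (@le_trans _ _ (53 / 20 * (53 / 20))); first by lra.
by apply: ler_pM => //; lra.
Qed.

(** Tangent to [ln] at [expR 2], its slope rounded up to [1 / 7]. *)
Lemma ln_le_7 y : 0 < y -> ln y <= y / 7 + 1.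
Proof.
move=> y0; have := expR2_ge; set E := expR 2 => hE.
have E0 : 0 < E by rewrite expR_gt0.
have : ln (y / E) <= y / E - 1.
  have := @le_ln1Dx R (y / E - 1); rewrite addrCA subrr addr0; apply.
  by have := divr_gt0 y0 E0; lra.
rewrite ln_div ?posrE// expRK => h.
have : y / E <= y / 7 by rewrite ler_pM2l// lef_pV2// posrE; lra.
lra.
Qed.

(** Tangent to [ln] at [expR (7 / 5)], its slope rounded up to [13 / 50]; sharper than [ln_le_7] for
    moderate arguments. *)
Lemma ln_le_14 y : 0 < y -> ln y <= 13 / 50 * y + 2 / 5.
Proof.
move=> y0.
have hE : 50 / 13 <= expR (7 / 5) :> R.
  have -> : 7 / 5 = 1 + 2 / 5 :> R by field.
  rewrite expRD; have h1 := expR1_ge.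
  have h2 : 1 + 2 / 5 + 1 / 16 <= expR (2 / 5) :> R.
    have -> : 2 / 5 = 2%:R * (1 / 5) :> R by field.
    rewrite expRM_natl expr2; have := expR_ge1Dx (1 / 5 : R).
    have h3 : 1 + 1 / 5 + 1 / 100 <= expR (1 / 5) :> R.
      have -> : 1 / 5 = 2%:R * (1 / 10) :> R by field.
      rewrite expRM_natl expr2; have h4 := expR_ge1Dx (1 / 10 : R).
      apply: (@le_trans _ _ ((1 + 1 / 10) * (1 + 1 / 10))); first by lra.
      by apply: ler_pM => //; lra.
    move=> _; apply: (@le_trans _ _ ((1 + 1 / 5 + 1 / 100) * (1 + 1 / 5 + 1 / 100))); first by lra.
    by apply: ler_pM => //; lra.
  apply: (@le_trans _ _ (53 / 20 * (1 + 2 / 5 + 1 / 16))); first by lra.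
  by apply: ler_pM => //; lra.
set E := expR (7 / 5) in hE *.
have E0 : 0 < E by lra.
have : ln (y / E) <= y / E - 1.
  have := @le_ln1Dx R (y / E - 1); rewrite addrCA subrr addr0; apply.
  by have := divr_gt0 y0 E0; lra.
rewrite ln_div ?posrE// expRK => h.
have : y / E <= y * (13 / 50).
  rewrite ler_pM2l//; have : E^-1 <= (50 / 13)^-1 by rewrite lef_pV2 ?posrE//; lra.
  by rewrite invf_div.
lra.
Qed.

(** [expR (- 3 / 2)] is the 64th power of [expR (- 3 / 128) >= 125 / 128]; the power is reached by
    repeated squaring, rounding down to small fractions. *)
Lemma expR_3_2_le : expR (3 / 2) <= 23 / 5 :> R.
Proof.
have sq (a b : R) k : 0 <= a -> a <= b ^+ k -> a * a <= b ^+ (k * 2).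
  by move=> a0 ab; rewrite exprM expr2; apply: ler_pM.
have h4 : 211 / 232 <= (125 / 128) ^+ 4 :> R by rewrite !exprS expr0; lra.
have h8 : 110 / 133 <= (125 / 128) ^+ (4 * 2) :> R.
  by apply: le_trans (sq _ _ _ _ h4); lra.
have h16 : 119 / 174 <= (125 / 128) ^+ (4 * 2 * 2) :> R.
  by apply: le_trans (sq _ _ _ _ h8); lra.
have h32 : 36 / 77 <= (125 / 128) ^+ (4 * 2 * 2 * 2) :> R.
  by apply: le_trans (sq _ _ _ _ h16); lra.
have h64 : 5 / 23 <= (125 / 128) ^+ (4 * 2 * 2 * 2 * 2) :> R.
  by apply: le_trans (sq _ _ _ _ h32); lra.
have : 5 / 23 <= expR (- (3 / 2)) :> R.
  have -> : - (3 / 2) = 64%:R * (- (3 / 128)) :> R by field.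
  rewrite expRM_natl; apply: le_trans h64 _.
  rewrite lerXn2r ?nnegrE ?expR_ge0//.
  by apply: le_trans (expR_ge1Dx _); lra.
rewrite expRN => h; rewrite -[leLHS]invrK -[leRHS]invrK lef_pV2 ?posrE ?invr_gt0 ?expR_gt0//; last by lra.
Qed.

End exp_bounds.

(** * Chernoff bounds for Gaussian quadratic forms *)

Section gauss_tails.
Context (R : realType) (n : nat) (lam : 'I_n -> R).
Hypothesis lam01 : forall i, 0 <= lam i <= 1.
Local Notation P := (\sum_i lam i).

Definition wsq (c : 'I_n -> R) (g : 'cV[R]_n) : R := \sum_i c i * g i 0 ^+ 2.

Lemma measurable_wsq c : measurable_fun setT (wsq c).
Proof.
apply: measurable_sum => i; apply: measurable_funM => //; apply: measurable_funX.
exact: measurable_mx_entry.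
Qed.

Lemma wsq_ge0 c g : (forall i, 0 <= c i) -> 0 <= wsq c g.
Proof. by move=> c0; apply: sumr_ge0 => i _; rewrite mulr_ge0// sqr_ge0. Qed.

Lemma wsqD c c' g : wsq (fun i => c i + c' i) g = wsq c g + wsq c' g.
Proof. by rewrite -big_split; apply: eq_bigr => i _; rewrite mulrDl. Qed.

Lemma wsqZ k c g : wsq (fun i => k * c i) g = k * wsq c g.
Proof. by rewrite mulr_sumr; apply: eq_bigr => i _; rewrite mulrA. Qed.

Lemma le_wsq c c' g : (forall i, c i <= c' i) -> wsq c g <= wsq c' g.
Proof. by move=> h; apply: ler_sum => i _; rewrite ler_wpM2r// sqr_ge0. Qed.

Definition Eg (F : 'cV[R]_n -> R) : \bar R := (\int[@std_gauss R n]_g (F g)%:E)%E.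
Arguments Eg F%_R.

Lemma le_Eg (F G : 'cV[R]_n -> R) : measurable_fun setT F -> measurable_fun setT G ->
  (forall g, 0 <= F g) -> (forall g, F g <= G g) -> (Eg F <= Eg G)%E.
Proof.
move=> mF mG F0 FG; apply: ge0_le_integral => //.
- by move=> g _; rewrite lee_fin.
- exact/measurable_EFinP.
- exact/measurable_EFinP.
- by move=> g _; rewrite lee_fin.
Qed.

Lemma EgD (F G : 'cV[R]_n -> R) : measurable_fun setT F -> measurable_fun setT G ->
  (forall g, 0 <= F g) -> (forall g, 0 <= G g) ->
  Eg (fun g => F g + G g) = (Eg F + Eg G)%E.
Proof.
move=> mF mG F0 G0; rewrite /Eg; under eq_integral do rewrite EFinD.
by rewrite ge0_integralD//; try exact/measurable_EFinP; move=> g _; rewrite lee_fin.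
Qed.

Lemma EgZ k (F : 'cV[R]_n -> R) : 0 <= k -> measurable_fun setT F -> (forall g, 0 <= F g) ->
  Eg (fun g => k * F g) = (k%:E * Eg F)%E.
Proof.
move=> k0 mF F0; rewrite /Eg; under eq_integral do rewrite EFinM.
by rewrite ge0_integralZl//; try exact/measurable_EFinP; move=> g _; rewrite lee_fin.
Qed.

Lemma Eg_ge0 (F : 'cV[R]_n -> R) : (forall g, 0 <= F g) -> (0 <= Eg F)%E.
Proof. by move=> F0; apply: integral_ge0 => g _; rewrite lee_fin. Qed.

Lemma Eg_cst k : Eg (fun=> k) = k%:E.
Proof.
by rewrite /Eg integral_cst// [X in (_ * X)%E](@probability_setT _ _ _ (@std_gauss R n)) mule1.
Qed.

(** The mean is the product of the [(1 - c i) ^ (- 1 / 2)]; exponential lower bounds on the factors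
    make the result depend on the trace alone. *)
Lemma Eg_quad_le (c : 'I_n -> R) (k : R) : (forall i, 0 <= k * lam i) ->
  (forall i, expR (- (k * lam i)) <= 1 - c i) ->
  (Eg (fun g => expR (2^-1 * wsq c g)) <= (expR (2^-1 * (k * P)))%:E)%E.
Proof.
move=> k0 h.
have c1 i : c i < 1 by rewrite -subr_gt0; apply: lt_le_trans (h i); exact: expR_gt0.
rewrite /Eg std_gauss_expR_quad// lee_fin.
have h1 : expR (- (k * P)) <= \prod_i (1 - c i).
  by rewrite mulr_sumr -sumrN expR_sum; apply: ler_prod => i _; rewrite expR_ge0 h.
have p0 : 0 < \prod_i (1 - c i) by apply: lt_le_trans h1; exact: expR_gt0.
rewrite -[leRHS]invrK lef_pV2 ?posrE ?invr_gt0 ?expR_gt0 ?sqrtr_gt0//.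
rewrite -expRN -[leLHS]ger0_norm ?expR_ge0// -sqrtr_sqr ler_sqrt ?(ltW p0)//.
rewrite -expRM_natl; by apply: le_trans h1; rewrite ler_expR; lra.
Qed.

(** For [0 <= lam i <= 1], convexity gives [(1 - s) ^ lam i <= 1 - s * lam i], so the spectrum
    enters only through its sum. *)
Lemma Eg_chernoff s : 0 <= s < 1 ->
  (Eg (fun g => expR (2^-1 * (s * wsq lam g))) <= (expR (- 2^-1 * (ln (1 - s) * P)))%:E)%E.
Proof.
move=> /andP[s0 s1].
have s1' : 0 < 1 - s by rewrite subr_gt0.
have ls : 0 <= - ln (1 - s) by rewrite oppr_ge0 ln_le0//; lra.
have := @Eg_quad_le (fun i => s * lam i) (- ln (1 - s)).
rewrite (_ : (fun g => _) = (fun g => expR (2^-1 * (s * wsq lam g)))); last first.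
  by apply/funext => g; rewrite wsqZ.
rewrite (_ : 2^-1 * (- ln (1 - s) * P) = - 2^-1 * (ln (1 - s) * P)); last by ring.
apply => i; have /andP[l0 l1] := lam01 i; first by rewrite mulr_ge0.
rewrite mulNr opprK mulrC; apply: le_trans (expR_convex01 _ (lam01 i)) _.
by rewrite lnK ?posrE//; lra.
Qed.

(** Rests on [\prod (1 - x_i) >= 1 - \sum x_i]. For a small trace this admits parameters [s >= 1],
    out of reach of [Eg_chernoff]. *)
Lemma Eg_chernoff2 s : 0 <= s -> s * P < 1 ->
  (Eg (fun g => expR (2^-1 * (s * wsq lam g))) <= ((Num.sqrt (1 - s * P))^-1)%:E)%E.
Proof.
move=> s0 sP.
have l0 i : 0 <= lam i by have /andP[] := lam01 i.
have lP i : lam i <= P by rewrite (bigD1 i)//= lerDl sumr_ge0.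
have c1 i : s * lam i < 1 by apply: le_lt_trans sP; rewrite ler_wpM2l.
have -> : Eg (fun g => expR (2^-1 * (s * wsq lam g))) = ((Num.sqrt (\prod_i (1 - s * lam i)))^-1)%:E.
  by rewrite -(std_gauss_expR_quad c1); apply: eq_integral => g _; rewrite -wsqZ.
rewrite lee_fin.
have h : 1 - s * P <= \prod_i (1 - s * lam i).
  suff [] : 0 <= \prod_i (1 - s * lam i) <= 1 /\ 1 - s * P <= \prod_i (1 - s * lam i) by [].
  elim/big_rec2: _ => [|i y x _ [/andP[y0 y1] IH]]; first by rewrite mulr0 subr0 ler01 lexx.
  have b0 : 0 <= s * lam i by rewrite mulr_ge0.
  have b1 := ltW (c1 i); split; first by apply/andP; split; nra.
  by rewrite mulrDr; nra.
have p0 : 0 < \prod_i (1 - s * lam i) by rewrite prodr_gt0// => i _; rewrite subr_gt0.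
by rewrite lef_pV2 ?posrE ?sqrtr_gt0 ?subr_gt0// ler_sqrt// ltW.
Qed.

(** Compares the terms of first order in [s] in [E (1 + s * g_i ^ 2 / 2) <= E expR (s * g_i ^ 2 / 2)
    = (1 - s) ^ (- 1 / 2)]. *)
Lemma Eg_sqr_le1 i : (Eg (fun g => (g i 0 ^+ 2)%R) <= 1)%E.
Proof.
apply/lee_addgt0Pr => e e0.
pose s : R := Num.min (e / 2) (1 / 2).
have s0 : 0 < s by rewrite lt_min; apply/andP; split; lra.
have s1 : s <= 1 / 2 by rewrite ge_min lexx orbT.
have se' : s <= e / 2 by rewrite ge_min lexx.
have se : 2 * s <= e by lra.
pose c (j : 'I_n) := if j == i then s else 0.
have wc g : wsq c g = s * g i 0 ^+ 2.
  rewrite /wsq (bigD1 i)//= /c eqxx big1 ?addr0// => j /negbTE ->.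
  by rewrite mul0r.
have c1 j : c j < 1 by rewrite /c; case: ifP => _; lra.
have pc : \prod_j (1 - c j) = 1 - s.
  rewrite (bigD1 i)//= /c eqxx big1 ?mulr1// => j /negbTE ->.
  by rewrite subr0.
have := @std_gauss_expR_quad R n c c1; rewrite pc => hq.
have h1 : (Eg (fun g => 1 + 2^-1 * s * g i 0 ^+ 2)%R <= (1 + s / 2 + s ^+ 2)%:E)%E.
  apply: (@le_trans _ _ (Eg (fun g => expR (2^-1 * wsq c g)))).
    apply: le_Eg.
    - by apply: measurable_funD => //; apply: measurable_funM => //; apply: measurable_funX; exact: measurable_mx_entry.
    - by apply: measurableT_comp => //; apply: measurable_funM => //; exact: measurable_wsq.
    - by move=> g; have := mulr_ge0 (ltW s0) (sqr_ge0 (g i 0)); lra.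
    - by move=> g; have := expR_ge1Dx (2^-1 * (s * g i 0 ^+ 2)); rewrite wc; lra.
  rewrite /Eg hq lee_fin.
  have q0 : 0 <= 1 + s / 2 + s ^+ 2 by have := sqr_ge0 s; lra.
  rewrite -[leLHS]mul1r ler_pdivrMr ?sqrtr_gt0; last lra.
  rewrite -{1}[1]sqrtr1 -[X in X * _]ger0_norm// -sqrtr_sqr -sqrtrM ?sqr_ge0// ler_sqrt; last first.
    by rewrite mulr_ge0 ?sqr_ge0//; lra.
  have -> : (1 + s / 2 + s ^+ 2) ^+ 2 * (1 - s) = 1 + s ^+ 2 * (5 / 4 - 5 / 4 * s - s ^+ 3) by field.
  have s3 : s ^+ 3 <= (1 / 2) ^+ 3 by apply: lerXn2r; rewrite ?nnegrE//; lra.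
  rewrite lerDl mulr_ge0 ?sqr_ge0//; move: s3; rewrite !exprS expr0; lra.
have m2 : measurable_fun setT (fun g : 'cV[R]_n => g i 0 ^+ 2).
  by apply: measurable_funX; exact: measurable_mx_entry.
rewrite EgD in h1 => //; last 2 first.
- exact: measurable_funM.
- by move=> g; have := mulr_ge0 (ltW s0) (sqr_ge0 (g i 0)); lra.
move: h1; rewrite Eg_cst EgZ//; last 2 first.
- by rewrite mulr_ge0// ltW.
- by move=> g; exact: sqr_ge0.
have := @Eg_ge0 (fun g => g i 0 ^+ 2) (fun g => sqr_ge0 _).
case: (Eg _) => [x| |]//=.
  rewrite -EFinM -EFinD !lee_fin => x0 h.
  have : s * x <= s * (1 + 2 * s) by nra.
  by rewrite ler_pM2l//; lra.
by rewrite mulry gtr0_sg ?mulr_gt0// mul1e.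
Qed.

End gauss_tails.
Arguments Eg {R n} F%_R.

Lemma ler_sqrt_sqr (R : rcfType) (x y : R) : 0 <= x -> x ^+ 2 <= y -> x <= Num.sqrt y.
Proof.
move=> x0 h; rewrite -[leLHS]ger0_norm// -sqrtr_sqr ler_sqrt//.
exact: le_trans (sqr_ge0 x) h.
Qed.

(** * Tails outside the local region *)

Section outer_tail.
Context (R : realType) (n : nat) (lam : 'I_n -> R).
Hypothesis lam01 : forall i, 0 <= lam i <= 1.
Local Notation P := (\sum_i lam i).
Local Notation Z := (wsq lam).
Local Notation sP := (Num.sqrt P).

Let lam0 i : 0 <= lam i. Proof. by have /andP[] := lam01 i. Qed.

Lemma trace_ge0 : 0 <= P. Proof. exact: sumr_ge0. Qed.

Lemma nneseries_le (u : nat -> R) (M : R) : (forall j, 0 <= u j) ->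
  (forall k, \sum_(0 <= j < k) u j <= M) -> (\sum_(j <oo) (u j)%:E <= M%:E)%E.
Proof.
move=> u0 uM; apply: lime_le.
  by apply: is_cvg_nneseries => k _ _; rewrite lee_fin.
by apply: nearW => k; rewrite sumEFin lee_fin.
Qed.

Lemma nneseries_ge_term (u : nat -> R) j : (forall j, 0 <= u j) ->
  ((u j)%:E <= \sum_(j <oo) (u j)%:E)%E.
Proof.
move=> u0; apply: (@le_trans _ _ (\sum_(0 <= i < j.+1) (u i)%:E)%E).
  by rewrite big_nat_recr//= leeDr// sume_ge0// => i _; rewrite lee_fin.
by apply: nneseries_lim_ge => k _; rewrite lee_fin.
Qed.

Lemma dyadic_shell (x : R) : 1 <= x -> exists j, 4 ^+ j <= x < 4 ^+ j.+1.
Proof.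
move=> x1; have [k xk] : exists k, x < 4 ^+ k.
  exists (Num.truncn x).+1; apply: lt_trans (truncnS_gt x) _.
  by rewrite -natrX ltr_nat ltn_expl.
pose p k := x < 4 ^+ k.
have ep : exists k, p k by exists k.
case: (ex_minnP ep) => -[|j] pj minj.
  by move: pj; rewrite /p expr0 ltNge x1.
exists j; rewrite -/(p j.+1) pj andbT leNgt; apply/negP => h.
by have := minj _ h; rewrite ltnn.
Qed.

(* Chernoff bound on each shell [4 ^ j * T ^ 2 <= Z < 4 ^ j.+1 * T ^ 2], with a
   parameter adapted to the shell. *)
Lemma Eg_outer_le (T m : R) : 0 < P -> 0 < T -> P <= 4 * T ^+ 2 -> 2 <= m * T - P ->
  (Eg (fun g => if T ^+ 2 <= Z g then expR (2^-1 * Z g - m * Num.sqrt (Z g)) else 0)%R <=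
  (4 / 3 * expR (- (m * T) + 2^-1 * P + P * ln (2 * T / sP)))%:E)%E.
Proof.
move=> P0 T0 PT mT.
have sP0 : 0 < sP by rewrite sqrtr_gt0.
have sPP : sP * sP = P by rewrite -expr2 sqr_sqrtr ?ltW.
have T20 : 0 < T ^+ 2 by rewrite exprn_gt0.
have m0 : 0 <= m.
  by rewrite -(pmulr_lge0 _ T0); lra.
(* [1 - e j] is the parameter that optimises [Eg_chernoff] for [Z] at the outer end of the shell.
   Inside the shell [e j * Z <= P], which accounts for the factor [expR (P / 2)] in [h]. *)
pose e (j : nat) : R := P / (4 ^+ j.+1 * T ^+ 2).
have d0 j : 0 < 4 ^+ j.+1 * T ^+ 2 :> R by rewrite mulr_gt0// exprn_gt0.
have e0 j : 0 < e j by rewrite divr_gt0.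
have e1 j : e j <= 1.
  rewrite ler_pdivrMr// mul1r; apply: le_trans PT _.
  apply: ler_wpM2r; first exact: ltW.
  rewrite exprS -[leLHS]mulr1 ler_pM2l//.
  by rewrite exprn_ege1//; lra.
pose h (j : nat) (g : 'cV[R]_n) : R :=
  expR (- (m * (2 ^+ j * T)) + 2^-1 * P) * expR (2^-1 * ((1 - e j) * Z g)).
have mZ : measurable_fun setT Z by exact: measurable_wsq.
have mh j : measurable_fun setT (h j).
  apply: measurable_funM => //; apply: measurableT_comp => //.
  by apply: measurable_funM => //; apply: measurable_funM.
have h0 j g : 0 <= h j g by rewrite mulr_ge0// expR_ge0.
have Eh j : (Eg (h j) <= (expR (- (m * T) + 2^-1 * P + P * ln (2 * T / sP)) * 4^-1 ^+ j)%:E)%E.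
  rewrite EgZ ?expR_ge0//; last first.
    by apply: measurableT_comp => //; apply: measurable_funM => //; apply: measurable_funM.
  have ee : 0 <= 1 - e j < 1 by apply/andP; split; have := e0 j; have := e1 j; lra.
  apply: le_trans (lee_wpmul2l _ (Eg_chernoff lam01 ee)) _.
    by rewrite lee_fin expR_ge0.
  rewrite -EFinM lee_fin -expRD subKr.
  have lneg : - ln (e j) <= 2 * (ln (2 * T / sP) + j%:R).
    rewrite -lnV ?posrE//.
    have -> : (e j)^-1 = (2 ^+ j * (2 * T / sP)) ^+ 2.
      rewrite /e -{1}sPP exprMn -exprM mulnC exprM -[2 ^+ 2]/(2 * 2).
      rewrite (_ : 2 * 2 = 4 :> R); last by ring.
      by rewrite exprS; field; rewrite !gt_eqF// exprn_gt0.
    have tp : 0 < 2 * T / sP by rewrite divr_gt0// mulr_gt0.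
    have tp2 : 0 < 2 ^+ j * (2 * T / sP) by rewrite mulr_gt0// exprn_gt0.
    rewrite lnXn// lnM ?posrE ?exprn_gt0//.
    have : ln (2 ^+ j) <= j%:R :> R.
      rewrite lnXn// -[_ *+ j]mulr_natr ler_piMl//.
      by have := @le_ln1Dx R 1; rewrite (_ : 1 + 1 = 2 :> R); [apply; lra|ring].
    lra.
  have hP : - 2^-1 * (ln (e j) * P) <= (ln (2 * T / sP) + j%:R) * P.
    by rewrite mulrA ler_pM2r//; lra.
  have h2 : 1 + j%:R <= 2 ^+ j :> R.
    by rewrite -natrX addrC natr1 ler_nat ltn_expl.
  have hm : m * T * (1 + j%:R) <= m * (2 ^+ j * T).
    by rewrite [in leRHS]mulrCA [in leRHS]mulrC ler_wpM2l// mulr_ge0// ltW.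
  have h4 : expR (- (2 * j%:R)) <= 4^-1 ^+ j :> R.
    rewrite -mulrN mulrC mulNr -mulrN expRM_natl lerXn2r ?nnegrE ?expR_ge0// expRN.
    by rewrite lef_pV2 ?posrE ?expR_gt0//; have := expR2_ge R; lra.
  apply: (@le_trans _ _ (expR (- (m * T) + 2^-1 * P + P * ln (2 * T / sP)) * expR (- (2 * j%:R)))); last first.
    by rewrite ler_wpM2l// expR_ge0.
  rewrite -expRD ler_expR.
  (* The Chernoff factor grows like [expR (j * P)] and the linear term decays like
     [expR (- j * m * T)]; the margin 2 between the two rates yields the ratio [1 / 4] and the
     geometric sum [4 / 3]. *)
  have : 0 <= j%:R * (m * T - P - 2) by rewrite mulr_ge0//; lra.
  by nra.
have mi : measurable_fun setT (fun g => if T ^+ 2 <= Z g then expR (2^-1 * Z g - m * Num.sqrt (Z g)) else 0).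
  apply: measurable_fun_ifT => //.
    exact: measurable_fun_ler.
  apply: measurableT_comp => //; apply: measurable_funB; first exact: measurable_funM.
  apply: measurable_funM => //; apply: measurableT_comp => //.
  by apply: continuous_measurable_fun => x; exact: sqrt_continuous.
apply: (@le_trans _ _ (\int[@std_gauss R n]_g \sum_(j <oo) (h j g)%:E)%E).
  apply: ge0_le_integral => //.
  - by move=> g _; case: ifP; rewrite lee_fin// expR_ge0.
  - exact/measurable_EFinP.
  - by apply: ge0_emeasurable_sum => [j g _ _|j _]; [rewrite lee_fin|exact/measurable_EFinP].
  - move=> g _; case: ifPn => [hZ|_]; last by apply: nneseries_ge0 => j _ _; rewrite lee_fin.
    have [|j /andP[j1 j2]] := @dyadic_shell (Z g / T ^+ 2); first by rewrite ler_pdivlMr// mul1r.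
    apply: le_trans (nneseries_ge_term j (fun j => h0 j g)); rewrite lee_fin /h -expRD ler_expR.
    move: j1 j2; rewrite ler_pdivlMr// ltr_pdivrMr// => j1 j2.
    have hs : 2 ^+ j * T <= Num.sqrt (Z g).
      apply: ler_sqrt_sqr; first by rewrite mulr_ge0 ?exprn_ge0// ltW.
      apply: le_trans j1; rewrite exprMn -exprM mulnC exprM -[2 ^+ 2]/(2 * 2).
      by rewrite (_ : 2 * 2 = 4 :> R)//; ring.
    have : m * (2 ^+ j * T) <= m * Num.sqrt (Z g) by rewrite ler_wpM2l.
    have : e j * Z g <= P.
      apply: (@le_trans _ _ (e j * (4 ^+ j.+1 * T ^+ 2))); first by rewrite ler_pM2l// ltW.
      by rewrite divfK// gt_eqF.
    by nra.
rewrite integral_nneseries//; last 2 first.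
- by move=> j; exact/measurable_EFinP.
- by move=> j g _; rewrite lee_fin.
apply: (@le_trans _ _ (\sum_(j <oo) (expR (- (m * T) + 2^-1 * P + P * ln (2 * T / sP)) * 4^-1 ^+ j)%:E)%E).
  apply: lee_nneseries => *; last exact: Eh.
  by apply: integral_ge0 => g _; rewrite lee_fin.
apply: nneseries_le => [j|k]; first by rewrite mulr_ge0 ?expR_ge0// exprn_ge0// invr_ge0.
rewrite -mulr_sumr [leRHS]mulrC ler_wpM2l ?expR_ge0//.
have := @geometric_seriesE R 1 4^-1; rewrite /series /geometric /=.
move=> /(_ _)/(congr1 (fun f => f k)) /=; under eq_bigr do rewrite mul1r.
move=> ->; last by rewrite neq_lt; apply/orP; left; lra.
have : 0 <= 4^-1 ^+ k :> R by rewrite exprn_ge0// invr_ge0.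
by rewrite mul1r ler_pdivrMr; lra.
Qed.

End outer_tail.

Section tails.
Context (R : realType) (n : nat) (lam : 'I_n -> R).
Hypothesis lam01 : forall i, 0 <= lam i <= 1.
Local Notation P := (\sum_i lam i).
Local Notation Z := (wsq lam).
Local Notation sP := (Num.sqrt P).

Let lam0 i : 0 <= lam i. Proof. by have /andP[] := lam01 i. Qed.

Let mZ : measurable_fun setT Z. Proof. exact: measurable_wsq. Qed.

Let mexpZ k : measurable_fun setT (fun g => expR (2^-1 * (k * Z g))).
Proof. by apply: measurableT_comp => //; apply: measurable_funM => //; apply: measurable_funM. Qed.

Lemma measurable_expZ_sqrt m :
  measurable_fun setT (fun g => expR (2^-1 * Z g - m * Num.sqrt (Z g))).
Proof.
apply: measurableT_comp => //; apply: measurable_funB; first exact: measurable_funM.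
apply: measurable_funM => //; apply: measurableT_comp => //.
by apply: continuous_measurable_fun => x; exact: sqrt_continuous.
Qed.

(** With the Chernoff parameter [1 - sP / r] and [ln t <= t - 1], the exponent is exactly minus half
    the square of [r - sP]. If the trace vanishes, [Z] is identically 0. *)
Lemma Eg_tail_le (r : R) : sP < r ->
  (Eg (fun g => if r ^+ 2 < Z g then 1 else 0)%R <= (expR (- (2^-1 * (r - sP) ^+ 2)))%:E)%E.
Proof.
move=> sPr; have sP0 : 0 <= sP by exact: sqrtr_ge0.
have r0 : 0 < r by exact: le_lt_trans sPr.
have P0 : 0 <= P by exact: trace_ge0.
have sPP : sP * sP = P by rewrite -expr2 sqr_sqrtr.
have mI : measurable_fun setT (fun g => if r ^+ 2 < Z g then 1 else 0 : R).
  by apply: measurable_fun_ifT => //; exact: measurable_fun_ltr.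
have [sPe|sPn0] := eqVneq sP 0.
  have PE : P = 0 by rewrite -sPP sPe mul0r.
  have l00 i : lam i = 0.
    exact: (psumr_eq0P (fun i _ => lam0 i) PE).
  rewrite (_ : (fun g => _) = fun=> 0); last first.
    apply/funext => g; rewrite /wsq big1 => [|i _]; last by rewrite l00 mul0r.
    by rewrite ltNge sqr_ge0.
  by rewrite Eg_cst lee_fin expR_ge0.
have sP1 : 0 < sP by rewrite lt_neqAle eq_sym sPn0.
pose s := 1 - sP / r.
have s01 : 0 <= s < 1.
  have : sP / r <= 1 by rewrite ler_pdivrMr// mul1r ltW.
  by have : 0 < sP / r by [rewrite divr_gt0]; rewrite /s => ? ?; apply/andP; split; lra.
have [s0 s1] := andP s01.
have mh : measurable_fun setT (fun g => expR (- (2^-1 * (s * r ^+ 2))) * expR (2^-1 * (s * Z g))) by exact: measurable_funM.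
apply: (@le_trans _ _ (Eg (fun g => expR (- (2^-1 * (s * r ^+ 2))) * expR (2^-1 * (s * Z g)))%R)).
  apply: le_Eg => // g; first by case: ifP.
  case: ifPn => [h|_]; rewrite -expRD ?expR_ge0//.
  by rewrite -[leLHS]expR0 ler_expR; have := ler_wpM2l s0 (ltW h); lra.
rewrite EgZ ?expR_ge0//.
apply: le_trans (lee_wpmul2l _ (Eg_chernoff lam01 s01)) _; first by rewrite lee_fin expR_ge0.
rewrite -EFinM -expRD lee_fin ler_expR.
have hl : - ln (1 - s) <= r / sP - 1.
  rewrite /s subKr -lnV ?posrE ?divr_gt0// invf_div.
  have := @le_ln1Dx R (r / sP - 1); rewrite addrCA subrr addr0; apply.
  by have : 0 < r / sP by [rewrite divr_gt0]; lra.
have h2 : - ln (1 - s) * P <= (r / sP - 1) * P by rewrite ler_wpM2r.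
have h3 : (r / sP - 1) * P = r * sP - P.
  by rewrite mulrBl mul1r -[X in _ * X - _]sPP mulrA divfK.
have h4 : s * r ^+ 2 = r ^+ 2 - sP * r by rewrite /s; field; rewrite gt_eqF.
have h5 : (r - sP) ^+ 2 = r ^+ 2 - 2 * r * sP + P by have := sPP; lra.
by rewrite h4 h5; lra.
Qed.

(** The parameter [27 / 20] satisfies [27 / 20 * P <= 9 / 10], whence the constant
    [sqrt 10 <= 10 / 3] from [Eg_chernoff2]. The coefficient [61 / 120 >= 1 / 2] is the one that
    gives equality of the exponents at [Z = r ^ 2]. *)
Lemma Eg_outer_small_trace (r : R) : 0 <= r -> P <= 2 / 3 ->
  (Eg (fun g => if (r ^+ 2 < Z g)%R then expR (2^-1 * Z g - r / 3 * Num.sqrt (Z g)) else 0)%R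
   <= (10 / 3 * expR (- (2^-1 * r ^+ 2)))%:E)%E.
Proof.
move=> r0 P23.
have mh : measurable_fun setT (fun g => expR (- (61 / 120 * r ^+ 2)) * expR (2^-1 * (27 / 20 * Z g))) by exact: measurable_funM.
apply: (@le_trans _ _ (Eg (fun g => expR (- (61 / 120 * r ^+ 2)) * expR (2^-1 * (27 / 20 * Z g)))%R)).
  apply: le_Eg => //.
  - by apply: measurable_fun_ifT => //; [exact: measurable_fun_ltr|exact: measurable_expZ_sqrt].
  - by move=> g; case: ifP => _ //; rewrite expR_ge0.
  - move=> g; case: ifPn => [h|_]; rewrite -expRD ?expR_ge0// ler_expR.
    have : r <= Num.sqrt (Z g) by apply: ler_sqrt_sqr => //; exact: ltW.
    by have := sqr_ge0 r; nra.
rewrite EgZ ?expR_ge0//.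
have h1 : 27 / 20 * P < 1 by lra.
have h0 : 0 <= 27 / 20 :> R by lra.
apply: le_trans (lee_wpmul2l _ (Eg_chernoff2 lam01 h0 h1)) _; first by rewrite lee_fin expR_ge0.
rewrite -EFinM lee_fin mulrC; apply: ler_pM; rewrite ?invr_ge0 ?expR_ge0//.
- rewrite -[10 / 3]invrK lef_pV2 ?posrE ?invr_gt0 ?sqrtr_gt0; [|lra|lra].
  by apply: ler_sqrt_sqr; [rewrite invr_ge0; lra|rewrite exprVn; lra].
- by rewrite ler_expR; have := sqr_ge0 r; lra.
Qed.

(* [wsq etal <= r ^+ 2] is the enlargement of the local region on which
   [contr (2 / 3)] maps back into [Z <= r ^+ 2]. *)
Definition etal i := lam i - 5 / 9 * lam i ^+ 2.

(** For [r <= sqrt Z <= 3 / 2 * r] the square root lies above its chord: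
    [r * sqrt Z >= 2 / 5 * Z + 3 / 5 * r ^ 2]. This leaves [11 / 15] of the weight [Z]. The
    constraint [r ^ 2 < wsq etal] then enters with the multiplier [mm], whose main part [3 / 5]
    brings the coefficient of [r ^ 2] to [- 1 / 2]. *)
Lemma Eg_near_le (r : R) : 0 < P -> 0 < r -> P <= 1 / 2 * r ^+ 2 ->
  (Eg (fun g => if ((r ^+ 2 < wsq etal g) && (Z g <= 9 / 4 * r ^+ 2))%R
       then expR (2^-1 * Z g - r / 3 * Num.sqrt (Z g)) else 0)%R
   <= (expR (- (2^-1 * r ^+ 2) + 3 / 2 * P + 2 / 7 * (r * sP)))%:E)%E.
Proof.
move=> P0 r0 Pr.
have sP0 : 0 < sP by rewrite sqrtr_gt0.
have sPP : sP * sP = P by rewrite -expr2 sqr_sqrtr// ltW.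
have r2 : 0 < r ^+ 2 by rewrite exprn_gt0.
pose e := P / (9 / 4 * r ^+ 2).
have e0 : 0 < e by rewrite divr_gt0// mulr_gt0//; lra.
have e1 : e <= 2 / 9 by rewrite ler_pdivrMr ?mulr_gt0//; lra.
have er : e * r ^+ 2 = 4 / 9 * P by rewrite /e; field; rewrite gt_eqF.
pose mm := 3 / 5 - 9 / 4 * e.
have mm0 : 0 <= mm by rewrite /mm; lra.
pose c i := 11 / 15 * lam i + mm * etal i.
have cE g : wsq c g = 11 / 15 * Z g + mm * wsq etal g by rewrite /c wsqD !wsqZ.
pose K := expR (r ^+ 2 / 6 - 11 / 30 * r ^+ 2 - 2^-1 * mm * r ^+ 2).
have mc : measurable_fun setT (fun g => expR (2^-1 * wsq c g)).
  by apply: measurableT_comp => //; apply: measurable_funM => //; exact: measurable_wsq.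
apply: (@le_trans _ _ (Eg (fun g => K * expR (2^-1 * wsq c g))%R)).
  apply: le_Eg => //.
  - apply: measurable_fun_ifT => //; last exact: measurable_expZ_sqrt.
    apply: measurable_and; first by apply: measurable_fun_ltr => //; exact: measurable_wsq.
    exact: measurable_fun_ler.
  - exact: measurable_funM.
  - by move=> g; case: ifP => _ //; rewrite expR_ge0.
  - move=> g; case: ifPn => [/andP[h h']|_]; rewrite /K -expRD ?expR_ge0// ler_expR cE.
    have Z0 : 0 <= Z g by exact: wsq_ge0.
    have eZ : wsq etal g <= Z g.
      by apply: le_wsq => i; rewrite /etal; have := sqr_ge0 (lam i); lra.
    have ZZ : Num.sqrt (Z g) ^+ 2 = Z g by rewrite sqr_sqrtr.
    have z1 : r <= Num.sqrt (Z g).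
      by apply: ler_sqrt_sqr; [exact: ltW|apply: le_trans eZ; exact: ltW].
    have z2 : Num.sqrt (Z g) <= 3 / 2 * r.
      rewrite -[leRHS]ger0_norm ?mulr_ge0//; last exact: ltW.
      by rewrite -sqrtr_sqr ler_sqrt ?sqr_ge0//; rewrite exprMn; lra.
    have hz : 0 <= (Num.sqrt (Z g) - r) * (3 / 2 * r - Num.sqrt (Z g)) by rewrite mulr_ge0//; lra.
    have hm := ler_wpM2l mm0 (ltW h).
    by rewrite -{1 2}ZZ in hz *; nra.
rewrite EgZ ?expR_ge0//.
have k0 : 0 <= - ln (2 / 3 * e) by rewrite oppr_ge0 ln_le0//; lra.
have hk i : 0 <= - ln (2 / 3 * e) * lam i by rewrite mulr_ge0.
(* Both [(2 / 3) ^ lam i] and [e ^ lam i] lie below their chords on [[0, 1]], and the product of the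
   chords stays below [1 - c i]. *)
have hc i : expR (- (- ln (2 / 3 * e) * lam i)) <= 1 - c i.
  have /andP[l0 l1] := lam01 i.
  have -> : - (- ln (2 / 3 * e) * lam i) = lam i * ln (2 / 3) + lam i * ln e.
    have -> : ln (2 / 3 * e) = ln (2 / 3) + ln e by rewrite lnM// posrE; lra.
    ring.
  rewrite expRD.
  have h1 : expR (lam i * ln (2 / 3)) <= 1 - lam i / 3.
    by apply: le_trans (expR_convex01 _ (lam01 i)) _; rewrite lnK ?posrE; lra.
  have h2 : expR (lam i * ln e) <= 1 - lam i + lam i * e.
    by apply: le_trans (expR_convex01 _ (lam01 i)) _; rewrite lnK ?posrE.
  apply: le_trans (ler_pM (expR_ge0 _) (expR_ge0 _) h1 h2) _.
  have q1 : 0 <= 5 / 4 - 11 / 12 * lam i by lra.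
  have := mulr_ge0 (mulr_ge0 (ltW e0) l0) q1.
  by rewrite /c /etal /mm; nra.
apply: le_trans (lee_wpmul2l _ (Eg_quad_le hk hc)) _; first by rewrite lee_fin expR_ge0.
rewrite -EFinM /K -expRD lee_fin ler_expR.
have hl : - ln (2 / 3 * e) <= 2 * (2 * r / sP / 7 + 1).
  have tp : 0 < 2 * r / sP by rewrite divr_gt0// mulr_gt0.
  rewrite -lnV ?posrE; last by rewrite mulr_gt0//; lra.
  have h1 : (2 / 3 * e)^-1 <= (2 * r / sP) ^+ 2.
    have -> : (2 * r / sP) ^+ 2 = 4 * (r ^+ 2 / P) by rewrite -[in RHS]sPP; field; rewrite gt_eqF.
    have -> : (2 / 3 * e)^-1 = 27 / 8 * (r ^+ 2 / P) by rewrite /e; field; rewrite !gt_eqF.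
    by rewrite ler_wpM2r//; [rewrite divr_ge0// ltW|lra].
  apply: (@le_trans _ _ (ln ((2 * r / sP) ^+ 2))).
    by rewrite ler_ln ?posrE ?exprn_gt0 ?invr_gt0//; lra.
  by rewrite lnXn//; have := ln_le_7 tp; lra.
have h2 : - ln (2 / 3 * e) * P <= 2 * (2 * r / sP / 7 + 1) * P by rewrite ler_wpM2r// ltW.
have h3 : 2 * r / sP / 7 * P = 2 / 7 * (r * sP).
  by rewrite -[X in _ * X]sPP; field; rewrite gt_eqF.
by rewrite /mm; lra.
Qed.

End tails.

(** * The dilation barrier *)

Lemma measurable_invr (R : realType) : measurable_fun setT (@GRing.inv R).
Proof.
rewrite [X in measurable_fun _ X](_ : _ = fun x : R => x * expR (- ln (x ^+ 2))).
  apply: measurable_funM => //; apply: measurableT_comp => //; apply: measurableT_comp => //.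
  by apply: measurableT_comp => //; exact: measurable_funX.
apply/funext => x; have [->|x0] := eqVneq x 0; first by rewrite invr0 mul0r.
rewrite expRN lnK ?posrE ?exprn_even_gt0//.
by rewrite expr2 invfM mulrA divff// mul1r.
Qed.

Section contraction.
Context (R : realType) (n : nat) (lam : 'I_n -> R).
Hypothesis lam01 : forall i, 0 <= lam i <= 1.
Local Notation P := (\sum_i lam i).
Local Notation Z := (wsq lam).

Let lam0 i : 0 <= lam i. Proof. by have /andP[] := lam01 i. Qed.
Let lam1 i : lam i <= 1. Proof. by have /andP[] := lam01 i. Qed.

Let mZ : measurable_fun setT Z. Proof. exact: measurable_wsq. Qed.

(** A gradient descent step of length [k] for [Z / 2]. *)
Definition contr (k : R) (g : 'cV[R]_n) : 'cV[R]_n := \col_i ((1 - k * lam i) * g i 0).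

Lemma contrE k g : contr k g = dmx (fun i => 1 - k * lam i) *m g.
Proof. by rewrite mul_dmx. Qed.

Lemma wsq_contr c k g : wsq c (contr k g) = wsq (fun i => c i * (1 - k * lam i) ^+ 2) g.
Proof. by apply: eq_bigr => i _; rewrite mxE exprMn mulrA. Qed.

Lemma wsq_contr_le c k g : (forall i, 0 <= c i) -> 0 <= k <= 1 -> wsq c (contr k g) <= wsq c g.
Proof.
move=> c0 /andP[k0 k1]; rewrite wsq_contr; apply: le_wsq => i.
rewrite -[leRHS]mulr1 ler_wpM2l//.
have : 0 <= k * lam i <= 1 by rewrite mulr_ge0//= mulr_ile1.
by move=> /andP[h0 h1]; rewrite expr_le1//; lra.
Qed.

Lemma measurable_contr k : measurable_fun setT (contr k).
Proof.
apply: measurable_mx_entries => i j; rewrite ord1.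
rewrite [X in measurable_fun _ X](_ : _ = fun g : 'cV[R]_n => (1 - k * lam i) * g i 0).
  by apply: measurable_funM => //; exact: measurable_mx_entry.
by apply/funext => g; rewrite mxE.
Qed.

(** The Jacobian of [contr k] is at least [1 - k * P], and [1 - (1 - k * lam i) ^ 2 >= (2 * k - k ^
    2) * lam i] because [lam i ^ 2 <= lam i]. *)
Lemma Eg_contr_le (k : R) (F : 'cV[R]_n -> R) : 0 <= k < 1 -> k * P <= 1 ->
  measurable_fun setT F -> (forall g, 0 <= F g) ->
  (Eg (fun g => (1 - k * P) * (F (contr k g) * expR ((2 * k - k ^+ 2) * (2^-1 * Z g))))%R <= Eg F)%E.
Proof.
move=> /andP[k0 k1] kP mF F0.
pose A := dmx (fun i => 1 - k * lam i).
have a0 i : 0 < 1 - k * lam i.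
  have : k * lam i <= k by rewrite ler_piMr.
  lra.
have uA : A \in unitmx by apply: unit_dmx => i; rewrite gt_eqF.
have mE : measurable_fun setT (EFin \o F) by exact/measurable_EFinP.
have := ge0_integral_std_gauss_linear uA mE (fun g => F0 g).
rewrite /Eg /= => <-.
have mFc : measurable_fun setT (fun g => F (contr k g)).
  exact: (measurableT_comp mF (measurable_contr k)).
have mAg : measurable_fun setT (fun g : 'cV[R]_n => A *m g).
  have h := measurable_mulmx_cV A 0.
  by apply: eq_measurable_fun h => u _; rewrite addr0.
have q0 : 0 <= 2 * k - k ^+ 2 by rewrite -[2 * k - _]subr0; nra.
have dA : 1 - k * P <= `|\det A|.
  rewrite det_dmx ger0_norm; last by apply: prodr_ge0 => i _; exact: ltW.
  suff [] : 0 <= \prod_i (1 - k * lam i) <= 1 /\ 1 - k * P <= \prod_i (1 - k * lam i) by [].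
  elim/big_rec2: _ => [|i y x _ [/andP[y0 y1] IH]]; first by rewrite mulr0 subr0 ler01 lexx.
  have b0 : 0 <= k * lam i by rewrite mulr_ge0.
  have b1 := ltW (a0 i); split; first by apply/andP; split; nra.
  by rewrite mulrDr; nra.
apply: ge0_le_integral => //.
- by move=> g _; rewrite lee_fin mulr_ge0 ?mulr_ge0 ?expR_ge0//; lra.
- apply/measurable_EFinP; apply: measurable_funM => //; apply: measurable_funM => //.
  by apply: measurableT_comp => //; apply: measurable_funM => //; apply: measurable_funM.
- apply/measurable_EFinP; apply: measurable_funM.
    exact: (measurableT_comp mF mAg).
  apply: measurable_funM => //; apply: measurableT_comp => //; apply: measurable_funM => //.
  apply: measurable_funB; first exact: measurable_sqnorm.
  exact: (measurableT_comp (@measurable_sqnorm R n) mAg).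
- move=> g _; rewrite -EFinM lee_fin -contrE mulrCA ler_wpM2l//.
  apply: ler_pM; rewrite ?expR_ge0//; first lra.
  rewrite ler_expR mulrCA ler_pM2l// -sumrB mulr_sumr; apply: ler_sum => i _.
  rewrite mxE -subr_ge0 (_ : _ - _ = k ^+ 2 * (lam i * (1 - lam i)) * g i 0 ^+ 2); last by ring.
  by rewrite mulr_ge0 ?sqr_ge0// mulr_ge0 ?sqr_ge0// mulr_ge0// subr_ge0.
Qed.

Section function.
Variables (d : 'cV[R]_n -> R) (w r : R).
Local Notation q := (fun g => 2^-1 * Z g).
Hypothesis md : measurable_fun setT d.
Hypothesis w01 : 0 <= w <= 1 / 3.
Hypothesis r0 : 0 < r.
Hypothesis dconc : forall (t : R) u v, 0 <= t <= 1 ->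
  (1 - t) * (d u - q u) + t * (d v - q v) <=
  d ((1 - t) *: u + t *: v) - q ((1 - t) *: u + t *: v).
Hypothesis d00 : d 0 = 0.
Hypothesis dq : forall u, d u <= q u.
Hypothesis dU : forall u, Z u <= r ^+ 2 -> `|d u| <= w * q u.

Let w0 : 0 <= w. Proof. by have /andP[] := w01. Qed.
Let w13 : w <= 1 / 3. Proof. by have /andP[] := w01. Qed.

(** Concavity of [d - q] on the segment from 0 to [u], tested where it crosses [Z = r ^ 2]: there
    [dU] gives [d - q <= - (1 - w) / 2 * r ^ 2]. *)
Lemma d_ray u : r ^+ 2 < Z u ->
  d u <= 2^-1 * Z u - (1 - w) * r / 2 * Num.sqrt (Z u).
Proof.
move=> rZ; have Z0 : 0 < Z u by apply: le_lt_trans rZ; exact: sqr_ge0.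
set z := Num.sqrt (Z u).
have z0 : 0 < z by rewrite sqrtr_gt0.
have zz : z ^+ 2 = Z u by rewrite sqr_sqrtr// ltW.
have rz : r <= z by apply: ler_sqrt_sqr; exact: ltW.
pose s := r / z.
have s0 : 0 < s by rewrite divr_gt0.
have s1 : s <= 1 by rewrite ler_pdivrMr// mul1r.
have Zs : Z (s *: u) = r ^+ 2.
  have -> : Z (s *: u) = s ^+ 2 * Z u.
    by rewrite mulr_sumr; apply: eq_bigr => i _; rewrite mxE exprMn mulrCA.
  by rewrite -zz /s; field; rewrite gt_eqF.
have s01 : 0 <= s <= 1 by rewrite s1 ltW.
have Z00 : Z 0 = 0 by apply: big1 => i _; rewrite mxE expr0n mulr0.
have := dconc 0 u s01; rewrite scaler0 add0r Zs d00 Z00 mulr0 subrr mulr0 add0r => h.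
have /ler_normlP[_ hU] : `|d (s *: u)| <= w * (2^-1 * r ^+ 2) by rewrite -Zs dU ?Zs.
have h2 : s * (d u - 2^-1 * Z u) <= - ((1 - w) / 2 * r ^+ 2) by lra.
have h3 : d u - 2^-1 * Z u <= - ((1 - w) / 2 * r ^+ 2) / s.
  by rewrite ler_pdivlMr// mulrC.
have h4 : - ((1 - w) / 2 * r ^+ 2) / s = - ((1 - w) * r / 2 * z).
  by rewrite /s; field; rewrite !gt_eqF.
by rewrite -zz; move: h3; rewrite h4 -zz; lra.
Qed.

(* [contr k u] lies on the segment from [u] to [contr (2 / 3) u], where the local
   bound [dU] applies. *)
Lemma d_contr k u : 0 <= k <= 2 / 3 -> Z (contr (2 / 3) u) <= r ^+ 2 ->
  d u - k * (3 / 2 * d u + (2 / 3 + w / 6) * q u) <= d (contr k u).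
Proof.
move=> /andP[k0 k1] Zy.
pose t := 3 / 2 * k.
have t01 : 0 <= t <= 1 by rewrite /t; apply/andP; split; lra.
have -> : contr k u = (1 - t) *: u + t *: contr (2 / 3) u.
  by apply/colP => i; rewrite !mxE /t; field.
have := dconc u (contr (2 / 3) u) t01.
have -> : (1 - t) *: u + t *: contr (2 / 3) u = contr k u.
  by apply/colP => i; rewrite !mxE /t; field.
have /ler_normlP[hU _] := dU Zy.
have t0 : 0 <= t by have /andP[] := t01.
have hty := ler_wpM2l t0 hU.
suff : k * ((2 / 3 + w / 6) * q u) + q (contr k u) - (1 - t) * q u - t * (1 + w) * q (contr (2 / 3) u) >= 0.
  by rewrite /t in hty *; nra.
rewrite !wsq_contr.
(* All forms are diagonal, so one sign per coordinate remains. It holds because [w <= 1 / 3] makes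
   [1 + lam i - w * (2 - lam i)] nonnegative. *)
have -> : k * ((2 / 3 + w / 6) * (2^-1 * Z u)) + 2^-1 * wsq (fun i => lam i * (1 - k * lam i) ^+ 2) u -
   (1 - t) * (2^-1 * Z u) - t * (1 + w) * (2^-1 * wsq (fun i => lam i * (1 - 2 / 3 * lam i) ^+ 2) u) =
   \sum_i (2^-1 * k * lam i * (k * lam i ^+ 2 + 2 / 3 * (1 - lam i) * (1 + lam i - w * (2 - lam i)))) * u i 0 ^+ 2.
  rewrite !mulr_sumr -big_split/= -!sumrB; by apply: eq_bigr => i _; rewrite /t; field.
apply: sumr_ge0 => i _; rewrite mulr_ge0 ?sqr_ge0//.
have l0 := lam0 i; have l1 := lam1 i.
have h1 : w * (2 - lam i) <= 1 / 3 * (2 - lam i) by rewrite ler_wpM2r//; lra.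
have h2 : 0 <= (1 - lam i) * (1 + lam i - w * (2 - lam i)) by rewrite mulr_ge0//; lra.
rewrite mulr_ge0 ?mulr_ge0//.
by have := mulr_ge0 k0 (sqr_ge0 (lam i)); lra.
Qed.

Section barrier.
Variables (zeta : 'I_n -> R) (A K : R).
Hypothesis zetaP : forall i, lam i * (1 - 2 / 3 * lam i) ^+ 2 <= zeta i.
Hypothesis K0 : 0 <= K.
Hypothesis AK : K <= A * expR (3 / 2).
Local Notation W := (fun g => wsq zeta g <= r ^+ 2).

(* A convex nondecreasing barrier vanishing where [d <= 3 / 2]. *)
Definition Psi (x : R) : R := if 3 / 2 < x then A * (expR x - expR (3 / 2)) - K * (x - 3 / 2) else 0.

Let A0 : 0 <= A.
Proof. by rewrite -(pmulr_lge0 _ (expR_gt0 (3 / 2))); exact: le_trans AK. Qed.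

Let zeta0 i : 0 <= zeta i.
Proof. by apply: le_trans (zetaP i); rewrite mulr_ge0// sqr_ge0. Qed.

Lemma expR_tangent (x y : R) : expR x * (1 + (y - x)) <= expR y.
Proof.
have -> : expR y = expR x * expR (y - x) by rewrite -expRD addrCA subrr addr0.
by rewrite ler_wpM2l ?expR_ge0 ?expR_ge1Dx.
Qed.

Lemma Psi_homo x y : x <= y -> Psi x <= Psi y.
Proof.
move=> xy; rewrite /Psi.
have incr (a b : R) : 3 / 2 <= a -> a <= b -> K * (b - a) <= A * (expR b - expR a).
  move=> ha ab; apply: (@le_trans _ _ (A * expR (3 / 2) * (b - a))).
    by rewrite ler_wpM2r//; lra.
  rewrite -mulrA ler_wpM2l//.
  have h1 := expR_tangent a b; have : expR (3 / 2) <= expR a by rewrite ler_expR.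
  by nra.
case: ltP => hx; case: ltP => hy.
- by have := incr _ _ (ltW hx) xy; lra.
- lra.
- by have := incr _ _ (lexx _) (ltW hy); lra.
- by [].
Qed.

Lemma Psi_ge0 x : 0 <= Psi x.
Proof.
have [h|h] := leP x (3 / 2); first by rewrite /Psi ltNge h.
by apply: le_trans (Psi_homo (ltW h)); rewrite /Psi ltxx.
Qed.

Lemma Psi_convex x h : 3 / 2 < x -> 0 <= h ->
  Psi x - h * (A * expR x - K) <= Psi (x - h).
Proof.
move=> hx h0; rewrite {1}/Psi hx {1}/Psi.
have hA := ler_wpM2l A0 (expR_tangent x (x - h)).
case: ltP => hxh; first by lra.
have h1 := ler_wpM2l A0 (expR_tangent x (3 / 2)).
have D0 : 0 <= A * expR x - K.
  have hAx : A * expR (3 / 2) <= A * expR x by rewrite ler_wpM2l// ler_expR; exact: ltW.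
  by rewrite subr_ge0; exact: le_trans AK hAx.
have : 0 <= (h - (x - 3 / 2)) * (A * expR x - K) by rewrite mulr_ge0//; lra.
by nra.
Qed.

(** The rate at which [d] may decrease along [contr], relative to [2 * q]: where [q] is nonzero, the
    left side of [d_contr] is [d - k * (2 * q * rho)]. *)
Definition rho g := 2^-1 * (3 / 2 * (d g / q g) + 2 / 3 + w / 6).

(** First-order expansion in [k] of the integrand in [Eg_contr_le], by [expR E >= 1 + E], with an
    explicit remainder. Here [y] and [x] stand for the barrier before and after the dilation, [D]
    for its slope and [Q] for [q]. *)
Lemma barrier_expand k P' (x y D c Q : R) : 0 <= k <= 1 -> 0 <= P' -> k * P' <= 1 -> 0 < Q ->
  0 <= y -> 0 <= D -> 0 <= c -> 0 <= x -> y - k * c * D <= x ->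
  y + k * ((2 * Q - P') * y - c * D) - k ^+ 2 * Q * (y + 2 * P' * y + 2 * c * D)
  <= (1 - k * P') * (x * expR ((2 * k - k ^+ 2) * Q)).
Proof.
move=> /andP[k0 k1] P0 kP Q0 y0 D0 c0 x0 yx.
have [E EE] : exists E, E = (2 * k - k ^+ 2) * Q by eexists.
rewrite -EE.
have E0 : 0 <= E by rewrite EE mulr_ge0 ?(ltW Q0)//; nra.
have EQ : E <= 2 * k * Q by rewrite EE ler_wpM2r ?(ltW Q0)//; have := sqr_ge0 k; lra.
have hP : 0 <= 1 - k * P' by lra.
have cD : 0 <= c * D by rewrite mulr_ge0.
have h1 : (1 - k * P') * ((y - k * c * D) * (1 + E)) <= (1 - k * P') * (x * expR E).
  rewrite ler_wpM2l//; apply: (@le_trans _ _ (x * (1 + E))).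
    by rewrite ler_wpM2r//; lra.
  by rewrite ler_wpM2l// expR_ge1Dx.
apply: le_trans h1.
have e1 : 0 <= k * P' * (k * (c * D)) by rewrite !mulr_ge0.
have e2 : 0 <= k * P' * E * (k * (c * D)) by rewrite !mulr_ge0.
have e3 : 0 <= (2 * k * Q - E) * (k * (c * D)) by rewrite mulr_ge0 ?mulr_ge0//; lra.
have e4 : 0 <= (2 * k * Q - E) * (k * P' * y) by rewrite mulr_ge0 ?mulr_ge0//; lra.
have eE : E = 2 * k * Q - k ^+ 2 * Q by rewrite EE; ring.
have -> : (1 - k * P') * ((y - k * c * D) * (1 + E)) = y - k * (c * D) + E * y - k * P' * y
  - k * P' * E * y - E * (k * (c * D)) + k * P' * (k * (c * D)) + k * P' * E * (k * (c * D)) by ring.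
rewrite {1}eE.
by nra.
Qed.

Local Notation S := (fun g => (wsq zeta g <= r ^+ 2) && (3 / 2 < d g)).

(** Dividing by [q] turns the gain [2 * q * Psi] into [2 * Psi] and absorbs the factor [Q] of the
    remainder in [barrier_expand], which leaves the uniform bound [M0]. *)
Let F g := if S g then Psi (d g) / q g else 0.

Let mS : measurable_fun setT S.
Proof.
apply: measurable_and; last exact: measurable_fun_ltr.
by apply: measurable_fun_ler => //; exact: measurable_wsq.
Qed.

Let mPsi : measurable_fun setT (fun g => Psi (d g)).
Proof.
apply: measurable_fun_ifT => //; first exact: measurable_fun_ltr.
apply: measurable_funB; apply: measurable_funM => //; apply: measurable_funB => //.
exact: measurableT_comp.
Qed.

Let mq : measurable_fun setT q. Proof. exact: measurable_funM. Qed.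

Let mF : measurable_fun setT F.
Proof.
apply: measurable_fun_ifT => //; apply: measurable_funM => //.
exact: (measurableT_comp (@measurable_invr R) mq).
Qed.

Let W_q g : wsq zeta g <= r ^+ 2 -> q g <= 9 / 2 * r ^+ 2.
Proof.
move=> Wg; have : wsq (fun i => 9^-1 * lam i) g <= r ^+ 2.
  apply: le_trans Wg; apply: le_wsq => i; apply: le_trans (zetaP i).
  have l0 := lam0 i; have l1 := lam1 i.
  have : 0 <= lam i * ((1 - lam i) * (2 - lam i)) by rewrite !mulr_ge0//; lra.
  by nra.
by rewrite wsqZ; lra.
Qed.

Let S_q g : S g -> 3 / 2 < q g.
Proof. by case/andP => _ h; apply: lt_le_trans h _; exact: dq. Qed.

Let S_D g : S g -> 0 <= A * expR (d g) - K.
Proof.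
case/andP => _ h; rewrite subr_ge0; apply: le_trans AK _.
by rewrite ler_wpM2l// ler_expR ltW.
Qed.

Let F0 g : 0 <= F g.
Proof.
rewrite /F; case: ifP => // /S_q h; rewrite divr_ge0 ?Psi_ge0//.
by apply: ltW; apply: lt_trans h; lra.
Qed.

Let S_Psi g : S g -> Psi (d g) <= A * expR (9 / 2 * r ^+ 2).
Proof.
case/andP => Wg h; rewrite /Psi h.
have h1 : 0 <= A * expR (3 / 2) by rewrite mulr_ge0// expR_ge0.
have h2 : A * expR (d g) <= A * expR (9 / 2 * r ^+ 2).
  by rewrite ler_wpM2l// ler_expR; apply: le_trans (dq g) (W_q Wg).
have : 0 <= K * (d g - 3 / 2) by rewrite mulr_ge0//; lra.
lra.
Qed.

Let M0 := (1 + 2 * P + 27 * r ^+ 2) * (A * expR (9 / 2 * r ^+ 2)).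

Let M00 : 0 <= M0.
Proof.
rewrite mulr_ge0 ?mulr_ge0 ?expR_ge0//.
by have := trace_ge0 lam01; have := sqr_ge0 r; lra.
Qed.

Let pointwise k g G H : 0 < k <= 2 / 3 -> k * P <= 1 -> 0 <= H ->
  (S g -> G <= (1 - P / (2 * q g)) * Psi (d g) - rho g * (A * expR (d g) - K) + H) ->
  (if S g then Psi (d g) / q g + 2 * k * G else 0) <=
  (1 - k * P) * (F (contr k g) * expR ((2 * k - k ^+ 2) * (2^-1 * Z g))) +
  ((if S g then 2 * k * H else 0) + k ^+ 2 * M0).
Proof.
move=> /andP[k0 k23] kP H0 hG.
have kP0 : 0 <= 1 - k * P by lra.
have M2 : 0 <= k ^+ 2 * M0 by rewrite mulr_ge0// sqr_ge0.
have R0 : 0 <= (1 - k * P) * (F (contr k g) * expR ((2 * k - k ^+ 2) * (2^-1 * Z g))).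
  by rewrite !mulr_ge0 ?expR_ge0.
case: ifPn => [Sg|_]; last by rewrite add0r addr_ge0.
have q0 : 0 < q g by apply: lt_trans (S_q Sg); lra.
have := hG Sg => {}hG.
have [Wg dg] := andP Sg.
have P0 := trace_ge0 lam01.
pose c := 3 / 2 * d g + (2 / 3 + w / 6) * q g.
have c0 : 0 <= c by rewrite /c; have := mulr_ge0 w0 (ltW q0); have := q0; lra.
have k01 : 0 <= k <= 1 by apply/andP; split; lra.
have WT : wsq zeta (contr k g) <= r ^+ 2 by apply: le_trans Wg; exact: wsq_contr_le.
have Zy : Z (contr (2 / 3) g) <= r ^+ 2.
  by apply: le_trans Wg; rewrite wsq_contr; apply: le_wsq.
have hd : d g - k * c <= d (contr k g) by apply: d_contr => //; apply/andP; split; lra.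
(* [contr k g] can leave [S] only by [d] falling to [3 / 2] or below, where [Psi] already vanishes;
   otherwise [q] has decreased, which helps. *)
have FT : Psi (d g - k * c) / q g <= F (contr k g).
  have hP := Psi_homo hd; rewrite /F WT /=; case: ltP => hT.
    have qT : 0 < q (contr k g) by apply: lt_le_trans (dq _); lra.
    have qle : q (contr k g) <= q g by rewrite ler_pM2l// wsq_contr_le.
    by rewrite ler_pM ?Psi_ge0 ?invr_ge0 ?(ltW q0)// lef_pV2 ?posrE.
  have : Psi (d g - k * c) <= 0 by apply: le_trans hP _; rewrite /Psi ltNge hT.
  by rewrite ler_pdivrMr// mul0r.
have D0 := S_D Sg.
have kc0 : 0 <= k * c by rewrite mulr_ge0 ?(ltW k0).
have := barrier_expand k01 P0 kP q0 (Psi_ge0 _) D0 c0 (Psi_ge0 _) (Psi_convex dg kc0).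
set D := A * expR (d g) - K in hG D0 *; set y := Psi (d g) in hG *.
set X := expR _ => hE.
have hE' : (y + k * ((2 * q g - P) * y - c * D) - k ^+ 2 * q g * (y + 2 * P * y + 2 * c * D)) / q g
   <= (1 - k * P) * (F (contr k g) * X).
  rewrite ler_pdivrMr//; apply: le_trans hE _.
  rewrite -mulrA ler_wpM2l// [leRHS]mulrAC ler_wpM2r ?expR_ge0//.
  by rewrite -ler_pdivrMr.
apply: (@le_trans _ _ ((y + k * ((2 * q g - P) * y - c * D) - k ^+ 2 * q g * (y + 2 * P * y + 2 * c * D)) / q g
   + (2 * k * H + k ^+ 2 * M0))); last by rewrite lerD2r.
have hM : y + 2 * P * y + 2 * c * D <= M0.
  have y1 : y <= A * expR (9 / 2 * r ^+ 2) by exact: S_Psi.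
  have D1 : D <= A * expR (9 / 2 * r ^+ 2).
    rewrite /D; apply: (@le_trans _ _ (A * expR (d g))); first by rewrite gerBl.
    by rewrite ler_wpM2l// ler_expR; apply: le_trans (dq g) (W_q Wg).
  have c1 : c <= 27 / 2 * r ^+ 2.
    have h1 := W_q Wg; have h2 := dq g.
    have : w * q g <= 1 / 3 * q g by rewrite ler_wpM2r// ltW.
    rewrite /c; lra.
  have h3 : c * D <= 27 / 2 * r ^+ 2 * (A * expR (9 / 2 * r ^+ 2)) by rewrite ler_pM.
  have h4 : P * y <= P * (A * expR (9 / 2 * r ^+ 2)) by rewrite ler_wpM2l.
  rewrite /M0; lra.
have hM2 : k ^+ 2 * (y + 2 * P * y + 2 * c * D) <= k ^+ 2 * M0 by rewrite ler_wpM2l// sqr_ge0.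
have -> : (y + k * ((2 * q g - P) * y - c * D) - k ^+ 2 * q g * (y + 2 * P * y + 2 * c * D)) / q g
  = y / q g + 2 * k * ((1 - P / (2 * q g)) * y - rho g * D) - k ^+ 2 * (y + 2 * P * y + 2 * c * D).
  have Zg0 : Z g != 0 by apply: lt0r_neq0; have := q0; lra.
  by rewrite /rho /c; field; rewrite Zg0.
have k2 : 0 <= 2 * k by lra.
have := ler_wpM2l k2 hG; lra.
Qed.

(* The derivative at [k = 0] of [Eg_contr_le] applied to [Psi \o d / q] restricted
   to [wsq zeta <= r ^+ 2]. *)
Lemma barrier_ineq (G H : 'cV[R]_n -> R) :
  measurable_fun setT G -> measurable_fun setT H ->
  (forall g, 0 <= G g) -> (forall g, 0 <= H g) ->
  (forall g, S g -> G g <= (1 - P / (2 * q g)) * Psi (d g) - rho g * (A * expR (d g) - K) + H g) ->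
  (Eg (fun g => if S g then G g else 0)%R <= Eg (fun g => if S g then H g else 0)%R)%E.
Proof.
move=> mG mH G0 H0 hG.
apply/lee_addgt0Pr => e e0.
have P0 := trace_ge0 lam01.
(* The second entry keeps [1 - k * P] nonnegative. The third makes [k * M0 <= e], so the
   second-order error is at most [e] after division by [2 * k]. *)
pose k := Num.min (1 / 2) (Num.min (1 / (1 + P)) (e / (1 + M0))).
have k0 : 0 < k.
  have p1 : 0 < 1 + P by lra.
  have m1 : 0 < 1 + M0 by have := M00; lra.
  by rewrite !lt_min !divr_gt0.
have k12 : k <= 1 / 2 by rewrite ge_min lexx.
have kP : k * P <= 1.
  have h : k <= 1 / (1 + P) by rewrite !ge_min lexx !orbT.
  apply: (@le_trans _ _ (1 / (1 + P) * P)); first by rewrite ler_wpM2r.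
  by rewrite mulrAC mul1r ler_pdivrMr; lra.
have kM : k * M0 <= e.
  have h : k <= e / (1 + M0) by rewrite !ge_min lexx !orbT.
  apply: (@le_trans _ _ (e / (1 + M0) * M0)); first by rewrite ler_wpM2r.
  by have m0 := M00; rewrite mulrAC ler_pdivrMr; [rewrite ler_wpM2l//; lra|lra].
have k01 : 0 <= k < 1 by apply/andP; split; lra.
have k02 : 0 < k <= 2 / 3 by apply/andP; split; lra.
have mSG (f : 'cV[R]_n -> R) : measurable_fun setT f -> measurable_fun setT (fun g => if S g then f g else 0).
  by move=> mf; apply: measurable_fun_ifT.
have SG0 (f : 'cV[R]_n -> R) : (forall g, 0 <= f g) -> forall g, 0 <= (if S g then f g else 0).
  by move=> f0 g; case: ifP.
pose FT g := (1 - k * P) * (F (contr k g) * expR ((2 * k - k ^+ 2) * (2^-1 * Z g))).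
have mFT : measurable_fun setT FT.
  apply: measurable_funM => //; apply: measurable_funM.
    exact: (measurableT_comp mF (measurable_contr k)).
  by apply: measurableT_comp => //; exact: measurable_funM.
have FT0 g : 0 <= FT g by rewrite !mulr_ge0 ?expR_ge0//; lra.
(* [Eg F] appears on both sides of the next inequality and is cancelled; it is finite since [Psi]
   and [1 / q] are bounded on [S]. *)
have EF : Eg F \is a fin_num.
  rewrite ge0_fin_numE ?Eg_ge0//.
  apply: (@le_lt_trans _ _ (Eg (fun=> A * expR (9 / 2 * r ^+ 2))%R)); last by rewrite Eg_cst ltry.
  apply: le_Eg => // g; rewrite /F; case: ifPn => Sg; last by rewrite mulr_ge0// expR_ge0.
  have q1 := S_q Sg; rewrite ler_pdivrMr; last lra.
  apply: le_trans (S_Psi Sg) _; rewrite ler_peMr//; last lra.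
  by rewrite mulr_ge0// expR_ge0.
have main : (Eg F + (2 * k)%:E * Eg (fun g => if S g then G g else 0)%R <=
    Eg F + ((2 * k)%:E * Eg (fun g => if S g then H g else 0)%R + (k ^+ 2 * M0)%:E))%E.
  have k2 : 0 <= 2 * k by lra.
  rewrite -!EgZ//; try exact: mSG; try exact: SG0.
  rewrite -EgD//; last 2 first.
  - by apply: measurable_funM => //; exact: mSG.
  - by move=> g; rewrite mulr_ge0//; exact: SG0.
  apply: (@le_trans _ _ (Eg (fun g => FT g + ((if S g then 2 * k * H g else 0) + k ^+ 2 * M0))%R)).
    apply: le_Eg.
    - by apply: measurable_funD => //; apply: measurable_funM => //; exact: mSG.
    - by apply: measurable_funD => //; apply: measurable_funD => //; apply: mSG; exact: measurable_funM.
    - by move=> g; rewrite addr_ge0// mulr_ge0//; exact: SG0.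
    - move=> g; have := pointwise k02 kP (H0 g) (hG g).
      apply: le_trans; rewrite /F; case: ifP => // _; by rewrite mulr0 addr0.
  have mH2 : measurable_fun setT (fun g => if S g then 2 * k * H g else 0).
    by apply: mSG; exact: measurable_funM.
  have H20 : forall g, 0 <= (if S g then 2 * k * H g else 0).
    by apply: SG0 => g; exact: mulr_ge0.
  rewrite EgD//; last 2 first.
  - exact: measurable_funD.
  - by move=> g; rewrite addr_ge0// mulr_ge0// sqr_ge0.
  rewrite leeD//; first exact: Eg_contr_le.
  rewrite EgD//; last by move=> g; rewrite mulr_ge0// sqr_ge0.
  rewrite Eg_cst leeD2r//; apply: le_Eg => // [|g].
    by apply: measurable_funM => //; exact: mSG.
  by case: ifP => // _; rewrite mulr0.
move: main; rewrite leeD2lE//.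
have : (0 <= Eg (fun g => if S g then H g else 0)%R)%E by apply: Eg_ge0; exact: SG0.
have : (0 <= Eg (fun g => if S g then G g else 0)%R)%E by apply: Eg_ge0; exact: SG0.
have k2 : 0 < 2 * k by lra.
case: (Eg (fun g => if S g then H g else 0)%R) => [h| |]//= hg hh; last by rewrite leey.
case: (Eg (fun g => if S g then G g else 0)%R) hg => [h'| |]//=; last by rewrite gt0_muley ?lte_fin.
rewrite -!EFinM -!EFinD !lee_fin => _ hm.
by rewrite -(ler_pM2l k2); nra.
Qed.

End barrier.
End function.
End contraction.

(** * Barrier inequalities and the mean excess *)

Section excess.
Context (R : realType) (n : nat) (lam : 'I_n -> R).
Hypothesis lam01 : forall i, 0 <= lam i <= 1.
Local Notation P := (\sum_i lam i).
Local Notation Z := (wsq lam).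
Variables (d : 'cV[R]_n -> R) (w r : R).
Local Notation q := (fun g => 2^-1 * Z g).
Hypothesis md : measurable_fun setT d.
Hypothesis w01 : 0 <= w <= 1 / 3.
Hypothesis r0 : 0 < r.
Hypothesis dconc : forall (t : R) u v, 0 <= t <= 1 ->
  (1 - t) * (d u - q u) + t * (d v - q v) <=
  d ((1 - t) *: u + t *: v) - q ((1 - t) *: u + t *: v).
Hypothesis d00 : d 0 = 0.
Hypothesis dq : forall u, d u <= q u.
Hypothesis dU : forall u, Z u <= r ^+ 2 -> `|d u| <= w * q u.

(* Constants for which both [interior_ineq] and [exterior_ineq] hold while
   [barK / 6 <= (1 - w) `^ (- (3 / 2))], cf. [barK_powR]. *)
Definition barA : R := 9 / 2 * (1 + w).
Definition barK : R := 6 + 9 * w + 45 / 4 * w ^+ 2.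

Let w0 : 0 <= w. Proof. by have /andP[] := w01. Qed.
Let w13 : w <= 1 / 3. Proof. by have /andP[] := w01. Qed.

Lemma barK_ge6 : 6 <= barK.
Proof. by rewrite /barK; have h1 := w0; have := sqr_ge0 w; lra. Qed.

Lemma barAK : barK <= barA * expR (3 / 2).
Proof.
have h1 := w0; have h2 := w13.
apply: (@le_trans _ _ (barA * (5 / 2))).
  by rewrite /barA /barK; have : 0 <= w * (1 / 3 - w) by [rewrite mulr_ge0//; lra]; lra.
rewrite ler_wpM2l//; first by rewrite /barA; lra.
by apply: le_trans (expR_ge1Dx _); lra.
Qed.

Lemma barA_gt0 : 0 < barA.
Proof. by rewrite /barA; have := w0; lra. Qed.

Lemma expR_sub1_le (t : R) : 0 <= t <= 3 / 2 -> expR t - 1 <= 6 * t.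
Proof.
move=> /andP[t0 t1].
have h01 : 0 <= 2 / 3 * t <= 1 by apply/andP; split; lra.
have := expR_convex01 (3 / 2) h01; rewrite (_ : 2 / 3 * t * (3 / 2) = t); last by field.
have := expR_3_2_le R; set e := expR (3 / 2) => he h.
have : t * e <= t * (23 / 5) by rewrite ler_wpM2l.
lra.
Qed.

(** A large [d] forces a large [q]: from [d <= w * q] and [w * P <= 2 / 3] follows
    [P * d <= 2 / 3 * q], so the trace term is at most [1 / (3 * d) <= 2 / 9], while
    [rho <= 1 / 3 + 5 / 6 * w]. The coefficient of [expR d] that remains on the right is then at
    least 1. *)
Lemma interior_ineq g : Z g <= r ^+ 2 -> w * P <= 2 / 3 -> 3 / 2 < d g ->
  expR (d g) - 1 <= (1 - P / (2 * q g)) * Psi barA barK (d g)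
    - rho lam d w g * (barA * expR (d g) - barK) + barK * d g.
Proof.
move=> Zg wP dg; have h1 := w0; have h2 := w13.
have P0 := trace_ge0 lam01; have hK := barK_ge6; have hA := barA_gt0.
have /ler_normlP[_ dw] := dU Zg.
have q0 : 0 < q g by apply: lt_le_trans (dq g); lra.
have Psi0 : 0 <= Psi barA barK (d g) by apply: Psi_ge0; [lra|exact: barAK].
set t := d g in dg dw *; set Q := q g in dw q0 *.
have p1 : P / (2 * Q) <= 1 / (3 * t).
  have t3 : 0 < 3 * t by lra.
  have q2 : 0 < 2 * Q by lra.
  rewrite ler_pdivrMr// mulrAC mul1r ler_pdivlMr//.
  have : P * t <= P * (w * Q) by rewrite ler_wpM2l.
  have : w * P * Q <= 2 / 3 * Q by rewrite ler_wpM2r// ltW.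
  lra.
have r1 : rho lam d w g <= 1 / 3 + 5 / 6 * w.
  rewrite /rho -/t -/Q; have : t / Q <= w by rewrite ler_pdivrMr.
  lra.
have e1 : expR (3 / 2) <= expR t by rewrite ler_expR ltW.
have D0 : 0 <= barA * expR t - barK.
  by rewrite subr_ge0; apply: le_trans barAK _; rewrite ler_wpM2l// ltW.
have e3 := expR_3_2_le R.
set e := expR (3 / 2) in e1 e3 *; set x := expR t in e1 D0 *.
have hPsi : Psi barA barK t = barA * (x - e) - barK * (t - 3 / 2) by rewrite /Psi dg.
have k1 : (P / (2 * Q)) * Psi barA barK t <= 1 / (3 * t) * Psi barA barK t by rewrite ler_wpM2r.
have k2 : rho lam d w g * (barA * x - barK) <= (1 / 3 + 5 / 6 * w) * (barA * x - barK) by rewrite ler_wpM2r.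
have t0 : 0 < t by lra.
pose s := 1 / (3 * t).
have s0 : 0 < s by rewrite divr_gt0// mulr_gt0.
have s1 : s <= 2 / 9 by rewrite ler_pdivrMr ?mulr_gt0//; lra.
have st : s * t = 1 / 3 by rewrite /s; field; rewrite gt_eqF.
have c0 : 0 <= barA * (1 - s - (1 / 3 + 5 / 6 * w)) - 1.
  have : 0 <= barA * (2 / 9 - s) by rewrite mulr_ge0 ?(ltW hA)//; lra.
  have : 0 <= (1 / 3 - w) * (w + 4 / 5) by rewrite mulr_ge0//; lra.
  rewrite /barA; nra.
have k3 := ler_wpM2l c0 e1.
have k4 : 0 <= (23 / 5 - e) * (barA * (1 / 3 + 5 / 6 * w) + 1).
  by rewrite mulr_ge0//; [lra|rewrite addr_ge0// mulr_ge0 ?(ltW hA)//; lra].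
have k5 : 0 <= - (23 / 5) * (barA * (1 / 3 + 5 / 6 * w) + 1) + barK * (1 / 3 + 5 / 6 * w + 3 / 2) + 1.
  rewrite /barA /barK.
  have : 0 <= (w - 1 / 9) ^+ 2 by exact: sqr_ge0.
  have : 0 <= w ^+ 3 by rewrite exprn_ge0.
  nra.
have kk0 : 0 <= barK by lra.
have t32 : 0 <= t - 3 / 2 by lra.
have k6 := mulr_ge0 (mulr_ge0 kk0 (ltW s0)) t32.
rewrite mulrBl mul1r; move: k1; rewrite hPsi => k1.
suff : x - 1 <= (1 - s) * (barA * (x - e) - barK * (t - 3 / 2)) - (1 / 3 + 5 / 6 * w) * (barA * x - barK) + barK * t.
  by rewrite /s; lra.
nra.
Qed.

(** Here [d_ray] replaces [dU]: up to [sqrt Z = 3 / 2 * r] it yields [d / q <= 1 / 3 + 2 / 3 * w],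
    hence [rho <= 7 / 12 * (1 + w)]. The extra constant [barA * expR (3 / 2)] is later multiplied by
    the small probability of [r ^ 2 < Z]. *)
Lemma exterior_ineq g : r ^+ 2 < Z g -> Z g <= 9 / 4 * r ^+ 2 -> 20 * P <= r ^+ 2 -> 3 / 2 < d g ->
  expR (d g) - 1 <= (1 - P / (2 * q g)) * Psi barA barK (d g)
    - rho lam d w g * (barA * expR (d g) - barK) + (barK * d g + barA * expR (3 / 2)).
Proof.
move=> rZ Zr rP dg; have h1 := w0; have h2 := w13.
have P0 := trace_ge0 lam01; have hK := barK_ge6; have hA := barA_gt0.
have q0 : 0 < q g by apply: lt_le_trans (dq g); lra.
have Psi0 : 0 <= Psi barA barK (d g) by apply: Psi_ge0; [lra|exact: barAK].
have dray := d_ray r0 dconc d00 dU rZ.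
have Z0 : 0 < Z g by have := q0; lra.
have zz : Num.sqrt (Z g) ^+ 2 = Z g by rewrite sqr_sqrtr// ltW.
have z0 : 0 < Num.sqrt (Z g) by rewrite sqrtr_gt0.
have z1 : Num.sqrt (Z g) <= 3 / 2 * r.
  rewrite -[leRHS]ger0_norm; last by rewrite mulr_ge0// ltW.
  by rewrite -sqrtr_sqr ler_sqrt ?sqr_ge0//; rewrite exprMn; lra.
set t := d g in dg dray *; set z := Num.sqrt (Z g) in dray zz z0 z1.
have p1 : P / (2 * q g) <= 1 / 20.
  rewrite ler_pdivrMr ?mulr_gt0//.
  lra.
have r1 : rho lam d w g <= 7 / 12 * (1 + w).
  have : t / q g <= 1 / 3 + 2 / 3 * w.
    rewrite ler_pdivrMr//.
    have : 0 <= (1 - w) * z * (3 / 2 * r - z) by rewrite !mulr_ge0//; lra.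
    rewrite -zz; rewrite -zz in dray; lra.
  by rewrite /rho -/t; lra.
have e1 : expR (3 / 2) <= expR t by rewrite ler_expR ltW.
have D0 : 0 <= barA * expR t - barK.
  by rewrite subr_ge0; apply: le_trans barAK _; rewrite ler_wpM2l// ltW.
set e := expR (3 / 2) in e1 *; set x := expR t in e1 D0 *.
have e0 : 0 < e by exact: expR_gt0.
have hPsi : Psi barA barK t = barA * (x - e) - barK * (t - 3 / 2) by rewrite /Psi dg.
have k1 : (P / (2 * q g)) * Psi barA barK t <= 1 / 20 * Psi barA barK t by rewrite ler_wpM2r.
have k2 : rho lam d w g * (barA * x - barK) <= 7 / 12 * (1 + w) * (barA * x - barK) by rewrite ler_wpM2r.
have c0 : 0 <= barA * (19 / 20 - 7 / 12 * (1 + w)) - 1.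
  have : 0 <= (1 / 3 - w) * (w + 1) by rewrite mulr_ge0//; lra.
  rewrite /barA; nra.
have k3 := ler_wpM2l c0 (ltW (lt_le_trans e0 e1)).
have k4 : 0 <= barA * e by rewrite mulr_ge0 ?(ltW e0) ?(ltW hA).
have k5 : 0 <= barK * (7 / 12 * (1 + w)) by rewrite mulr_ge0//; lra.
have k6 : 0 <= barK * t by rewrite mulr_ge0//; lra.
rewrite mulrBl mul1r; move: k1; rewrite hPsi => k1.
suff : x - 1 <= 19 / 20 * (barA * (x - e) - barK * (t - 3 / 2)) - 7 / 12 * (1 + w) * (barA * x - barK) + (barK * t + barA * e).
  by lra.
nra.
Qed.

(** [barrier_ineq] treats the part [d > 3 / 2]; on the rest the chord bound [expR d - 1 <= 6 * d]
    for [d >= 0] and [barK >= 6] suffice. [zeta] is either [lam] itself or the enlargement [etal],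
    and [B] is charged only where [r ^ 2 < Z]. *)
Lemma excess_le (zeta : 'I_n -> R) (B : R) :
  (forall i, lam i * (1 - 2 / 3 * lam i) ^+ 2 <= zeta i) -> w * P <= 2 / 3 -> 0 <= B ->
  (forall g, wsq zeta g <= r ^+ 2 -> r ^+ 2 < Z g -> 3 / 2 < d g ->
    expR (d g) - 1 <= (1 - P / (2 * q g)) * Psi barA barK (d g)
    - rho lam d w g * (barA * expR (d g) - barK) + (barK * d g + B)) ->
  (Eg (fun g => if wsq zeta g <= r ^+ 2 then Num.max (expR (d g) - 1) 0 else 0)%R <=
   barK%:E * Eg (fun g => `|d g|)%R + B%:E * Eg (fun g => if r ^+ 2 < Z g then 1 else 0)%R)%E.
Proof.
move=> zetaP wP B0 hB.
have hK := barK_ge6; have K0 : 0 <= barK by lra.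
have mZ : measurable_fun setT Z by exact: measurable_wsq.
have mW : measurable_fun setT (fun g => wsq zeta g <= r ^+ 2).
  by apply: measurable_fun_ler => //; exact: measurable_wsq.
have mD : measurable_fun setT (fun g => 3 / 2 < d g) by exact: measurable_fun_ltr.
have mS : measurable_fun setT (fun g => (wsq zeta g <= r ^+ 2) && (3 / 2 < d g)) by exact: measurable_and.
have mI : measurable_fun setT (fun g => if r ^+ 2 < Z g then 1 else 0 : R).
  by apply: measurable_fun_ifT => //; exact: measurable_fun_ltr.
have mN : measurable_fun setT (fun g => `|d g|) by exact: measurableT_comp.
have mG : measurable_fun setT (fun g => Num.max (expR (d g) - 1) 0).
  apply: measurable_maxr => //; apply: measurable_funB => //.
  exact: measurableT_comp.
have [H HE] : exists H, H = fun g => barK * `|d g| + B * (if r ^+ 2 < Z g then 1 else 0) by eexists.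
have mH : measurable_fun setT H by rewrite HE; apply: measurable_funD; exact: measurable_funM.
have I0 g : 0 <= (if r ^+ 2 < Z g then 1 else 0 : R) by case: ifP.
have H0 g : 0 <= H g by rewrite HE addr_ge0 ?mulr_ge0.
have max0 (x : R) : 0 <= Num.max x 0 by rewrite le_max lexx orbT.
have := @barrier_ineq R n lam lam01 d w r md w01 dconc dq dU zeta barA barK zetaP K0 barAK
  (fun g => Num.max (expR (d g) - 1) 0) H mG mH (fun=> max0 _) H0.
move=> /(_ _)/wrap[|hbar].
  move=> g /andP[Wg dg].
  have dg0 : 0 <= d g by lra.
  rewrite max_l; last by rewrite subr_ge0 -[leLHS]expR0 ler_expR.
  rewrite HE ger0_norm//; case: ltP => hZ; first by rewrite mulr1; exact: hB.
  by rewrite mulr0 addr0; exact: interior_ineq.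
rewrite -EgZ// -EgZ// -EgD//; try exact: measurable_funM; try by move=> g; rewrite mulr_ge0.
rewrite -[X in (_ <= Eg X)%E]/(fun g => barK * `|d g| + B * (if r ^+ 2 < Z g then 1 else 0)) -HE.
pose S g := (wsq zeta g <= r ^+ 2) && (3 / 2 < d g).
apply: (@le_trans _ _ (Eg (fun g => (if S g then Num.max (expR (d g) - 1) 0 else 0) + (if S g then 0 else H g))%R)).
  apply: le_Eg => //.
  - exact: measurable_fun_ifT.
  - by apply: measurable_funD; exact: measurable_fun_ifT.
  - by move=> g; case: ifP.
  - move=> g; rewrite /S; case: ifPn => Wg /=; last by rewrite add0r.
    case: ltP => dg; first by rewrite addr0.
    rewrite add0r ge_max H0 andbT.
    have [d0|d0] := leP 0 (d g).
      have t01 : 0 <= d g <= 3 / 2 by rewrite d0.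
      have := expR_sub1_le t01; have : 0 <= B * (if r ^+ 2 < Z g then 1 else 0) by rewrite mulr_ge0.
      have : 6 * d g <= barK * d g by rewrite ler_wpM2r.
      by rewrite HE ger0_norm//; lra.
    apply: le_trans (H0 g); rewrite subr_le0 -expR0 ler_expR; exact: ltW.
rewrite EgD//; try exact: measurable_fun_ifT; try by move=> g; case: ifP.
apply: (@le_trans _ _ (Eg (fun g => if S g then H g else 0)%R + Eg (fun g => if S g then 0 else H g)%R)%E).
  by rewrite leeD2r.
rewrite -EgD//; try exact: measurable_fun_ifT; try by move=> g; case: ifP.
rewrite (_ : (fun g => _) = H)//.
by apply/funext => g; case: ifP => _; rewrite ?addr0 ?add0r.
Qed.

End excess.

(** * Excess and defect in the different ranges of trace and radius *)

Section core.
Context (R : realType) (n : nat) (lam : 'I_n -> R).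
Hypothesis lam01 : forall i, 0 <= lam i <= 1.
Local Notation P := (\sum_i lam i).
Local Notation Z := (wsq lam).
Local Notation sP := (Num.sqrt P).
Variables (d : 'cV[R]_n -> R) (w a : R).
Local Notation q := (fun g => 2^-1 * Z g).
Local Notation r := (2 * sP + a).
Local Notation ex := (expR (- (a ^+ 2 / 2))).
Hypothesis md : measurable_fun setT d.
Hypothesis w01 : 0 <= w <= 1 / 3.
Hypothesis a0 : 0 < a.
Hypothesis dconc : forall (t : R) u v, 0 <= t <= 1 ->
  (1 - t) * (d u - q u) + t * (d v - q v) <=
  d ((1 - t) *: u + t *: v) - q ((1 - t) *: u + t *: v).
Hypothesis d00 : d 0 = 0.
Hypothesis dq : forall u, d u <= q u.
Hypothesis dU : forall u, Z u <= r ^+ 2 -> `|d u| <= w * q u.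
Hypothesis wP : w * P <= 2 / 3.

Let w0 : 0 <= w. Proof. by have /andP[] := w01. Qed.
Let w13 : w <= 1 / 3. Proof. by have /andP[] := w01. Qed.
Let P0 : 0 <= P. Proof. exact: trace_ge0. Qed.
Let sP0 : 0 <= sP. Proof. exact: sqrtr_ge0. Qed.
Let sPP : sP ^+ 2 = P. Proof. by rewrite sqr_sqrtr. Qed.
Let r0 : 0 < r. Proof. by have := sP0; have := a0; lra. Qed.
(** Replaces the square root by a variable, so that later inequalities become polynomial. *)
Let sqP : exists s, [/\ sP = s, 0 <= s & P = s ^+ 2]. Proof. by exists sP. Qed.
Let lam0 i : 0 <= lam i. Proof. by have /andP[] := lam01 i. Qed.

Let mZ : measurable_fun setT Z. Proof. exact: measurable_wsq. Qed.
Let md1 : measurable_fun setT (fun g => Num.max (expR (d g) - 1) 0).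
Proof.
by apply: measurable_maxr => //; apply: measurable_funB => //; apply: measurableT_comp.
Qed.
Let mabs : measurable_fun setT (fun g => `|d g|).
Proof. by apply: measurableT_comp => //; exact: measurable_normr. Qed.
Let mout : measurable_fun setT (fun g => r ^+ 2 < Z g).
Proof. by apply: measurable_fun_ltr. Qed.

Let exp_d_le m g : m <= (1 - w) * r / 2 -> r ^+ 2 < Z g ->
  Num.max (expR (d g) - 1) 0 <= expR (2^-1 * Z g - m * Num.sqrt (Z g)).
Proof.
move=> mr rZ; have h := d_ray r0 dconc d00 dU rZ.
rewrite ge_max expR_ge0 andbT; apply: (@le_trans _ _ (expR (d g))); first by lra.
rewrite ler_expR; apply: le_trans h _; rewrite lerD2l lerN2.
by rewrite ler_wpM2r// sqrtr_ge0.
Qed.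

Let r3 : r / 3 <= (1 - w) * r / 2.
Proof. by have := r0; have := w13; set x := r; nra. Qed.

Let outer_small : P <= 2 / 3 ->
  (Eg (fun g => if (r ^+ 2 < Z g)%R then Num.max (expR (d g) - 1) 0 else 0)%R
   <= (10 / 3 * ex)%:E)%E.
Proof.
move=> P23; apply: le_trans (_ : _ <= (10 / 3 * expR (- (2^-1 * r ^+ 2)))%:E)%E _.
  apply: le_trans (Eg_outer_small_trace lam01 (ltW r0) P23).
  apply: le_Eg => [|||g].
  - by apply: measurable_fun_ifT.
  - by apply: measurable_fun_ifT => //; exact: measurable_expZ_sqrt.
  - by move=> g; case: ifP => // _; rewrite le_max lexx orbT.
  - by case: ifP => // rZ; apply: exp_d_le.
rewrite lee_fin ler_wpM2l// ler_expR lerN2.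
by have [s [-> s0 _]] := sqP; have := a0; nra.
Qed.

(** [Eg_outer_le] with [T = r], the logarithm being bounded by the line of [ln_le_14] so that the
    exponent becomes polynomial in [a] and [sP]. *)
Let outer_large (E : R) : 0 < P -> 2 <= (1 - w) * r / 2 * r - P ->
  - ((1 - w) * r / 2 * r) + 2^-1 * P + P * (13 / 50 * (2 * r / sP) + 2 / 5) <= E ->
  (Eg (fun g => if (r ^+ 2 < Z g)%R then Num.max (expR (d g) - 1) 0 else 0)%R
   <= (4 / 3 * expR E)%:E)%E.
Proof.
move=> Pp h2 hE; have sp : 0 < sP by rewrite sqrtr_gt0.
have Pr : P <= 4 * r ^+ 2 by have [s [-> s0 ->]] := sqP; have := a0; nra.
apply: le_trans (_ : (_ <= _)%E) (le_trans (Eg_outer_le lam01 Pp r0 Pr h2) _).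
  apply: le_Eg => [|||g].
  - by apply: measurable_fun_ifT.
  - apply: measurable_fun_ifT => //; first exact: measurable_fun_ler.
    exact: measurable_expZ_sqrt.
  - by move=> g; case: ifP => // _; rewrite le_max lexx orbT.
  - case: ifP => [rZ|_]; first by rewrite (ltW rZ) exp_d_le.
    by case: ifP => // _; rewrite expR_ge0.
rewrite lee_fin ler_wpM2l// ler_expR; apply: le_trans hE; rewrite lerD2l ler_wpM2l//.
by apply: ln_le_14; rewrite divr_gt0// mulr_gt0.
Qed.

(** The numerical content of assuming a nontrivial bound; the exact threshold is [sqrt (2 * ln 4)],
    about 1.665. *)
Let a_large : 4 * ex < 1 -> 41 / 25 <= a.
Proof.
move=> h; rewrite leNgt; apply/negP => ha.
have : 1 / 4 <= ex.
  apply: (@le_trans _ _ (expR (- (27 / 20)))); last first.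
    by rewrite ler_expR lerN2; have := a0; nra.
  have -> : - (27 / 20) = - (3 / 2) + 3 / 20 :> R by lra.
  rewrite expRD expRN.
  have := expR_3_2_le R; have := expR_gt0 (3 / 2 : R); set e := expR _ => e0 e1.
  have := expR_ge1Dx (3 / 20 : R); set f := expR _ => f1.
  apply: (@le_trans _ _ ((1 + 3 / 20) / e)); last by rewrite mulrC ler_wpM2l// invr_ge0 ltW.
  by rewrite ler_pdivlMr//; lra.
lra.
Qed.

Let as_large : 4 * ex < 1 -> 2 / 3 <= P -> 133 / 100 <= a * sP.
Proof.
move=> /a_large ha hP; have hs : 22 / 27 <= sP by apply: ler_sqrt_sqr => //; lra.
apply: (@le_trans _ _ (41 / 25 * (22 / 27))); first by lra.
by apply: ler_pM; lra.
Qed.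

Let exp_half : expR (1 / 2) <= 2 :> R.
Proof.
have := expR_ge1Dx (- (1 / 2) : R); rewrite expRN => h.
have e0 := expR_gt0 (1 / 2 : R); rewrite -[expR _]invrK -[leRHS]invrK lef_pV2 ?posrE ?invr_gt0//; lra.
Qed.

Let exp_quarter : expR (1 / 4) <= 4 / 3 :> R.
Proof.
have := expR_ge1Dx (- (1 / 4) : R); rewrite expRN => h.
have e0 := expR_gt0 (1 / 4 : R); rewrite -[expR _]invrK -[4 / 3]invrK lef_pV2 ?posrE ?invr_gt0//.
rewrite invf_div; lra.
Qed.

Let outer_cond : 4 * ex < 1 -> 2 / 3 <= P -> 2 <= (1 - w) * r / 2 * r - P.
Proof.
move=> h hP; have := as_large h hP; have ha := a_large h.
have : r / 3 * r <= (1 - w) * r / 2 * r by rewrite ler_wpM2r// ltW// r3.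
move: hP; have [s [-> s0 ->]] := sqP; move=> hP hr has.
by nra.
Qed.

Let exponent_eq k : 0 < P -> - ((1 - w) * r / 2 * r) + 2^-1 * P + P * (13 / 50 * (2 * r / sP) + 2 / 5) - k =
  - (a ^+ 2 / 2) - (3 / 50) * sP ^+ 2 - 37 / 25 * (a * sP) + w / 2 * r ^+ 2 - k.
Proof.
move=> Pp; have : sP != 0 by rewrite gt_eqF// sqrtr_gt0.
by have [s [-> s0 ->]] := sqP => sp; field.
Qed.

Let wsP : w * sP ^+ 2 <= 2 / 3. Proof. by rewrite sPP. Qed.

(** As long as [a] is comparable to [sP], the loss [w / 2 * r ^ 2] in the exponent is covered by
    [w * P <= 2 / 3], up to a constant [1 / 2]. *)
Let outer_mid : 4 * ex < 1 -> 2 / 3 <= P -> a <= 4 * sP ->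
  (Eg (fun g => if (r ^+ 2 < Z g)%R then Num.max (expR (d g) - 1) 0 else 0)%R
   <= (4 * ex)%:E)%E.
Proof.
move=> h hP h4; have Pp : 0 < P by lra.
apply: le_trans (_ : _ <= (4 / 3 * expR (- (a ^+ 2 / 2) + 1 / 2))%:E)%E _; last first.
  rewrite lee_fin expRD; have := exp_half; have := expR_gt0 (- (a ^+ 2 / 2)).
  by set e := expR _; set f := expR _ => e0 f2; nra.
apply: outer_large => //; first exact: outer_cond.
rewrite -subr_le0 exponent_eq//.
have ha := a_large h; have := as_large h hP; have hw := w13; have hw0 := w0.
have := wsP; move: hP h4; have [s [-> s0 ->]] := sqP => hP h4 hws has.
suff : w / 2 * (2 * s + a) ^+ 2 <= 1 / 2 + 3 / 50 * s ^+ 2 + 37 / 25 * (a * s) by lra.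
(* For [s ^ 2 < 2] the bound [w <= 1 / 3] is the better one; for larger [s] it is
   [w * s ^ 2 <= 2 / 3], used through the ratio [a / s <= 4]. *)
have [s2|s2] := leP 2 (s ^+ 2); last first.
  have s14 : s <= 3 / 2 by rewrite leNgt; apply/negP => ?; nra.
  apply: (@le_trans _ _ ((2 * s + a) ^+ 2 / 6)).
    by have := sqr_ge0 (2 * s + a); nra.
  have h1 : 0 <= (a - 41 / 25) * (4 * s - a) by rewrite mulr_ge0; lra.
  have h2 : 0 <= (4 * s - a) * (3 / 2 - s) by rewrite mulr_ge0; lra.
  by nra.
have s1 : 7 / 5 <= s by rewrite leNgt; apply/negP => ?; nra.
have [as1|as1] := leP a s.
  have : w * (2 * s + a) ^+ 2 <= 6.
    apply: (@le_trans _ _ (w * (9 * s ^+ 2))); last by lra.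
    by rewrite ler_wpM2l//; nra.
  by nra.
have : w / 2 * (2 * s + a) ^+ 2 <= 3 * (a / s).
  have sne : s != 0 by lra.
  have -> : w / 2 * (2 * s + a) ^+ 2 = w * s ^+ 2 * (2^-1 * (2 + a / s) ^+ 2) by field.
  set b := a / s; have b1 : 1 <= b by rewrite ler_pdivlMr; lra.
  have b4 : b <= 4 by rewrite ler_pdivrMr; lra.
  apply: (@le_trans _ _ (2 / 3 * (2^-1 * (2 + b) ^+ 2))).
    by rewrite ler_wpM2r//; have := sqr_ge0 (2 + b); lra.
  by nra.
have : 2 * (a / s) <= a * s.
  rewrite mulrA ler_pdivrMr; last lra.
  have : 0 <= a * (s ^+ 2 - 2) by rewrite mulr_ge0; have := a0; lra.
  lra.
have : a / s <= 4 by rewrite ler_pdivrMr; lra.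
by nra.
Qed.

Let max0_ge0 (x : R) : 0 <= Num.max x 0. Proof. by rewrite le_max lexx orbT. Qed.

Let eta_le i : 4 / 9 * lam i <= etal lam i.
Proof. by rewrite /etal; have /andP[] := lam01 i; nra. Qed.

Let eta_contr i : lam i * (1 - 2 / 3 * lam i) ^+ 2 <= etal lam i.
Proof.
rewrite /etal; have /andP[l0 l1] := lam01 i.
have : 0 <= lam i ^+ 2 * (7 - 4 * lam i) by rewrite mulr_ge0 ?sqr_ge0//; lra.
by nra.
Qed.

Let Z_eta g : Z g <= 9 / 4 * wsq (etal lam) g.
Proof. by rewrite -wsqZ; apply: le_wsq => i; have := eta_le i; lra. Qed.

Let eta_Z g : wsq (etal lam) g <= Z g.
Proof. by apply: le_wsq => i; rewrite /etal; have := sqr_ge0 (lam i); lra. Qed.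

Let meta : measurable_fun setT (wsq (etal lam)). Proof. exact: measurable_wsq. Qed.

Let exp_neg3 : expR (- 3) <= 1 / 18 :> R.
Proof.
rewrite expRN; have := expR1_ge R => h1.
have : 18 <= expR (3 : R).
  have -> : (3 : R) = 2 + 1 by lra.
  rewrite expRD; have := expR2_ge R; move: h1; set e := expR 1; set f := expR 2.
  by move=> h1 h2; nra.
move=> h; rewrite ler_pdivlMr; last lra.
by rewrite mulrC ler_pdivrMr; lra.
Qed.

(** Here [r >= 6 * sP], and the exponents of the near part [Z <= 9 / 4 * r ^ 2] and of the far part
    both beat [- a ^ 2 / 2] by 3, where [expR (- 3) <= 1 / 18]. With the factor [4 / 3] of the far
    part the total is [7 / 54 <= 1 / 6]. *)
Let far_large : 4 * ex < 1 -> 2 / 3 <= P -> 4 * sP <= a ->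
  (Eg (fun g => if (r ^+ 2 < wsq (etal lam) g)%R then Num.max (expR (d g) - 1) 0 else 0)%R
   <= (1 / 6 * ex)%:E)%E.
Proof.
move=> h hP h4; have Pp : 0 < P by lra.
have sp : 0 < sP by rewrite sqrtr_gt0.
have r32 : 0 < 3 / 2 * r by have := r0; lra.
have r6 : 36 * P <= r ^+ 2.
  move: h4 sp; have [s [-> s0 ->]] := sqP => h4 sp.
  apply: (@le_trans _ _ ((6 * s) ^+ 2)); first by lra.
  have := a0; rewrite lerXn2r ?nnegrE; lra.
have Pr : P <= 1 / 2 * r ^+ 2 by lra.
have Pr2 : P <= 4 * (3 / 2 * r) ^+ 2 by rewrite exprMn; lra.
have mr2 : 2 <= r / 3 * (3 / 2 * r) - P by have : r / 3 * (3 / 2 * r) = r ^+ 2 / 2 by [field]; lra.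
have near := Eg_near_le lam01 Pp r0 Pr.
have far := Eg_outer_le lam01 Pp r32 Pr2 mr2.
have mexp := measurable_expZ_sqrt lam (r / 3).
have mn : measurable_fun setT (fun g => if ((r ^+ 2 < wsq (etal lam) g) && (Z g <= 9 / 4 * r ^+ 2))%R
       then expR (2^-1 * Z g - r / 3 * Num.sqrt (Z g)) else 0).
  apply: measurable_fun_ifT => //; apply: measurable_and.
    exact: measurable_fun_ltr.
  exact: measurable_fun_ler.
have mf : measurable_fun setT (fun g => if (3 / 2 * r) ^+ 2 <= Z g
       then expR (2^-1 * Z g - r / 3 * Num.sqrt (Z g)) else 0).
  by apply: measurable_fun_ifT => //; exact: measurable_fun_ler.
apply: (@le_trans _ _ (Eg (fun g => (if ((r ^+ 2 < wsq (etal lam) g) && (Z g <= 9 / 4 * r ^+ 2))%R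
       then expR (2^-1 * Z g - r / 3 * Num.sqrt (Z g)) else 0)
  + (if (3 / 2 * r) ^+ 2 <= Z g then expR (2^-1 * Z g - r / 3 * Num.sqrt (Z g)) else 0))%R)).
  apply: le_Eg => [|||g].
  - by apply: measurable_fun_ifT => //; apply: measurable_fun_ltr.
  - exact: measurable_funD.
  - by move=> g; case: ifP.
  case: ifP => [rZ|_]; last by rewrite addr_ge0//; case: ifP => //; rewrite expR_ge0.
  have rZ' := lt_le_trans rZ (eta_Z g).
  have := exp_d_le r3 rZ'.
  case: (leP (Z g)) => [_ hh|hh]; first by apply: le_trans hh _; rewrite lerDl; case: ifP; rewrite ?expR_ge0.
  rewrite (_ : (3 / 2 * r) ^+ 2 <= Z g) ?add0r//.
  by apply: le_trans (ltW hh); rewrite exprMn; lra.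
have n0 g : 0 <= (if ((r ^+ 2 < wsq (etal lam) g) && (Z g <= 9 / 4 * r ^+ 2))%R
       then expR (2^-1 * Z g - r / 3 * Num.sqrt (Z g)) else 0) by case: ifP; rewrite ?expR_ge0.
have f0 g : 0 <= (if (3 / 2 * r) ^+ 2 <= Z g
       then expR (2^-1 * Z g - r / 3 * Num.sqrt (Z g)) else 0) by case: ifP; rewrite ?expR_ge0.
rewrite (EgD mn mf n0 f0).
have nf := leeD near far;  apply: (le_trans nf); rewrite -EFinD lee_fin; clear nf near far mn mf n0 f0 mexp.
have e1 : expR (- (2^-1 * r ^+ 2) + 3 / 2 * P + 2 / 7 * (r * sP)) <= 1 / 18 * ex.
  apply: (@le_trans _ _ (expR (- (a ^+ 2 / 2) + - 3))); last first.
    by rewrite expRD mulrC ler_wpM2r ?expR_ge0 ?exp_neg3.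
  rewrite ler_expR; move: h4 sp hP; have [s [-> s0 ->]] := sqP => h4 sp hP'.
  have : 0 <= s * (a - 4 * s) by rewrite mulr_ge0; lra.
  lra.
have e2 : expR (- (r / 3 * (3 / 2 * r)) + 2^-1 * P + P * ln (2 * (3 / 2 * r) / sP)) <= 1 / 18 * ex.
  apply: (@le_trans _ _ (expR (- (a ^+ 2 / 2) + - 3))); last first.
    by rewrite expRD mulrC ler_wpM2r ?expR_ge0 ?exp_neg3.
  rewrite ler_expR.
  apply: (@le_trans _ _ (- (r / 3 * (3 / 2 * r)) + 2^-1 * P + P * (2 * (3 / 2 * r) / sP / 7 + 1))).
    rewrite lerD2l ler_wpM2l//; apply: ln_le_7.
    by rewrite divr_gt0// mulr_gt0.
  have -> : P * (2 * (3 / 2 * r) / sP / 7 + 1) = 3 / 7 * (r * sP) + P.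
    by move: sp; have [s [-> s0 ->]] := sqP => sp; field; rewrite gt_eqF.
  move: h4 sp hP; have [s [-> s0 ->]] := sqP => h4 sp hP'.
  have : 0 <= s * (a - 4 * s) by rewrite mulr_ge0; lra.
  lra.
have := expR_gt0 (- (a ^+ 2 / 2)); lra.
Qed.

Let tail_le : (Eg (fun g => if r ^+ 2 < Z g then 1 else 0)%R <= (expR (- (2^-1 * (sP + a) ^+ 2)))%:E)%E.
Proof.
have sr : sP < r by have := sP0; have := a0; lra.
by apply: le_trans (Eg_tail_le lam01 sr) _; rewrite (_ : r - sP = sP + a)//; ring.
Qed.

Let split_max (b : 'cV[R]_n -> bool) : measurable_fun setT b ->
  Eg (fun g => Num.max (expR (d g) - 1) 0) =
  (Eg (fun g => if b g then 0 else Num.max (expR (d g) - 1) 0)%R +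
   Eg (fun g => if b g then Num.max (expR (d g) - 1) 0 else 0)%R)%E.
Proof.
move=> mb; rewrite -EgD.
- by congr Eg; apply/funext => g; case: ifP; rewrite ?addr0 ?add0r.
- exact: measurable_fun_ifT.
- exact: measurable_fun_ifT.
- by move=> g; case: ifP.
- by move=> g; case: ifP.
Qed.

(** For [P <= 2 / 3] or [a <= 4 * sP] the barrier on [Z <= r ^ 2] and a tail bound suffice.
    Otherwise the barrier runs on [wsq etal <= r ^ 2]; its extra constant, at most [138 / 5], meets
    a tail probability of at most [ex / 18]. *)
Lemma excess_le3 : 4 * ex < 1 ->
  (Eg (fun g => Num.max (expR (d g) - 1) 0)%R <=
   (barK w)%:E * Eg (fun g => `|d g|)%R + (4 * ex)%:E)%E.
Proof.
move=> h.
have small : (Eg (fun g => if (r ^+ 2 < Z g)%R then Num.max (expR (d g) - 1) 0 else 0)%R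
   <= (4 * ex)%:E)%E -> (Eg (fun g => Num.max (expR (d g) - 1) 0)%R <=
   (barK w)%:E * Eg (fun g => `|d g|)%R + (4 * ex)%:E)%E.
  move=> hs; rewrite (split_max mout); apply: leeD hs.
  have := @excess_le R n lam lam01 d w r md w01 dconc dq dU lam 0.
  rewrite mul0e adde0 (_ : (fun g => if Z g <= r ^+ 2 then _ else _) =
    (fun g => if r ^+ 2 < Z g then 0 else Num.max (expR (d g) - 1) 0)); last first.
    by apply/funext => g; rewrite ltNge; case: (Z g <= _).
  apply => //; last by move=> g; rewrite leNgt => /negP.
  move=> i.  by have /andP[l0 l1] := lam01 i; rewrite ler_piMr// expr_le1//; lra.
have e0 := expR_gt0 (- (a ^+ 2 / 2)).
have [P23|P23] := leP P (2 / 3).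
  by apply: small; apply: le_trans (outer_small P23) _; rewrite lee_fin; lra.
have [a4|a4] := leP a (4 * sP); first by apply: small; exact: outer_mid (ltW P23) a4.
have mb : measurable_fun setT (fun g => r ^+ 2 < wsq (etal lam) g) by exact: measurable_fun_ltr.
have hA := barA_gt0 w01.
have hB : 0 <= barA w * expR (3 / 2) by rewrite mulr_ge0 ?expR_ge0// ltW.
have rP : 20 * P <= r ^+ 2.
  move: a4; have [s [-> s0 ->]] := sqP => a4.
  apply: (@le_trans _ _ ((6 * s) ^+ 2)); first by nra.
  have := a0; rewrite lerXn2r ?nnegrE; lra.
rewrite (split_max mb).
have := @excess_le R n lam lam01 d w r md w01 dconc dq dU (etal lam) (barA w * expR (3 / 2)).
rewrite (_ : (fun g => if wsq (etal lam) g <= r ^+ 2 then _ else _) =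
    (fun g => if r ^+ 2 < wsq (etal lam) g then 0 else Num.max (expR (d g) - 1) 0)); last first.
    by apply/funext => g; rewrite ltNge; case: (wsq (etal lam) g <= _).
move=> /(_ eta_contr wP hB) H; apply: le_trans (leeD (H _) (far_large h (ltW P23) (ltW a4))) _.
  move=> g hZ rZ dg; have := Z_eta g => hz.
  by apply: (exterior_ineq lam01 w01 r0) => //; lra.
rewrite -addeA leeD2l//.
apply: (@le_trans _ _ ((barA w * expR (3 / 2))%:E * (expR (- (2^-1 * (sP + a) ^+ 2)))%:E + (1 / 6 * ex)%:E)%E).
  by rewrite leeD2r// lee_pmul2l ?tail_le//= lte_fin mulr_gt0 ?expR_gt0.
rewrite -EFinM -EFinD lee_fin.
have : expR (- (2^-1 * (sP + a) ^+ 2)) <= 1 / 18 * ex.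
  apply: (@le_trans _ _ (expR (- (a ^+ 2 / 2) + - 3))); last first.
    by rewrite expRD mulrC ler_wpM2r ?expR_ge0 ?exp_neg3.
  rewrite ler_expR; move: a4 P23; have [s [-> s0 ->]] := sqP => a4 P23.
  have : 0 <= s * (a - 4 * s) by rewrite mulr_ge0; lra.
  lra.
have : barA w * expR (3 / 2) <= 6 * (23 / 5).
  rewrite ler_pM ?expR_ge0 ?expR_3_2_le// ?(ltW hA)//.
  by rewrite /barA; have := w13; lra.
move: hB e0; set B := _ * expR _; set e := expR _; set f := expR _ => hB e0 hB2 hf.
have : B * f <= 6 * (23 / 5) * (1 / 18 * e).
  by apply: ler_pM => //; exact: expR_ge0.
lra.
Qed.

(** Inside, [d <= w * q], and the mean of [expR (w * q)] is [1 / sqrt Pi]. Now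
    [sqrt Pi >= 1 - w * P / (2 * (1 - w))], and [w * P <= 2 / 3] gives [sqrt Pi >= 2 / 3]; so
    [1 / sqrt Pi - 1] is at most [3 / 2] times [w * P / (2 * (1 - w))], which is the origin of the
    constant [3 / 4] in [diam2]. *)
Let inner2 : (Eg (fun g => if (r ^+ 2 < Z g)%R then 0 else Num.max (expR (d g) - 1) 0)%R
  <= (3 / 4 * w * P / (1 - w))%:E)%E.
Proof.
have c1 i : w * lam i < 1 by have /andP[] := lam01 i; have := w0; have := w13; nra.
have mE : measurable_fun setT (fun g => expR (2^-1 * wsq (fun i => w * lam i) g)).
  by apply: measurableT_comp => //; apply: measurable_funM => //; exact: measurable_wsq.
have mE1 : measurable_fun setT (fun g => expR (2^-1 * wsq (fun i => w * lam i) g) - 1).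
  exact: measurable_funB.
have E1 g : 0 <= expR (2^-1 * wsq (fun i => w * lam i) g) - 1.
  rewrite subr_ge0 -expR0 ler_expR mulr_ge0//; apply: wsq_ge0 => i.
  by rewrite mulr_ge0.
set Pi := \prod_i (1 - w * lam i).
have Pi49 : 4 / 9 <= Pi.
  apply: (@le_trans _ _ (\prod_i expR (3 * (w * lam i) * ln (2 / 3)))); last first.
    apply: ler_prod => i _; rewrite expR_ge0/=.
    have /andP[l0 l1] := lam01 i; have hw := w13; have hw0 := w0.
    apply: le_trans (expR_convex01 _ _) _; first by apply/andP; split; nra.
    by rewrite lnK ?posrE//; lra.
  rewrite -expR_sum -mulr_suml -mulr_sumr -mulr_sumr.
  have -> : 4 / 9 = expR (2 * ln (2 / 3)) :> R.
    by rewrite expRM_natl lnK ?posrE//; lra.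
  rewrite ler_expR; have : ln (2 / 3) <= 0 :> R by rewrite ln_le0//; lra.
  by have := wP; set Q := w * P; set l := ln _ => *; nra.
have Piexp : 1 - w * P / (2 * (1 - w)) <= Num.sqrt Pi.
  have : expR (- (w * P / (1 - w))) <= Pi.
    rewrite mulr_sumr mulr_suml -sumrN expR_sum; apply: ler_prod => i _; rewrite expR_ge0/=.
    have t1 := c1 i; have /andP[l0 l1] := lam01 i; have hw := w13; have hw0 := w0.
    rewrite expRN -[leRHS]invrK lef_pV2 ?posrE ?expR_gt0 ?invr_gt0 ?subr_gt0//.
    apply: le_trans (expR_ge1Dx _).
    have -> : (1 - w * lam i)^-1 = 1 + w * lam i / (1 - w * lam i).
      by field; lra.
    rewrite lerD2l ler_wpM2l ?mulr_ge0// lef_pV2 ?posrE; [|lra..].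
    by nra.
  have -> : expR (- (w * P / (1 - w))) = expR (- (w * P / (2 * (1 - w)))) ^+ 2.
    rewrite -expRM_natl; congr expR; field; have := w13; lra.
  move/(ler_sqrt_sqr (expR_ge0 _)); apply: le_trans; exact: expR_ge1Dx.
have sq23 : 2 / 3 <= Num.sqrt Pi by apply: ler_sqrt_sqr; lra.
have PiE : (Eg (fun g => expR (2^-1 * wsq (fun i => w * lam i) g))%R = ((Num.sqrt Pi)^-1)%:E)%E.
  exact: std_gauss_expR_quad.
apply: (@le_trans _ _ (Eg (fun g => expR (2^-1 * wsq (fun i => w * lam i) g) - 1)%R)).
  apply: le_Eg => // [||g].
  - exact: measurable_fun_ifT.
  - by move=> g; case: ifP.
  case: ifP => [_|/negbT]; first exact: E1.
  rewrite -leNgt => /dU hd; rewrite ge_max E1 andbT lerD2r ler_expR.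
  by apply: le_trans (ler_norm _) _; apply: le_trans hd _; rewrite wsqZ; lra.
have : (Eg (fun g => expR (2^-1 * wsq (fun i => w * lam i) g) - 1)%R + Eg (fun _ : 'cV[R]_n => 1)%R = ((Num.sqrt Pi)^-1)%:E)%E.
  have m1 : measurable_fun setT (fun _ : 'cV[R]_n => 1 : R) by exact: measurable_cst.
  rewrite -PiE; apply: etrans (esym (EgD mE1 m1 E1 (fun=> ler01))) _; congr Eg.
  by apply/funext => g; rewrite subrK.
rewrite Eg_cst; set X := Eg _; case: X => [x| |]//.
rewrite -EFinD => -[xE]; rewrite lee_fin.
have -> : x = (Num.sqrt Pi)^-1 - 1 by lra.
move: sq23 Piexp; set y := Num.sqrt Pi => y23 hy.
have -> : y^-1 - 1 = (1 - y) / y by field; lra.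
rewrite ler_pdivrMr; last lra.
have -> : 3 / 4 * w * P / (1 - w) = 3 / 2 * (w * P / (2 * (1 - w))).
  by field; have := w13; lra.
have : 0 <= w * P / (2 * (1 - w)).
  by rewrite divr_ge0// ?mulr_ge0//; have := w13; lra.
set X' := w * P / _ in hy *; move=> X0; nra.
Qed.

(** With [y = (1 - w) * x] the difference of the exponentials is at most
    [w / (1 - w) * (y * expR (- y))], and [y * expR (- y) <= expR (- 1) <= 20 / 53]. *)
Let exp_gap (x : R) : 0 <= x -> expR (- ((1 - w) * x)) <= expR (- x) + 20 / 53 * (w / (1 - w)).
Proof.
move=> x0; have hw := w13; have hw0 := w0.
have h1 : 1 - w * x <= expR (- (w * x)) := expR_ge1Dx _.
have e0 := expR_gt0 (- ((1 - w) * x)).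
have -> : expR (- x) = expR (- ((1 - w) * x)) * expR (- (w * x)) by rewrite -expRD; congr expR; ring.
set y := (1 - w) * x in e0 *.
have y0 : 0 <= y by rewrite mulr_ge0//; lra.
have yE : w * x = w / (1 - w) * y by rewrite /y; field; lra.
have hy : y * expR (- y) <= 20 / 53.
  rewrite expRN ler_pdivrMr ?expR_gt0//.
  have -> : expR y = expR 1 * expR (y - 1) by rewrite -expRD; congr expR; ring.
  have := expR_ge1Dx (y - 1); have := expR1_ge R.
  set e := expR 1; set f := expR _ => he hf.
  have : 53 / 20 * y <= e * f by apply: ler_pM; lra.
  lra.
have k0 : 0 <= w / (1 - w) by rewrite divr_ge0//; lra.
move: h1; rewrite yE; set k := w / (1 - w) in k0 *; set e := expR (- y) in e0 hy *; set f := expR _ => h1.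
nra.
Qed.

(** The interior uses up one of the four available copies of [diam2]. The other three pay for the
    factor [1 - w] in the outer exponent through [exp_gap], where [P >= 2 / 3] turns [w / (1 - w)]
    into a multiple of [diam2]. *)
Lemma excess_le2 : 4 * ex < 1 ->
  (Eg (fun g => Num.max (expR (d g) - 1) 0)%R <=
   (4 * (3 / 4 * w * P / (1 - w) + ex))%:E)%E.
Proof.
move=> h; rewrite (split_max mout).
have e0 := expR_gt0 (- (a ^+ 2 / 2)).
have hw := w13; have hw0 := w0.
have D0 : 0 <= 3 / 4 * w * P / (1 - w) by rewrite divr_ge0 ?mulr_ge0//; lra.
apply: (@le_trans _ _ ((3 / 4 * w * P / (1 - w))%:E + (4 * ex + 3 * (3 / 4 * w * P / (1 - w)))%:E)%E); last first.
  by rewrite -EFinD lee_fin; lra.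
apply: leeD; first exact: inner2.
have [P23|P23] := leP P (2 / 3).
  by apply: le_trans (outer_small P23) _; rewrite lee_fin; lra.
have Pp : 0 < P by lra.
apply: le_trans (_ : _ <= (4 / 3 * expR (- ((1 - w) * (a ^+ 2 / 2)) + 1 / 4))%:E)%E _.
  apply: outer_large => //; first exact: outer_cond (ltW P23).
  rewrite -subr_le0 exponent_eq//.
  have := as_large h (ltW P23); have := wsP.
  move: P23; have [s [-> s0 ->]] := sqP => P23 hws has.
  have : 0 <= (1 / 3 - w) * (a * s) by rewrite mulr_ge0; lra.
  have : 0 <= (1 / 3 - w) * (a ^+ 2) by rewrite mulr_ge0; have := sqr_ge0 a; lra.
  lra.
rewrite lee_fin expRD.
have := exp_gap (_ : 0 <= a ^+ 2 / 2); rewrite divr_ge0 ?sqr_ge0// => /(_ isT).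
set e1 := expR (- ((1 - w) * _)) => h1; have e10 : 0 <= e1 by exact: expR_ge0.
have := exp_quarter; set f := expR (1 / 4) => hf.
have : e1 * f <= e1 * (4 / 3) by rewrite ler_wpM2l.
have : w / (1 - w) * (2 / 3) <= w / (1 - w) * P by rewrite ler_wpM2l ?divr_ge0//; lra.
have -> : 3 / 4 * w * P / (1 - w) = 3 / 4 * (w / (1 - w) * P) by ring.
have : 0 <= w / (1 - w) by rewrite divr_ge0//; lra.
lra.
Qed.

Lemma defect_le3 : (Eg (fun g => Num.max (1 - expR (d g)) 0)%R <= Eg (fun g => `|d g|)%R)%E.
Proof.
apply: le_Eg => [||g|g] //.
- by apply: measurable_maxr => //; apply: measurable_funB => //; apply: measurableT_comp.
rewrite ge_max normr_ge0 andbT; have := expR_ge1Dx (d g); have := ler_norm (- d g).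
rewrite normrN; lra.
Qed.

(** Inside, the defect is at most [w * q], of mean at most [w * P / 2]; outside it is at most 1 and
    the tail probability decides. *)
Lemma defect_le2 : (Eg (fun g => Num.max (1 - expR (d g)) 0)%R <=
   (3 / 4 * w * P / (1 - w) + ex)%:E)%E.
Proof.
have hw := w13; have hw0 := w0.
have mi : measurable_fun setT (fun g => if r ^+ 2 < Z g then 1 else 0 : R) by exact: measurable_fun_ifT.
have mwZ : measurable_fun setT (fun g => w / 2 * Z g) by exact: measurable_funM.
apply: (@le_trans _ _ (Eg (fun g => w / 2 * Z g + (if r ^+ 2 < Z g then 1 else 0))%R)).
  apply: le_Eg => [|||g].
  - by apply: measurable_maxr => //; apply: measurable_funB => //; apply: measurableT_comp.
  - exact: measurable_funD.
  - by move=> g.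
  have Z0 : 0 <= w / 2 * Z g by rewrite mulr_ge0 ?wsq_ge0//; lra.
  have hd := expR_ge1Dx (d g); have he := expR_ge0 (d g).
  case: ifPn => hZ; rewrite ge_max; apply/andP; split; try lra.
  rewrite -leNgt in hZ; have := dU hZ; have := ler_norm (- d g); rewrite normrN; lra.
have Z0 g : 0 <= w / 2 * Z g by rewrite mulr_ge0 ?wsq_ge0//; lra.
rewrite EgD// => [|g]; last by case: ifP.
rewrite EFinD; apply: leeD.
  have -> : Eg (fun g => w / 2 * Z g)%R = ((w / 2)%:E * Eg Z)%E.
    by apply: EgZ => // [|g]; [lra|exact: wsq_ge0].
  have EZ : (Eg Z <= P%:E)%E.
    have -> : Eg Z = (\sum_i (Eg (fun g => lam i * g i 0 ^+ 2)%R))%E.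
      rewrite /Eg -ge0_integral_sum//.
      - by apply: eq_integral => g _; rewrite -sumEFin.
      - move=> i; apply/measurable_EFinP; apply: measurable_funM => //.
        by apply: measurable_funX; exact: measurable_mx_entry.
      - by move=> i g _; rewrite lee_fin mulr_ge0// sqr_ge0.
    rewrite -sumEFin; apply: lee_sum => i _.
    rewrite EgZ//; last by move=> g; exact: sqr_ge0.
    + rewrite -[leRHS]mule1; apply: lee_wpmul2l; rewrite ?lee_fin//; exact: Eg_sqr_le1.
    + by apply: measurable_funX; exact: measurable_mx_entry.
  apply: le_trans (lee_wpmul2l _ EZ) _; first by rewrite lee_fin; lra.
  rewrite -EFinM lee_fin ler_pdivlMr; last lra.
  have : 0 <= w * P by rewrite mulr_ge0.
  by set Q := P => wQ; nra.
apply: le_trans tail_le _; rewrite lee_fin ler_expR lerN2.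
by have [s [-> s0 _]] := sqP; have := a0; nra.
Qed.

End core.

(** * From excess and defect to probabilities *)

(** [p] is the probability of an event, [aA], [aC] the excess and [bA], [bC] the defect on it and on
    its complement. If the defect is the smaller, the normaliser is at least 1; otherwise the excess
    too is below [Y / 4] and the normaliser is at least [3 / 4]. Either way the final constant is
    1. *)
Lemma tilt_ratio_le (R : realFieldType) (p aA aC bA bC Y : R) : 0 <= p <= 1 ->
  0 <= aA -> 0 <= aC -> 0 <= bA -> 0 <= bC -> aA + aC <= Y -> bA + bC <= Y / 4 -> Y < 1 ->
  0 < 1 + (aA + aC) - (bA + bC) /\
  `|(p + aA - bA) / (1 + (aA + aC) - (bA + bC)) - p| <= Y.
Proof.
move=> /andP[p0 p1] aA0 aC0 bA0 bC0 aY bY Y1.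
set I := 1 + _ - _.
have I0 : 0 < I by rewrite /I; lra.
split=> //.
have Y0 : 0 <= Y by lra.
have key (s t : R) : 0 <= s <= aA + aC -> 0 <= t <= bA + bC -> (1 - p) * s + p * t <= Y * I
  /\ p * s + (1 - p) * t <= Y * I.
  move=> /andP[s0 s1] /andP[t0 t1].
  have [ab|ab] := leP (bA + bC) (aA + aC).
    have YI : Y <= Y * I by rewrite ler_peMr// /I; lra.
    split; apply: le_trans YI; nra.
  have YI : Y / 4 <= Y * I by apply: (@le_trans _ _ (Y * (3 / 4))); [lra|rewrite ler_wpM2l// /I; lra].
  by split; apply: le_trans YI; nra.
have [k1 k2] := key aA bC (ltac:(lra)) (ltac:(lra)).
have [k3 k4] := key aC bA (ltac:(lra)) (ltac:(lra)).
have -> : (p + aA - bA) / I - p = ((1 - p) * (aA - bA) - p * (aC - bC)) / I.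
  apply: (mulIf (lt0r_neq0 I0)); rewrite mulrBl !divfK ?lt0r_neq0// /I; ring.
rewrite normrM normfV (gtr0_norm I0) ler_pdivrMr// ler_norml; apply/andP; split.
  have : 0 <= (1 - p) * aA by rewrite mulr_ge0; lra.
  have : 0 <= p * bC by rewrite mulr_ge0; lra.
  lra.
have : 0 <= (1 - p) * bA by rewrite mulr_ge0; lra.
have : 0 <= p * aC by rewrite mulr_ge0; lra.
lra.
Qed.

Lemma tilted_probability_le d (T : measurableType d) (R : realType) (P : probability T R)
    (F : T -> R) (Y : R) (A : set T) : measurable_fun setT F -> (forall x, 0 <= F x) -> Y < 1 ->
  (\int[P]_x (Num.max (F x - 1) 0)%:E <= Y%:E)%E ->
  (\int[P]_x (Num.max (1 - F x) 0)%:E <= (Y / 4)%:E)%E -> measurable A ->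
  [/\ (0 < \int[P]_x (F x)%:E)%E, (\int[P]_x (F x)%:E < +oo)%E &
   (`|(\int[P]_(x in A) (F x)%:E) / (\int[P]_x (F x)%:E) - P A| <= Y%:E)%E].
Proof.
move=> mF F0 Y1 hu hl mA.
pose u x := Num.max (F x - 1) 0; pose l x := Num.max (1 - F x) 0.
have mu : measurable_fun setT u by apply: measurable_maxr => //; exact: measurable_funB.
have ml : measurable_fun setT l by apply: measurable_maxr => //; exact: measurable_funB.
have u0 x : 0 <= u x by rewrite le_max lexx orbT.
have l0 x : 0 <= l x by rewrite le_max lexx orbT.
(* Written without subtraction, this identity integrates in the extended reals and shows that [F]
   has a finite integral. *)
have FE x : F x + l x = 1 + u x.
  rewrite /u /l; case: (leP (F x - 1) 0) => h1; case: (leP (1 - F x) 0) => h2; lra.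
have split_set (G : T -> R) : measurable_fun setT G -> (forall x, 0 <= G x) ->
    (\int[P]_x (G x)%:E = \int[P]_(x in A) (G x)%:E + \int[P]_(x in ~` A) (G x)%:E)%E.
  move=> mG G0; rewrite -(@setUv _ A) ge0_integral_setU//=.
  - exact: measurableC.
  - by rewrite setUv; exact/measurable_EFinP.
  - by move=> x _; rewrite lee_fin.
  - by rewrite disj_set2E setICr.
have eqB B : measurable B -> (\int[P]_(x in B) (F x)%:E + \int[P]_(x in B) (l x)%:E =
    P B + \int[P]_(x in B) (u x)%:E)%E.
  move=> mB; have mm (G : T -> R) : measurable_fun setT G -> measurable_fun B (fun x => (G x)%:E).
    by move=> mG; apply/measurable_EFinP; exact: measurable_funTS.
  rewrite -ge0_integralD//; [|by move=> x _; rewrite lee_fin|exact: mm|by move=> x _; rewrite lee_fin|exact: mm].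
  have -> : (P B = \int[P]_(x in B) (cst 1 x))%E by rewrite integral_cst// mul1e.
  rewrite -ge0_integralD//; [|by move=> x _; rewrite lee_fin|exact: mm].
  by apply: eq_integral => x _; rewrite -!EFinD FE.
have ge0 (G : T -> R) B : (forall x, 0 <= G x) -> (0 <= \int[P]_(x in B) (G x)%:E)%E.
  by move=> G0; apply: integral_ge0 => x _; rewrite lee_fin.
have mAC : measurable (~` A) by exact: measurableC.
have eA := eqB _ mA; have eC := eqB _ mAC.
have pC : (P A + P (~` A) = 1)%E.
  by rewrite -[RHS](probability_setT P) -(setUv A) measureU// setICr.
move: hu hl; rewrite (split_set _ mF F0) (split_set _ mu u0) (split_set _ ml l0).
move: eA eC pC (ge0 F A F0) (ge0 F (~` A) F0) (ge0 u A u0) (ge0 u (~` A) u0) (ge0 l A l0) (ge0 l (~` A) l0).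
have q1 : (0 <= P A)%E by exact: measure_ge0.
have q2 : (0 <= P (~` A))%E by exact: measure_ge0.
move: q1 q2.
set a1 := (\int[P]_(x in A) (F x)%:E)%E; set a2 := (\int[P]_(x in ~` A) (F x)%:E)%E.
set a3 := (\int[P]_(x in A) (u x)%:E)%E; set a4 := (\int[P]_(x in ~` A) (u x)%:E)%E.
set a5 := (\int[P]_(x in A) (l x)%:E)%E; set a6 := (\int[P]_(x in ~` A) (l x)%:E)%E.
case: (P A) => [p| |]; case: (P (~` A)) => [p'| |]//.
case: a3 => [aA| |]; case: a4 => [aC| |]; case: a5 => [bA| |]; case: a6 => [bC| |]//.
case: a1 => [F1| |]; case: a2 => [F2| |]//.
rewrite -!EFinD !lee_fin => p0 p'0 [e1] [e2] [e3] F10 F20 aA0 aC0 bA0 bC0 aY bY.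
have p01 : 0 <= p <= 1 by apply/andP; split; lra.
have [] := tilt_ratio_le p01 aA0 aC0 bA0 bC0 aY bY Y1.
have -> : 1 + (aA + aC) - (bA + bC) = F1 + F2 by lra.
have -> : p + aA - bA = F1 by lra.
move=> I0 hI; split; rewrite ?lte_fin ?ltry//.
by rewrite inver gt_eqF// -EFinM -EFinB abse_EFin lee_fin.
Qed.

(** * Spectral theorem *)

Section spectral.
Context (R : realType).
Import complex.

(** The reflection in the hyperplane orthogonal to [v - e] exchanges the unit vectors [v] and
    [e]. *)
Lemma householder n (v : 'cV[R]_n.+1) : sqnorm v = 1 ->
  exists H : 'M[R]_n.+1, [/\ H^T = H, H *m H = 1%:M & H *m delta_mx 0 0 = v].
Proof.
move=> v1; pose e : 'cV[R]_n.+1 := delta_mx 0 0.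
have sc (u t : 'cV[R]_n.+1) : u^T *m t = ((u^T *m t) 0 0)%:M by rewrite {1}[u^T *m t]mx11_scalar.
have [ve|ve] := eqVneq v e.
  by exists 1%:M; split; rewrite ?trmx1 ?mul1mx.
have [w wE] : exists w, w = v - e by eexists.
pose s := (w^T *m w) 0 0.
have ee : (e^T *m e) 0 0 = 1.
  by rewrite -sqnormE /sqnorm (bigD1 0)//= big1 ?addr0 ?mxE ?expr1n// => i i0; rewrite mxE (negbTE i0) expr0n.
have vv : (v^T *m v) 0 0 = 1 by rewrite -sqnormE.
have ev : (e^T *m v) 0 0 = (v^T *m e) 0 0 by rewrite -[e^T *m v]trmxK trmx_mul trmxK mxE.
have sE : s = 2 - 2 * (v^T *m e) 0 0.
  rewrite /s wE [trmx _]linearB/= mulmxBl !mulmxBr.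
  rewrite !mxE in ee vv ev *; rewrite ee vv ev; ring.
have s0 : s != 0.
  apply: contra ve; rewrite /s -sqnormE /sqnorm psumr_eq0; last by move=> i _; exact: sqr_ge0.
  move=> /allP h; rewrite -subr_eq0; apply/eqP/colP => i.
  by have := h i (mem_index_enum _); rewrite /= sqrf_eq0 -wE => /eqP ->; rewrite mxE.
have we : w^T *m e = (- (s / 2))%:M.
  rewrite sc; congr _%:M; rewrite sE wE [trmx _]linearB/= mulmxBl.
  by rewrite !mxE in ee *; rewrite ee; field.
exists (1%:M - (2 / s) *: (w *m w^T)); split.
- by rewrite linearB/= linearZ/= trmx_mul trmxK trmx1.
- have WW : w *m w^T *m (w *m w^T) = s *: (w *m w^T).
    by rewrite -mulmxA (mulmxA w^T) (sc w w) -/s mul_scalar_mx scalemxAr.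
  rewrite mulmxBr mulmx1 mulmxBl mul1mx -scalemxAl -scalemxAr WW !scalerA.
  have -> : 2 / s * (2 / s) * s = 2 / s + 2 / s by field.
  by rewrite scalerDl opprB addrK subrK.
- rewrite mulmxBl mul1mx -scalemxAl -mulmxA we mul_mx_scalar scalerA.
  have -> : 2 / s * - (s / 2) = -1 by field.
  by rewrite scaleN1r opprK wE addrC subrK.
Qed.

(* The real and imaginary parts of a complex eigenvector; symmetry forces the
   eigenvalue to be real. *)
Lemma symmetric_eigenvector n (A : 'M[R]_n.+1) : A^T = A ->
  exists l (v : 'cV[R]_n.+1), sqnorm v = 1 /\ A *m v = l *: v.
Proof.
move=> At.
suff [l [v [v0 Av]]] : exists l (v : 'cV[R]_n.+1), v != 0 /\ A *m v = l *: v.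
  have s0 : 0 < sqnorm v.
    rewrite lt_def sqnorm_ge0 andbT; apply: contra v0.
    rewrite /sqnorm psumr_eq0; last by move=> i _; exact: sqr_ge0.
    move=> /allP h; apply/eqP/colP => i.
    by have := h i (mem_index_enum _); rewrite /= sqrf_eq0 => /eqP ->; rewrite mxE.
  exists l, ((Num.sqrt (sqnorm v))^-1 *: v); split; last first.
    by rewrite -scalemxAr Av !scalerA mulrC.
  rewrite /sqnorm; under eq_bigr do rewrite mxE exprMn.
  by rewrite -mulr_sumr -/(sqnorm v) exprVn sqr_sqrtr ?sqnorm_ge0// mulVf// gt_eqF.
pose AC := map_mx (real_complex R) A.
have [z] : exists z, root (char_poly AC) z.
  by apply: closed_rootP; rewrite size_char_poly.
rewrite -eigenvalue_root_char => /eigenvalueP[x xA x0].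
pose u : 'cV[R]_n.+1 := \col_i complex.Re (x 0 i); pose v : 'cV[R]_n.+1 := \col_i complex.Im (x 0 i).
pose a := complex.Re z; pose b := complex.Im z.
have Auv i : (A *m u) i 0 = a * u i 0 - b * v i 0 /\ (A *m v) i 0 = a * v i 0 + b * u i 0.
  have := congr1 (fun M : 'rV_n.+1 => M 0 i) xA; rewrite !mxE => h.
  have hs : \sum_j x 0 j * AC j i = ((\sum_j A i j * u j 0) +i* (\sum_j A i j * v j 0))%C.
    have : forall j, x 0 j * AC j i = ((A i j * u j 0) +i* (A i j * v j 0))%C.
      move=> j; rewrite !mxE -[in A i j]At mxE; case: (x 0 j) => c d /=.
      by apply/eqP; rewrite eq_complex /= !mulr0 subr0 add0r ![A j i * _]mulrC !eqxx.
    move=> E; rewrite (eq_bigr _ (fun j _ => E j)); elim/big_rec3: _ => //= j s1 s2 s3 _ ->.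
    by [].
  move: h; rewrite hs; case: z @a @b {xA} => a b; case: (x 0 i) => c d /=.
  by rewrite /GRing.mul/= => -[-> ->]; split; rewrite // addrC.
have hb : b = 0.
  have e1 : (v^T *m (A *m u)) 0 0 = (u^T *m (A *m v)) 0 0.
    have -> : v^T *m (A *m u) = (u^T *m (A *m v))^T by rewrite !trmx_mul trmxK At mulmxA.
    by rewrite [LHS]mxE.
  have : b * (sqnorm u + sqnorm v) = 0.
    move: e1; rewrite !mxE; under eq_bigr do rewrite mxE (Auv _).1.
    under [RHS]eq_bigr do rewrite mxE (Auv _).2.
    move=> e1; rewrite /sqnorm -big_split/= mulr_sumr.
    transitivity (\sum_i u i 0 * (a * v i 0 + b * u i 0) - \sum_i v i 0 * (a * u i 0 - b * v i 0)).
      by rewrite -sumrB; apply: eq_bigr => i _; ring.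
    by rewrite e1 subrr.
  move/eqP; rewrite mulf_eq0 => /orP[/eqP//|].
  rewrite paddr_eq0 ?sqnorm_ge0// => /andP[/eqP su /eqP sv].
  have z0 (t : 'cV[R]_n.+1) i : sqnorm t = 0 -> t i 0 = 0.
    move/eqP; rewrite /sqnorm psumr_eq0; last by move=> j _; exact: sqr_ge0.
    by move=> /allP/(_ i (mem_index_enum _)); rewrite /= sqrf_eq0 => /eqP.
  case/negP: x0; apply/eqP/rowP => i; rewrite mxE.
  have := z0 _ i su; have := z0 _ i sv; rewrite !mxE.
  by case: (x 0 i) => c d /= -> ->.
have [u0|u0] := eqVneq u 0; last first.
  by exists a, u; split=> //; apply/colP => i; rewrite (Auv i).1 hb mul0r subr0 [RHS]mxE.
exists a, v; split; last by apply/colP => i; rewrite (Auv i).2 hb mul0r addr0 [RHS]mxE.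
apply: contra x0 => /eqP v0; apply/eqP/rowP => i; rewrite mxE.
have := congr1 (fun t : 'cV_n.+1 => t i 0) u0; have := congr1 (fun t : 'cV_n.+1 => t i 0) v0.
by rewrite !mxE; case: (x 0 i) => c d /= -> ->.
Qed.

(** Deflation: conjugation by the reflection that takes the first basis vector to a unit eigenvector
    splits off the eigenvalue and leaves a symmetric block of smaller size. *)
Theorem symmetric_spectral n (A : 'M[R]_n) : A^T = A ->
  exists (O : 'M[R]_n) (lam : 'I_n -> R), [/\ O^T *m O = 1%:M, O *m O^T = 1%:M & A = O *m dmx lam *m O^T].
Proof.
elim: n A => [|n IH] A At.
  by exists 1%:M, (fun=> 0); split; apply/matrixP => -[].
have [l [v [v1 Av]]] := symmetric_eigenvector At.
have [H [Ht HH He]] := householder v1.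
have [B BEq] : exists B : 'M[R]_(1 + n), B = H *m A *m H by eexists.
have Bt : B^T = B by rewrite BEq !trmx_mul At Ht mulmxA.
have Be : B *m delta_mx 0 0 = l *: delta_mx 0 0 :> 'cV[R]_(1 + n).
  by rewrite BEq -!mulmxA He Av -scalemxAr -He mulmxA HH mul1mx.
have B0 : col 0 B = l *: delta_mx 0 0 by rewrite colE.
have Bul : ulsubmx B = l%:M.
  apply/matrixP => i j; rewrite !ord1 !mxE.
  by have := congr1 (fun t : 'cV_(1 + n) => t 0 0) B0; rewrite !mxE /= mulr1 => <-; congr (B _ _); apply: val_inj.
have Bdl : dlsubmx B = 0.
  apply/matrixP => i j; rewrite !ord1 !mxE.
  by have := congr1 (fun t : 'cV_(1 + n) => t (rshift 1 i) 0) B0; rewrite !mxE /= mulr0 => <-; congr (B _ _); apply: val_inj.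
have Bur : ursubmx B = 0.
  apply/matrixP => i j; have := congr1 (fun M : 'M[R]_(n, 1) => M j i) Bdl; rewrite !mxE => <-.
  by rewrite -[in LHS]Bt mxE.
have /IH : (drsubmx B)^T = drsubmx B by rewrite trmx_drsub Bt.
move=> [U [lam1 [Ut Us UE]]].
pose O2 : 'M[R]_(1 + n) := block_mx 1%:M 0 0 U.
have O2t : O2^T *m O2 = 1%:M.
  by rewrite /O2 tr_block_mx !trmx0 trmx1 mulmx_block !mulmx0 !mul0mx mulmx1 !addr0 add0r Ut -scalar_mx_block.
have O2s : O2 *m O2^T = 1%:M.
  by rewrite /O2 tr_block_mx !trmx0 trmx1 mulmx_block !mulmx0 !mul0mx mulmx1 !addr0 add0r Us -scalar_mx_block.
pose lam (i : 'I_(1 + n)) := if fintype.split i is inr j then lam1 j else l.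
have BE : B = O2 *m dmx lam *m O2^T.
  have -> : dmx lam = block_mx l%:M 0 0 (dmx lam1).
    rewrite /dmx; have -> : \row_i lam i = row_mx l%:M (\row_i lam1 i).
      apply/rowP => i; rewrite !mxE /lam; case: splitP => j _; rewrite ?mxE// ord1 eqxx //.
    rewrite diag_mx_row; congr block_mx.
    by apply/matrixP => i j; rewrite !ord1 !mxE.
  rewrite /O2 tr_block_mx !trmx0 trmx1 !mulmx_block !mulmx0 !mul0mx !mulmx1 !mul1mx !addr0 !add0r ?mul0mx ?mulmx0 -UE.
  by rewrite -[LHS]submxK Bul Bdl Bur.
exists (H *m O2), lam; split.
- by rewrite trmx_mul Ht mulmxA -(mulmxA _ H H) HH mulmx1.
- by rewrite trmx_mul Ht -mulmxA (mulmxA O2) O2s mul1mx.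
- rewrite trmx_mul Ht -!mulmxA (mulmxA (dmx lam)) (mulmxA O2) (mulmxA O2) -BE BEq.
  by rewrite !mulmxA HH mul1mx -mulmxA HH mulmx1.
Qed.

End spectral.

(** * First-order condition and whitening *)

(** If the derivative were nonzero, the difference quotient at a small step of the same sign would
    be close to it, yet maximality gives this quotient the opposite sign or 0. *)
Lemma derive_at_max (R : realType) (V : normedModType R) (f : V -> R) (x v : V) :
  derivable f x v -> (forall y, f y <= f x) -> 'D_v f x = 0.
Proof.
move=> df fx; set L := 'D_v f x.
have /cvgrPdist_lt h : (fun h : R => h^-1 *: ((f \o shift x) (h *: v) - f x)) @ 0^' --> L by exact: df.
have [//|L0] := eqVneq L 0.
have /h /nbhs_ballP[d /= d0 hd] : 0 < `|L| by rewrite normr_gt0.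
have near_d (s : R) : s = d / 2 \/ s = - (d / 2) -> `|L - s^-1 * (f (s *: v + x) - f x)| < `|L|.
  move=> sE; have := hd s; rewrite /ball /= sub0r normrN; apply.
    by case: sE => ->; rewrite ?normrN gtr0_norm; lra.
  by apply/eqP; case: sE; lra.
have [Lp|Lp] := ltP 0 L.
  have := near_d (d / 2) (or_introl erefl).
  have := fx (d / 2 *: v + x).
  have i0 : 0 < (d / 2)^-1 by rewrite invr_gt0; lra.
  move=> h1; have : (d / 2)^-1 * (f (d / 2 *: v + x) - f x) <= 0.
    by rewrite pmulr_rle0// subr_le0.
  by move=> h2; rewrite [ltRHS]gtr0_norm// ger0_norm; lra.
have := near_d (- (d / 2)) (or_intror erefl).
have := fx (- (d / 2) *: v + x).
have i0 : (- (d / 2))^-1 < 0 by rewrite invr_lt0; lra.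
move=> h1; have : 0 <= (- (d / 2))^-1 * (f (- (d / 2) *: v + x) - f x).
  by rewrite nmulr_rge0// subr_le0.
have Ln : L < 0 by rewrite lt_neqAle L0.
by move=> h2; rewrite [ltRHS]ltr0_norm// ler0_norm; lra.
Qed.

Section posdef.
Context (R : realType).

Lemma posdefmx_unit n (S : 'M[R]_n) : posdefmx S -> S \in unitmx.
Proof.
move=> [St Sp]; rewrite -row_free_unit -kermx_eq0.
apply/negPn/negP => /rowV0Pn[v /sub_kermxP vS v0].
have := Sp v^T; rewrite trmx_eq0 v0 trmxK vS mul0mx mxE ltxx.
by move=> /(_ isT).
Qed.

Lemma psd_sqrt_unit n (A S : 'M[R]_n) : psd_sqrt A S -> posdefmx S -> A \in unitmx.
Proof.
move=> [_ <-] /posdefmx_unit; rewrite !unitmxE det_mulmx unitrM => /andP[].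
by [].
Qed.

Lemma invmx_sqr n (A : 'M[R]_n) : A^T = A -> A \in unitmx ->
  invmx A *m (invmx A)^T = invmx (A *m A).
Proof.
move=> At Au; apply/esym/invmx_uniq.
by rewrite trmx_inv At -mulmxA (mulmxA A (invmx A)) mulmxV// mul1mx mulmxV.
Qed.

Lemma posdefmx_sqr n (A : 'M[R]_n) : posdefmx A -> [/\ A^T = A & A \in unitmx].
Proof. by move=> pA; split; [case: pA | exact: posdefmx_unit]. Qed.

Lemma quad_sqnorm m n (A : 'M[R]_(m, n)) (u : 'cV[R]_n) :
  (u^T *m (A^T *m A) *m u) 0 0 = sqnorm (A *m u).
Proof. by rewrite sqnormE trmx_mul !mulmxA. Qed.

Lemma quad_dmx n (c : 'I_n -> R) (u : 'cV[R]_n) : (u^T *m dmx c *m u) 0 0 = wsq c u.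
Proof.
rewrite -mulmxA mul_dmx mxE /wsq; apply: eq_bigr => i _.
by rewrite !mxE; ring.
Qed.

Lemma quad_delta n (A : 'M[R]_n) i :
  ((delta_mx i 0 : 'cV[R]_n)^T *m A *m (delta_mx i 0 : 'cV[R]_n)) 0 0 = A i i.
Proof. by rewrite trmx_delta -rowE -colE !mxE. Qed.

Lemma trace_dmx n (c : 'I_n -> R) : \tr (dmx c) = \sum_i c i.
Proof. by rewrite /dmx mxtrace_diag; apply: eq_bigr => i _; rewrite mxE. Qed.

(** [L = DG^-1 O], where [O] diagonalises [DG^-1 (S - G2) DG^-1]. The eigenvalues lie in [[0, 1]]
    because [0 <= S - G2 <= S]. *)
Lemma whitening n (S G2 D DG : 'M[R]_n) : posdefmx S -> psdmx G2 ->
  psd_sqrt D (S - G2) -> psd_sqrt DG S ->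
  exists (L : 'M[R]_n) (lam : 'I_n -> R),
  [/\ L \in unitmx, L *m L^T = invmx (DG *m DG), L^T *m S *m L = 1%:M,
      L^T *m (S - G2) *m L = dmx lam &
   (forall i, 0 <= lam i <= 1) /\ \sum_i lam i = pG D DG].
Proof.
move=> pS pG2 [[Dt _] DD] sDG; have DGu := psd_sqrt_unit sDG pS.
case: sDG => -[DGt _] DGS.
have iDGt : (invmx DG)^T = invmx DG by rewrite trmx_inv DGt.
have [|O [lam [OO OO' BE]]] := symmetric_spectral (A := invmx DG *m (S - G2) *m invmx DG).
  by rewrite !trmx_mul iDGt -DD trmx_mul Dt !mulmxA.
pose L := invmx DG *m O.
have LL : L *m L^T = invmx (DG *m DG).
  by rewrite /L trmx_mul mulmxA -(mulmxA _ O) OO' mulmx1 invmx_sqr.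
have Lu : L \in unitmx.
  by rewrite unitmx_mul unitmx_inv DGu/=; apply: (mulmx1_unit OO').1.
have LSL : L^T *m S *m L = 1%:M.
  by rewrite /L trmx_mul iDGt -DGS !mulmxA -(mulmxA O^T (invmx DG) DG) mulVmx// mulmx1 -(mulmxA O^T DG) mulmxV// mulmx1.
have LDL : L^T *m (S - G2) *m L = dmx lam.
  have -> : L^T *m (S - G2) *m L = O^T *m (invmx DG *m (S - G2) *m invmx DG) *m O.
    by rewrite /L trmx_mul iDGt !mulmxA.
  by rewrite BE !mulmxA OO mul1mx -mulmxA OO mulmx1.
have lamE i : lam i = (dmx lam) i i by rewrite !mxE eqxx.
exists L, lam; split=> //; split.
  move=> i; rewrite lamE -LDL -quad_delta.
  set e := delta_mx i 0.
  have E (A : 'M[R]_n) : e^T *m (L^T *m A *m L) *m e = (L *m e)^T *m A *m (L *m e).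
    by rewrite [(L *m e)^T]trmx_mul !mulmxA.
  rewrite E -DD -[X in X *m D]Dt quad_sqnorm sqnorm_ge0/= -quad_sqnorm Dt.
  have := pG2.2 (L *m e).
  have -> : G2 = S - (S - G2) by rewrite opprB addrC subrK.
  rewrite mulmxBr mulmxBl -E LSL mxE quad_delta [X in X + _]mxE eqxx -DD.
  by rewrite [X in _ + X]mxE subr_ge0.
rewrite -trace_dmx -LDL mxtrace_mulC mulmxA LL mxtrace_mulC /pG DD.
by [].
Qed.

End posdef.

(** * Laplace approximation *)

Lemma abse_sub_le1 (R : realType) (x y : \bar R) : (0 <= x -> x <= 1 -> 0 <= y -> y <= 1 -> `|x - y| <= 1)%E.
Proof.
case: x => [x| |]//; case: y => [y| |]//; rewrite !lee_fin => *.
by rewrite ler_norml; apply/andP; split; lra.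
Qed.

(** [barK w / 6 = 1 + 3 / 2 * w + 15 / 8 * w ^ 2] is the second Taylor polynomial of
    [(1 - w) ^ (- 3 / 2)]. After squaring, what is left is a polynomial divisible by [w ^ 3]. *)
Lemma barK_powR (R : realType) (w : R) : 0 <= w <= 1 / 3 -> barK w / 6 * (1 - w) `^ (3 / 2) <= 1.
Proof.
move=> w01; have /andP[w0 w3] := w01.
have w1 : 0 < 1 - w by lra.
rewrite (_ : 3 / 2 = 1 + 2^-1); last by lra.
rewrite powRD; last by rewrite gt_eqF ?implybT.
have w1' := ltW w1; rewrite powRr1// powR12_sqrt//.
set s := Num.sqrt (1 - w).
have s0 : 0 <= s by exact: sqrtr_ge0.
have s2 : s ^+ 2 = 1 - w by rewrite sqr_sqrtr ?ltW.
have K0 := barK_ge6 w01.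
have K1 : 0 <= barK w / 6 * ((1 - w) * s) by rewrite !mulr_ge0//; lra.
suff : (barK w / 6 * ((1 - w) * s)) ^+ 2 <= 1 by rewrite expr_le1.
rewrite !exprMn s2 /barK.
have : 0 <= w ^+ 3 * (35 / 8 - 105 / 64 * w - 21 / 64 * w ^+ 2 - 315 / 64 * w ^+ 3 + 225 / 64 * w ^+ 4).
  apply: mulr_ge0; first exact: exprn_ge0.
  have wq2 : w ^+ 2 <= 1 / 9 by rewrite expr2; nra.
  have wq3 : w ^+ 3 <= 1 / 27 by rewrite exprS; nra.
  have wq4 : 0 <= w ^+ 4 by rewrite exprn_ge0.
  lra.
lra.
Qed.

Section laplace_approximation.
Context (R : realType) (p : nat).
Variables (f : 'cV[R]_p -> R) (xs : 'cV[R]_p) (G2 G D DG : 'M[R]_p) (nu xx w : R).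
Hypothesis fC : Ck 3 f.
Hypothesis fint : (\int[lebesgue_cV p]_y (expR (f y))%:E < +oo)%E.
Hypothesis fmax : forall y, f y <= f xs.
Hypothesis pS : posdefmx (- hess f xs).
Hypothesis pG2 : psdmx G2.
Hypothesis sG : psd_sqrt G G2.
Hypothesis sD : psd_sqrt D (- hess f xs - G2).
Hypothesis sDG : psd_sqrt DG (- hess f xs).
Hypothesis conc : concave (fun u => f (xs + u) + 2^-1 * enorm (G *m u) ^+ 2).
Hypothesis nu01 : 0 < nu < 1.
Hypothesis xx0 : 0 < xx.
Hypothesis om : omega f xs D DG nu xx = w%:E.
Hypothesis w13 : w <= 1 / 3.
Hypothesis wP : w * pG D DG <= 2 / 3.

Local Notation S := (invmx (DG *m DG)).

Lemma continuous_f : continuous f.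
Proof. by move=> x; apply: differentiable_continuous; exact: (fC.1 x). Qed.

Lemma grad_max : grad f xs = 0.
Proof.
apply/colP => i; rewrite !mxE; apply: derive_at_max fmax.
by apply: diff_derivable; exact: (fC.1 xs).
Qed.

Let DGt : DG^T = DG. Proof. by case: sDG => -[]. Qed.

Lemma delta3E u : delta3 f xs u = f (xs + u) - f xs + 2^-1 * sqnorm (DG *m u).
Proof.
rewrite /delta3 grad_max trmx0 mul0mx mxE subr0; congr (_ + _).
rewrite -quad_sqnorm DGt; case: sDG => _ ->.
by rewrite mulmxN mulNmx [in RHS]mxE; ring.
Qed.

Lemma delta3_0 : delta3 f xs 0 = 0.
Proof. by rewrite delta3E addr0 subrr mulmx0 add0r sqnorm0 mulr0. Qed.

Lemma measurable_delta3 : measurable_fun setT (delta3 f xs).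
Proof.
rewrite (_ : delta3 f xs = fun u => f (xs + u) - f xs + 2^-1 * sqnorm (DG *m u)); last first.
  by apply/funext => u; exact: delta3E.
apply: measurable_funD.
  apply: measurable_funB => //.
  have h := measurable_mulmx_cV (1%:M : 'M[R]_p) xs.
  apply: (measurableT_comp (continuous_mx_measurable continuous_f)).
  by apply: eq_measurable_fun h => u _; rewrite mul1mx addrC.
apply: measurable_funM => //; apply: (measurableT_comp (@measurable_sqnorm R p)).
have h := measurable_mulmx_cV DG (0 : 'cV[R]_p).
by apply: eq_measurable_fun h => u _; rewrite addr0.
Qed.

Lemma concave_excess (t : R) u v : 0 <= t <= 1 ->
  (1 - t) * (f (xs + u) + 2^-1 * sqnorm (G *m u)) + t * (f (xs + v) + 2^-1 * sqnorm (G *m v)) <=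
  f (xs + ((1 - t) *: u + t *: v)) + 2^-1 * sqnorm (G *m ((1 - t) *: u + t *: v)).
Proof.
move=> t01.
have [i iE] : exists i : {i01 R}, i%:num = t.
  have /andP[t0 t1] := t01.
  exists (Itv01 t0 t1); by [].
have := conc i (in_setT v) (in_setT u).
have -> : conv i (v : convex_lmodType 'cV[R]_p) u = (1 - t) *: u + t *: v.
  by rewrite addrC -iE.
rewrite convRE iE /unstable.onem !sqr_enorm /=; lra.
Qed.

(** [xs] also maximises the penalised concave function: an excess at [u] would grow linearly in [t]
    along the segment from [xs], whereas the penalty is of order [t ^ 2] and [f] is at most [f xs].
    This supplies [d <= q]. *)
Lemma local_max_excess u : f (xs + u) + 2^-1 * sqnorm (G *m u) <= f xs.
Proof.
apply/ler_addgt0Pr => e e0; rewrite -lerBlDl.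
set s := sqnorm (G *m u); have s0 : 0 <= s := sqnorm_ge0 _.
pose t := e / (e + s); have es : 0 < e + s by lra.
have t0 : 0 < t by rewrite divr_gt0.
have t1 : t <= 1 by rewrite ler_pdivrMr; lra.
have := @concave_excess t 0 u; rewrite (ltW t0) t1 => /(_ isT).
rewrite !scaler0 !add0r addr0 mulmx0 -scalemxAr.
rewrite sqnorm0.
have -> : sqnorm (t *: (G *m u)) = t ^+ 2 * s.
  by rewrite /sqnorm mulr_sumr; apply: eq_bigr => i _; rewrite mxE exprMn.
have := fmax (xs + t *: u).
have ts : t * s <= e by rewrite mulrAC ler_pdivrMr//; nra.
set a := f (xs + u); set b := f (xs + t *: u); set c := f xs => h1 h2.
have : t * (a + 2^-1 * s - c) <= t * e.
  rewrite -/s in h2; apply: (@le_trans _ _ (t * (2^-1 * (t * s)))); first by lra.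
  by rewrite ler_wpM2l ?ltW//; lra.
by rewrite ler_pM2l.
Qed.

Lemma omega_bound u : enorm (D *m u) <= nu^-1 * rG D DG xx ->
  `|delta3 f xs u| <= w * (2^-1 * sqnorm (D *m u)).
Proof.
move=> uU.
have : (`|delta3 f xs u|%:E / (enorm (D *m u) ^+ 2 / 2)%:E <= w%:E)%E.
  by rewrite -om; apply: ereal_sup_ubound; exists u.
rewrite sqr_enorm inver; case: eqP => [s0|/eqP s0].
  rewrite (_ : 2^-1 * sqnorm (D *m u) = 0) ?mulr0; last by lra.
  have [->|d0] := eqVneq (delta3 f xs u) 0; first by rewrite normr0.
  by rewrite gt0_muley ?lte_fin ?normr_gt0//.
rewrite -EFinM lee_fin ler_pdivrMr; first by rewrite mulrC (mulrC _ w) [_ * 2^-1]mulrC; lra.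
by rewrite lt_def s0 divr_ge0// sqnorm_ge0.
Qed.

Lemma omega_ge0 : 0 <= w.
Proof.
rewrite -lee_fin -om; apply: ereal_sup_ubound; exists 0 => /=.
  rewrite /Uset /mkset mulmx0 (_ : enorm _ = 0); last first.
    by rewrite /enorm big1 ?sqrtr0// => i _; rewrite mxE expr0n.
  have /andP[n0 n1] := nu01.
  apply: mulr_ge0; first by rewrite invr_ge0 ltW.
  by rewrite /rG addr_ge0 ?mulr_ge0 ?sqrtr_ge0.
by rewrite delta3_0 normr0 mul0e.
Qed.

Lemma gauss_linear (m : 'cV[R]_p) (L T : 'M[R]_p) B : L \in unitmx -> L *m L^T = T -> measurable B ->
  gauss m T B = @std_gauss R p [set g | B (L *m g + m)].
Proof.
move=> Lu LT mB.
have h := measurable_mulmx_cV L m.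
have mB' : measurable [set g | B (L *m g + m)] by rewrite -[X in measurable X]setTI; exact: h.
have -> : gauss m T B = (\int[gauss m T]_u (\1_B u)%:E)%E by rewrite integral_indic// setIT.
rewrite (ge0_integral_gauss m Lu LT); last 2 first.
- by apply/measurable_EFinP; exact: measurable_indic.
- by move=> u; rewrite lee_fin.
by rewrite (_ : (fun g => _) = (fun g => (\1_[set g | B (L *m g + m)] g)%:E)) ?integral_indic ?setIT.
Qed.

Let d (L : 'M[R]_p) g := delta3 f xs (L *m g).

Lemma measurable_delta3L L : measurable_fun setT (d L).
Proof.
have h := measurable_mulmx_cV L (0 : 'cV[R]_p).
apply: (measurableT_comp measurable_delta3).
by apply: eq_measurable_fun h => u _; rewrite addr0.
Qed.

Lemma delta3L_0 L : d L 0 = 0. Proof. by rewrite /d mulmx0 delta3_0. Qed.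

Lemma standardized : exists (L : 'M[R]_p) (lam : 'I_p -> R),
  [/\ L \in unitmx, L *m L^T = S, forall i, 0 <= lam i <= 1, \sum_i lam i = pG D DG &
   [/\ forall (t : R) u v, 0 <= t <= 1 ->
      (1 - t) * (d L u - 2^-1 * wsq lam u) + t * (d L v - 2^-1 * wsq lam v) <=
      d L ((1 - t) *: u + t *: v) - 2^-1 * wsq lam ((1 - t) *: u + t *: v),
     forall u, d L u <= 2^-1 * wsq lam u,
     forall u, wsq lam u <= (2 * Num.sqrt (\sum_i lam i) + Num.sqrt (2 * xx)) ^+ 2 ->
       `|d L u| <= w * (2^-1 * wsq lam u) &
     forall u, d L u = f (L *m u + xs) - f xs + 2^-1 * sqnorm u]].
Proof.
have [L [lam [Lu LS LSL LDL [lam01 lamP]]]] := whitening pS pG2 sD sDG.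
exists L, lam; split=> //.
have DE u : sqnorm (D *m (L *m u)) = wsq lam u.
  rewrite -quad_sqnorm; case: sD => -[-> _] ->; rewrite -quad_dmx -LDL.
  by rewrite [(L *m u)^T]trmx_mul !mulmxA.
have DGE u : sqnorm (DG *m (L *m u)) = sqnorm u.
  rewrite -quad_sqnorm DGt; case: sDG => _ ->.
  have -> : (L *m u)^T *m (- hess f xs) *m (L *m u) = u^T *m (L^T *m (- hess f xs) *m L) *m u.
    by rewrite [(L *m u)^T]trmx_mul !mulmxA.
  by rewrite LSL mulmx1 sqnormE.
have GE u : sqnorm (G *m (L *m u)) = sqnorm u - wsq lam u.
  rewrite -quad_sqnorm; case: sG => -[-> _] ->.
  have -> : G2 = - hess f xs - (- hess f xs - G2) by rewrite opprB addrC subrK.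
  rewrite [(L *m u)^T]trmx_mul.
  have -> : u^T *m L^T *m (- hess f xs - (- hess f xs - G2)) *m (L *m u) =
     u^T *m (L^T *m (- hess f xs) *m L) *m u - u^T *m (L^T *m (- hess f xs - G2) *m L) *m u.
    by rewrite mulmxBr mulmxBl !mulmxA.
  rewrite LSL LDL mulmx1 mxE -sqnormE; congr (_ + _).
  by rewrite mxE quad_dmx.
(* The quadratic part of [delta3] is [sqnorm u], and [sqnorm u - wsq lam u] is the penalty; hence
   concavity and maximality of the penalised function pass to [d - q]. *)
have dE u : d L u - 2^-1 * wsq lam u = f (xs + L *m u) + 2^-1 * sqnorm (G *m (L *m u)) - f xs.
  by rewrite /d delta3E DGE GE; ring.
split.
- move=> t u v t01; rewrite !dE mulmxDr -!scalemxAr.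
  by have := concave_excess (L *m u) (L *m v) t01; lra.
- by move=> u; rewrite -subr_le0 dE subr_le0; exact: local_max_excess.
- move=> u; rewrite lamP => hu; rewrite -DE; apply: omega_bound.
  have /andP[n0 n1] := nu01.
  have r0 : 0 <= rG D DG xx by rewrite /rG addr_ge0 ?mulr_ge0 ?sqrtr_ge0.
  (* Since [nu < 1], the ball of radius [rG] lies in [Uset]. *)
  apply: (@le_trans _ _ (rG D DG xx)); last by rewrite ler_peMl// invf_ge1// ltW.
  have := hu; rewrite -DE -sqr_enorm -[X in _ <= X ^+ 2]/(rG D DG xx).
  by rewrite ler_sqr ?nnegrE ?sqrtr_ge0.
- by move=> u; rewrite /d delta3E DGE addrC [xs + _]addrC addrC.
Qed.

(** [expR f] is, up to a constant, [expR d] times the density of [gauss xs S]. The constant is the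
    same for all events and cancels in [gibbs]. *)
Lemma gibbs_tilt L : L \in unitmx -> L *m L^T = S ->
  (forall u, d L u = f (L *m u + xs) - f xs + 2^-1 * sqnorm u) ->
  exists2 c : R, 0 < c & forall B, measurable B -> (\int[lebesgue_cV p]_(y in B) (expR (f y))%:E =
   c%:E * \int[@std_gauss R p]_(g in [set g | B (L *m g + xs)%R]) (expR (d L g))%:E)%E.
Proof.
move=> Lu LS dE.
have detS : 0 < \det S.
  rewrite -LS det_mulmx det_tr -expr2 lt_def sqr_ge0 andbT sqrf_eq0.
  by rewrite -unitfE -unitmxE.
set k := Num.sqrt ((2 * pi) ^+ p * \det S).
have k0 : 0 < k by rewrite sqrtr_gt0 mulr_gt0// exprn_gt0// mulr_gt0// pi_gt0.
exists (expR (f xs) * k); first by rewrite mulr_gt0// expR_gt0.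
move=> B mB.
pose F y := expR (d L (invmx L *m (y - xs))) * (expR (f xs) * k).
have mF : measurable_fun setT F.
  apply: measurable_funM => //; apply: measurableT_comp => //; apply: (measurableT_comp (measurable_delta3L L)).
  have h := measurable_mulmx_cV (invmx L) (- (invmx L *m xs)).
  by apply: eq_measurable_fun h => u _; rewrite mulmxBr.
have F0 y : 0 <= F y by rewrite mulr_ge0 ?expR_ge0// mulr_ge0 ?expR_ge0// ltW.
have fE y : expR (f y) = F y * gauss_pdf xs S y.
  rewrite /F dE mulmxA mulmxV// mul1mx subrK /gauss_pdf -/k.
  have -> : ((y - xs)^T *m invmx S *m (y - xs)) 0 0 = sqnorm (invmx L *m (y - xs)).
    rewrite -quad_sqnorm -LS; congr (fun_of_matrix (_ *m _ *m _) _ _).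
    have LTu : L^T \in unitmx by rewrite unitmx_tr.
    apply: invmx_uniq; rewrite trmx_inv -mulmxA (mulmxA L^T) mulmxV// mul1mx.
    by rewrite mulmxV.
  rewrite !expRD expRN; set a := expR (f y); set b := expR (f xs).
  have b0 : b != 0 by rewrite gt_eqF// expR_gt0.
  rewrite mulNr expRN; set e := expR _.
  have e0 : e != 0 by rewrite gt_eqF// expR_gt0.
  by field; rewrite b0 e0 gt_eqF.
have mB' : measurable [set g | B (L *m g + xs)].
  have h := measurable_mulmx_cV L xs.
  by rewrite -[X in measurable X]setTI; exact: h.
transitivity (\int[lebesgue_cV p]_y ((F y * \1_B y)%:E * (gauss_pdf xs S y)%:E))%E.
  rewrite integral_mkcond; apply: eq_integral => y _.
  rewrite patchE indicE; case: ifP => _; rewrite ?mulr1 ?mulr0 ?mul0e// fE.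
  by rewrite EFinM.
rewrite -(@ge0_integral_density _ _ _ (lebesgue_cV p) (gauss xs S) (gauss_pdf xs S) _ _ _ (fun y => (F y * \1_B y)%:E))//; last 4 first.
- exact: measurable_gauss_pdf.
- exact: gauss_pdf_ge0.
- by apply/measurable_EFinP; apply: measurable_funM => //; exact: measurable_indic.
- by move=> y; rewrite lee_fin mulr_ge0.
rewrite (ge0_integral_gauss xs Lu LS); last 2 first.
- by apply/measurable_EFinP; apply: measurable_funM => //; exact: measurable_indic.
- by move=> y; rewrite lee_fin mulr_ge0.
rewrite [in RHS]integral_mkcond -ge0_integralZl//; last 3 first.
- apply/(measurable_restrictT _ _).1 => //; apply/measurable_EFinP.
  by apply: measurable_funTS; apply: measurableT_comp => //; exact: measurable_delta3L.
- by move=> g _; rewrite patchE; case: ifP => _; rewrite lee_fin// expR_ge0.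
- by rewrite lee_fin mulr_ge0 ?expR_ge0// ltW.
apply: eq_integral => g _; rewrite patchE indicE /F addrK mulKmx//.
have -> : (g \in [set g | B (L *m g + xs)]) = (L *m g + xs \in B) by apply/idP/idP; rewrite !inE.
by case: ifP => _; rewrite ?mulr1 ?mulr0 ?mule0// mulrC EFinM.
Qed.

Lemma gibbs_gauss_le L B Y : L \in unitmx -> L *m L^T = S -> measurable B ->
  (forall u, d L u = f (L *m u + xs) - f xs + 2^-1 * sqnorm u) -> Y < 1 ->
  (Eg (fun g => Num.max (expR (d L g) - 1) 0)%R <= Y%:E)%E ->
  (Eg (fun g => Num.max (1 - expR (d L g)) 0)%R <= (Y / 4)%:E)%E ->
  (`|gibbs f B - gauss xs S B| <= Y%:E)%E.
Proof.
move=> Lu LS mB dE Y1 hu hl.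
have mF : measurable_fun setT (fun g => expR (d L g)).
  by apply: measurableT_comp => //; exact: measurable_delta3L.
have mB' : measurable [set g | B (L *m g + xs)].
  have h := measurable_mulmx_cV L xs.
  by rewrite -[X in measurable X]setTI; exact: h.
have [I0 Ioo hI] := tilted_probability_le mF (fun g => expR_ge0 _) Y1 hu hl mB'.
rewrite (gauss_linear xs Lu LS mB); apply: le_trans hI; rewrite le_eqVlt; apply/orP; left; apply/eqP.
congr (`|_ - _|)%E; rewrite /gibbs.
have [c c0 E] := gibbs_tilt Lu LS dE.
rewrite (E _ mB) (E _ measurableT).
have J0 : (0 <= \int[@std_gauss R p]_(g in [set g | B (L *m g + xs)%R]) (expR (d L g))%:E)%E.
  by apply: integral_ge0 => g _; rewrite lee_fin expR_ge0.
have JI : (\int[@std_gauss R p]_(g in [set g | B (L *m g + xs)%R]) (expR (d L g))%:E <=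
    \int[@std_gauss R p]_g (expR (d L g))%:E)%E.
  by apply: ge0_subset_integral => //; exact/measurable_EFinP.
have -> : [set g | [set: 'cV[R]_p] (L *m g + xs)] = setT by [].
move: I0 Ioo J0 JI; set I := (\int[_]_g _)%E; set J := (\int[_]_(g in _) _)%E.
case: I => [i| |]//; case: J => [j| |]//; rewrite lte_fin => i0 _ _ _.
rewrite -!EFinM !inver !gt_eqF ?mulr_gt0// -!EFinM; congr _%:E.
by field; rewrite !gt_eqF.
Qed.

(** Disposes of the case in which the bound to be proved is at least 1. *)
Lemma gibbs_gauss_le1 B : measurable B -> (`|gibbs f B - gauss xs S B| <= 1)%E.
Proof.
move=> mB; have [L [lam [Lu LS _ _ _]]] := standardized.
rewrite (gauss_linear xs Lu LS mB).
have [g0 g1] : (0 <= @std_gauss R p [set g | B (L *m g + xs)%R] /\ @std_gauss R p [set g | B (L *m g + xs)%R] <= 1)%E.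
  split; first exact: measure_ge0.
  apply: probability_le1.
  have h := measurable_mulmx_cV L xs.
  by rewrite -[X in measurable X]setTI; exact: h.
have [h0 h1] : (0 <= gibbs f B /\ gibbs f B <= 1)%E.
  rewrite /gibbs.
  have J0 : (0 <= \int[lebesgue_cV p]_(y in B) (expR (f y))%:E)%E.
    by apply: integral_ge0 => g _; rewrite lee_fin expR_ge0.
  have JI : (\int[lebesgue_cV p]_(y in B) (expR (f y))%:E <= \int[lebesgue_cV p]_y (expR (f y))%:E)%E.
    apply: ge0_subset_integral => //.
    by apply/measurable_EFinP; apply: measurableT_comp => //; exact: continuous_mx_measurable continuous_f.
  move: fint J0 JI; set I := (\int[_]_y _)%E; set J := (\int[_]_(y in _) _)%E.
  case: I => [i| |]//; last by case: J.
  case: J => [j| |]// _; rewrite !lee_fin => j0 ji.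
  rewrite inver; case: eqP => [i0|/eqP i0].
    have -> : j = 0 by apply/eqP; rewrite eq_le j0 -i0 ji.
    by rewrite mul0e.
  have ip : 0 < i by rewrite lt_def i0 (le_trans j0).
  rewrite -EFinM !lee_fin; split; last by rewrite ler_pdivrMr ?mul1r.
  by apply: divr_ge0 => //; exact: ltW.
exact: abse_sub_le1.
Qed.

Let a := Num.sqrt (2 * xx).
Let a0 : 0 < a. Proof. by rewrite sqrtr_gt0 mulr_gt0. Qed.
Let aE : a ^+ 2 / 2 = xx. Proof. by rewrite sqr_sqrtr ?mulr_ge0 ?ltW// mulrC mulKf. Qed.
Let w01 : 0 <= w <= 1 / 3. Proof. by rewrite omega_ge0. Qed.
Let pG0 : 0 <= pG D DG.
Proof.
by have [L [lam [_ _ lam01 <- _]]] := standardized; apply: trace_ge0.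
Qed.

Lemma gibbs_gauss2 B : measurable B ->
  (`|gibbs f B - gauss xs S B| <= 4%:E * (diam2 w D DG + expR (- xx))%:E)%E.
Proof.
move=> mB; rewrite -EFinM.
have [Y1|Y1] := leP 1 (4 * (diam2 w D DG + expR (- xx))).
  by apply: le_trans (gibbs_gauss_le1 mB) _; rewrite lee_fin.
have [L [lam [Lu LS lam01 lamP [dconc dq dU dE]]]] := standardized.
have w0 := omega_ge0; have P0 := pG0; have w3 := w13.
have D0 : 0 <= diam2 w D DG.
  by apply: divr_ge0; [apply: mulr_ge0 => //; lra|lra].
have ex1 : 4 * expR (- (a ^+ 2 / 2)) < 1 by rewrite aE; lra.
have wP' : w * (\sum_i lam i) <= 2 / 3 by rewrite lamP.
have md := measurable_delta3L L.
apply: (gibbs_gauss_le Lu LS mB dE Y1).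
  have := @excess_le2 R p lam lam01 (d L) w a md w01 a0 dconc (delta3L_0 L) dU wP' ex1.
  by rewrite lamP aE.
have := @defect_le2 R p lam lam01 (d L) w a md w01 a0 dU.
rewrite lamP aE (_ : 4 * (diam2 w D DG + expR (- xx)) / 4 = diam2 w D DG + expR (- xx)) //.
by field.
Qed.

Lemma gibbs_gauss3 tau3 B : tau3_bound f xs tau3 -> measurable B ->
  (`|gibbs f B - gauss xs S B| <= 4%:E * (diam3 w DG tau3 + (expR (- xx))%:E))%E.
Proof.
move=> [mt _ ht] mB.
have w32 : 0 < (1 - w) `^ (3 / 2) by rewrite powR_gt0// subr_gt0; apply: le_lt_trans w13 _; lra.
have w32K := barK_powR w01.
have t0 u : 0 <= tau3 u by have := ht u; have := normr_ge0 (delta3 f xs u); lra.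
have [L [lam [Lu LS lam01 lamP [dconc dq dU dE]]]] := standardized.
have w0 := omega_ge0; have P0 := pG0; have w3 := w13.
pose It := (\int[gauss 0 S]_u (tau3 u)%:E)%E.
have It0 : (0 <= It)%E by apply: integral_ge0 => u _; rewrite lee_fin.
have md := measurable_delta3L L.
have EgT : (6%:E * Eg (fun g => `|d L g|)%R <= It)%E.
  rewrite /It (ge0_integral_gauss 0 Lu LS); last 2 first.
  - exact/measurable_EFinP.
  - by move=> u; rewrite lee_fin.
  have mabs : measurable_fun setT (fun g => `|d L g|).
    by apply: measurableT_comp => //; exact: measurable_normr.
  have -> : (6%:E * Eg (fun g => `|d L g|)%R = Eg (fun g => 6 * `|d L g|)%R)%E by apply/esym/EgZ.
  apply: le_Eg => [||g|g].
  - exact: measurable_funM.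
  - have h := measurable_mulmx_cV L (0 : 'cV[R]_p).
    exact: (measurableT_comp mt h).
  - by rewrite mulr_ge0.
  - by rewrite addr0; have := ht (L *m g); rewrite /d; lra.
have dia : diam3 w DG tau3 = (It / (4 * (1 - w) `^ (3 / 2))%:E)%E by [].
(* An infinite expectation of [tau3] makes the bound infinite. *)
have [Ioo|Ifin] := eqVneq It +oo%E.
  rewrite dia Ioo inver gt_eqF ?mulr_gt0// gt0_mulye ?lte_fin ?invr_gt0 ?mulr_gt0//.
  by rewrite addye// gt0_muley ?lte_fin// leey.
move: dia EgT It0 Ifin; case: It => [t| |]// -> EgT; rewrite lee_fin => t00 _.
rewrite inver gt_eqF ?mulr_gt0// -EFinM.
set Y := 4 * _.
have [Y1|Y1] := leP 1 Y.
  by apply: le_trans (gibbs_gauss_le1 mB) _; rewrite lee_fin.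
have K0 := barK_ge6 w01.
(* The right side is [t * (1 - w) ^ (- 3 / 2)], so this is [barK_powR]. Together with
   [6 * E|d| <= t] it bounds [barK * E|d|] by four times [diam3]. *)
have tK : barK w / 6 * t <= 4 * (t / (4 * (1 - w) `^ (3 / 2))).
  have -> : 4 * (t / (4 * (1 - w) `^ (3 / 2))) = t / ((1 - w) `^ (3 / 2)).
    by field; rewrite gt_eqF.
  rewrite ler_pdivlMr//; nra.
have ex0 := expR_gt0 (- xx).
have tt0 : t <= barK w / 6 * t by rewrite ler_peMl//; lra.
have ex1 : 4 * expR (- (a ^+ 2 / 2)) < 1.
  by rewrite aE; move: Y1; rewrite /Y; lra.
have wP' : w * (\sum_i lam i) <= 2 / 3 by rewrite lamP.
have Efin : exists2 e : R, Eg (fun g => `|d L g|)%R = e%:E & 0 <= e /\ 6 * e <= t.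
  have : (0 <= Eg (fun g => `|d L g|)%R)%E by apply: Eg_ge0.
  move: EgT; case: (Eg _) => [e| |]//; first by rewrite -EFinM !lee_fin; exists e.
  by rewrite gt0_muley ?lte_fin.
have [e eE [e0 e6]] := Efin.
apply: (gibbs_gauss_le Lu LS mB dE Y1).
  have := @excess_le3 R p lam lam01 (d L) w a md w01 a0 dconc (delta3L_0 L) dq dU wP' ex1.
  move/le_trans; apply; rewrite eE aE -EFinM -EFinD lee_fin /Y.
  have : barK w * e <= barK w / 6 * t by have : 0 <= barK w * (t - 6 * e) by [rewrite mulr_ge0; lra]; lra.
  lra.
apply: le_trans (@defect_le3 R p (d L) md) _; rewrite eE lee_fin /Y; lra.
Qed.

End laplace_approximation.

(** * One-dimensional normal integrals *)

Lemma lee_double (R : realType) (x y : \bar R) : (0 <= x -> 0 <= y -> x + x <= y + y -> x <= y)%E.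
Proof. by case: x => [x| |]//; case: y => [y| |]//=; rewrite ?leey// -?EFinD !lee_fin; lra. Qed.

Section normal.
Context (R : realType).
Local Notation mu := (@lebesgue_measure R).
Local Notation N1 := (@normal_prob R 0 1).
Implicit Types (F : R -> \bar R).

Lemma std_gauss0_integral (F : 'cV[R]_0 -> \bar R) : measurable_fun setT F ->
  (forall u, 0 <= F u)%E -> (\int[@std_gauss R 0]_v F v = F 0%R)%E.
Proof.
move=> mF F0; rewrite (_ : F = cst (F 0)); last by apply/funext => v /=; congr F; apply/matrixP => -[].
by rewrite integral_cst// [X in (_ * X)%E](@probability_setT _ _ _ (@std_gauss R 0)) mule1.
Qed.

Lemma std_gauss1_integral (F : 'cV[R]_1 -> \bar R) : measurable_fun setT F ->
  (forall u, 0 <= F u)%E -> (\int[@std_gauss R 1]_v F v = \int[N1]_t F (ccons t 0%R))%E.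
Proof.
move=> mF F0; rewrite ge0_integral_std_gaussS//; apply: eq_integral => t _.
rewrite std_gauss0_integral//.
exact: (measurableT_comp mF (measurable_ccons2 _)).
Qed.

Lemma le_normal (F G : R -> \bar R) : measurable_fun setT F -> measurable_fun setT G ->
  (forall x, 0 <= F x)%E -> (forall x, F x <= G x)%E -> (\int[N1]_x F x <= \int[N1]_x G x)%E.
Proof. by move=> mF mG F0 FG; exact: ge0_le_integral. Qed.

Lemma normal_cst (k : R) : (\int[N1]__ k%:E = k%:E)%E.
Proof. by rewrite integral_cst// [X in (_ * X)%E](@probability_setT _ _ _ N1) mule1. Qed.

(** The one-dimensional Cameron-Martin formula. *)
Lemma normal_shift F (b : R) : measurable_fun setT F -> (forall x, 0 <= F x)%E ->
  (\int[N1]_x F (x + b)%R = \int[N1]_x (F x * (expR (b * x - b ^+ 2 / 2))%:E))%E.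
Proof.
move=> mF F0.
have ms (c : R) : measurable_fun setT (fun x : R => x + c) by exact: measurable_funD.
have mE : measurable_fun setT (fun x => expR (b * x - b ^+ 2 / 2)).
  by apply: measurableT_comp => //; apply: measurable_funB => //; exact: measurable_funM.
rewrite ge0_integral_normal//; last exact: (measurableT_comp mF (ms b)).
rewrite ge0_integral_normal//; last 2 first.
- by apply: emeasurable_funM => //; exact/measurable_EFinP.
- by move=> x; rewrite mule_ge0// lee_fin expR_ge0.
have mp : measurable_fun setT (normal_pdf (0 : R) 1) by exact: measurable_normal_pdf.
rewrite -[RHS](mul1e) -(_ : `|1 : R|^-1%:E = 1%E); last by rewrite normr1 invr1.
rewrite -(@ge0_integral_affine1 R 1 b); last 3 first.
- exact: oner_neq0.
- by apply: emeasurable_funM; [apply: emeasurable_funM => //; exact/measurable_EFinP|exact/measurable_EFinP].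
- by move=> x; rewrite !mule_ge0// lee_fin ?expR_ge0 ?normal_pdf_ge0.
apply: eq_integral => x _; rewrite mul1r -muleA -EFinM; congr (_ * _%:E)%E.
rewrite !normal_pdf01.
have -> : expR (- 2^-1 * x ^+ 2) = expR (b * (x + b) - b ^+ 2 / 2) * expR (- 2^-1 * (x + b) ^+ 2).
  by rewrite -expRD; congr expR; field.
by rewrite -mulrA.
Qed.

Lemma normal_opp F : measurable_fun setT F -> (forall x, 0 <= F x)%E ->
  (\int[N1]_x F (- x)%R = \int[N1]_x F x)%E.
Proof.
move=> mF F0.
have mN : measurable_fun setT (fun x : R => F (- x)) by apply: (measurableT_comp mF); exact: oppr_measurable.
rewrite !ge0_integral_normal// -[RHS]ge0_integral_opp.
- by apply: eq_integral => x _; rewrite !normal_pdf01 sqrrN.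
- by apply: emeasurable_funM => //; apply/measurable_EFinP; exact: measurable_normal_pdf.
- by move=> x; rewrite mule_ge0// lee_fin normal_pdf_ge0.
Qed.

(* Reflection about [b / 2] exchanges the densities of [xi] and [xi + b]; the
   rearrangement inequality then gives the claim pointwise. *)
Lemma normal_anderson (h : R -> R) (b : R) : measurable_fun setT h ->
  (forall x, 0 <= h x) -> (forall x y, `|x| <= `|y| -> h x <= h y) ->
  (\int[N1]_x (h x)%:E <= \int[N1]_x (h (x + b))%:E)%E.
Proof.
move=> mh h0 hh.
pose W x := expR (b * x - b ^+ 2 / 2).
have mW : measurable_fun setT W.
  by apply: measurableT_comp => //; apply: measurable_funB => //; exact: measurable_funM.
have mhE : measurable_fun setT (fun x => (h x)%:E) by exact/measurable_EFinP.
have h0E x : (0 <= (h x)%:E)%E by rewrite lee_fin.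
have mr : measurable_fun setT (fun x : R => b - x) by exact: measurable_funB.
have mhr : measurable_fun setT (fun x : R => h (b - x)) by exact: (measurableT_comp mh mr).
have mhrE : measurable_fun setT (fun x : R => (h (b - x))%:E) by exact/measurable_EFinP.
have hN x : h (- x) = h x by apply/eqP; rewrite eq_le !hh// normrN.
have e1 : (\int[N1]_x (h (x + b))%:E = \int[N1]_x (h x * W x)%:E)%E.
  by rewrite (normal_shift b mhE h0E).
have e2 : (\int[N1]_x (h (x + b))%:E = \int[N1]_x (h (b - x))%:E)%E.
  rewrite -normal_opp//; last first.
    by apply/measurable_EFinP; apply: (measurableT_comp mh); exact: measurable_funD.
  by apply: eq_integral => x _; rewrite addrC.
have e3 : (\int[N1]_x (h x)%:E = \int[N1]_x (h (b - x) * W x)%:E)%E.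
  transitivity (\int[N1]_x (h (b - (x + b)))%:E)%E.
    by apply: eq_integral => x _; rewrite opprD addrCA subrr addr0 hN.
  by rewrite (normal_shift b mhrE)// => x; rewrite lee_fin.
have mprod (f g : R -> R) : measurable_fun setT f -> measurable_fun setT g ->
    measurable_fun setT (fun x => (f x * g x)%:E).
  by move=> mf mg; apply/measurable_EFinP; exact: measurable_funM.
have p0 f x : (forall x, 0 <= f x) -> (0 <= (f x * W x)%:E)%E.
  by move=> f0; rewrite lee_fin mulr_ge0 ?expR_ge0.
pose u := (\int[N1]_x (h x)%:E)%E; pose v := (\int[N1]_x (h (x + b))%:E)%E.
have H : (u + u <= v + v)%E.
  rewrite /u /v {u v}.
  rewrite {1}e3 {1}e1 e2 -!ge0_integralD//; try by [exact: mprod | move=> x _; rewrite lee_fin ?mulr_ge0 ?expR_ge0].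
  apply: ge0_le_integral => //.
  - by move=> x _; rewrite adde_ge0// lee_fin// mulr_ge0 ?expR_ge0.
  - by apply: emeasurable_funD => //; exact: mprod.
  - by apply: emeasurable_funD => //; exact: mprod.
  move=> x _; rewrite -!EFinD lee_fin.
  have [bx|bx] := leP (b ^+ 2 / 2) (b * x).
    have W1 : 1 <= W x by rewrite -expR0 ler_expR subr_ge0.
    have hx : h (b - x) <= h x by apply: hh; rewrite -ler_sqr ?nnegrE// !real_normK ?num_real//; nra.
    nra.
  have W1 : W x <= 1 by rewrite -[leRHS]expR0 ler_expR subr_le0 ltW.
  have hx : h x <= h (b - x) by apply: hh; rewrite -ler_sqr ?nnegrE// !real_normK ?num_real//; nra.
  nra.
by apply: (lee_double _ _ H); apply: integral_ge0 => x _; rewrite lee_fin.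
Qed.

Lemma normal_sqr_le1 : (\int[N1]_x (x ^+ 2)%:E <= 1)%E.
Proof.
have := @Eg_sqr_le1 R 1 ord0; rewrite /Eg std_gauss1_integral.
- by under eq_integral do rewrite ccons0.
- by apply/measurable_EFinP; apply: measurable_funX; exact: measurable_mx_entry.
- by move=> u; rewrite lee_fin sqr_ge0.
Qed.

Lemma normal_expR_quad (c : R) : c < 1 ->
  (\int[N1]_x (expR (2^-1 * (c * x ^+ 2)))%:E = ((Num.sqrt (1 - c))^-1)%:E)%E.
Proof.
move=> c1; have := @std_gauss_expR_quad R 1 (fun=> c) (fun=> c1).
rewrite std_gauss1_integral.
- by under eq_integral do rewrite big_ord1 ccons0; rewrite big_ord1.
- apply/measurable_EFinP; apply: measurableT_comp => //; apply: measurable_funM => //.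
  apply: measurable_sum => i; apply: measurable_funM => //; apply: measurable_funX.
  exact: measurable_mx_entry.
- by move=> u; rewrite lee_fin expR_ge0.
Qed.

Lemma normal_rotation (G : measurableTypeR R * measurableTypeR R -> \bar R) :
  measurable_fun setT G -> (forall x, 0 <= G x)%E ->
  let c := (Num.sqrt 2)^-1 in
  (\int[N1]_x \int[N1]_y G (x, y) = \int[N1]_x \int[N1]_y G ((x - y) * c, (x + y) * c)%R)%E.
Proof.
move=> mG G0 c.
have cc : c ^+ 2 = 1 / 2 by rewrite /c exprVn sqr_sqrtr// div1r.
pose F (g : 'cV[R]_2) := G (g ord0 0, g (lift ord0 ord0) 0).
have mF : measurable_fun setT F.
  apply: (measurableT_comp mG); apply: measurable_fun_pair; exact: measurable_mx_entry.
have F0 g : (0 <= F g)%E by exact: G0.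
have E H : measurable_fun setT H -> (forall g, 0 <= H g)%E ->
    (\int[@std_gauss R 2]_g H g = \int[N1]_x \int[N1]_y H (ccons x (ccons y 0%R)))%E.
  move=> mH H0; rewrite ge0_integral_std_gaussS//; apply: eq_integral => x _.
  by rewrite std_gauss1_integral//; exact: (measurableT_comp mH (measurable_ccons2 _)).
pose A : 'M[R]_2 := \matrix_(i, j) if ((i == 0 :> nat) && (j == 1 :> nat))%N then - c else c.
have AA : A^T *m A = 1%:M.
  apply/matrixP => i j; rewrite !mxE !big_ord_recl big_ord0 !mxE /=.
  by case: i => [[|[|i]] hi]//; case: j => [[|[|j]] hj]//=; rewrite ?mulr1n ?mulr0n; lra.
have := ge0_integral_std_gauss_orthogonal AA mF F0.
rewrite (E _ mF F0) E; last 2 first.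
- by have h := measurable_mulmx_cV A (0 : 'cV[R]_2); apply: (measurableT_comp mF); apply: eq_measurable_fun h => u _; rewrite addr0.
- by move=> g; exact: F0.
have Fe x y : F (ccons x (ccons y 0)) = G (x, y) by rewrite /F ccons0 cconsS ccons0.
have FA x y : F (A *m ccons x (ccons y 0)) = G ((x - y) * c, (x + y) * c)%R.
  rewrite /F [X in G (X, _)]mxE [X in G (_, X)]mxE !big_ord_recl !big_ord0 !ccons0 !cconsS !ccons0 !mxE /=.
  by congr (G (_, _)); ring.
under eq_integral do under eq_integral do rewrite FA.
by move=> ->; apply: eq_integral => x _; apply: eq_integral => y _; rewrite Fe.
Qed.

End normal.

(** * Characteristic functions of the normal law and of its squares *)

Section trig_bounds.
Context (R : realType).

Lemma sin_le_id (y : R) : 0 <= y -> `|sin y| <= y.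
Proof.
rewrite le_eqVlt => /predU1P[<-|y0]; first by rewrite sin0 normr0.
have [x _] := @MVT R sin cos 0 y y0 (fun x _ => is_derive_sin x) (continuous_subspaceT (@continuous_sin R)).
rewrite sin0 !subr0 => ->; rewrite normrM (gtr0_norm y0).
by rewrite ger_pMl// cos_max.
Qed.

Lemma cos_half (y : R) : cos y = 1 - 2 * sin (y / 2) ^+ 2.
Proof.
have -> : cos y = cos (y / 2 + y / 2) by congr cos; lra.
by rewrite cosD; have := cos2Dsin2 (y / 2); rewrite -!expr2; lra.
Qed.

Lemma cos_ge_quad (y : R) : 1 - y ^+ 2 / 2 <= cos y.
Proof.
have : sin (y / 2) ^+ 2 <= (y / 2) ^+ 2.
  rewrite -(real_normK (num_real (sin _))) -[leRHS](real_normK (num_real _)).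
  rewrite ler_sqr ?nnegrE//; have [h|h] := leP 0 (y / 2).
    by rewrite (ger0_norm h) sin_le_id.
  by rewrite (ltr0_norm h) -normrN -sinN sin_le_id// oppr_ge0 ltW.
by rewrite cos_half; lra.
Qed.

Lemma sin_ge_lin (y : R) : 0 <= y <= 1 / 2 -> 7 / 8 * y <= sin y.
Proof.
move=> /andP[]; rewrite le_eqVlt => /predU1P[<-|y0 y1]; first by rewrite sin0 mulr0.
have [x] := @MVT R sin cos 0 y y0 (fun x _ => is_derive_sin x) (continuous_subspaceT (@continuous_sin R)).
rewrite sin0 !subr0 in_itv /= => /andP[x0 xy] ->; rewrite ler_wpM2r ?(ltW y0)//.
by apply: le_trans (cos_ge_quad x); nra.
Qed.

Lemma cos_le_quad (y : R) : 0 <= y <= 1 -> cos y <= 1 - 3 / 8 * y ^+ 2.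
Proof.
move=> /andP[y0 y1]; have := @sin_ge_lin (y / 2); rewrite cos_half.
have -> : 0 <= y / 2 <= 1 / 2 by apply/andP; split; lra.
by move=> /(_ isT); nra.
Qed.

End trig_bounds.

Section char_fun.
Context (R : realType).
Local Notation N1 := (@normal_prob R 0 1).

Definition Ecos (Y : R -> R) : R := fine (\int[N1]_x (cos (Y x))%:E)%E.
Definition Esin (Y : R -> R) : R := fine (\int[N1]_x (sin (Y x))%:E)%E.

(** The summand 1 makes such integrands nonnegative when [p ^ 2 + q ^ 2 <= 1], so that Tonelli and
    the substitution lemmas apply to them. *)
Lemma normal_trig (Y : R -> R) (p q : R) : measurable_fun setT Y ->
  (\int[N1]_x (1 + p * cos (Y x) + q * sin (Y x))%:E = (1 + p * Ecos Y + q * Esin Y)%:E)%E.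
Proof.
move=> mY.
have N1oo : (N1 setT < +oo)%E by rewrite [X in (X < _)%E](@probability_setT _ _ _ N1) ltry.
have ib (u : R -> R) (k : R) : measurable_fun setT u -> (forall x, `|u x| <= k) -> N1.-integrable setT (EFin \o u).
  move=> mu' u1; apply: measurable_bounded_integrable => //.
  by exists k; split; rewrite ?num_real// => M M1 x _ /=; apply: le_trans (u1 x) (ltW M1).
have mc : measurable_fun setT (fun x => cos (Y x)).
  by apply: measurableT_comp => //; apply: continuous_measurable_fun; exact: continuous_cos.
have ms : measurable_fun setT (fun x => sin (Y x)).
  by apply: measurableT_comp => //; apply: continuous_measurable_fun; exact: continuous_sin.
have ic : N1.-integrable setT (EFin \o (fun x => cos (Y x))).
  by apply: (ib _ 1) => // x; exact: cos_max.
have is_ : N1.-integrable setT (EFin \o (fun x => sin (Y x))).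
  by apply: (ib _ 1) => // x; exact: sin_max.
have i1 : N1.-integrable setT (EFin \o (fun _ : R => 1 : R)).
  by apply: (ib _ 1) => // x; rewrite normr1.
have ip : N1.-integrable setT (EFin \o (fun x => p * cos (Y x))).
  by apply: (ib _ `|p|) => [|x]; [exact: measurable_funM|rewrite normrM ler_piMr// cos_max].
have iq : N1.-integrable setT (EFin \o (fun x => q * sin (Y x))).
  by apply: (ib _ `|q|) => [|x]; [exact: measurable_funM|rewrite normrM ler_piMr// sin_max].
have i1p : N1.-integrable setT (EFin \o (fun x => 1 + p * cos (Y x))).
  apply: (ib _ (1 + `|p|)) => [|x]; first by apply: measurable_funD => //; exact: measurable_funM.
  by apply: le_trans (ler_normD _ _) _; rewrite normr1 lerD2l normrM ler_piMr// cos_max.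
rewrite integralD_EFin// integralD_EFin//.
rewrite integral_cst// [X in (_ * X)%E](@probability_setT _ _ _ N1) mule1.
have -> : (\int[N1]_x (p * cos (Y x))%:E = p%:E * \int[N1]_x (cos (Y x))%:E)%E.
  by rewrite -integralZl//; apply: eq_integral => x _; rewrite EFinM.
have -> : (\int[N1]_x (q * sin (Y x))%:E = q%:E * \int[N1]_x (sin (Y x))%:E)%E.
  by rewrite -integralZl//; apply: eq_integral => x _; rewrite EFinM.
by rewrite !EFinD !EFinM /Ecos /Esin !fineK//; exact: integrable_fin_num.
Qed.

Lemma normal_cos (Y : R -> R) : measurable_fun setT Y ->
  (\int[N1]_x (1 + cos (Y x))%:E = (1 + Ecos Y)%:E)%E.
Proof.
move=> mY; have := normal_trig 1 0 mY; rewrite !(mul1r, mul0r, addr0) => <-.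
by apply: eq_integral => x _; rewrite !(mul1r, mul0r, addr0).
Qed.

Let mlin (k : R) : measurable_fun setT (fun x : R => k * x).
Proof. exact: measurable_funM. Qed.

Let msin : measurable_fun setT (@sin R).
Proof. by apply: continuous_measurable_fun; exact: continuous_sin. Qed.

Let mcos : measurable_fun setT (@cos R).
Proof. by apply: continuous_measurable_fun; exact: continuous_cos. Qed.

Lemma Esin_lin (k : R) : Esin (fun x => k * x) = 0.
Proof.
pose Y x := k * x.
have m1 : measurable_fun setT (fun x => (1 + sin (Y x))%:E).
  apply/measurable_EFinP; apply: measurable_funD => //.
  exact: (measurableT_comp msin (mlin k)).
have h0 x : (0 <= (1 + sin (Y x))%:E)%E by rewrite lee_fin; have := sin_geN1 (Y x); lra.
have := normal_opp m1 h0.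
have e1 := normal_trig 0 1 (mlin k); have e2 := normal_trig 0 (-1) (mlin k).
rewrite (_ : (\int[N1]_x (1 + sin (Y x))%:E = (1 + 0 * Ecos Y + 1 * Esin Y)%:E)%E); last first.
  by rewrite -e1; apply: eq_integral => x _; rewrite mul0r addr0 mul1r.
rewrite (_ : (\int[N1]_x (1 + sin (Y (- x)))%:E = (1 + 0 * Ecos Y + -1 * Esin Y)%:E)%E); last first.
  by rewrite -e2; apply: eq_integral => x _; rewrite mul0r addr0 mulN1r /Y mulrN sinN.
by move=> -[]; rewrite -/(Esin Y); lra.
Qed.

(** The characteristic function of the standard normal law, real by symmetry. Bounds on it are drawn
    from the functional equation [charN_sqrt2]. *)
Definition charN (k : R) : R := Ecos (fun x => k * x).

(* Rotation invariance of the planar Gaussian law. *)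
Lemma charN_sqrt2 (k : R) : charN (Num.sqrt 2 * k) = charN k ^+ 2.
Proof.
have s2 : Num.sqrt 2 * Num.sqrt 2 = 2 :> R by rewrite -expr2 sqr_sqrtr.
have s20 : Num.sqrt 2 != 0 :> R by rewrite gt_eqF// sqrtr_gt0.
pose G (z : measurableTypeR R * measurableTypeR R) := (1 + cos (Num.sqrt 2 * k * z.2))%:E.
have mG : measurable_fun setT G.
  apply/measurable_EFinP; apply: measurable_funD => //.
  by apply: (measurableT_comp mcos); apply: measurable_funM => //; exact: measurable_snd.
have G0 z : (0 <= G z)%E by rewrite lee_fin; have := cos_geN1 (Num.sqrt 2 * k * z.2); lra.
have := normal_rotation mG G0; rewrite /G /=.
under eq_integral do rewrite (normal_cos (mlin _)).
rewrite integral_cst// [X in (_ * X)%E](@probability_setT _ _ _ N1) mule1.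
have E x y : cos (Num.sqrt 2 * k * ((x + y) * (Num.sqrt 2)^-1)) = cos (k * x) * cos (k * y) - sin (k * x) * sin (k * y).
  by rewrite -cosD; congr cos; field.
under [in RHS]eq_integral => x _.
  rewrite (_ : (\int[N1]_y _ = (1 + charN k * cos (k * x) + 0 * sin (k * x))%:E)%E); first over.
  have := normal_trig (cos (k * x)) (- sin (k * x)) (mlin k).
  rewrite Esin_lin mulr0 addr0 mul0r addr0 -/(charN k) [charN k * _]mulrC => <-.
  by apply: eq_integral => y _; rewrite E mulNr addrA.
rewrite (normal_trig _ _ (mlin k)) mul0r addr0 -/(charN k) -/(charN _) => -[].
by rewrite expr2; lra.
Qed.

Lemma charN_half (k : R) : charN k = charN (k / Num.sqrt 2) ^+ 2.
Proof. by rewrite -charN_sqrt2 mulrC divfK// gt_eqF// sqrtr_gt0. Qed.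

Lemma charN_ge0 (k : R) : 0 <= charN k.
Proof. by rewrite charN_half sqr_ge0. Qed.

Lemma charN_ge (k : R) : 1 - k ^+ 2 / 2 <= charN k.
Proof.
have m1 : measurable_fun setT (fun x => (1 + cos (k * x))%:E).
  apply/measurable_EFinP; apply: measurable_funD => //; exact: (measurableT_comp mcos (mlin k)).
have m2 : measurable_fun setT (fun x : R => (x ^+ 2)%:E).
  by apply/measurable_EFinP; exact: measurable_funX.
have k0 : 0 <= k ^+ 2 / 2 by rewrite divr_ge0 ?sqr_ge0.
have h0 x : (0 <= (1 + cos (k * x))%:E)%E by rewrite lee_fin; have := cos_geN1 (k * x); lra.
have H : (\int[N1]_x 2%:E <= \int[N1]_x ((1 + cos (k * x))%:E + (k ^+ 2 / 2)%:E * (x ^+ 2)%:E))%E.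
  apply: ge0_le_integral => //.
  - by apply: emeasurable_funD => //; exact: measurable_funeM.
  - by move=> x _; rewrite -EFinM -EFinD lee_fin; have := cos_ge_quad (k * x); rewrite exprMn; lra.
move: H; rewrite integral_cst// [X in (_ * X)%E](@probability_setT _ _ _ N1) mule1.
rewrite ge0_integralD//; last 2 first.
- by move=> x _; rewrite mule_ge0// lee_fin// sqr_ge0.
- exact: measurable_funeM.
rewrite normal_cos// ge0_integralZl//; last by move=> x _; rewrite lee_fin sqr_ge0.
have := @normal_sqr_le1 R; have := integral_ge0.
set X := (\int[N1]_x (x ^+ 2)%:E)%E => _ X1 H.
have : (2%:E <= (1 + charN k)%:E + (k ^+ 2 / 2)%:E * 1)%E.
  by apply: le_trans H _; rewrite leeD2l// lee_wpmul2l.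
by rewrite mule1 -EFinD lee_fin; lra.
Qed.

(** On [[1, 2]], which has positive normal probability, [cos_le_quad] gives a definite loss;
    elsewhere [cos <= 1]. *)
Lemma charN_small : exists2 c : R, 0 < c & forall k, 0 <= k <= 1 / 2 -> charN k <= 1 - c * k ^+ 2.
Proof.
pose A : set R := `[1, 2]%classic.
have mA : measurable A by exact: measurable_itv.
have NA0 : (0 < N1 A)%E.
  have : ((expR (- 2^-1 * 2 ^+ 2) / Num.sqrt (2 * pi))%:E <= N1 A)%E.
    have -> : N1 A = (\int[lebesgue_measure]_(x in A) (normal_pdf 0 1 x)%:E)%E by [].
    apply: (@le_trans _ _ (\int[lebesgue_measure]_(x in A) (expR (- 2^-1 * 2 ^+ 2) / Num.sqrt (2 * pi))%:E)%E).
      rewrite integral_cst//= lebesgue_measure_itv /= lte_fin ltr1n.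
      by rewrite -EFinB -EFinM lee_fin (_ : 2 - 1 = 1) ?mulr1//; lra.
    apply: ge0_le_integral => //.
    - apply/measurable_EFinP; apply: measurable_funTS; exact: measurable_normal_pdf.
    - move=> x; rewrite /A /= in_itv /= => /andP[x1 x2].
      rewrite lee_fin normal_pdf01 ler_wpM2r ?invr_ge0 ?sqrtr_ge0// ler_expR.
      by rewrite !mulNr lerN2 ler_wpM2l// ler_sqr ?nnegrE//; lra.
  by apply: lt_le_trans; rewrite lte_fin divr_gt0 ?expR_gt0// sqrtr_gt0 mulr_gt0// pi_gt0.
have NAfin : N1 A = (fine (N1 A))%:E by rewrite fineK// fin_num_measure.
set a := fine (N1 A) in NAfin.
have a0 : 0 < a by move: NA0; rewrite NAfin lte_fin.
exists (3 / 8 * a); first by rewrite mulr_gt0.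
move=> k /andP[k0 k1].
have m1 : measurable_fun setT (fun x => (1 + cos (k * x))%:E).
  apply/measurable_EFinP; apply: measurable_funD => //; exact: (measurableT_comp mcos (mlin k)).
have h0 x : (0 <= (1 + cos (k * x))%:E)%E by rewrite lee_fin; have := cos_geN1 (k * x); lra.
have kk : 0 <= 3 / 8 * k ^+ 2 by rewrite mulr_ge0 ?sqr_ge0.
have mi : measurable_fun setT (fun x => (\1_A x)%:E : \bar R) by apply/measurable_EFinP; exact: measurable_indic.
have : (\int[N1]_x ((1 + cos (k * x))%:E + (3 / 8 * k ^+ 2)%:E * (\1_A x)%:E) <= \int[N1]_x 2%:E)%E.
  apply: ge0_le_integral => //.
  - by move=> x _; rewrite adde_ge0// mule_ge0// lee_fin.
  - by apply: emeasurable_funD => //; exact: measurable_funeM.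
  - move=> x _; rewrite -EFinM -EFinD lee_fin indicE; case: (boolP (x \in A)) => [|_].
      rewrite inE /A /= in_itv /= mulr1 => /andP[x1 x2].
      have : 0 <= k * x <= 1 by apply/andP; split; nra.
      have : k ^+ 2 <= k ^+ 2 * x ^+ 2 by rewrite ler_peMr ?sqr_ge0// exprn_ege1.
      by move=> h /cos_le_quad; rewrite exprMn; lra.
    by rewrite mulr0 addr0; have := cos_le1 (k * x); lra.
rewrite integral_cst// [X in (_ * X)%E](@probability_setT _ _ _ N1) mule1.
rewrite ge0_integralD//; last 2 first.
- by move=> x _; rewrite mule_ge0// lee_fin.
- exact: measurable_funeM.
rewrite normal_cos// ge0_integralZl//.
have -> : (\int[N1]_x (\1_A x)%:E = a%:E)%E by rewrite integral_indic// setIT; exact: NAfin.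
rewrite -EFinM -EFinD lee_fin -/(charN k).
lra.
Qed.

(** Dividing [k] by [sqrt 2] replaces both sides by their square roots, so finitely many divisions
    reduce the claim to [charN_small]. *)
Lemma charN_exp : exists2 c : R, 0 < c & forall k, charN k <= expR (- (c * k ^+ 2)).
Proof.
have [c c0 hc] := charN_small; exists c => // k.
wlog k0 : k / 0 <= k.
  move=> H; have [/H//|k0] := leP 0 k.
  have := H (- k); rewrite sqrrN /charN => h.
  rewrite (_ : Ecos (fun x => k * x) = Ecos (fun x => - k * x)).
    by apply: h; rewrite oppr_ge0 ltW.
  by congr fine; apply: eq_integral => x _; rewrite mulNr cosN.
have [n hn] : exists n, k ^+ 2 <= 2 ^+ n / 4.
  exists (Num.bound (4 * k ^+ 2)); rewrite ler_pdivlMr// mulrC.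
  have : 4 * k ^+ 2 < (Num.bound (4 * k ^+ 2))%:R by apply: archi_boundP; rewrite mulr_ge0 ?sqr_ge0.
  move/ltW/le_trans; apply; rewrite -natrX ler_nat; apply: ltnW; exact: ltn_expl.
elim: n k k0 hn => [|n IH] k k0 hn.
  have k1 : 0 <= k <= 1 / 2.
    by rewrite k0/= -ler_sqr ?nnegrE//; rewrite expr0 in hn; lra.
  by apply: le_trans (hc k k1) _; exact: expR_ge1Dx.
have s0 : 0 < Num.sqrt 2 :> R by rewrite sqrtr_gt0.
have kE : (k / Num.sqrt 2) ^+ 2 = k ^+ 2 / 2 by rewrite exprMn exprVn sqr_sqrtr.
have := IH (k / Num.sqrt 2); rewrite kE divr_ge0 ?(ltW s0)// => /(_ isT) h.
have {h}h : charN (k / Num.sqrt 2) <= expR (- (c * (k ^+ 2 / 2))).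
  by apply: h; rewrite [2 ^+ n.+1]exprS in hn; lra.
rewrite charN_half (_ : - (c * k ^+ 2) = 2%:R * - (c * (k ^+ 2 / 2))); last by lra.
by rewrite expRM_natl ler_sqr ?nnegrE ?expR_ge0 ?charN_ge0.
Qed.

(* The dual of [normal_anderson] for a bounded nonincreasing function. *)
Lemma normal_anderson_decr (h : R -> R) (M b : R) : measurable_fun setT h ->
  (forall x, 0 <= h x <= M) -> (forall x y, `|x| <= `|y| -> h y <= h x) ->
  (\int[N1]_x (h (x + b))%:E <= \int[N1]_x (h x)%:E)%E.
Proof.
move=> mh h0 hh; pose g x := M - h x.
have mg : measurable_fun setT g by exact: measurable_funB.
have ms : measurable_fun setT (fun x : R => x + b) by exact: measurable_funD.
have g0 x : 0 <= g x by rewrite subr_ge0; have /andP[] := h0 x.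
have h00 x : 0 <= h x by have /andP[] := h0 x.
have sumE (k : R -> R) : measurable_fun setT k ->
    (\int[N1]_x (g (k x))%:E + \int[N1]_x (h (k x))%:E = M%:E)%E.
  move=> mk; rewrite -ge0_integralD//.
  - under eq_integral do rewrite -EFinD subrK.
    by rewrite integral_cst// [X in (_ * X)%E](@probability_setT _ _ _ N1) mule1.
  - by move=> x _; rewrite lee_fin.
  - by apply/measurable_EFinP; exact: (measurableT_comp mg mk).
  - by move=> x _; rewrite lee_fin.
  - by apply/measurable_EFinP; exact: (measurableT_comp mh mk).
have H : (\int[N1]_x (g x)%:E <= \int[N1]_x (g (x + b))%:E)%E.
  by apply: normal_anderson => // x y xy; rewrite lerD2l lerN2 hh.
have := sumE _ ms; have := sumE id (@measurable_id _ _ setT); move: H.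
have p1 : (0 <= \int[N1]_x (g x)%:E)%E by apply: integral_ge0 => x _; rewrite lee_fin.
have p2 : (0 <= \int[N1]_x (h x)%:E)%E by apply: integral_ge0 => x _; rewrite lee_fin.
have p3 : (0 <= \int[N1]_x (g (x + b))%:E)%E by apply: integral_ge0 => x _; rewrite lee_fin.
have p4 : (0 <= \int[N1]_x (h (x + b))%:E)%E by apply: integral_ge0 => x _; rewrite lee_fin.
move: p1 p2 p3 p4; move: (\int[N1]_x (g x)%:E)%E (\int[N1]_x (h x)%:E)%E (\int[N1]_x (g (x + b))%:E)%E (\int[N1]_x (h (x + b))%:E)%E.
case=> [x1| |]// [x2| |]// [x3| |]// [x4| |]// _ _ _ _.
by rewrite -!EFinD !lee_fin => h1 [] h2 [] h3; lra.
Qed.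

(** The left side is a squared modulus, that is, the mean of the cosine of the difference of two
    independent copies. A rotation by a quarter of pi makes this difference a product, linear in [y]
    for fixed [x]. Integration over [y] gives a value of [charN], bounded by [charN_exp]; Anderson's
    inequality removes the shift, and a Gaussian integral remains. *)
Lemma chi2_char : exists2 c : R, 0 < c & forall t l a, 0 <= l ->
  Ecos (fun x => t * (Num.sqrt l * x + a) ^+ 2) ^+ 2 +
  Esin (fun x => t * (Num.sqrt l * x + a) ^+ 2) ^+ 2 <= (Num.sqrt (1 + c * (t ^+ 2 * l ^+ 2)))^-1.
Proof.
have [c c0 hc] := charN_exp; exists (8 * c); first by rewrite mulr_gt0.
move=> t l a l0; set Y := fun x => t * _.
have s2 : Num.sqrt 2 * Num.sqrt 2 = 2 :> R by rewrite -expr2 sqr_sqrtr.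
have s20 : Num.sqrt 2 != 0 :> R by rewrite gt_eqF// sqrtr_gt0.
have sl : Num.sqrt l ^+ 2 = l by rewrite sqr_sqrtr.
have mY : measurable_fun setT Y.
  by apply: measurable_funM => //; apply: measurable_funX; apply: measurable_funD.
pose G (z : measurableTypeR R * measurableTypeR R) := (1 + cos (Y z.2 - Y z.1))%:E.
have mG : measurable_fun setT G.
  apply/measurable_EFinP; apply: measurable_funD => //; apply: (measurableT_comp mcos).
  apply: measurable_funB.
    exact: (measurableT_comp mY (@measurable_snd _ _ _ _)).
  exact: (measurableT_comp mY (@measurable_fst _ _ _ _)).
have G0 z : (0 <= G z)%E by rewrite lee_fin; have := cos_geN1 (Y z.2 - Y z.1); lra.
have e1 : (\int[N1]_x \int[N1]_y G (x, y) = (1 + Ecos Y * Ecos Y + Esin Y * Esin Y)%:E)%E.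
  rewrite -normal_trig//; apply: eq_integral => x _.
  transitivity (1 + cos (Y x) * Ecos Y + sin (Y x) * Esin Y)%:E; last by congr (_ + _ + _)%:E; rewrite mulrC.
  rewrite -normal_trig//; apply: eq_integral => y _.
  by rewrite /G /= cosB -addrA; congr (_ + (_ + _))%:E; rewrite mulrC.
pose K x := 2 * t * Num.sqrt l * (Num.sqrt l * x + Num.sqrt 2 * a).
have e2 : (\int[N1]_x \int[N1]_y G ((x - y) / Num.sqrt 2, (x + y) / Num.sqrt 2)%R = \int[N1]_x (1 + charN (K x))%:E)%E.
  apply: eq_integral => x _; rewrite -normal_cos//; apply: eq_integral => y _.
  rewrite /G /=; congr (1 + cos _)%:E; rewrite /Y /K.
  have -> : (Num.sqrt 2)^-1 = Num.sqrt 2 / 2 :> R.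
    by apply: (mulfI s20); rewrite mulfV// mulrA s2 mulfV.
  transitivity (t * Num.sqrt l * y * (Num.sqrt 2 * Num.sqrt 2 * Num.sqrt l * x + 2 * Num.sqrt 2 * a)).
    by field.
  by rewrite s2; ring.
have h1 x : 0 <= 1 + charN (K x) by have := charN_ge0 (K x); lra.
pose u x := 1 + expR (- (c * (2 * t * l * x) ^+ 2)).
have mu' : measurable_fun setT u.
  apply: measurable_funD => //; apply: measurableT_comp => //; apply: measurableT_comp => //.
  by apply: measurable_funM => //; apply: measurable_funX; exact: mlin.
have u0 x : 0 <= u x by rewrite addr_ge0 ?expR_ge0.
have mF : measurable_fun setT (fun k => (1 + charN k)%:E).
  rewrite (_ : (fun k => _) = (fun k => \int[N1]_x (1 + cos (k * x))%:E)%E); last first.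
    by apply/funext => k; rewrite normal_cos.
  apply: (@measurable_fun_fubini_tonelli_F _ _ _ _ _ N1 (fun y : measurableTypeR R * measurableTypeR R => (1 + cos (y.1 * y.2))%:E)) => [|z].
    apply/measurable_EFinP; apply: measurable_funD => //; apply: (measurableT_comp mcos).
    by apply: measurable_funM; [exact: measurable_fst|exact: measurable_snd].
  by rewrite lee_fin; have := cos_geN1 (z.1 * z.2); lra.
have mK : measurable_fun setT K.
  by apply: measurable_funM => //; apply: measurable_funD => //; exact: mlin.
have key : (\int[N1]_x (1 + charN (K x))%:E <= \int[N1]_x (u x)%:E)%E.
  have lin x : charN (K x) <= expR (- (c * (2 * t * Num.sqrt l * (Num.sqrt l * x + Num.sqrt 2 * a)) ^+ 2)) := hc _.
  have [l00|lp] := eqVneq l 0.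
    apply: le_normal => [|||x].
    - exact: (measurableT_comp mF mK).
    - exact/measurable_EFinP.
    - by move=> x; rewrite lee_fin.
    rewrite lee_fin lerD2l; apply: le_trans (lin x) _.
    by rewrite l00 sqrtr0 !(mulr0, mul0r).
  have slp : Num.sqrt l != 0 by rewrite gt_eqF// sqrtr_gt0 lt_def lp.
  pose b := Num.sqrt 2 * a / Num.sqrt l.
  have u02 x : 0 <= u x <= 2.
    rewrite u0/= /u; have : expR (- (c * (2 * t * l * x) ^+ 2)) <= expR 0.
      by rewrite ler_expR oppr_le0 mulr_ge0 ?sqr_ge0// ltW.
    by rewrite expR0; lra.
  apply: le_trans (normal_anderson_decr b mu' u02 _).
    apply: le_normal => [|||x].
    - exact: (measurableT_comp mF mK).
    - apply/measurable_EFinP; apply: (measurableT_comp mu'); exact: measurable_funD.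
    - by move=> x; rewrite lee_fin.
    - rewrite lee_fin lerD2l; apply: le_trans (lin x) _.
      rewrite le_eqVlt; apply/orP; left; apply/eqP; congr (expR (- (c * _ ^+ 2))).
      by rewrite /b -{3}sl; field.
  move=> x y xy; rewrite lerD2l ler_expR lerN2 ler_wpM2l ?(ltW c0)// [leLHS]exprMn [leRHS]exprMn ler_wpM2l ?sqr_ge0//.
  by rewrite -(real_normK (num_real x)) -(real_normK (num_real y)) ler_sqr ?nnegrE.
have eu : (\int[N1]_x (u x)%:E = (1 + (Num.sqrt (1 + 8 * c * (t ^+ 2 * l ^+ 2)))^-1)%:E)%E.
  pose cc := - (8 * c * (t ^+ 2 * l ^+ 2)).
  have cc0 : cc < 1.
    have h : 0 <= t ^+ 2 * l ^+ 2 by rewrite mulr_ge0// sqr_ge0.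
    have := mulr_ge0 (ltW c0) h; rewrite /cc; lra.
  have -> : 1 + 8 * c * (t ^+ 2 * l ^+ 2) = 1 - cc by rewrite /cc; lra.
  rewrite EFinD -normal_expR_quad//; under eq_integral do rewrite EFinD.
  rewrite ge0_integralD//.
  - rewrite integral_cst// [X in (_ * X)%E](@probability_setT _ _ _ N1) mule1; congr (_ + _)%E.
    by apply: eq_integral => x _; congr (expR _)%:E; rewrite /cc; field.
  - by apply/measurable_EFinP; rewrite (_ : (fun x => _) = (fun x => u x - 1)); [exact: measurable_funB|apply/funext => x; rewrite /u; lra].
have := normal_rotation mG G0; rewrite e1 /= e2 => H.
by move: key; rewrite -H eu lee_fin !expr2; lra.
Qed.

End char_fun.

(** * Noncentral quadratic forms *)

Section chi2.
Context (R : realType).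
Local Notation N1 := (@normal_prob R 0 1).
Implicit Types (F G : R -> \bar R) (c : R * R) (s : seq (R * R)).

(* [chi2 (l, a)] adds an independent [(sqrt l * xi + a) ^+ 2] to the argument. *)
Definition chi2 c F (z : R) : \bar R := (\int[N1]_x F (z + (Num.sqrt c.1 * x + c.2) ^+ 2)%R)%E.

Definition chis s F : R -> \bar R := foldr chi2 F s.

Lemma measurable_chi2_arg c :
  measurable_fun setT (fun y : measurableTypeR R * measurableTypeR R => y.1 + (Num.sqrt c.1 * y.2 + c.2) ^+ 2).
Proof.
apply: measurable_funD; first exact: measurable_fst.
apply: measurable_funX; apply: measurable_funD => //.
by apply: measurable_funM => //; exact: measurable_snd.
Qed.

Lemma measurable_chi2_sqr c z : measurable_fun setT (fun x : R => z + (Num.sqrt c.1 * x + c.2) ^+ 2).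
Proof.
by apply: measurable_funD => //; apply: measurable_funX; apply: measurable_funD.
Qed.

Lemma chi2_ge0 c F : (forall x, 0 <= F x)%E -> forall z, (0 <= chi2 c F z)%E.
Proof. by move=> F0 z; exact: integral_ge0. Qed.

Lemma measurable_chi2 c F : measurable_fun setT F -> (forall x, 0 <= F x)%E ->
  measurable_fun setT (chi2 c F).
Proof.
move=> mF F0; apply: (@measurable_fun_fubini_tonelli_F _ _ _ _ _ N1
  (fun y : measurableTypeR R * measurableTypeR R => F (y.1 + (Num.sqrt c.1 * y.2 + c.2) ^+ 2))) => //.
exact: (measurableT_comp mF (measurable_chi2_arg c)).
Qed.

Lemma chi2_comm c c' F : measurable_fun setT F -> (forall x, 0 <= F x)%E ->
  chi2 c (chi2 c' F) = chi2 c' (chi2 c F).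
Proof.
move=> mF F0; apply/funext => z; rewrite /chi2.
pose K (y : measurableTypeR R * measurableTypeR R) :=
  F (z + (Num.sqrt c.1 * y.1 + c.2) ^+ 2 + (Num.sqrt c'.1 * y.2 + c'.2) ^+ 2).
have mK : measurable_fun setT K.
  apply: (measurableT_comp mF); apply: measurable_funD.
    apply: measurable_funD => //; apply: measurable_funX; apply: measurable_funD => //.
    by apply: measurable_funM => //; exact: measurable_fst.
  apply: measurable_funX; apply: measurable_funD => //.
  by apply: measurable_funM => //; exact: measurable_snd.
have := @fubini_tonelli _ _ _ _ _ N1 N1 K mK (fun y => F0 _).
rewrite /K /= => ->; apply: eq_integral => y _; apply: eq_integral => x _.
by rewrite addrAC.
Qed.

Lemma chis_ge0 s F : (forall x, 0 <= F x)%E -> forall z, (0 <= chis s F z)%E.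
Proof. by move=> F0; elim: s => //= c s IH; exact: chi2_ge0. Qed.

Lemma measurable_chis s F : measurable_fun setT F -> (forall x, 0 <= F x)%E ->
  measurable_fun setT (chis s F).
Proof. by move=> mF F0; elim: s => //= c s IH; apply: measurable_chi2 => //; exact: chis_ge0. Qed.

Lemma chis_chi2 s c F : measurable_fun setT F -> (forall x, 0 <= F x)%E ->
  chis s (chi2 c F) = chi2 c (chis s F).
Proof.
move=> mF F0; elim: s => //= c' s ->; apply: chi2_comm.
  exact: measurable_chis.
exact: chis_ge0.
Qed.

Lemma chis_cat s t F : chis (s ++ t) F = chis s (chis t F).
Proof. by rewrite /chis foldr_cat. Qed.

Lemma perm_chis s t F : perm_eq s t -> measurable_fun setT F -> (forall x, 0 <= F x)%E ->
  chis s F = chis t F.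
Proof.
move=> st mF F0; elim: s t st => [|c s IH] t st.
  by have -> : t = [::] by apply/perm_nilP; rewrite perm_sym.
have ct : c \in t by rewrite -(perm_mem st) mem_head.
have [t1 [t2 tE]] : exists t1 t2, t = t1 ++ c :: t2 by case/path.splitPr: ct => t1 t2; exists t1, t2.
rewrite tE chis_cat /= chis_chi2; last 2 first.
- exact: measurable_chis.
- exact: chis_ge0.
rewrite -chis_cat -(IH (t1 ++ t2))//.
by rewrite -(perm_cons c) (perm_trans st)// tE -cat1s perm_catCA.
Qed.

Lemma le_chi2 c F G z : measurable_fun setT F -> measurable_fun setT G ->
  (forall x, 0 <= F x)%E -> (forall x, F x <= G x)%E -> (chi2 c F z <= chi2 c G z)%E.
Proof.
move=> mF mG F0 FG; apply: le_normal => // [|].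
  exact: (measurableT_comp mF (measurable_chi2_sqr c z)).
exact: (measurableT_comp mG (measurable_chi2_sqr c z)).
Qed.

Lemma le_chis s F G z : measurable_fun setT F -> measurable_fun setT G ->
  (forall x, 0 <= F x)%E -> (forall x, F x <= G x)%E -> (chis s F z <= chis s G z)%E.
Proof.
move=> mF mG F0 FG; have G0 x : (0 <= G x)%E by exact: le_trans (F0 x) (FG x).
elim: s z => //= c s IH z; apply: le_chi2 => //.
- exact: measurable_chis.
- exact: measurable_chis.
- exact: chis_ge0.
Qed.

Lemma chis_cst s (k : R) : chis s (fun=> k%:E) = fun=> k%:E.
Proof. by elim: s => //= c s ->; apply/funext => z; rewrite /chi2 normal_cst. Qed.

Lemma chisD s F G : measurable_fun setT F -> measurable_fun setT G ->
  (forall x, 0 <= F x)%E -> (forall x, 0 <= G x)%E ->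
  chis s (fun x => F x + G x)%E = (fun z => chis s F z + chis s G z)%E.
Proof.
move=> mF mG F0 G0; elim: s => //= c s ->; apply/funext => z.
rewrite /chi2 ge0_integralD//.
- by move=> x _; exact: chis_ge0.
- by apply: measurableT_comp (measurable_chi2_sqr c z); exact: measurable_chis.
- by move=> x _; exact: chis_ge0.
- by apply: measurableT_comp (measurable_chi2_sqr c z); exact: measurable_chis.
Qed.

Lemma chis_shift s F (h z : R) : chis s (fun x => F (x + h)) z = chis s F (z + h).
Proof.
elim: s z => //= c s IH z; apply: eq_integral => x _.
by rewrite IH addrAC.
Qed.

Lemma chis_std_gauss n (l a : 'I_n -> R) F (z : R) : measurable_fun setT F -> (forall x, 0 <= F x)%E ->
  (\int[@std_gauss R n]_g F (z + \sum_i (Num.sqrt (l i) * g i 0 + a i) ^+ 2)%R =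
   chis [seq (l i, a i) | i <- enum 'I_n] F z)%E.
Proof.
move=> mF F0; elim: n l a z => [|n IH] l a z.
  rewrite std_gauss0_integral//; first by rewrite big_ord0 addr0 enum_ord0.
  by rewrite (_ : (fun _ => _) = cst (F z)) //; apply/funext => g; rewrite big_ord0 addr0.
have mS m (l' a' : 'I_m -> R) z' : measurable_fun setT (fun g : 'cV[R]_m => z' + \sum_i (Num.sqrt (l' i) * g i 0 + a' i) ^+ 2).
  apply: measurable_funD => //; apply: measurable_sum => i; apply: measurable_funX.
  by apply: measurable_funD => //; apply: measurable_funM => //; exact: measurable_mx_entry.
rewrite ge0_integral_std_gaussS//; last exact: (measurableT_comp mF (mS _ _ _ _)).
rewrite enum_ordSl /= -map_comp; apply: eq_integral => x _.
rewrite -IH; apply: eq_integral => g _.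
by rewrite (sum_ccons x g (fun i t => (Num.sqrt (l i) * t + a i) ^+ 2)) addrA.
Qed.

End chi2.

(** * Density bound from two coordinates *)

Section lipschitz.
Context (R : realType).
Local Notation N1 := (@normal_prob R 0 1).
Local Notation mu := (@lebesgue_measure R).
Implicit Types (F G : R -> \bar R) (c : R * R) (s : seq (R * R)).

Definition slab (x h y : R) : \bar R := (if x < y <= x + h then 1 else 0)%:E.

(* The law of the associated noncentral quadratic form has density at most [L]. *)
Definition lip_law (L : R) s := forall x h z, 0 <= h -> (chis s (slab x h) z <= (L * h)%:E)%E.

Lemma slab_ge0 x h y : (0 <= slab x h y)%E. Proof. by rewrite /slab lee_fin; case: ifP. Qed.

Lemma measurable_slab x h : measurable_fun setT (slab x h).
Proof.
apply/measurable_EFinP; apply: measurable_fun_ifT => //.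
by apply: measurable_and; [exact: measurable_fun_ltr|exact: measurable_fun_ler].
Qed.

Definition below (rho y : R) : \bar R := (if y <= rho then 1 else 0)%:E.

Lemma below_ge0 rho y : (0 <= below rho y)%E. Proof. by rewrite /below lee_fin; case: ifP. Qed.

Lemma measurable_below rho : measurable_fun setT (below rho).
Proof. by apply/measurable_EFinP; apply: measurable_fun_ifT => //; exact: measurable_fun_ler. Qed.

Lemma lip_law_perm L s t : perm_eq s t -> lip_law L s -> lip_law L t.
Proof.
move=> st H x h z h0; rewrite -(perm_chis st); first exact: H.
- exact: measurable_slab.
- exact: slab_ge0.
Qed.

(** Further independent terms average translates of the law, which preserves a bound on its
    density. *)
Lemma lip_law_cat L s t : lip_law L s -> lip_law L (t ++ s).
Proof.
move=> H x h z h0; rewrite chis_cat -[leRHS]/((fun=> (L * h)%:E) z) -(chis_cst t (L * h)).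
apply: le_chis => //.
- by apply: measurable_chis; [exact: measurable_slab|exact: slab_ge0].
- by apply: chis_ge0; exact: slab_ge0.
- by move=> y; exact: H.
Qed.

Lemma le_lip_law L L' s : L <= L' -> lip_law L s -> lip_law L' s.
Proof. by move=> LL H x h z h0; apply: le_trans (H _ _ _ h0) _; rewrite lee_fin ler_wpM2r. Qed.

Lemma normal_le_lebesgue F : measurable_fun setT F -> (forall x, 0 <= F x)%E ->
  (\int[N1]_x F x <= \int[mu]_x F x)%E.
Proof.
move=> mF F0; rewrite ge0_integral_normal//; apply: ge0_le_integral => //.
- by move=> x _; rewrite mule_ge0// lee_fin normal_pdf_ge0.
- by apply: emeasurable_funM => //; apply/measurable_EFinP; exact: measurable_normal_pdf.
- move=> x _; rewrite -[leRHS]mule1; apply: lee_wpmul2l => //.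
  rewrite lee_fin normal_pdf01 ler_pdivrMr ?sqrtr_gt0 ?mulr_gt0 ?pi_gt0// mul1r.
  apply: (@le_trans _ _ 1); first by rewrite -[leRHS]expR0 ler_expR mulNr oppr_le0 mulr_ge0 ?sqr_ge0.
  by apply: ler_sqrt_sqr => //; have := pi_ge2 R; lra.
Qed.

Let plane F := (\int[mu]_u \int[mu]_v F (u ^+ 2 + v ^+ 2)%R)%E.

Let mplane F : measurable_fun setT F ->
  measurable_fun setT (fun y : measurableTypeR R * measurableTypeR R => F (y.1 ^+ 2 + y.2 ^+ 2)).
Proof.
move=> mF; apply: (measurableT_comp mF); apply: measurable_funD; apply: measurable_funX.
  exact: measurable_fst.
exact: measurable_snd.
Qed.

Let minner F : measurable_fun setT F -> (forall x, 0 <= F x)%E ->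
  measurable_fun setT (fun u : R => \int[mu]_v F (u ^+ 2 + v ^+ 2)%R)%E.
Proof.
move=> mF F0; apply: (@measurable_fun_fubini_tonelli_F _ _ _ _ _ mu
  (fun y : measurableTypeR R * measurableTypeR R => F (y.1 ^+ 2 + y.2 ^+ 2))) => //.
exact: mplane.
Qed.

Let msq F (u : R) : measurable_fun setT F -> measurable_fun setT (fun v : R => F (u ^+ 2 + v ^+ 2)).
Proof. by move=> mF; apply: (measurableT_comp mF); apply: measurable_funD => //; exact: measurable_funX. Qed.

Let plane_scale F (k : R) : measurable_fun setT F -> (forall x, 0 <= F x)%E -> 0 < k ->
  plane F = ((k ^+ 2)%:E * plane (fun y : R => F (k ^+ 2 * y)%R))%E.
Proof.
move=> mF F0 k0.
have mk : measurable_fun setT (fun y : R => F (k ^+ 2 * y)).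
  by apply: (measurableT_comp mF); exact: measurable_funM.
have i0 u : (0 <= \int[mu]_v F (u ^+ 2 + v ^+ 2)%R)%E by exact: integral_ge0.
have aff (H : R -> \bar R) : measurable_fun setT H -> (forall x, 0 <= H x)%E ->
    (\int[mu]_t H t = k%:E * \int[mu]_t H (k * t + 0)%R)%E.
  move=> mH H0; rewrite ge0_integral_affine1 ?gt_eqF// gtr0_norm// muleA -EFinM divff ?gt_eqF//.
  by rewrite mul1e.
have J0 (t : R) : (0 <= \int[mu]_r F (k ^+ 2 * (t ^+ 2 + r ^+ 2))%R)%E by exact: integral_ge0.
have e (t : R) : (\int[mu]_v F ((k * t + 0) ^+ 2 + v ^+ 2)%R = k%:E * \int[mu]_r F (k ^+ 2 * (t ^+ 2 + r ^+ 2))%R)%E.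
  rewrite (aff _ (msq _ mF) (fun v => F0 _)).
  by congr (_ * _)%E; apply: eq_integral => v _; congr F; ring.
rewrite [LHS](aff _ (minner mF F0) i0); under eq_integral do rewrite e.
rewrite ge0_integralZl//; last 2 first.
- exact: (minner mk (fun y => F0 _)).
- by rewrite lee_fin ltW.
by rewrite muleA -EFinM expr2.
Qed.

Let disc : (plane (below 1) <= 4%:E)%E.
Proof.
have b0 := below_ge0; have mb := measurable_below.
pose A : set R := `[-1, 1]%classic.
have mA : measurable A by exact: measurable_itv.
have muA : (\int[mu]_v (\1_A v)%:E = 2%:E)%E.
  rewrite integral_indic// setIT /= lebesgue_measure_itv /= lte_fin.
  by rewrite gtrN// -EFinB; congr EFin; rewrite opprK.
have mi : measurable_fun setT (fun v : R => (\1_A v)%:E : \bar R).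
  by apply/measurable_EFinP; exact: measurable_indic.
apply: (@le_trans _ _ (\int[mu]_u (2%:E * (\1_A u)%:E))%E); last first.
  rewrite ge0_integralZl// muA -EFinM lee_fin; lra.
apply: ge0_le_integral => //.
- by move=> u _; exact: integral_ge0.
- exact: minner.
- exact: measurable_funeM.
move=> u _; rewrite -muA -ge0_integralZr//.
apply: ge0_le_integral => //.
- exact: msq.
- by apply: emeasurable_funM.
move=> v _; rewrite -EFinM lee_fin /= !indicE.
case: ifP => [h|_]; last by rewrite mulr_ge0.
have hA (x : R) : x ^+ 2 <= 1 -> (x \in A) = true.
  by move=> x1; apply/mem_set; rewrite /A /= in_itv /= -ler_norml -(@expr_le1 _ 2)// real_normK ?num_real.
by rewrite !hA ?mulr1//; have := sqr_ge0 u; have := sqr_ge0 v; lra.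
Qed.

(** Areas of discs scale with the squared radius, so an annulus between the squared radii [y >= 0]
    and [y + h] has [h] times the area of the unit disc. The constant 4 is the area of the square
    around that disc. *)
Let annulus (y h : R) : 0 <= h -> (plane (slab y h) <= (4 * h)%:E)%E.
Proof.
have b0 := below_ge0; have mb := measurable_below.
move=> h0.
have plane_ge0 F : (forall x, 0 <= F x)%E -> (0 <= plane F)%E.
  by move=> F0; apply: integral_ge0 => u _; exact: integral_ge0.
have leplane F G : measurable_fun setT F -> measurable_fun setT G -> (forall x, 0 <= F x)%E ->
    (forall x : R, (0 <= x)%R -> F x <= G x)%E -> (plane F <= plane G)%E.
  move=> mF mG F0 FG; have e (u v : R) : (F (u ^+ 2 + v ^+ 2)%R <= G (u ^+ 2 + v ^+ 2)%R)%E.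
    by apply: FG; rewrite addr_ge0 ?sqr_ge0.
  apply: ge0_le_integral => //.
  - by move=> u _; exact: integral_ge0.
  - exact: minner.
  - apply: (@measurable_fun_fubini_tonelli_F _ _ _ _ _ mu
      (fun y : measurableTypeR R * measurableTypeR R => G (y.1 ^+ 2 + y.2 ^+ 2))); first exact: mplane.
    by move=> z; apply: le_trans (e z.1 z.2).
  - by move=> u _; apply: ge0_le_integral => //; exact: msq.
have below_scale (s : R) : 0 < s -> plane (below s) = (s%:E * plane (below 1))%E.
  move=> s0; have q0 : 0 < Num.sqrt s by rewrite sqrtr_gt0.
  rewrite (plane_scale (measurable_below s) (below_ge0 s) q0) sqr_sqrtr; last exact: ltW.
  congr (_ * plane _)%E; apply/funext => x; rewrite /below.
  by rewrite -[X in _ <= X]mulr1 ler_pM2l.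
have d0 : (0 <= plane (below 1))%E by exact: plane_ge0.
have fd : plane (below 1) \is a fin_num.
  by rewrite ge0_fin_numE// (le_lt_trans disc)// ltry.
move: h0; rewrite le_eqVlt => /predU1P[<-|h0].
  rewrite mulr0 (_ : slab y 0 = cst 0%E).
    by rewrite /plane /=; under eq_integral do rewrite integral0; rewrite integral0.
  by apply/funext => x; rewrite /slab addr0 /=; case: ltP => //= ?; case: leP => //; lra.
have hd : (h%:E * plane (below 1) <= (4 * h)%:E)%E.
  by rewrite mulrC EFinM lee_wpmul2l ?lee_fin ?(ltW h0)//; exact: disc.
have [y0|y0] := leP y 0.
  apply: le_trans hd; rewrite -below_scale//; apply: leplane => //; first exact: measurable_slab.
    exact: slab_ge0.
  move=> x x0; rewrite /slab /below lee_fin; case: ifP => [/andP[h1 h2]|_]; last by case: ifP.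
  by case: ifP => //; lra.
have sp F G : measurable_fun setT F -> measurable_fun setT G -> (forall x, 0 <= F x)%E -> (forall x, 0 <= G x)%E ->
   (plane F + plane G = plane (fun x => F x + G x))%E.
  move=> mF mG F0 G0; rewrite /plane -ge0_integralD//; last 4 first.
  - by move=> u _; exact: integral_ge0.
  - exact: minner.
  - by move=> u _; exact: integral_ge0.
  - exact: minner.
  by apply: eq_integral => u _; rewrite -ge0_integralD//; exact: msq.
have e : (plane (below y) + plane (slab y h) = plane (below (y + h)))%E.
  rewrite (sp _ _ (mb y) (measurable_slab y h) (b0 y) (slab_ge0 y h)).
  congr plane; apply/funext => x; rewrite /below /slab -EFinD; congr _%:E.
  case: (leP x y) => xy /=; last by rewrite add0r.
  by rewrite addr0; case: leP => //; lra.
move: e; rewrite (below_scale y y0) (below_scale (y + h) (addr_gt0 y0 h0)).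
move: d0 fd hd; move: (plane (below 1)) (plane_ge0 _ (slab_ge0 y h)).
case=> [d| |]// + d0 _; case: (plane (slab y h)) => [p| |]// p0.
rewrite -!EFinM -!EFinD !lee_fin => hd [] hp.
by move: hd hp; lra.
Qed.

(** The planar normal density is at most 1, and an affine substitution turns the event into an
    annulus. Two coordinates are taken together because the square of a single one has an unbounded
    density. *)
Lemma lip_law2 l1 l2 a1 a2 : 0 < l1 -> 0 < l2 ->
  lip_law (4 / (Num.sqrt l1 * Num.sqrt l2)) [:: (l1, a1); (l2, a2)].
Proof.
move=> l10 l20 x h z h0 /=.
have s1 : 0 < Num.sqrt l1 by rewrite sqrtr_gt0.
have s2 : 0 < Num.sqrt l2 by rewrite sqrtr_gt0.
pose F y := slab x h (z + y).
have mF : measurable_fun setT F by apply: (measurableT_comp (measurable_slab x h)); exact: measurable_funD.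
have F0 y : (0 <= F y)%E by exact: slab_ge0.
have mFu (u : R) : measurable_fun setT (fun v : R => F (u + v ^+ 2)).
  by apply: (measurableT_comp mF); apply: measurable_funD => //; exact: measurable_funX.
apply: (@le_trans _ _ (\int[mu]_t \int[mu]_r F ((Num.sqrt l1 * t + a1) ^+ 2 + (Num.sqrt l2 * r + a2) ^+ 2)%R)%E).
  have mm (t : R) : measurable_fun setT (fun r : R => F ((Num.sqrt l1 * t + a1) ^+ 2 + (Num.sqrt l2 * r + a2) ^+ 2)%R).
    apply: (measurableT_comp mF); apply: measurable_funD => //; apply: measurable_funX.
    by apply: measurable_funD => //; exact: measurable_funM.
  have mp : measurable_fun setT (fun y : measurableTypeR R * measurableTypeR R =>
      F ((Num.sqrt l1 * y.1 + a1) ^+ 2 + (Num.sqrt l2 * y.2 + a2) ^+ 2)).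
    apply: (measurableT_comp mF); apply: measurable_funD; apply: measurable_funX; apply: measurable_funD => //.
      by apply: measurable_funM => //; exact: measurable_fst.
    by apply: measurable_funM => //; exact: measurable_snd.
  have mi (m : {sigma_finite_measure set (measurableTypeR R) -> \bar R}) : measurable_fun setT (fun t : R => \int[m]_r F ((Num.sqrt l1 * t + a1) ^+ 2 + (Num.sqrt l2 * r + a2) ^+ 2)%R)%E.
    exact: (@measurable_fun_fubini_tonelli_F _ _ _ _ _ m _ mp).
  apply: (@le_trans _ _ (\int[N1]_t \int[mu]_r F ((Num.sqrt l1 * t + a1) ^+ 2 + (Num.sqrt l2 * r + a2) ^+ 2)%R)%E).
    have -> : chi2 (l1, a1) (chi2 (l2, a2) (slab x h)) z = (\int[N1]_t \int[N1]_r F ((Num.sqrt l1 * t + a1) ^+ 2 + (Num.sqrt l2 * r + a2) ^+ 2)%R)%E.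
      by apply: eq_integral => t _; apply: eq_integral => r _; rewrite /F addrA.
    apply: le_normal => [|||t].
    - exact: (mi N1).
    - exact: (mi mu).
    - by move=> t; exact: integral_ge0.
    - exact: normal_le_lebesgue.
  by apply: normal_le_lebesgue; [exact: (mi mu)|move=> t; exact: integral_ge0].
have i0 u : (0 <= \int[mu]_v F (u ^+ 2 + v ^+ 2)%R)%E by exact: integral_ge0.
under eq_integral => t _.
  rewrite (ge0_integral_affine1 a2 (F := fun v => F ((Num.sqrt l1 * t + a1) ^+ 2 + v ^+ 2)) (lt0r_neq0 s2)) //.
  over.
rewrite ge0_integralZl//; last first.
  have := @measurable_affine1 R (Num.sqrt l1) a1; exact: (measurableT_comp (minner mF F0)).
rewrite (ge0_integral_affine1 a1 (F := fun u => \int[mu]_v F (u ^+ 2 + v ^+ 2)%R)%E (lt0r_neq0 s1))//; last exact: minner.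
rewrite !gtr0_norm// muleA -EFinM -[X in (_ * X)%E]/(plane F).
have -> : F = slab (x - z) h.
  by apply/funext => y; rewrite /F /slab; congr (if _ then _ else _)%:E; congr andb; apply/idP/idP; lra.
apply: le_trans (lee_wpmul2l _ (annulus (x - z) h0)) _; first by rewrite lee_fin mulr_ge0// invr_ge0 ltW.
by rewrite -EFinM lee_fin invfM; lra.
Qed.

End lipschitz.

(** * Density bound from characteristic functions *)

Section fourier.
Context (R : realType).
Local Notation N1 := (@normal_prob R 0 1).
Local Notation mu := (@lebesgue_measure R).
Implicit Types (F G : R -> \bar R) (c : R * R) (s : seq (R * R)).

(** Each independent term multiplies the complex amplitude with coordinates [p], [q] by its
    characteristic function at [t] (up to conjugation), so squared moduli multiply. *)
Lemma chis_trig (k t : R) : (forall l a : R, 0 <= l ->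
    Ecos (fun x => t * (Num.sqrt l * x + a) ^+ 2) ^+ 2 +
    Esin (fun x => t * (Num.sqrt l * x + a) ^+ 2) ^+ 2 <= (Num.sqrt (1 + k * (t ^+ 2 * l ^+ 2)))^-1) ->
  forall s (p q : R), {in s, forall c, 0 <= c.1} ->
  exists p' q', chis s (fun x => (1 + p * cos (t * x) + q * sin (t * x))%:E) =
     (fun z => (1 + p' * cos (t * z) + q' * sin (t * z))%:E) /\
  p' ^+ 2 + q' ^+ 2 <= (p ^+ 2 + q ^+ 2) * \prod_(c <- s) (Num.sqrt (1 + k * (t ^+ 2 * c.1 ^+ 2)))^-1.
Proof.
move=> hk; elim=> [|c s IH] p q hs; first by exists p, q; rewrite big_nil mulr1.
have [|p' [q' [E le]]] := IH p q; first by move=> d ds; apply: hs; rewrite inE ds orbT.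
have c0 : 0 <= c.1 by apply: hs; rewrite mem_head.
pose Y x := t * (Num.sqrt c.1 * x + c.2) ^+ 2.
have mY : measurable_fun setT Y.
  by apply: measurable_funM => //; apply: measurable_funX; apply: measurable_funD.
exists (p' * Ecos Y + q' * Esin Y), (q' * Ecos Y - p' * Esin Y); split.
  rewrite /= E; apply/funext => z; rewrite /chi2.
  transitivity (1 + (p' * cos (t * z) + q' * sin (t * z)) * Ecos Y + (q' * cos (t * z) - p' * sin (t * z)) * Esin Y)%:E; last first.
    by congr EFin; ring.
  rewrite -normal_trig//; apply: eq_integral => x _; congr EFin.
  by rewrite mulrDr -/(Y x) cosD sinD; ring.
rewrite big_cons; set r := (Num.sqrt _)^-1; set P := \prod_(_ <- s) _.
have -> : (p' * Ecos Y + q' * Esin Y) ^+ 2 + (q' * Ecos Y - p' * Esin Y) ^+ 2 =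
   (p' ^+ 2 + q' ^+ 2) * (Ecos Y ^+ 2 + Esin Y ^+ 2) by ring.
rewrite (mulrC r) mulrA; apply: ler_pM => //.
- by rewrite addr_ge0 ?sqr_ge0.
- by rewrite addr_ge0 ?sqr_ge0.
- exact: hk.
Qed.

Lemma chis_fubini s (K : measurableTypeR R * measurableTypeR R -> \bar R) :
  measurable_fun setT K -> (forall y, 0 <= K y)%E ->
  measurable_fun setT (fun y : measurableTypeR R * measurableTypeR R => chis s (fun x => K (y.1, x)) y.2) /\
  forall z, chis s (fun x => \int[N1]_u K (u, x))%E z = (\int[N1]_u chis s (fun x => K (u, x)) z)%E.
Proof.
move=> mK K0; elim: s => [|c s [mIH IH]] /=.
  split => //; rewrite (_ : (fun _ => _) = K)//.
  by apply/funext => -[].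
pose H y := chis s (fun x => K (y.1, x)) y.2.
have H0 y : (0 <= H y)%E by apply: chis_ge0 => x.
split.
  apply: (@measurable_fun_fubini_tonelli_F _ _ _ _ _ N1
    (fun y : (measurableTypeR R * measurableTypeR R) * measurableTypeR R => H (y.1.1, y.1.2 + (Num.sqrt c.1 * y.2 + c.2) ^+ 2)%R)) => //.
  apply: (measurableT_comp mIH); apply: measurable_fun_pair.
    exact: (measurableT_comp measurable_fst measurable_fst).
  apply: measurable_funD; first exact: (measurableT_comp measurable_snd measurable_fst).
  apply: measurable_funX; apply: measurable_funD => //.
  by apply: measurable_funM => //; exact: measurable_snd.
move=> z; rewrite /chi2.
under eq_integral do rewrite IH.
have mH : measurable_fun setT (fun y : measurableTypeR R * measurableTypeR R => H (y.2, z + (Num.sqrt c.1 * y.1 + c.2) ^+ 2)%R).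
  apply: (measurableT_comp mIH); apply: measurable_fun_pair; first exact: measurable_snd.
  apply: measurable_funD => //; apply: measurable_funX; apply: measurable_funD => //.
  by apply: measurable_funM => //; exact: measurable_fst.
exact: (@fubini_tonelli _ _ _ _ _ N1 N1 _ mH (fun y => H0 _)).
Qed.

(** With [theta = c.1 ^ 2 / m <= 1], Bernoulli's inequality gives
    [1 + theta * y >= (1 + y) ^ theta], and the exponents [theta] sum to at least 4. The square root
    of the result decays like [t ^ (- 2)] and is therefore integrable. *)
Lemma prod_decay (k t m : R) s : 0 <= k -> 0 < m -> {in s, forall c, c.1 ^+ 2 <= m} ->
  4 * m <= \sum_(c <- s) c.1 ^+ 2 ->
  \prod_(c <- s) (Num.sqrt (1 + k * (t ^+ 2 * c.1 ^+ 2)))^-1 <= ((1 + k * (t ^+ 2 * m))^-1) ^+ 2.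
Proof.
move=> k0 m0 hs sm; set y := k * (t ^+ 2 * m).
have y0 : 0 <= y by rewrite /y mulr_ge0// mulr_ge0 ?sqr_ge0// ltW.
have y1 : 0 < 1 + y by lra.
set Lm := ln (1 + y); have L0 : 0 <= Lm by rewrite ln_ge0//; lra.
have EL : expR Lm = 1 + y by rewrite lnK.
apply: (@le_trans _ _ (\prod_(c <- s) expR (- (c.1 ^+ 2 / m / 2 * Lm)))).
  rewrite big_seq [leRHS]big_seq; apply: ler_prod => c cs; rewrite invr_ge0 sqrtr_ge0/=.
  have th : 0 <= c.1 ^+ 2 / m <= 1.
    by rewrite divr_ge0 ?sqr_ge0 ?(ltW m0)//= ler_pdivrMr// mul1r hs.
  have -> : 1 + k * (t ^+ 2 * c.1 ^+ 2) = 1 + c.1 ^+ 2 / m * y.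
    by rewrite /y; field; rewrite gt_eqF.
  rewrite expRN lef_pV2 ?posrE ?expR_gt0//; last first.
    by rewrite sqrtr_gt0; have /andP[h _] := th; have := mulr_ge0 h y0; lra.
  apply: ler_sqrt_sqr; rewrite ?expR_ge0// -expRM_natl.
  have -> : 2%:R * (c.1 ^+ 2 / m / 2 * Lm) = c.1 ^+ 2 / m * Lm by field; rewrite gt_eqF.
  by apply: le_trans (expR_convex01 _ th) _; rewrite EL; lra.
rewrite -expR_sum sumrN -mulr_suml -mulr_suml -mulr_suml -EL -expRN -expRM_natl ler_expR.
have : 4 <= (\sum_(c <- s) c.1 ^+ 2) / m by rewrite ler_pdivlMr.
set X := _ / m => X4; nra.
Qed.

Lemma integral_oneDsqrV : exists2 C : R, 0 < C &
  (\int[mu]_x ((1 + x ^+ 2)^-1)%:E <= C%:E)%E.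
Proof.
exists pi; first exact: pi_gt0.
have := @ge0_symfun_integralT R (fun x => (oneDsqr x)^-1) _ _ _.
have -> : [set x : R | 0 <= x] = `[0%R, +oo[%classic.
  by apply/seteqP; split => x /=; rewrite in_itv /= andbT.
rewrite integral0y_oneDsqr => ->.
- by rewrite -EFinM lee_fin; lra.
- by move=> x; rewrite invr_ge0 addr_ge0// sqr_ge0.
- exact: continuous_oneDsqrV.
- by move=> x; rewrite /= /oneDsqr sqrrN.
Qed.

(* Fubini with the majorant [2 * charN ((y - y0) / h)] of the indicator of the
   interval of center [y0] and length [h]. *)
Lemma lip_law_small : exists2 C : R, 0 < C & forall s (m : R), 0 < m ->
  {in s, forall c, 0 <= c.1} -> {in s, forall c, c.1 ^+ 2 <= m} ->
  4 * m <= \sum_(c <- s) c.1 ^+ 2 -> lip_law (C / Num.sqrt m) s.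
Proof.
have [k k0 hk] := @chi2_char R; have [C1 C10 hC1] := integral_oneDsqrV.
exists (2 * C1 / Num.sqrt k); first by rewrite divr_gt0 ?mulr_gt0 ?sqrtr_gt0.
move=> s m m0 s0 sm ssum x h z; rewrite le_eqVlt => /predU1P[<-|h0].
  rewrite mulr0 (_ : slab x 0 = fun=> 0%:E) ?chis_cst//.
  by apply/funext => y; rewrite /slab addr0 /=; case: ltP => //= ?; case: leP => //; lra.
pose y0 := x + h / 2.
pose W u y := (1 + cos (u * ((y - y0) / h)))%:E : \bar R.
have W0 u y : (0 <= W u y)%E by rewrite lee_fin; have := cos_geN1 (u * ((y - y0) / h)); lra.
have mW : measurable_fun setT (fun y : measurableTypeR R * measurableTypeR R => W y.1 y.2).
  apply/measurable_EFinP; apply: measurable_funD => //.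
  apply: (measurableT_comp (continuous_measurable_fun (@continuous_cos R))).
  apply: measurable_funM; first exact: measurable_fst.
  by apply: measurable_funM => //; apply: measurable_funB => //; exact: measurable_snd.
have [_ fub] := chis_fubini s mW (fun y => W0 _ _).
have Wc y : (\int[N1]_u W u y = (1 + charN ((y - y0) / h))%:E)%E.
  rewrite /charN -normal_cos; last by apply: measurable_funM.
  by apply: eq_integral => u _; rewrite /W mulrC.
have decay u : (chis s (W u) z <= (1 + (1 + k * ((u / h) ^+ 2 * m))^-1)%:E)%E.
  pose t := u / h.
  have [p' [q' [E le]]] := chis_trig (hk t) (cos (t * y0)) (sin (t * y0)) s0.
  have -> : W u = (fun y => (1 + cos (t * y0) * cos (t * y) + sin (t * y0) * sin (t * y))%:E).
    apply/funext => y; rewrite /W -addrA; congr (1 + _)%:E.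
    rewrite (_ : u * ((y - y0) / h) = t * y - t * y0); last by rewrite /t; ring.
    by rewrite cosB; ring.
  rewrite E lee_fin -addrA lerD2l.
  set rho := (1 + _)^-1.
  have rho0 : 0 <= rho 
    by rewrite invr_ge0 addr_ge0// mulr_ge0 ?(ltW k0)// mulr_ge0 ?sqr_ge0// ltW.
  have pq : p' ^+ 2 + q' ^+ 2 <= rho ^+ 2.
    apply: le_trans le _; have := cos2Dsin2 (t * y0) => ->; rewrite mul1r.
    exact: prod_decay (ltW k0) m0 sm ssum.
  set X := p' * _ + q' * _; have [X0|X0] := leP X 0; first exact: le_trans X0 rho0.
  (* Cauchy-Schwarz: an amplitude of modulus at most [rho] gives a trigonometric value of at most
     [rho]. *)
  rewrite -ler_sqr ?nnegrE ?(ltW X0)//; apply: le_trans pq.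
  have cs := cos2Dsin2 (t * z); rewrite /X.
  set C := cos (t * z) in cs *; set S := sin (t * z) in cs *.
  have : 0 <= (p' * S - q' * C) ^+ 2 by exact: sqr_ge0.
  by have : (p' ^+ 2 + q' ^+ 2) * (C ^+ 2 + S ^+ 2) = p' ^+ 2 + q' ^+ 2 by [rewrite cs mulr1]; nra.
pose kp := Num.sqrt k * Num.sqrt m / h.
have kp0 : 0 < kp by rewrite divr_gt0// mulr_gt0// sqrtr_gt0.
have kpE u : k * ((u / h) ^+ 2 * m) = (kp * u + 0) ^+ 2.
  rewrite addr0 /kp !exprMn !exprVn !sqr_sqrtr ?ltW//; ring.
pose V u := ((1 + (kp * u + 0) ^+ 2)^-1)%:E : \bar R.
have mV1 : measurable_fun setT (fun x : R => ((1 + x ^+ 2)^-1)%:E : \bar R).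
  apply/measurable_EFinP; apply: (measurableT_comp (@measurable_invr R)).
  by apply: measurable_funD => //; exact: measurable_funX.
have mV : measurable_fun setT V.
  by have := @measurable_affine1 R kp 0; exact: (measurableT_comp mV1).
have V10 (x' : R) : (0 <= ((1 + x' ^+ 2)^-1)%:E)%E.
  by rewrite lee_fin invr_ge0 addr_ge0// sqr_ge0.
have V0 u : (0 <= V u)%E by exact: V10.
have intV : (\int[N1]_u V u <= (C1 / kp)%:E)%E.
  apply: le_trans (normal_le_lebesgue mV V0) _.
  rewrite (ge0_integral_affine1 0 (F := fun x => ((1 + x ^+ 2)^-1)%:E) (lt0r_neq0 kp0))//.
  by rewrite gtr0_norm// (mulrC C1) EFinM lee_wpmul2l ?lee_fin ?invr_ge0 ?(ltW kp0).
have upper : (\int[N1]_u chis s (W u) z <= (1 + C1 / kp)%:E)%E.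
  apply: (@le_trans _ _ (\int[N1]_u (1%:E + V u))%E).
    apply: le_normal => [|||u].
    - have [mm _] := chis_fubini s mW (fun y => W0 _ _).
      have mz : measurable_fun setT (fun u : measurableTypeR R => (u, z) : measurableTypeR R * measurableTypeR R).
        exact: measurable_fun_pair.
      exact: (measurableT_comp mm mz).
    - exact: emeasurable_funD.
    - by move=> u; apply: chis_ge0 => y; exact: W0.
    - by apply: le_trans (decay u) _; rewrite /V -EFinD kpE.
  by rewrite ge0_integralD// normal_cst EFinD leeD2l.
have msl := measurable_slab x h.
have mI : measurable_fun setT (fun y : R => \int[N1]_u W u y)%E.
  apply: (@measurable_fun_fubini_tonelli_F _ _ _ _ _ N1
    (fun y : measurableTypeR R * measurableTypeR R => W y.2 y.1)) => //.
  have msw : measurable_fun setT (fun y : measurableTypeR R * measurableTypeR R => (y.2, y.1)).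
    by apply: measurable_fun_pair; [exact: measurable_snd|exact: measurable_fst].
  exact: (measurableT_comp mW msw).
(* Adding 2 replaces the majorant [2 * charN] by the mean of [2 * (1 + cos)], which is nonnegative
   as Tonelli requires; the 2 cancels at the end. On the interval the argument of [charN] is at most
   [1 / 2] in absolute value, so [charN >= 7 / 8]. *)
have : (chis s (slab x h) z + 2%:E <= 2%:E * (1 + C1 / kp)%:E)%E.
  have -> : (chis s (slab x h) z + 2%:E = chis s (fun y => slab x h y + 2%:E) z)%E.
    rewrite chisD//; [by rewrite chis_cst|exact: slab_ge0].
  apply: (@le_trans _ _ (chis s (fun y => (\int[N1]_u W u y) + (\int[N1]_u W u y))%E z)).
    apply: le_chis => //.
    - by apply: emeasurable_funD.
    - by apply: emeasurable_funD.
    - by move=> y; rewrite adde_ge0 ?slab_ge0// lee_fin.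
    move=> y; rewrite !Wc -!EFinD lee_fin /slab.
    case: ifP => [/andP[h1 h2]|_]; last by rewrite add0r; have := charN_ge0 ((y - y0) / h); lra.
    have := charN_ge ((y - y0) / h).
    have : ((y - y0) / h) ^+ 2 <= 1 / 4.
      rewrite exprMn exprVn ler_pdivrMr ?exprn_gt0// /y0; nra.
    lra.
  rewrite chisD//; last 2 first.
  - by move=> y; exact: integral_ge0.
  - by move=> y; exact: integral_ge0.
  rewrite fub; apply: le_trans (leeD upper upper) _.
  by rewrite -EFinM -EFinD lee_fin; lra.
have := chis_ge0 s (slab_ge0 x h) z; case: (chis s (slab x h) z) => [r| |]//.
rewrite -EFinM -EFinD !lee_fin => _.
have -> : 2 * C1 / Num.sqrt k / Num.sqrt m * h = 2 * (C1 / kp).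
  by rewrite /kp; field; rewrite !gt_eqF ?sqrtr_gt0.
lra.
Qed.

(** With two terms above [v / 20], [lip_law2] applies. With at most one, the others retain
    [3 / 5 * v - 2 / 5 * v = 4 * (v / 20)], as [lip_law_small] requires. The total [3 / 5 * v] is
    what is left of [v] when one term is deleted. *)
Lemma lip_law_spread : exists2 C : R, 0 < C & forall s (v : R), 0 < v ->
  {in s, forall c, 0 <= c.1} -> {in s, forall c, c.1 ^+ 2 <= 2 / 5 * v} ->
  3 / 5 * v <= \sum_(c <- s) c.1 ^+ 2 -> lip_law (C / Num.sqrt v) s.
Proof.
have [C C0 hC] := lip_law_small.
pose k : R := Num.sqrt 20.
have k0 : 0 < k by rewrite sqrtr_gt0.
exists ((4 + C) * k); first by rewrite mulr_gt0// addr_gt0.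
move=> s v v0 s0 sv ssum.
have v20 : 0 < v / 20 by lra.
have sqE : Num.sqrt (v / 20) = Num.sqrt v / k by rewrite sqrtrM ?ltW// sqrtrV.
have sv0 : 0 < Num.sqrt v by rewrite sqrtr_gt0.
pose big c := v / 20 < c.1 ^+ 2.
pose sb := [seq c <- s | big c]; pose ss := [seq c <- s | ~~ big c].
have perm_s : perm_eq (sb ++ ss) s by rewrite perm_sym -(perm_filterC big) perm_refl.
apply: (lip_law_perm perm_s).
have sumE : \sum_(c <- s) c.1 ^+ 2 = \sum_(c <- sb) c.1 ^+ 2 + \sum_(c <- ss) c.1 ^+ 2.
  by rewrite -big_cat /=; apply: perm_big; rewrite perm_sym.
have small : 4 * (v / 20) <= \sum_(c <- ss) c.1 ^+ 2 -> lip_law ((4 + C) * k / Num.sqrt v) (sb ++ ss).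
  move=> hsum; apply: lip_law_cat; apply: (@le_lip_law _ (C / Num.sqrt (v / 20))).
    rewrite sqE invf_div mulrA -!mulrA ler_pM2r ?mulr_gt0 ?invr_gt0//; lra.
  apply: hC => // c; rewrite mem_filter => /andP[h cs]; first exact: s0.
  by rewrite leNgt.
have memb c : c \in sb -> [/\ 0 <= c.1, c.1 ^+ 2 <= 2 / 5 * v & v / 20 < c.1 ^+ 2].
  by rewrite mem_filter => /andP[h cs]; split; [exact: s0|exact: sv|].
move: memb sumE small; case: sb {perm_s} => [|c1 [|c2 sb]] memb.
- by rewrite big_nil add0r => sumE; apply; rewrite -sumE; lra.
- rewrite big_seq1 => sumE; apply; have [_ h _] := memb c1 (mem_head _ _).
  by rewrite sumE in ssum; lra.
move=> _ _.
have [l10 _ h1] := memb c1 (mem_head _ _).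
have [l20 _ h2] : [/\ 0 <= c2.1, c2.1 ^+ 2 <= 2 / 5 * v & v / 20 < c2.1 ^+ 2].
  by apply: memb; rewrite !inE eqxx orbT.
have gtm (l : R) : 0 <= l -> v / 20 < l ^+ 2 -> Num.sqrt (v / 20) < l.
  move=> l0 hl; rewrite -(ger0_norm l0) -sqrtr_sqr ltr_sqrt//.
  by apply: lt_trans hl.
have g1 := gtm _ l10 h1; have g2 := gtm _ l20 h2.
set m := Num.sqrt (v / 20) in g1 g2.
have m0 : 0 < m by rewrite sqrtr_gt0.
have p1 : 0 < c1.1 by lra.
have p2 : 0 < c2.1 by lra.
apply: (@lip_law_perm _ _ ((sb ++ ss) ++ [:: c1; c2])).
  by rewrite perm_catC.
apply: lip_law_cat.
apply: (@le_lip_law _ (4 / (Num.sqrt c1.1 * Num.sqrt c2.1))); last first.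
  by have := lip_law2 c1.2 c2.2 p1 p2; rewrite -!surjective_pairing.
apply: (@le_trans _ _ (4 / m)); last first.
  rewrite /m sqE invf_div mulrA -!mulrA ler_pM2r ?mulr_gt0 ?invr_gt0//; lra.
rewrite ler_pM2l// lef_pV2 ?posrE ?mulr_gt0 ?sqrtr_gt0//.
have -> : m = Num.sqrt m * Num.sqrt m by rewrite -expr2 sqr_sqrtr// ltW.
by apply: ler_pM; rewrite ?sqrtr_ge0// ler_sqrt ltW.
Qed.

End fourier.

(** * Shifts of the mean *)

Section shift.
Context (R : realType).
Local Notation N1 := (@normal_prob R 0 1).
Implicit Types (F G : R -> \bar R) (c : R * R) (s : seq (R * R)).

Let mb := @measurable_below R.
Let b0 := @below_ge0 R.

Lemma chis_below_le1 s rho z : (chis s (below rho) z <= 1)%E.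
Proof.
rewrite -[leRHS]/((fun=> 1%:E) z) -(chis_cst s 1); apply: le_chis => // x.
by rewrite /below lee_fin; case: ifP.
Qed.

Lemma chis_below_anti s rho z z' : z <= z' -> (chis s (below rho) z' <= chis s (below rho) z)%E.
Proof.
move=> zz; have -> : z' = z + (z' - z) by ring.
rewrite -chis_shift; apply: le_chis => //.
- by apply: (measurableT_comp (mb rho)); exact: measurable_funD.
- move=> x; rewrite /below lee_fin; case: ifP => [h|_]; last by case: ifP.
  by rewrite (_ : x <= rho)//; lra.
Qed.

Lemma chis_below_lip L s rho z h : lip_law L s -> 0 <= h ->
  (chis s (below rho) z <= chis s (below rho) (z + h) + (L * h)%:E)%E.
Proof.
move=> hL h0; have ms := @measurable_slab R (rho - h) h; have s0 := @slab_ge0 R (rho - h) h.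
have mbh : measurable_fun setT (fun x : R => below rho (x + h)).
  by apply: (measurableT_comp (mb rho)); exact: measurable_funD.
have E : below rho = (fun x => below rho (x + h) + slab (rho - h) h x)%E.
  apply/funext => x; rewrite /below /slab subrK -EFinD; congr _%:E.
  rewrite -lerBrDr; case: (leP x (rho - h)) => hx /=; last by rewrite add0r.
  by rewrite addr0; case: leP => //; lra.
by rewrite {1}E chisD// chis_shift leeD2l//; exact: hL.
Qed.

(** Averaging over [x] and [- x] removes the cross term before integration, so all integrands remain
    nonnegative. *)
Lemma normal_second_moment (k a : R) :
  (\int[N1]_x ((k * x + a) ^+ 2)%:E <= (k ^+ 2)%:E * \int[N1]_x (x ^+ 2)%:E + (a ^+ 2)%:E)%E.
Proof.
have msq (g : R -> R) : measurable_fun setT g -> measurable_fun setT (fun x => (g x ^+ 2)%:E).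
  by move=> mg; apply/measurable_EFinP; exact: measurable_funX.
have ml (k' : R) : measurable_fun setT (fun x : R => k' * x + a).
  by apply: measurable_funD => //; exact: measurable_funM.
have sq0 (g : R -> R) x : (0 <= (g x ^+ 2)%:E)%E by rewrite lee_fin sqr_ge0.
apply: lee_double.
- by apply: integral_ge0 => x _; exact: sq0.
- by rewrite adde_ge0 ?mule_ge0 ?lee_fin ?sqr_ge0//; apply: integral_ge0 => x _; rewrite lee_fin sqr_ge0.
have e1 : (\int[N1]_x ((k * x + a) ^+ 2)%:E = \int[N1]_x ((- k * x + a) ^+ 2)%:E)%E.
  rewrite -normal_opp; [|exact: msq|exact: sq0].
  by apply: eq_integral => x _; rewrite mulrN mulNr.
rewrite {2}e1 -ge0_integralD//; [|exact: msq|exact: msq].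
under eq_integral => x _.
  rewrite -EFinD (_ : (k * x + a) ^+ 2 + (- k * x + a) ^+ 2 = (2 * k ^+ 2) * x ^+ 2 + 2 * a ^+ 2); last by ring.
  rewrite EFinD EFinM; over.
rewrite ge0_integralD; last 5 first.
- by [].
- by move=> x _; rewrite mule_ge0 ?lee_fin ?sqr_ge0// mulr_ge0 ?sqr_ge0.
- by apply: measurable_funeM; exact: (msq id).
- by move=> x _; rewrite lee_fin mulr_ge0// sqr_ge0.
- by [].
rewrite normal_cst ge0_integralZl//; last 3 first.
- exact: (msq id).
- by move=> x _; rewrite lee_fin sqr_ge0.
- by rewrite lee_fin mulr_ge0 ?sqr_ge0.
have i0 : (0 <= \int[N1]_x (x ^+ 2)%:E)%E by apply: integral_ge0 => x _; rewrite lee_fin sqr_ge0.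
have := @normal_sqr_le1 R; move: i0; case: (\int[N1]_x (x ^+ 2)%:E)%E => [m| |]// _ _.
by rewrite -!EFinM -!EFinD lee_fin; lra.
Qed.

Section one_coordinate.
Variables (s : seq (R * R)) (rho : R).
Let phi := chis s (below rho).
Let phir z := fine (phi z).

Let phiE z : phi z = (phir z)%:E.
Proof.
rewrite /phir fineK// ge0_fin_numE; last exact: chis_ge0.
by apply: le_lt_trans (chis_below_le1 _ _ _) _; rewrite ltry.
Qed.

Let phi01 z : 0 <= phir z <= 1.
Proof. by rewrite -!lee_fin -phiE chis_below_le1 andbT; exact: chis_ge0. Qed.

Let phi_anti z z' : z <= z' -> phir z' <= phir z.
Proof. by move=> zz; rewrite -lee_fin -!phiE; exact: chis_below_anti. Qed.

Let mphi : measurable_fun setT phir.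
Proof.
apply/measurable_EFinP; rewrite (_ : EFin \o phir = phi); first exact: measurable_chis.
by apply/funext => z; rewrite phiE.
Qed.

Lemma chi2_shift_le l a z : 0 <= l -> (chi2 (l, a) phi z <= chi2 (l, 0%R) phi z)%E.
Proof.
rewrite le_eqVlt => /predU1P[<-|l0]; rewrite /chi2 /=.
  apply: le_normal => [|||x].
  - exact: (measurableT_comp (measurable_chis _ (mb rho) (b0 rho)) (measurable_chi2_sqr (0, a) z)).
  - exact: (measurableT_comp (measurable_chis _ (mb rho) (b0 rho)) (measurable_chi2_sqr (0, 0) z)).
  - by move=> x; exact: chis_ge0.
  - by apply: chis_below_anti; rewrite sqrtr0 !mul0r !add0r expr0n addr0 lerDl sqr_ge0.
have sl : 0 < Num.sqrt l by rewrite sqrtr_gt0.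
pose h x := phir (z + (Num.sqrt l * x + 0) ^+ 2).
have mh : measurable_fun setT h by exact: (measurableT_comp mphi (measurable_chi2_sqr (l, 0) z)).
have := @normal_anderson_decr R h 1 (a / Num.sqrt l) mh (fun x => phi01 _).
have -> : (\int[N1]_x (h (x + a / Num.sqrt l))%:E = \int[N1]_x phi (z + (Num.sqrt l * x + a) ^+ 2)%R)%E.
  apply: eq_integral => x _; rewrite phiE; congr (phir (_ + _ ^+ 2))%:E.
  by rewrite mulrDr addr0 mulrCA divff ?mulr1// gt_eqF.
have -> : (\int[N1]_x (h x)%:E = \int[N1]_x phi (z + (Num.sqrt l * x + 0) ^+ 2)%R)%E.
  by apply: eq_integral => x _; rewrite phiE.
apply => x y xy; apply: phi_anti; rewrite lerD2l !addr0 !exprMn ler_wpM2l ?sqr_ge0//.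
by rewrite -(real_normK (num_real x)) -(real_normK (num_real y)) ler_sqr ?nnegrE.
Qed.

(** [phi] decreases at rate at most [L], so [phi (z + y) + L * y] is nondecreasing in [y], and
    Anderson's inequality applies in the direction opposite to [chi2_shift_le]. The second moments
    of [sqrt l * xi + a] and [sqrt l * xi] differ by [a ^ 2], hence a loss quadratic in the
    shift. *)
Lemma chi2_shift_ge L l a z : lip_law L s -> 0 <= L -> 0 <= l ->
  (chi2 (l, 0%R) phi z <= chi2 (l, a) phi z + (L * a ^+ 2)%:E)%E.
Proof.
move=> hL L0; have lipr z' h' : 0 <= h' -> phir z' <= phir (z' + h') + L * h'.
  by move=> h0; rewrite -lee_fin EFinD -!phiE; exact: chis_below_lip.
rewrite le_eqVlt => /predU1P[<-|l0]; rewrite /chi2 /=.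
  apply: (@le_trans _ _ (\int[N1]_x (phi (z + (Num.sqrt 0 * x + a) ^+ 2)%R + (L * a ^+ 2)%:E))%E).
    apply: le_normal => [|||x].
    - exact: (measurableT_comp (measurable_chis _ (mb rho) (b0 rho)) (measurable_chi2_sqr (0, 0) z)).
    - apply: emeasurable_funD => //.
      exact: (measurableT_comp (measurable_chis _ (mb rho) (b0 rho)) (measurable_chi2_sqr (0, a) z)).
    - by move=> x; exact: chis_ge0.
    - rewrite !phiE -EFinD lee_fin sqrtr0 !mul0r !add0r expr0n addr0.
      by apply: lipr; exact: sqr_ge0.
  rewrite ge0_integralD//.
  - by rewrite normal_cst.
  - by move=> x _; exact: chis_ge0.
  - exact: (measurableT_comp (measurable_chis _ (mb rho) (b0 rho)) (measurable_chi2_sqr (0, a) z)).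
  - by move=> x _; rewrite lee_fin mulr_ge0 ?sqr_ge0.
have sl : 0 < Num.sqrt l by rewrite sqrtr_gt0.
have sll : Num.sqrt l ^+ 2 = l by rewrite sqr_sqrtr// ltW.
pose g x := phir (z + (Num.sqrt l * x) ^+ 2) + L * (Num.sqrt l * x) ^+ 2.
have msq : measurable_fun setT (fun x : R => (Num.sqrt l * x) ^+ 2).
  by apply: measurable_funX; exact: measurable_funM.
have mg : measurable_fun setT g.
  apply: measurable_funD; last exact: measurable_funM.
  by apply: (measurableT_comp mphi); exact: measurable_funD.
have g0 x : 0 <= g x.
  by rewrite addr_ge0//; [have /andP[] := phi01 (z + (Num.sqrt l * x) ^+ 2)|rewrite mulr_ge0 ?sqr_ge0].
have gh x y : `|x| <= `|y| -> g x <= g y.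
  move=> xy; rewrite /g.
  have hxy : (Num.sqrt l * x) ^+ 2 <= (Num.sqrt l * y) ^+ 2.
    rewrite !exprMn ler_wpM2l ?sqr_ge0//.
    by rewrite -(real_normK (num_real x)) -(real_normK (num_real y)) ler_sqr ?nnegrE.
  set X := _ ^+ 2 in hxy *; set Y := (_ * y) ^+ 2 in hxy *.
  have := @lipr (z + X) (Y - X); rewrite subr_ge0 hxy => /(_ isT).
  have -> : z + X + (Y - X) = z + Y by ring.
  lra.
have := normal_anderson (a / Num.sqrt l) mg g0 gh.
have i0 : (0 <= \int[N1]_x (x ^+ 2)%:E)%E by apply: integral_ge0 => x _; rewrite lee_fin sqr_ge0.
have mx2 : measurable_fun setT (fun x : R => (x ^+ 2)%:E) by apply/measurable_EFinP; exact: measurable_funX.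
have -> : (\int[N1]_x (g x)%:E = \int[N1]_x phi (z + (Num.sqrt l * x + 0) ^+ 2)%R + (L * l)%:E * \int[N1]_x (x ^+ 2)%:E)%E.
  rewrite -ge0_integralZl//; [|by move=> x _; rewrite lee_fin sqr_ge0|by rewrite lee_fin mulr_ge0// ltW].
  rewrite -ge0_integralD//.
  - apply: eq_integral => x _; rewrite phiE -EFinM -EFinD /g addr0.
    by congr (_ + _)%:E; rewrite exprMn sll mulrA.
  - by move=> x _; exact: chis_ge0.
  - exact: (measurableT_comp (measurable_chis _ (mb rho) (b0 rho)) (measurable_chi2_sqr (l, 0) z)).
  - by move=> x _; rewrite mule_ge0 ?lee_fin ?sqr_ge0 ?mulr_ge0// ltW.
  - exact: measurable_funeM.
have -> : (\int[N1]_x (g (x + a / Num.sqrt l))%:E = \int[N1]_x phi (z + (Num.sqrt l * x + a) ^+ 2)%R + L%:E * \int[N1]_x ((Num.sqrt l * x + a) ^+ 2)%:E)%E.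
  have ma : measurable_fun setT (fun x : R => ((Num.sqrt l * x + a) ^+ 2)%:E).
    by apply/measurable_EFinP; apply: measurable_funX; apply: measurable_funD => //; exact: measurable_funM.
  rewrite -ge0_integralZl//; [|by move=> x _; rewrite lee_fin sqr_ge0].
  rewrite -ge0_integralD//.
  - apply: eq_integral => x _; rewrite phiE -EFinM -EFinD /g.
    have -> : Num.sqrt l * (x + a / Num.sqrt l) = Num.sqrt l * x + a by field; rewrite gt_eqF.
    by [].
  - by move=> x _; exact: chis_ge0.
  - exact: (measurableT_comp (measurable_chis _ (mb rho) (b0 rho)) (measurable_chi2_sqr (l, a) z)).
  - by move=> x _; rewrite mule_ge0 ?lee_fin ?sqr_ge0.
  - exact: measurable_funeM.
have sm := normal_second_moment (Num.sqrt l) a; rewrite sll in sm.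
have m1 := @normal_sqr_le1 R.
have p1 : (0 <= \int[N1]_x phi (z + (Num.sqrt l * x + 0) ^+ 2)%R)%E by apply: integral_ge0 => x _; exact: chis_ge0.
have p2 : (0 <= \int[N1]_x phi (z + (Num.sqrt l * x + a) ^+ 2)%R)%E by apply: integral_ge0 => x _; exact: chis_ge0.
move=> H.
have LE0 : (0 <= L%:E)%E by rewrite lee_fin.
have := le_trans H (leeD2l _ (lee_wpmul2l LE0 sm)).
move: i0 m1 p1 p2 {sm H}; move: (\int[N1]_x (x ^+ 2)%:E)%E (\int[N1]_x phi (z + (Num.sqrt l * x + 0) ^+ 2)%R)%E (\int[N1]_x phi (z + (Num.sqrt l * x + a) ^+ 2)%R)%E.
move=> [m| |] [u| |] [v| |]//; rewrite -?EFinM -?EFinD ?lee_fin -?EFinM -?EFinD ?lee_fin ?leey//; lra.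
Qed.

End one_coordinate.

Definition zero_shifts s : seq (R * R) := [seq (c.1, 0) | c <- s].

Lemma chis_shift_le s rho z : {in s, forall c, 0 <= c.1} ->
  (chis s (below rho) z <= chis (zero_shifts s) (below rho) z)%E.
Proof.
elim: s z => //= c s IH z hs.
have c0 : 0 <= c.1 by apply: hs; rewrite mem_head.
apply: (@le_trans _ _ (chi2 c (chis (zero_shifts s) (below rho)) z)).
  apply: le_chi2.
  - exact: measurable_chis.
  - exact: measurable_chis.
  - exact: chis_ge0.
  - by move=> x; apply: IH => d ds; apply: hs; rewrite inE ds orbT.
by rewrite {1}[c]surjective_pairing; exact: chi2_shift_le.
Qed.

(* Replaces the shifts by 0 one at a time. *)
Lemma chis_shift_ge L s rho z : 0 <= L -> {in s, forall c, 0 <= c.1} ->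
  (forall t1 c t2, map fst (t1 ++ c :: t2) = map fst s -> lip_law L (t1 ++ t2)) ->
  (chis (zero_shifts s) (below rho) z <= chis s (below rho) z + (L * \sum_(c <- s) c.2 ^+ 2)%:E)%E.
Proof.
move=> L0 hs hL.
suff H : forall s2 s1, s1 ++ s2 = s ->
  (chis (s1 ++ zero_shifts s2) (below rho) z <= chis s (below rho) z + (L * \sum_(c <- s2) c.2 ^+ 2)%:E)%E.
  exact: (H s [::]).
elim=> [|c s2 IH] s1 sE.
  by rewrite cats0 in sE *; rewrite sE big_nil mulr0 adde0.
have c0 : 0 <= c.1 by apply: hs; rewrite -sE mem_cat mem_head orbT.
have mid x : chis (s1 ++ (c.1, x) :: zero_shifts s2) (below rho) = chi2 (c.1, x) (chis (s1 ++ zero_shifts s2) (below rho)).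
  rewrite -[RHS]/(chis ((c.1, x) :: (s1 ++ zero_shifts s2)) (below rho)).
  by apply: perm_chis => //; rewrite -cat1s perm_catCA.
rewrite /= mid; apply: le_trans (@chi2_shift_ge _ _ L c.1 c.2 z _ L0 c0) _.
  apply: (hL _ c); rewrite -sE !map_cat /=; congr (_ ++ _ :: _).
  by rewrite -map_comp.
rewrite -mid -surjective_pairing big_cons mulrDr [X in (_ <= _ + X)%E]EFinD addeA [X in (_ <= X)%E]addeAC.
by rewrite leeD2r// -cat_rcons; apply: IH; rewrite cat_rcons.
Qed.

End shift.

(** * Gaussian probabilities of balls *)

Section ball_probability.
Context (R : realType).

(* The probability that a Gaussian vector with mean [a] and covariance [M M^T]
   lies in the centered ball of radius [r]. *)
Definition pball p q (M : 'M[R]_(q, p)) (a : 'cV[R]_q) (r : R) : \bar R :=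
  @std_gauss R p [set g | enorm (M *m g + a) <= r].

Lemma sqnormD n (u v : 'cV[R]_n) : sqnorm (u + v) = sqnorm u + 2 * (u^T *m v) 0 0 + sqnorm v.
Proof.
rewrite /sqnorm mxE mulr_sumr -!big_split/=; apply: eq_bigr => i _.
by rewrite !mxE; ring.
Qed.

Lemma sqnorm_eq0 n (u : 'cV[R]_n) : sqnorm u = 0 -> u = 0.
Proof.
move/eqP; rewrite /sqnorm psumr_eq0; last by move=> i _; exact: sqr_ge0.
move=> /allP h; apply/colP => i.
by have := h i (mem_index_enum _); rewrite /= sqrf_eq0 mxE => /eqP.
Qed.

Lemma enorm_le n (u : 'cV[R]_n) (r : R) : 0 <= r -> (enorm u <= r) = (sqnorm u <= r ^+ 2).
Proof. by move=> r0; rewrite -sqr_enorm ler_sqr ?nnegrE ?sqrtr_ge0. Qed.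

Lemma measurable_sqnorm_affine p q (M : 'M[R]_(q, p)) (a : 'cV[R]_q) :
  measurable_fun setT (fun g => sqnorm (M *m g + a)).
Proof. exact: (measurableT_comp (@measurable_sqnorm R q) (measurable_mulmx_cV M a)). Qed.

Lemma measurable_pball p q (M : 'M[R]_(q, p)) (a : 'cV[R]_q) r : 0 <= r ->
  measurable [set g | enorm (M *m g + a) <= r].
Proof.
move=> r0; have h : measurable_fun setT (fun g => sqnorm (M *m g + a) <= r ^+ 2).
  by apply: measurable_fun_ler => //; exact: measurable_sqnorm_affine.
have -> : [set g | enorm (M *m g + a) <= r] = (fun g => sqnorm (M *m g + a) <= r ^+ 2) @^-1` [set true].
  by apply/seteqP; split => g /=; rewrite enorm_le.
by rewrite -[X in measurable X]setTI; exact: (h measurableT [set true]).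
Qed.

Lemma pballE p q (M : 'M[R]_(q, p)) (a : 'cV[R]_q) r : 0 <= r ->
  pball M a r = (\int[@std_gauss R p]_g below (r ^+ 2) (sqnorm (M *m g + a)))%E.
Proof.
move=> r0; have mA := measurable_pball M a r0.
rewrite (_ : (fun g => below _ _) = (fun g => (\1_[set g | enorm (M *m g + a) <= r] g)%:E)); last first.
  apply/funext => g; rewrite /below indicE -enorm_le//.
  by case: (boolP (enorm (M *m g + a) <= r)) => h; [rewrite mem_set|rewrite memNset//=; exact/negP].
by rewrite integral_indic// setIT.
Qed.

Lemma pball_le1 p q (M : 'M[R]_(q, p)) (a : 'cV[R]_q) r : 0 <= r -> (pball M a r <= 1)%E.
Proof. by move=> r0; apply: probability_le1; exact: measurable_pball. Qed.

Lemma pball_ge0 p q (M : 'M[R]_(q, p)) (a : 'cV[R]_q) r : (0 <= pball M a r)%E.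
Proof. exact: measure_ge0. Qed.

Section diagonal.
Variables (p q : nat) (M : 'M[R]_(q, p)) (O : 'M[R]_p) (lam : 'I_p -> R).
Hypothesis OO : O^T *m O = 1%:M.
Hypothesis ME : M^T *m M = O *m dmx lam *m O^T.

Let MO : (M *m O)^T *m (M *m O) = dmx lam.
Proof.
by rewrite trmx_mul -mulmxA (mulmxA M^T) ME !mulmxA OO mul1mx -mulmxA OO mulmx1.
Qed.

Lemma sqnorm_col_diag i : sqnorm (M *m O *m delta_mx i 0) = lam i.
Proof. by rewrite -quad_sqnorm MO quad_delta !mxE eqxx. Qed.

Lemma diag_ge0 i : 0 <= lam i.
Proof. by rewrite -sqnorm_col_diag sqnorm_ge0. Qed.

Variable a : 'cV[R]_q.

(** Coordinates of [a] along the left singular vectors of [M]; they are 0 where [lam i = 0], by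
    division by zero. *)
Definition dshift i : R := ((M *m O)^T *m a) i 0 / Num.sqrt (lam i).
(** The squared norm of the component of [a] orthogonal to the range of [M]. *)
Definition drest : R := sqnorm a - \sum_i dshift i ^+ 2.

Let dshiftE i : Num.sqrt (lam i) * dshift i = ((M *m O)^T *m a) i 0.
Proof.
have [l0|l0] := eqVneq (lam i) 0; last first.
  by rewrite /dshift mulrC divfK// gt_eqF// sqrtr_gt0 lt_def l0 diag_ge0.
rewrite l0 sqrtr0 mul0r; have /sqnorm_eq0 := etrans (sqnorm_col_diag i) l0.
move=> /(congr1 trmx); rewrite trmx_mul trmx_delta trmx0 => h.
have := congr1 (fun X => (X *m a) 0 0) h; rewrite /= mul0mx -mulmxA -rowE.
by rewrite [LHS]mxE [RHS]mxE => ->.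
Qed.

Lemma sqnorm_diag (g : 'cV[R]_p) :
  sqnorm (M *m (O *m g) + a) = drest + \sum_i (Num.sqrt (lam i) * g i 0 + dshift i) ^+ 2.
Proof.
rewrite sqnormD mulmxA -quad_sqnorm MO quad_dmx /drest trmx_mul -mulmxA.
have -> : (g^T *m ((M *m O)^T *m a)) 0 0 = \sum_i g i 0 * (Num.sqrt (lam i) * dshift i).
  by rewrite mxE; apply: eq_bigr => i _; rewrite dshiftE mxE.
have -> : \sum_i (Num.sqrt (lam i) * g i 0 + dshift i) ^+ 2 =
    wsq lam g + 2 * (\sum_i g i 0 * (Num.sqrt (lam i) * dshift i)) + \sum_i dshift i ^+ 2.
  rewrite /wsq mulr_sumr -!big_split/=; apply: eq_bigr => i _.
  by rewrite -[X in _ = X * _ + _ + _](sqr_sqrtr (diag_ge0 i)); ring.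
by ring.
Qed.

Lemma drest_ge0 : 0 <= drest.
Proof.
(* This choice annihilates every square in [sqnorm_diag], which exhibits [drest] as a squared
   norm. *)
pose g : 'cV[R]_p := \col_i (- (dshift i / Num.sqrt (lam i))).
have := sqnorm_diag g; rewrite [X in _ = _ + X]big1 ?addr0 => [<-|i _]; first exact: sqnorm_ge0.
rewrite mxE; have [l0|l0] := eqVneq (Num.sqrt (lam i)) 0.
  by rewrite /dshift l0 invr0 !(mulr0, mul0r, addr0) expr0n.
by rewrite mulrN mulrC divfK// addNr expr0n.
Qed.

Lemma pball_chis r : 0 <= r ->
  pball M a r = chis [seq (lam i, dshift i) | i <- enum 'I_p] (below (r ^+ 2)) drest.
Proof.
move=> r0; rewrite pballE//.
have mB := measurable_below (r ^+ 2); have B0 := below_ge0 (r ^+ 2).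
rewrite -chis_std_gauss//.
rewrite -(ge0_integral_std_gauss_orthogonal OO); last 2 first.
- exact: (measurableT_comp mB (measurable_sqnorm_affine M a)).
- by move=> g; exact: B0.
by apply: eq_integral => g _; rewrite sqnorm_diag.
Qed.

End diagonal.

Lemma pball0_chis p q (M : 'M[R]_(q, p)) (O : 'M[R]_p) (lam : 'I_p -> R) r :
  O^T *m O = 1%:M -> M^T *m M = O *m dmx lam *m O^T -> 0 <= r ->
  pball M 0 r = chis [seq (lam i, 0) | i <- enum 'I_p] (below (r ^+ 2)) 0.
Proof.
move=> OO ME r0; rewrite (pball_chis OO ME 0 r0).
have d0 i : dshift M O lam 0 i = 0 by rewrite /dshift mulmx0 mxE mul0r.
rewrite /drest sqnorm0 big1 ?subr0 => [|i _]; last by rewrite d0 expr0n.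
by congr chis; apply: eq_map => i; rewrite d0.
Qed.

(* The spectrum of [M M^T] has no dominant eigenvalue; [v] is at most the squared
   Frobenius norm. *)
Definition spread p q (M : 'M[R]_(q, p)) (v : R) := exists (O : 'M[R]_p) (lam : 'I_p -> R),
  [/\ O^T *m O = 1%:M, M^T *m M = O *m dmx lam *m O^T, 0 < v,
      forall i, lam i ^+ 2 <= 2 / 5 * v & v <= \sum_i lam i ^+ 2].

(** The part of [a] orthogonal to the range is removed by the density bound, at cost [drest], and
    the part inside it by [chis_shift_ge], at cost [\sum dshift ^ 2]; the two add up to
    [sqnorm a]. *)
Lemma pball_shift : exists2 C : R, 0 < C & forall p q (M : 'M[R]_(q, p)) (v : R) (a : 'cV[R]_q) r,
  spread M v -> 0 <= r -> (pball M a r <= pball M 0 r)%E /\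
  (pball M 0 r <= pball M a r + (C / Num.sqrt v * sqnorm a)%:E)%E.
Proof.
have [C C0 hC] := lip_law_spread R; exists C => // p q M v a r [U [lam [UU ME v0 lamv lams]]] r0.
have l0 := diag_ge0 UU ME.
pose sa := [seq (lam i, dshift M U lam a i) | i <- enum 'I_p].
have E0 : pball M 0 r = chis (zero_shifts sa) (below (r ^+ 2)) 0.
  by rewrite (pball0_chis UU ME r0) /zero_shifts /sa -map_comp.
have Ea := pball_chis UU ME a r0; rewrite -/sa in Ea.
have d0 := drest_ge0 UU ME a.
have sa0 : {in sa, forall c, 0 <= c.1} by move=> c /mapP[i _ ->]; exact: l0.
have L0 : 0 <= C / Num.sqrt v by rewrite divr_ge0 ?sqrtr_ge0// ltW.
rewrite E0 Ea; split.
  apply: le_trans (chis_shift_le _ _ sa0) _; exact: chis_below_anti.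
have lipall (s : seq (R * R)) : {in s, forall c, 0 <= c.1} -> {in s, forall c, c.1 ^+ 2 <= 2 / 5 * v} ->
  3 / 5 * v <= \sum_(c <- s) c.1 ^+ 2 -> lip_law (C / Num.sqrt v) s by exact: hC.
have mapE (s : seq (R * R)) : map fst s = map fst sa -> [/\ {in s, forall c, 0 <= c.1},
    {in s, forall c, c.1 ^+ 2 <= 2 / 5 * v} & v <= \sum_(c <- s) c.1 ^+ 2].
  move=> hs; have ms : map fst s = [seq lam i | i <- enum 'I_p].
    by rewrite hs /sa -map_comp.
  have mem c : c \in s -> exists i, c.1 = lam i.
    move=> cs; have : c.1 \in map fst s by apply: map_f.
    by rewrite ms => /mapP[i _ ->]; exists i.
  split.
  - by move=> c /mem[i ->].
  - by move=> c /mem[i ->].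
  - have -> : \sum_(c <- s) c.1 ^+ 2 = \sum_(x <- map fst s) x ^+ 2 by rewrite big_map.
    by rewrite ms big_map big_enum.
have lip0 : lip_law (C / Num.sqrt v) (zero_shifts sa).
  have [|h1 h2 h3] := mapE (zero_shifts sa); first by rewrite /zero_shifts -map_comp.
  by apply: lipall => //; lra.
apply: le_trans (@chis_below_lip R (C / Num.sqrt v) (zero_shifts sa) (r ^+ 2) 0 (drest M U lam a) lip0 d0) _.
rewrite add0r.
have H := @chis_shift_ge R (C / Num.sqrt v) sa (r ^+ 2) (drest M U lam a) L0 sa0.
apply: le_trans (leeD2r _ (H _)) _.
  move=> t1 c t2 /mapE[h1 h2 h3]; apply: lipall.
  - by move=> x xt; apply: h1; move: xt; rewrite !mem_cat inE => /orP[->//|->]; rewrite !orbT.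
  - by move=> x xt; apply: h2; move: xt; rewrite !mem_cat inE => /orP[->//|->]; rewrite !orbT.
  (* The density bound is needed with one coordinate deleted; this costs at most [2 / 5 * v]. *)
  - have := h2 c; rewrite mem_cat mem_head orbT => /(_ isT).
    by move: h3; rewrite !big_cat big_cons /=; lra.
rewrite -addeA -EFinD leeD2l// lee_fin /sa big_map big_enum /= /drest; lra.
Qed.

End ball_probability.

(** * Independent Gaussian noise *)

Section noise.
Context (R : realType).
Local Notation N1 := (@normal_prob R 0 1).

Lemma row_mx_ccons p q k (M : 'M[R]_(q, p)) (N : 'M[R]_(q, k.+1)) t (v : 'cV[R]_(k + p)) :
  row_mx N M *m (ccons t v : 'cV[R]_(k.+1 + p)) = row_mx (col' ord0 N) M *m v + t *: col ord0 N.
Proof.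
apply/colP => l; rewrite !mxE.
rewrite (@sum_ccons R (k + p) R t v (fun i x => (row_mx N M : 'M[R]_(q, (k + p).+1)) l i * x)) addrC; congr (_ + _).
  apply: eq_bigr => i _; congr (_ * _).
  rewrite -(splitK i); case: (fintype.split i) => j /=.
    have -> : lift ord0 (lshift p j) = lshift p (lift ord0 j) :> 'I_(k.+1 + p) by apply: val_inj.
    by rewrite (row_mxEl N M) (row_mxEl (col' ord0 N) M) mxE.
  have -> : lift ord0 (rshift k j) = rshift k.+1 j :> 'I_(k.+1 + p) by apply: val_inj.
  by rewrite (row_mxEr N M) (row_mxEr (col' ord0 N) M).
have -> : ord0 = lshift p ord0 :> 'I_(k.+1 + p) by apply: val_inj.
by rewrite (row_mxEl N M) mulrC.
Qed.

Lemma pball_row_mxS p q k (M : 'M[R]_(q, p)) (N : 'M[R]_(q, k.+1)) a r : 0 <= r ->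
  pball (row_mx N M) a r = (\int[N1]_t pball (row_mx (col' ord0 N) M) (a + t *: col ord0 N) r)%E.
Proof.
move=> r0; rewrite pballE//.
have mB := measurable_below (r ^+ 2); have B0 := below_ge0 (r ^+ 2).
rewrite (@ge0_integral_std_gaussS R (k + p)); last 2 first.
- exact: (measurableT_comp mB (measurable_sqnorm_affine (row_mx N M) a)).
- by move=> u; exact: B0.
apply: eq_integral => t _; rewrite pballE//; apply: eq_integral => v _.
by rewrite row_mx_ccons -!addrA (addrC a).
Qed.

Lemma normal_sqnorm q (a n : 'cV[R]_q) :
  (\int[N1]_t (sqnorm (a + t *: n))%:E <= (sqnorm n + sqnorm a)%:E)%E.
Proof.
have sq0 i t : (0 <= ((n i 0 * t + a i 0) ^+ 2)%:E)%E by rewrite lee_fin sqr_ge0.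
have ms i : measurable_fun setT (fun t : R => ((n i 0 * t + a i 0) ^+ 2)%:E).
  by apply/measurable_EFinP; apply: measurable_funX; exact: measurable_affine1.
under eq_integral => t _.
  have -> : (sqnorm (a + t *: n))%:E = (\sum_i ((n i 0 * t + a i 0) ^+ 2)%:E)%E.
    rewrite sumEFin; congr EFin; apply: eq_bigr => i _; rewrite !mxE; ring.
  over.
rewrite ge0_integral_sum//.
rewrite /sqnorm -big_split -sumEFin /=; apply: lee_sum => i _.
apply: le_trans (normal_second_moment (n i 0) (a i 0)) _.
rewrite EFinD leeD2r// -[leRHS]mule1 lee_wpmul2l ?lee_fin ?sqr_ge0//.
exact: normal_sqr_le1.
Qed.

(** Each column [n] of [N] acts as a random shift [t *: n] of the mean. The loss in [pball_shift]
    being quadratic and [t] centred, the mean costs of the columns add up without cross terms. *)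
Lemma pball_noise : exists2 C : R, 0 < C & forall p q k (M : 'M[R]_(q, p)) (v : R)
    (N : 'M[R]_(q, k)) (a : 'cV[R]_q) r, spread M v -> 0 <= r ->
  (pball (row_mx N M) a r <= pball M 0 r)%E /\
  (pball M 0 r <= pball (row_mx N M) a r + (C / Num.sqrt v * (\sum_j sqnorm (col j N) + sqnorm a))%:E)%E.
Proof.
have [C C0 hC] := pball_shift R; exists C => // p q k M v + + r sM r0.
set L := C / Num.sqrt v; have L0 : 0 <= L by rewrite divr_ge0 ?sqrtr_ge0 ?(ltW C0).
elim: k => [|k IH] N a.
  have -> : pball (row_mx N M) a r = pball M a r.
    rewrite /pball; have -> // : (row_mx N M : 'M[R]_(q, p)) = M.
    apply/matrixP => i j; rewrite -[in LHS](_ : rshift 0 j = j); last exact: val_inj.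
    by rewrite (row_mxEr N M).
  by rewrite big_ord0 add0r; exact: hC.
have P0 b := pball_ge0 (row_mx (col' ord0 N) M) b r.
have mP : measurable_fun setT (fun t : R => pball (row_mx (col' ord0 N) M) (a + t *: col ord0 N) r).
  under eq_fun => t do rewrite pballE//.
  under eq_fun => t do under eq_integral => u do rewrite addrCA -row_mx_ccons.
  apply: (@measurable_integral_ccons R (k + p) (fun u => below (r ^+ 2) (sqnorm (a + row_mx N M *m (u : 'cV[R]_(k.+1 + p)))))).
    under eq_fun => u do rewrite addrC.
    exact: (measurableT_comp (measurable_below (r ^+ 2)) (measurable_sqnorm_affine (row_mx N M) a)).
  by move=> u; exact: below_ge0.
have fin : pball M 0 r \is a fin_num.
  by rewrite ge0_fin_numE ?pball_ge0//; apply: le_lt_trans (pball_le1 _ _ r0) _; rewrite ltry.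
have cstE : pball M 0 r = (\int[N1]__ (fine (pball M 0 r))%:E)%E by rewrite normal_cst fineK.
rewrite pball_row_mxS//; split.
  rewrite [leRHS]cstE fineK//.
  apply: le_normal => // t; by case: (IH (col' ord0 N) (a + t *: col ord0 N)).
pose h t : \bar R := (L * (\sum_j sqnorm (col j (col' ord0 N)) + sqnorm (a + t *: col ord0 N)))%:E.
have msq : measurable_fun setT (fun t : R => sqnorm (a + t *: col ord0 N)).
  apply: measurable_sum => i; apply: measurable_funX => /=.
  have -> : (fun t : R => (a + t *: col ord0 N) i 0) = (fun t : R => N i ord0 * t + a i 0).
    by apply/funext => t; rewrite !mxE; ring.
  exact: measurable_affine1.
have h0 t : (0 <= h t)%E.
  by rewrite lee_fin mulr_ge0// addr_ge0 ?sqnorm_ge0// sumr_ge0// => j _; exact: sqnorm_ge0.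
have mh : measurable_fun setT h.
  by apply/measurable_EFinP; apply: measurable_funM => //; exact: measurable_funD.
apply: (@le_trans _ _ (\int[N1]_t (pball (row_mx (col' ord0 N) M) (a + t *: col ord0 N) r + h t))%E).
  rewrite [leLHS]cstE fineK//.
  apply: le_normal => //.
  - exact: emeasurable_funD.
  - by move=> t; case: (IH (col' ord0 N) (a + t *: col ord0 N)).
rewrite ge0_integralD// leeD2l//.
have sum0 : 0 <= \sum_j sqnorm (col j (col' ord0 N)) by apply: sumr_ge0 => j _; exact: sqnorm_ge0.
apply: (@le_trans _ _ (L%:E * \int[N1]_t ((\sum_j sqnorm (col j (col' ord0 N)))%:E + (sqnorm (a + t *: col ord0 N))%:E))%E).
  rewrite -ge0_integralZl//.
  - by apply: emeasurable_funD => //; exact/measurable_EFinP.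
  - by move=> t _; rewrite adde_ge0 ?lee_fin ?sqnorm_ge0.
rewrite [leRHS](EFinM L) lee_wpmul2l ?lee_fin// ge0_integralD//; last 2 first.
- by move=> t _; rewrite lee_fin sqnorm_ge0.
- exact/measurable_EFinP.
rewrite normal_cst.
apply: le_trans (leeD2l _ (normal_sqnorm _ _)) _; rewrite lee_fin big_ord_recl addrA lerD2r addrC lerD2l.
by apply: ler_sum => j _; rewrite [X in sqnorm X <= _](_ : _ = col (lift ord0 j) N)//; apply/colP => i; rewrite !mxE.
Qed.

End noise.

(** * Dependence on the covariance alone *)

Section same_law.
Context (R : realType).

(** Sylvester's identity: the block matrix [D] is eliminated in two ways, giving one characteristic
    polynomial each. *)
Lemma char_poly_mulC (F : comNzRingType) m n (A : 'M[F]_(m, n)) (B : 'M[F]_(n, m)) :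
  'X^n * char_poly (A *m B) = 'X^m * char_poly (B *m A).
Proof.
set a := map_mx polyC A; set b := map_mx polyC B.
pose D : 'M[{poly F}]_(m + n) := block_mx 'X%:M a b 1%:M.
have <- : \det D = char_poly (A *m B).
  have := det_mulmx D (block_mx 1%:M 0 (- b) 1%:M).
  rewrite det_lblock !det1 !mulr1 => <-.
  rewrite mulmx_block !mulmx1 !mul1mx !mulmx0 !add0r mulmxN subrr det_ublock det1 mulr1.
  by rewrite /char_poly /char_poly_mx map_mxM.
have := det_mulmx (block_mx 1%:M 0 (- b) 'X%:M) D.
rewrite det_lblock det1 mul1r det_scalar => <-.
rewrite mulmx_block !mul1mx !mul0mx !mulmx1 !addr0 mulNmx scalar_mxC addNr det_ublock det_scalar.
by rewrite /char_poly /char_poly_mx map_mxM mulNmx addrC.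
Qed.

Lemma char_poly_spectral n (O : 'M[R]_n) (lam : 'I_n -> R) : O^T *m O = 1%:M ->
  char_poly (O *m dmx lam *m O^T) = \prod_i ('X - (lam i)%:P).
Proof.
move=> OO.
have -> : char_poly (O *m dmx lam *m O^T) = char_poly (dmx lam).
  have := char_poly_mulC (O *m dmx lam) O^T; rewrite mulmxA OO mul1mx.
  by apply: mulfI; rewrite expf_neq0// polyX_eq0.
rewrite char_poly_trig; first by apply: eq_bigr => i _; rewrite !mxE eqxx.
by apply/is_trig_mxP => i j ij; rewrite !mxE -val_eqE /= ltn_eqF.
Qed.

(** Equal [K K^T] give [K^T K] the same characteristic polynomial, hence the same eigenvalues up to
    order, and centred ball probabilities depend on these only. *)
Lemma pball_same_law q m (K1 K2 : 'M[R]_(q, m)) r : 0 <= r -> K1 *m K1^T = K2 *m K2^T ->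
  pball K1 0 r = pball K2 0 r.
Proof.
move=> r0 KK.
have sym (K : 'M[R]_(q, m)) : (K^T *m K)^T = K^T *m K by rewrite trmx_mul trmxK.
have [U1 [l1 [OO1 _ E1]]] := symmetric_spectral (sym K1).
have [U2 [l2 [OO2 _ E2]]] := symmetric_spectral (sym K2).
have prodE (l : 'I_m -> R) : \prod_(x <- [seq l i | i <- enum 'I_m]) ('X - x%:P) = \prod_i ('X - (l i)%:P).
  by rewrite big_map big_enum.
have perm : perm_eq [seq l1 i | i <- enum 'I_m] [seq l2 i | i <- enum 'I_m].
  apply: prod_XsubC_eq; rewrite !prodE.
  rewrite -(char_poly_spectral l1 OO1) -(char_poly_spectral l2 OO2) -E1 -E2.
  apply: (@mulfI _ ('X^q)); first by rewrite expf_neq0// polyX_eq0.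
  by rewrite -(char_poly_mulC K1 K1^T) -(char_poly_mulC K2 K2^T) KK.
rewrite (pball0_chis OO1 E1 r0) (pball0_chis OO2 E2 r0).
have mapE (l : 'I_m -> R) : [seq (l i, 0) | i <- enum 'I_m] = [seq (x, 0 : R) | x <- [seq l i | i <- enum 'I_m]].
  by rewrite -map_comp.
rewrite !mapE.
by rewrite (perm_chis (perm_map _ perm))//; [exact: measurable_below|exact: below_ge0].
Qed.

End same_law.

(** * Perturbation of the covariance *)

Section spectrum.
Context (R : realType).
Implicit Types (p q : nat).

Lemma frobnorm_trace q (S : 'M[R]_q) : S^T = S -> frobnorm S ^+ 2 = \tr (S *m S).
Proof.
move=> sS; rewrite /frobnorm sqr_sqrtr; last by do 2 apply: sumr_ge0 => ? _; exact: sqr_ge0.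
apply: eq_bigr => i _; rewrite mxE; apply: eq_bigr => j _.
by rewrite expr2 -{2}sS mxE.
Qed.

(** A supremum is an upper bound only of a bounded set; the absolute row sums of [S] provide
    boundedness. *)
Lemma opnorm_ub q (S : 'M[R]_q) u : sqnorm u <= 1 -> enorm (S *m u) <= opnorm S.
Proof.
move=> u1; apply: ub_le_sup; last first.
  by exists u => //=; rewrite /enorm -[leRHS]sqrtr1 ler_wsqrtr.
exists (Num.sqrt (\sum_i (\sum_j `|S i j|) ^+ 2)) => _ [v /= v1 <-].
have {}v1 : sqnorm v <= 1 by rewrite -sqr_enorm -[leRHS](expr1n _ 2) ler_sqr ?nnegrE ?sqrtr_ge0.
have v1j j : `|v j 0| <= 1.
  rewrite -[leRHS](expr1n _ 1) -(@ler_pXn2r _ 2) ?nnegrE// !expr1n real_normK ?num_real//.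
  apply: le_trans v1; rewrite /sqnorm (bigD1 j)//= lerDl sumr_ge0// => k _; exact: sqr_ge0.
apply: ler_wsqrtr; apply: ler_sum => i _.
rewrite -(real_normK (num_real _)) ler_sqr ?nnegrE ?sumr_ge0//.
rewrite mxE; apply: le_trans (ler_norm_sum _ _ _) _; apply: ler_sum => j _.
by rewrite normrM -[leRHS]mulr1 ler_wpM2l.
Qed.

Lemma sqnorm_orthogonal q (U : 'M[R]_q) u : U *m U^T = 1%:M -> sqnorm (U^T *m u) = sqnorm u.
Proof. by move=> UU; rewrite !sqnormE trmx_mul trmxK -mulmxA (mulmxA U) UU mul1mx. Qed.

Lemma quad_spectral q (U : 'M[R]_q) (l : 'I_q -> R) (u : 'cV[R]_q) :
  (u^T *m (U *m dmx l *m U^T) *m u) 0 0 = wsq l (U^T *m u).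
Proof. by rewrite -quad_dmx trmx_mul trmxK !mulmxA. Qed.

Lemma dmx_delta q (l : 'I_q -> R) i : dmx l *m delta_mx i 0 = l i *: delta_mx i 0 :> 'cV[R]_q.
Proof.
by apply/colP => j; rewrite mul_dmx !mxE; case: eqP => [->|_]//; rewrite !mulr0.
Qed.

Lemma sqnormZ_delta q (c : R) (i : 'I_q) : sqnorm (c *: delta_mx i 0 : 'cV[R]_q) = c ^+ 2.
Proof.
rewrite /sqnorm (bigD1 i)//= big1 => [|j ji]; rewrite !mxE ?(negbTE ji) ?eqxx.
  by rewrite mulr1 addr0.
by rewrite mulr0 expr0n.
Qed.

Lemma quad_le_opnorm q (S : 'M[R]_q) (u : 'cV[R]_q) : S^T = S ->
  (u^T *m S *m u) 0 0 <= opnorm S * sqnorm u.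
Proof.
move=> /symmetric_spectral[U [l [UU UU' SE]]].
have sU (w : 'cV[R]_q) : sqnorm (U *m w) = sqnorm w.
  by have := @sqnorm_orthogonal q U^T w; rewrite trmxK; apply.
have le_op i : l i <= opnorm S.
  have e1 : sqnorm (U *m delta_mx i 0 : 'cV[R]_q) <= 1.
    by rewrite sU -[delta_mx i 0]scale1r sqnormZ_delta expr1n.
  apply: le_trans (opnorm_ub S e1); rewrite [in S *m _]SE -!mulmxA (mulmxA U^T) UU mul1mx.
  by rewrite dmx_delta /enorm -/(sqnorm _) sU sqnormZ_delta sqrtr_sqr ler_norm.
rewrite [in leLHS]SE quad_spectral -(sqnorm_orthogonal u UU') /sqnorm mulr_sumr.
by apply: ler_sum => i _; rewrite ler_wpM2r// sqr_ge0.
Qed.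

Lemma opnorm_ge0 q (S : 'M[R]_q) : 0 <= opnorm S.
Proof.
have := @opnorm_ub q S 0; rewrite mulmx0 => /(_ _)/(le_trans (sqrtr_ge0 _)); apply.
by rewrite sqnorm0.
Qed.

Lemma tracenorm_spectral q (U : 'M[R]_q) (l : 'I_q -> R) : U^T *m U = 1%:M ->
  tracenorm (U *m dmx l *m U^T) = \sum_i `|l i|.
Proof.
move=> UU; set S := U *m _ *m _.
have charS : char_poly S = \prod_(a <- [seq l i | i <- enum 'I_q]) ('X - a%:P).
  by rewrite big_map big_enum char_poly_spectral.
have : [set s | char_poly S = \prod_(a <- s) ('X - a%:P)] (eigenvalues S).
  exact: xgetI charS.
rewrite /= charS => /prod_XsubC_eq.
by rewrite /tracenorm perm_sym => /(perm_big _) ->; rewrite big_map big_enum.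
Qed.

Section gram.
Variables (p q : nat) (M : 'M[R]_(q, p)) (O : 'M[R]_p) (lam : 'I_p -> R).
Hypothesis OO : O^T *m O = 1%:M.
Hypothesis ME : M^T *m M = O *m dmx lam *m O^T.

(** Tests the hypothesis on the unnormalised left singular vector, where its two sides are
    [lam i ^ 2] and [b * lam i]. *)
Lemma gram_eigen_le (b : R) i : 0 <= b ->
  (forall w : 'cV[R]_q, (w^T *m (M *m M^T) *m w) 0 0 <= b * sqnorm w) -> lam i <= b.
Proof.
move=> b0 /(_ (M *m O *m delta_mx i 0)); rewrite (sqnorm_col_diag OO ME).
pose e : 'cV[R]_p := delta_mx i 0; rewrite -/e.
have -> : ((M *m O *m e)^T *m (M *m M^T) *m (M *m O *m e)) 0 0 = lam i ^+ 2.
  transitivity (sqnorm (M^T *m (M *m O *m e))); first by rewrite -(quad_sqnorm M^T) trmxK.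
  rewrite !mulmxA ME -(mulmxA _ O^T) OO mulmx1 -mulmxA dmx_delta.
  have := @sqnorm_orthogonal p O^T (lam i *: delta_mx i 0); rewrite trmxK => ->//.
  exact: sqnormZ_delta.
have := diag_ge0 OO ME i; rewrite le_eqVlt => /predU1P[<-//|l0].
by rewrite expr2 ler_pM2r.
Qed.

Lemma gram_sum_sqr : \sum_i lam i ^+ 2 = \tr (M *m M^T *m (M *m M^T)).
Proof.
have -> : M *m M^T *m (M *m M^T) = M *m (M^T *m M *m M^T) by rewrite !mulmxA.
rewrite mxtrace_mulC -(mulmxA (M^T *m M)) ME.
have -> : O *m dmx lam *m O^T *m (O *m dmx lam *m O^T) = O *m (dmx lam *m (O^T *m O) *m dmx lam *m O^T).
  by rewrite !mulmxA.
rewrite OO mulmx1 mxtrace_mulC -(mulmxA _ O^T) OO mulmx1.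
apply: eq_bigr => i _; rewrite mxE (bigD1 i)//= big1 => [|j ji]; rewrite !mxE ?eqxx ?(negbTE ji).
  by rewrite addr0 expr2.
by rewrite mulr0.
Qed.

End gram.

End spectrum.

Section perturbation.
Context (R : realType).

Lemma spread_gram p q (M : 'M[R]_(q, p)) (b v : R) : 0 <= b ->
  (forall w : 'cV[R]_q, (w^T *m (M *m M^T) *m w) 0 0 <= b * sqnorm w) ->
  0 < v -> b ^+ 2 <= 2 / 5 * v -> v <= \tr (M *m M^T *m (M *m M^T)) -> spread M v.
Proof.
move=> b0 Mb v0 bv trv.
have sym : (M^T *m M)^T = M^T *m M by rewrite trmx_mul trmxK.
have [U [lam [UU _ ME]]] := symmetric_spectral sym.
exists U, lam; split=> //; last by rewrite (gram_sum_sqr UU ME).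
move=> i; apply: le_trans bv; rewrite ler_sqr ?nnegrE ?(diag_ge0 UU ME)//.
exact: (gram_eigen_le UU ME).
Qed.

Lemma col_sqrt_dmx q (U : 'M[R]_q) (l : 'I_q -> R) : U^T *m U = 1%:M -> (forall i, 0 <= l i) ->
  \sum_j sqnorm (col j (U *m dmx (fun i => Num.sqrt (l i)))) = \sum_i l i.
Proof.
move=> UU l0; apply: eq_bigr => i _.
rewrite colE -mulmxA dmx_delta.
have := @sqnorm_orthogonal R q U^T (Num.sqrt (l i) *: delta_mx i 0); rewrite trmxK => ->//.
by rewrite sqnormZ_delta sqr_sqrtr.
Qed.

Lemma gram_sqrt_dmx q (U : 'M[R]_q) (l : 'I_q -> R) : (forall i, 0 <= l i) ->
  let N := U *m dmx (fun i => Num.sqrt (l i)) in N *m N^T = U *m dmx l *m U^T.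
Proof.
move=> l0 N; rewrite /N trmx_mul mulmxA -(mulmxA U); congr (U *m _ *m _).
apply/matrixP => i j; rewrite mxE (bigD1 j)//= big1 => [|k kj]; rewrite !mxE ?eqxx ?(negbTE kj).
  by rewrite addr0 mulr1n; case: eqP => [->|_]; rewrite ?mulr0n ?mul0r// !mulr1n -expr2 sqr_sqrtr.
by rewrite [j == k]eq_sym (negbTE kj) mulr0n mulr0.
Qed.

(* With [M1 M1^T - M2 M2^T = P - N], [P] and [N] psd, the covariances
   [M1 M1^T + N] and [M2 M2^T + P] coincide. *)
Lemma pball_gram_perturb : exists2 C : R, 0 < C & forall p q (M1 M2 : 'M[R]_(q, p)) (v r : R),
  spread M1 v -> spread M2 v -> 0 <= r ->
  let T := tracenorm (M1 *m M1^T - M2 *m M2^T) in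
  (pball M1 0 r <= pball M2 0 r + (C / Num.sqrt v * T)%:E)%E /\
  (pball M2 0 r <= pball M1 0 r + (C / Num.sqrt v * T)%:E)%E.
Proof.
have [C C0 hC] := pball_noise R; exists C => // p q M1 M2 v r s1 s2 r0 T.
have sym : (M1 *m M1^T - M2 *m M2^T)^T = M1 *m M1^T - M2 *m M2^T.
  by rewrite linearB/= !trmx_mul !trmxK.
have [U [l [UU _ DE]]] := symmetric_spectral sym.
have TE : T = \sum_i `|l i| by rewrite /T DE tracenorm_spectral.
pose lp i := Num.max (l i) 0; pose ln i := Num.max (- l i) 0.
have lp0 i : 0 <= lp i by rewrite le_max lexx orbT.
have ln0 i : 0 <= ln i by rewrite le_max lexx orbT.
have lE i : l i = lp i - ln i by rewrite /lp /ln; have [h|h] := leP (l i) 0;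
    [rewrite max_l ?oppr_ge0//; lra|rewrite max_r ?oppr_le0 ?ltW//; lra].
have lpT : \sum_i lp i <= T.
  by rewrite TE; apply: ler_sum => i _; rewrite ge_max ler_norm normr_ge0.
have lnT : \sum_i ln i <= T.
  by rewrite TE; apply: ler_sum => i _; rewrite ge_max -normrN ler_norm normr_ge0.
pose Np := U *m dmx (fun i => Num.sqrt (lp i)); pose Nn := U *m dmx (fun i => Num.sqrt (ln i)).
have KK : row_mx Nn M1 *m (row_mx Nn M1)^T = row_mx Np M2 *m (row_mx Np M2)^T.
  rewrite !tr_row_mx !mul_row_col (gram_sqrt_dmx U ln0) (gram_sqrt_dmx U lp0).
  have : U *m dmx l *m U^T = U *m dmx lp *m U^T - U *m dmx ln *m U^T.
    rewrite -mulmxBl -mulmxBr; congr (_ *m _ *m _); apply/matrixP => i j; rewrite !mxE.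
    by rewrite (lE i); case: eqP; rewrite ?mulr1n// !mulr0n subr0.
  rewrite -DE => E; have -> : M1 *m M1^T = U *m dmx lp *m U^T - U *m dmx ln *m U^T + M2 *m M2^T.
    by rewrite -E subrK.
  by rewrite addrA; congr (_ + _); rewrite addrC subrK.
have same := pball_same_law r0 KK.
have L0 : 0 <= C / Num.sqrt v by rewrite divr_ge0 ?sqrtr_ge0 ?(ltW C0).
have z0 := @sqnorm0 R q.
have [u1 d1] := hC _ _ _ M1 v Nn 0 r s1 r0; have [u2 d2] := hC _ _ _ M2 v Np 0 r s2 r0.
rewrite z0 addr0 (col_sqrt_dmx UU ln0) in d1; rewrite z0 addr0 (col_sqrt_dmx UU lp0) in d2.
split.
- apply: le_trans d1 _; rewrite same; apply: leeD u2 _; rewrite lee_fin; exact: (ler_wpM2l L0 lnT).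
- apply: le_trans d2 _; rewrite -same; apply: leeD u1 _; rewrite lee_fin; exact: (ler_wpM2l L0 lpT).
Qed.

(* If the trace norm exceeds [1 / 50] of the Frobenius norm, the bound is trivial;
   otherwise both covariances are [spread]. *)
Lemma pball_perturb : exists2 C : R, 0 < C & forall p q (M1 M2 : 'M[R]_(q, p)) (a : 'cV[R]_q) (r : R),
  0 <= r -> 0 < frobnorm (M1 *m M1^T) ->
  3 * opnorm (M1 *m M1^T) ^+ 2 <= frobnorm (M1 *m M1^T) ^+ 2 ->
  (`|pball M1 a r - pball M2 0 r| <=
    (C / frobnorm (M1 *m M1^T) * (tracenorm (M1 *m M1^T - M2 *m M2^T) + sqnorm a))%:E)%E.
Proof.
have [C1 C10 hC1] := pball_shift R; have [C2 C20 hC2] := pball_gram_perturb.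
exists (50 + 2 * (C1 + C2)); first lra.
move=> p q M1 M2 a r r0 F0 h3.
set F := frobnorm _ in F0 h3 *; set b := opnorm _ in h3; set T := tracenorm _.
have sym1 : (M1 *m M1^T)^T = M1 *m M1^T by rewrite trmx_mul trmxK.
have sym2 : (M2 *m M2^T)^T = M2 *m M2^T by rewrite trmx_mul trmxK.
have symD : (M1 *m M1^T - M2 *m M2^T)^T = M1 *m M1^T - M2 *m M2^T by rewrite linearB/= sym1 sym2.
have [U [l [UU UU' DE]]] := symmetric_spectral symD.
have TE : T = \sum_i `|l i| by rewrite /T DE tracenorm_spectral.
have T0 : 0 <= T by rewrite TE sumr_ge0.
have a0 := sqnorm_ge0 a; have b0 : 0 <= b by exact: opnorm_ge0.
have [TF|TF] := leP (F / 50) T.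
  apply: (@le_trans _ _ 1%E).
    by apply: abse_sub_le1; rewrite ?pball_ge0 ?pball_le1.
  rewrite lee_fin mulrAC ler_pdivlMr// mul1r.
  have : 0 <= (50 + 2 * (C1 + C2)) * sqnorm a by rewrite mulr_ge0//; lra.
  have : 0 <= 2 * (C1 + C2) * T by rewrite !mulr_ge0//; lra.
  by clear - TF; lra.
have bF : b <= 3 / 5 * F.
  rewrite -(@ler_pXn2r _ 2) ?nnegrE//; last by rewrite mulr_ge0// ltW.
  by have : 0 <= F ^+ 2 := sqr_ge0 _; rewrite exprMn; lra.
have FT2 : F * T <= F ^+ 2 / 50 by rewrite expr2 -mulrA ler_pM2l// ltW.
have bT : b * T <= 3 / 5 * (F * T) by rewrite mulrA ler_wpM2r.
have TT : T ^+ 2 <= F ^+ 2 / 2500.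
  have -> : F ^+ 2 / 2500 = (F / 50) ^+ 2 by field.
  by rewrite ler_sqr ?nnegrE//; lra.
have F2 : 0 < F ^+ 2 by rewrite exprn_gt0.
have q1 w := quad_le_opnorm w sym1.
have sU i : sqnorm (U *m delta_mx i 0 : 'cV[R]_q) = 1.
  have := @sqnorm_orthogonal R q U^T (1 *: delta_mx i 0); rewrite trmxK scale1r => ->//.
  by rewrite -[delta_mx i 0]scale1r sqnormZ_delta expr1n.
have tr1 : F ^+ 2 = \tr (M1 *m M1^T *m (M1 *m M1^T)) by exact: frobnorm_trace.
(* Expanding the square loses at most [2 * b * T], and [b <= 3 / 5 * F], [T <= F / 50] make this at
   most [3 / 125 * F ^ 2]. *)
have tr2 : 24 / 25 * F ^+ 2 <= \tr (M2 *m M2^T *m (M2 *m M2^T)).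
  have -> : M2 *m M2^T = M1 *m M1^T - (M1 *m M1^T - M2 *m M2^T) by rewrite opprB addrC subrK.
  move: (M1 *m M1^T - M2 *m M2^T) symD DE => D symD DE.
  have -> : (M1 *m M1^T - D) *m (M1 *m M1^T - D) = M1 *m M1^T *m (M1 *m M1^T)
      - M1 *m M1^T *m D - D *m (M1 *m M1^T) + D *m D.
    by rewrite mulmxBl !mulmxBr opprB (addrC (D *m D)) addrA.
  rewrite 3!mxtraceD 2!raddfN /= (mxtrace_mulC D) -tr1 -(frobnorm_trace symD).
  (* Duality of operator and trace norm, read off in an eigenbasis of [D]. *)
  have : \tr (M1 *m M1^T *m D) <= b * T.
    rewrite DE !mulmxA mxtrace_mulC !mulmxA.
    rewrite TE mulr_sumr; apply: ler_sum => i _.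
    pose e : 'cV[R]_q := delta_mx i 0.
    have -> : (U^T *m M1 *m M1^T *m U *m dmx l) i i =
        ((U *m e)^T *m (M1 *m M1^T) *m (U *m e)) 0 0 * l i.
      have -> : (U *m e)^T *m (M1 *m M1^T) *m (U *m e) = e^T *m (U^T *m M1 *m M1^T *m U) *m e.
        by rewrite trmx_mul !mulmxA.
      rewrite quad_delta.
      rewrite mxE (bigD1 i)//= big1 => [|j ji]; last by rewrite !mxE (negbTE ji) mulr0n mulr0.
      by rewrite addr0; congr (_ * _); rewrite !mxE eqxx.
    have := q1 (U *m e); rewrite /e sU mulr1 -/b -/e.
    have : 0 <= ((U *m e)^T *m (M1 *m M1^T) *m (U *m e)) 0 0.
      have := quad_sqnorm M1^T (U *m e); rewrite trmxK => ->; exact: sqnorm_ge0.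
    move: (_ 0 0) => x x0 xb; apply: le_trans (ler_norm _) _.
    by rewrite normrM (ger0_norm x0) ler_wpM2r.
  by have := sqr_ge0 (frobnorm D); move: bT FT2 F2; clear; lra.
(* [spread] admits squared eigenvalues up to [2 / 5 * 24 / 25 = 0.384] times [F ^ 2]. The factor 3
   in the hypothesis keeps those of [M1 M1^T] below [F ^ 2 / 3], which leaves room for the
   perturbation of [M2 M2^T]. *)
have [|/= s1] := pselect (spread M1 (24 / 25 * F ^+ 2)); last first.
  case: s1; apply: (@spread_gram _ _ _ b) => //; rewrite -?tr1; move: h3 F2; clear; lra.
have [|/= s2 s1] := pselect (spread M2 (24 / 25 * F ^+ 2)); last first.
  case: s2; apply: (@spread_gram _ _ _ (b + T)) => //; [lra| |lra|].
    move=> w; have -> : M2 *m M2^T = M1 *m M1^T - (M1 *m M1^T - M2 *m M2^T) by rewrite opprB addrC subrK.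
    have qB (A B : 'M[R]_q) : (w^T *m (A - B) *m w) 0 0 = (w^T *m A *m w) 0 0 - (w^T *m B *m w) 0 0.
      by rewrite mulmxBr mulmxBl mxE; congr (_ + _); rewrite mxE.
    rewrite qB DE quad_spectral.
    have : - wsq l (U^T *m w) <= T * sqnorm w.
      rewrite -(sqnorm_orthogonal w UU') /wsq -sumrN /sqnorm mulr_sumr; apply: ler_sum => i _.
      rewrite -mulNr ler_wpM2r ?sqr_ge0//; apply: le_trans (ler_norm _) _; rewrite normrN.
      by rewrite TE (bigD1 i)//= lerDl sumr_ge0.
    by have := q1 w; rewrite -/b mulrDl; lra.
  by have -> : (b + T) ^+ 2 = b ^+ 2 + 2 * (b * T) + T ^+ 2 by [ring]; move: h3 bT FT2 TT F2; clear; lra.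
move=> s2 s1.
set v := 24 / 25 * F ^+ 2 in s1 s2.
have sv : F / 2 <= Num.sqrt v.
  apply: ler_sqrt_sqr; first by rewrite divr_ge0// ltW.
  have -> : (F / 2) ^+ 2 = F ^+ 2 / 4 by field.
  by rewrite /v; move: F2; clear; lra.
have [A1 A2] := hC1 _ _ M1 v a r s1 r0; have [B1 B2] := hC2 _ _ M1 M2 v r s1 s2 r0.
rewrite -/T in B1 B2.
have coef (C x : R) : 0 <= C -> 0 <= x -> C / Num.sqrt v * x <= 2 * C / F * x.
  move=> C0 x0; rewrite ler_wpM2r// (mulrC 2) -mulrA ler_wpM2l//.
  by rewrite -[leRHS]invf_div lef_pV2// posrE ?divr_gt0//; apply: lt_le_trans sv; rewrite divr_gt0.
have c1 := coef C1 _ (ltW C10) a0; have c2 := coef C2 _ (ltW C20) T0.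
have x0 : 0 <= 2 * C1 / F * T by rewrite mulr_ge0// divr_ge0 ?(ltW F0)// mulr_ge0// ltW.
have x1 : 0 <= 2 * C2 / F * sqnorm a by rewrite mulr_ge0// divr_ge0 ?(ltW F0)// mulr_ge0// ltW.
have x2 : 0 <= 50 / F * (T + sqnorm a) by rewrite mulr_ge0 ?addr_ge0// divr_ge0 ?(ltW F0).
have E : (50 + 2 * (C1 + C2)) / F * (T + sqnorm a) = 50 / F * (T + sqnorm a)
    + 2 * C1 / F * T + 2 * C1 / F * sqnorm a + 2 * C2 / F * T + 2 * C2 / F * sqnorm a by ring.
rewrite E; move: A1 A2 B1 B2 (pball_ge0 M1 a r) (pball_ge0 M1 0 r) (pball_ge0 M2 0 r)
  (pball_le1 M1 a r0) (pball_le1 M1 0 r0) (pball_le1 M2 0 r0).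
move: (pball M1 a r) (pball M1 0 r) (pball M2 0 r) c1 c2 x0 x1 x2.
move: (C1 / _ * _) (C2 / _ * _) (2 * C1 / F * T) (2 * C1 / F * _) (2 * C2 / F * T) (2 * C2 / F * _) (50 / F * _).
clear => y1 y2 z1 z2 z3 z4 z5.
move=> [x| |] [y| |] [z| |] //.
rewrite -!EFinD /= !lee_fin => *.
by rewrite ler_norml; apply/andP; split; lra.
Qed.

End perturbation.

(** * Transport to the given center and covariance, and conclusion *)

Section gaussian_transport.
Context (R : realType) (p : nat).
Implicit Types (x : 'cV[R]_p) (H : 'M[R]_p).

Lemma gauss_fin x H B : H^T = H -> H \in unitmx -> measurable B ->
  exists b : R, gauss x (invmx (H *m H)) B = b%:E.
Proof.
move=> sH uH mB; exists (fine (gauss x (invmx (H *m H)) B)); rewrite fineK// ge0_fin_numE//.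
have uL : invmx H \in unitmx by rewrite unitmx_inv.
rewrite (gauss_linear _ uL (invmx_sqr sH uH) mB).
apply: (@le_lt_trans _ _ 1%E); last exact: ltry.
apply: probability_le1; rewrite -[X in measurable X]setTI.
exact: (measurable_mulmx_cV (invmx H) x).
Qed.

Lemma TV_ge (P Q : {measure set 'cV[R]_p -> \bar R}) B : measurable B ->
  (`|P B - Q B| <= TV P Q)%E.
Proof.
move=> mB; apply: ereal_sup_ubound; exists (\1_B : 'cV[R]_p -> R).
  split; first exact: measurable_indic.
  by move=> u; rewrite indicE normr_nat lern1 leq_b1.
by rewrite !integral_indic// !setIT.
Qed.

(** Translating by [x] turns the centred Gaussian law into the one with mean [x]; then the triangle
    inequality through the law with mean [xs] and covariance [DG^-2]. *)
Lemma law_dist_le f xs x H DG (Y : \bar R) :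
  H^T = H -> H \in unitmx -> DG^T = DG -> DG \in unitmx ->
  (forall B, measurable B -> `|gibbs f B - gauss xs (invmx (DG *m DG)) B| <= Y)%E ->
  (law_dist f x H <= Y + TV (gauss x (invmx (H *m H))) (gauss xs (invmx (DG *m DG))))%E.
Proof.
move=> sH uH sD uD hY; apply: ge_ereal_sup => _ [A mA <-].
have uL : invmx H \in unitmx by rewrite unitmx_inv.
pose B := [set y | A (y - x)].
have mB : measurable B.
  have := measurable_mulmx_cV (1%:M : 'M[R]_p) (- x) measurableT mA.
  by rewrite setTI; congr (measurable _); apply/seteqP; split => y; rewrite /= mul1mx.
have -> : gauss 0 (invmx (H *m H)) A = gauss x (invmx (H *m H)) B.
  rewrite (gauss_linear _ uL (invmx_sqr sH uH) mA) (gauss_linear _ uL (invmx_sqr sH uH) mB).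
  by congr (std_gauss _); apply/seteqP; split => g; rewrite /B /= addr0 addrK.
have tri : (`|gibbs f B - gauss x (invmx (H *m H)) B| <=
    `|gibbs f B - gauss xs (invmx (DG *m DG)) B| +
    `|gauss x (invmx (H *m H)) B - gauss xs (invmx (DG *m DG)) B|)%E.
  have [b ->] := gauss_fin x sH uH mB; have [a ->] := gauss_fin xs sD uD mB.
  case: (gibbs f B) => [g| |]//; rewrite -!EFinD /= lee_fin.
  have -> : g - b = (g - a) - (b - a) by ring.
  exact: ler_normB.
by apply: le_trans tri _; apply: leeD; [exact: hY|exact: TV_ge].
Qed.

Lemma ball_dist_le f xs x H DG q (Q : 'M[R]_(q, p)) (Y Z : \bar R) :
  H^T = H -> H \in unitmx -> DG^T = DG -> DG \in unitmx ->
  (forall B, measurable B -> `|gibbs f B - gauss xs (invmx (DG *m DG)) B| <= Y)%E ->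
  (forall r : R, (0 < r)%R -> `|pball (Q *m invmx DG) (Q *m (xs - x)) r - pball (Q *m invmx H) 0 r| <= Z)%E ->
  (ball_dist f x H Q <= Y + Z)%E.
Proof.
move=> sH uH sD uD hY hZ; apply: ge_ereal_sup => _ [r /= r0 <-].
have uL : invmx DG \in unitmx by rewrite unitmx_inv.
set B := [set y | enorm (Q *m (y - x)) <= r].
have mB : measurable B.
  have := measurable_pball Q (- (Q *m x)) (ltW r0).
  by congr (measurable _); apply/seteqP; split => y; rewrite /B /= mulmxBr.
have -> : gauss 0 1%:M [set g | enorm (Q *m (invmx H *m g)) <= r] = pball (Q *m invmx H) 0 r.
  by congr (std_gauss _); apply/seteqP; split => g; rewrite /= addr0 mulmxA.
have E1 : gauss xs (invmx (DG *m DG)) B = pball (Q *m invmx DG) (Q *m (xs - x)) r.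
  rewrite (gauss_linear _ uL (invmx_sqr sD uD) mB).
  by congr (std_gauss _); apply/seteqP; split => g; rewrite /B /= -mulmxA -mulmxDr addrA.
have := hY B mB; have := hZ r r0; rewrite E1.
have := pball_le1 (Q *m invmx H) 0 (ltW r0); have := pball_ge0 (Q *m invmx H) 0 r.
have := pball_le1 (Q *m invmx DG) (Q *m (xs - x)) (ltW r0); have := pball_ge0 (Q *m invmx DG) (Q *m (xs - x)) r.
case: (pball _ _ _) => [a| |]// _ _; case: (pball _ _ _) => [b| |]// _ _ h1 h2.
apply: le_trans (leeD h2 h1).
case: (gibbs f B) => [g| |]//; rewrite -!EFinD /= lee_fin.
have -> : g - b = (g - a) + (a - b) by ring.
exact: ler_normD.
Qed.

End gaussian_transport.

Theorem theorem2p9 (R : realType) :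
  exists C : R,
  forall (p : nat) (f : 'cV[R]_p -> R) (xs : 'cV[R]_p)
    (G2 G D DG : 'M[R]_p) (nu xx w : R),
    Ck 3 f ->
    (\int[lebesgue_cV p]_y (expR (f y))%:E < +oo)%E ->
    (forall y, f y <= f xs) ->
    posdefmx (- hess f xs) ->
    psdmx G2 ->
    psdmx (- hess f xs - G2) ->
    psd_sqrt G G2 ->
    psd_sqrt D (- hess f xs - G2) ->
    psd_sqrt DG (- hess f xs) ->
    concave (fun u => f (xs + u) + 2^-1 * enorm (G *m u) ^+ 2) ->
    0 < nu < 1 ->
    0 < xx ->
    omega f xs D DG nu xx = w%:E ->
    w <= 1 / 3 ->
    w * pG D DG <= 2 / 3 ->
  forall (x : 'cV[R]_p) (H : 'M[R]_p),
    posdefmx H ->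
    (* (i) *)
    (law_dist f x H <= 4%:E * (diam2 w D DG + expR (- xx))%:E
       + TV (gauss x (invmx (H *m H))) (gauss xs (invmx (DG *m DG))))%E
    /\ (forall tau3 : 'cV[R]_p -> R, tau3_bound f xs tau3 ->
        (law_dist f x H <= 4%:E * (diam3 w DG tau3 + (expR (- xx))%:E)
           + TV (gauss x (invmx (H *m H))) (gauss xs (invmx (DG *m DG))))%E)
    (* (ii) *)
    /\ (forall tau3 : 'cV[R]_p -> R, tau3_bound f xs tau3 ->
        forall (q : nat) (Q : 'M[R]_(q, p)),
        let S := Q *m invmx (DG *m DG) *m Q^T in
        3 * opnorm S ^+ 2 <= frobnorm S ^+ 2 ->
        (ball_dist f x H Q <= 4%:E * (diam3 w DG tau3 + (expR (- xx))%:E)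
           + (C / frobnorm S
              * (tracenorm (Q *m (invmx (DG *m DG) - invmx (H *m H)) *m Q^T)
                 + enorm (Q *m (x - xs)) ^+ 2))%:E)%E).
Proof.
have [C C0 hC] := pball_perturb R; exists C.
move=> p f xs G2 G D DG nu xx w fC fint fmax pS pG2 _ sG sD sDG conc nu01 xx0 om w13 wP x H pH.
have [sH uH] := posdefmx_sqr pH; have uD := psd_sqrt_unit sDG pS.
have sDt : DG^T = DG by case: sDG => -[].
split; first by apply: law_dist_le => // B mB;
  exact: (gibbs_gauss2 fC fint fmax pS pG2 sG sD sDG conc nu01 xx0 om w13 wP).
split=> [tau3 ht|tau3 ht q Q S hS].
  by apply: law_dist_le => // B mB;
    exact: (gibbs_gauss3 fC fint fmax pS pG2 sG sD sDG conc nu01 xx0 om w13 wP ht).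
apply: (@ball_dist_le _ _ _ xs _ _ DG) => // [B mB|r r0].
  exact: (gibbs_gauss3 fC fint fmax pS pG2 sG sD sDG conc nu01 xx0 om w13 wP ht).
set M1 := Q *m invmx DG; set M2 := Q *m invmx H.
have gram A : A^T = A -> A \in unitmx ->
    (Q *m invmx A) *m (Q *m invmx A)^T = Q *m invmx (A *m A) *m Q^T.
  by move=> sA uA; rewrite trmx_mul -(invmx_sqr sA uA) !mulmxA.
have E1 : M1 *m M1^T = S by exact: gram.
have E2 : M2 *m M2^T = Q *m invmx (H *m H) *m Q^T by exact: gram.
have -> : Q *m (invmx (DG *m DG) - invmx (H *m H)) *m Q^T = M1 *m M1^T - M2 *m M2^T.
  by rewrite E1 E2 mulmxBr mulmxBl.
have -> : enorm (Q *m (x - xs)) ^+ 2 = sqnorm (Q *m (xs - x)).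
  by rewrite sqr_enorm -opprB mulmxN /sqnorm; apply: eq_bigr => i _; rewrite mxE sqrrN.
rewrite -E1 in hS *.
(* Division by a zero norm yields 0, so in that case the two ball probabilities must coincide. They
   do: [Q DG^-2 Q^T = 0] forces [Q = 0] because [DG] is invertible. *)
have [F0|F0] := eqVneq (frobnorm (M1 *m M1^T)) 0; last first.
  by apply: hC => //; [exact: ltW|rewrite lt_def F0 sqrtr_ge0].
have M10 : M1 = 0.
  have tr0 : \sum_i \sum_j (M1 *m M1^T) i j ^+ 2 = 0.
    by have := F0 => /(congr1 (fun y => y ^+ 2)); rewrite /frobnorm sqr_sqrtr ?expr0n// sumr_ge0// => i _; rewrite sumr_ge0// => j _; exact: sqr_ge0.
  apply/row_matrixP => i; apply: trmx_inj; rewrite row0 trmx0; apply: sqnorm_eq0.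
  have -> : sqnorm (row i M1)^T = (M1 *m M1^T) i i.
    by rewrite /sqnorm mxE; apply: eq_bigr => j _; rewrite !mxE expr2.
  apply/eqP; rewrite -(sqrf_eq0 ((M1 *m M1^T) i i)); apply/eqP; apply: le_anti; rewrite sqr_ge0 andbT -{}tr0.
  rewrite (bigD1 i)//= (bigD1 i)//= -addrA lerDl addr_ge0 ?sumr_ge0// => [j _|j _]; first exact: sqr_ge0.
  by rewrite sumr_ge0// => k _; exact: sqr_ge0.
have Q0 : Q = 0 by rewrite -(mulmxKV uD Q) -/M1 M10 mul0mx.
rewrite M10 /M2 Q0 !mul0mx subee ?abse0; last first.
  by rewrite ge0_fin_numE ?pball_ge0//; apply: le_lt_trans (pball_le1 _ _ (ltW r0)) _; rewrite ltry.
have -> : frobnorm (0 : 'M[R]_q) = 0.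
  by rewrite /frobnorm big1 ?sqrtr0// => i _; rewrite big1// => j _; rewrite mxE expr0n.
by rewrite invr0 mulr0 mul0r.
Qed.
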